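(* Let $A_\Gamma$ be the right-angled Artin group of a finite simplicial graph $\Gamma$. There is an algorithm that takes in two tuples $U$ and $V$ of conjugacy classes from $A_\Gamma$ and either produces an automorphism $\alpha\in\operatorname{Aut}(A_\Gamma)$ with $\alpha\cdot U=V$ or determines that no such automorphism exists.
   Context: For a finite simplicial graph $\Gamma$, the right-angled Artin group $A_\Gamma$ is the group presented with generators the vertices of $\Gamma$, whose only relations are that two generators commute if and only if they are adjacent in $\Gamma$. The group $\operatorname{Aut}(A_\Gamma)$ acts on conjugacy classes of $A_\Gamma$, and acts diagonally (entrywise) on $k$-tuples of conjugacy classes for each $k$. *)

(* Defs.v *)
From HB Require Import structures.
From mathcomp Require Import all_boot.
From mathcomp Require Import boolp classical_sets.

Set Implicit Arguments.
Unset Strict Implicit.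
Unset Printing Implicit Defensive.

Local Open Scope group_scope.
Local Open Scope quotient_scope.

(* The letter (x, false) is the generator x and (x, true) is its inverse. *)
Definition word (T : finType) := seq (T * bool).

Section RightAngledArtinGroup.
Variables (T : finType) (adj : rel T).
Implicit Types u v w : word T.

Definition inv_letter (a : T * bool) : T * bool := (a.1, ~~ a.2).

(* Equality of words in the group < T | xy = yx for x, y adjacent >. *)
Inductive word_equiv : word T -> word T -> Prop :=
| WordRefl u : word_equiv u u
| WordSym u v : word_equiv u v -> word_equiv v u
| WordTrans u v w : word_equiv u v -> word_equiv v w -> word_equiv u w
| WordCancel u v a : word_equiv (u ++ [:: a; inv_letter a] ++ v) (u ++ v)
| WordCommute u v x y : adj x y ->
    word_equiv (u ++ [:: (x, false); (y, false)] ++ v)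
               (u ++ [:: (y, false); (x, false)] ++ v).

Definition word_rel : rel (word T) := fun u v => `[< word_equiv u v >].

Lemma word_rel_refl : reflexive word_rel.
Proof. by move=> u; apply/asboolP; constructor. Qed.

Lemma word_rel_sym : symmetric word_rel.
Proof. by move=> u v; apply/asboolP/asboolP; apply: WordSym. Qed.

Lemma word_rel_trans : transitive word_rel.
Proof.
by move=> v u w /asboolP uv /asboolP vw; apply/asboolP; apply: WordTrans vw.
Qed.

Canonical word_rel_equiv :=
  EquivRel word_rel word_rel_refl word_rel_sym word_rel_trans.

Definition raag := {eq_quot word_rel}.

HB.instance Definition _ := Choice.on raag.
HB.instance Definition _ := EqQuotient.on raag.

Definition word_inv w : word T := rev (map inv_letter w).

Definition raag_mul (g h : raag) : raag := \pi_raag (repr g ++ repr h).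
Definition raag_one : raag := \pi_raag [::].
Definition raag_inv (g : raag) : raag := \pi_raag (word_inv (repr g)).

Lemma raag_eqP u v : \pi_raag u = \pi_raag v <-> word_equiv u v.
Proof.
by split=> [/eqmodP /asboolP // | uv]; apply/eqmodP; apply/asboolP.
Qed.

Lemma word_equiv_cat u u' v v' :
  word_equiv u u' -> word_equiv v v' -> word_equiv (u ++ v) (u' ++ v').
Proof.
move=> uu' vv'; apply: (@WordTrans _ (u' ++ v)).
  elim: uu' => {u u'} [u|u w _|u w t _ uw _|u w a|u w x y xy].
  - exact: WordRefl.
  - exact: WordSym.
  - exact: WordTrans.
  - by rewrite -!catA; apply: WordCancel.
  - by rewrite -!catA; apply: WordCommute.
elim: vv' => {v v'} [v|v w _|v w t _ vw _|v w a|v w x y xy].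
- exact: WordRefl.
- exact: WordSym.
- exact: WordTrans.
- by rewrite !(catA u'); apply: WordCancel.
- by rewrite !(catA u'); apply: WordCommute.
Qed.

Lemma word_equiv_invr w : word_equiv (w ++ word_inv w) [::].
Proof.
elim: w => [|a w IHw]; first exact: WordRefl.
have -> : (a :: w) ++ word_inv (a :: w) =
          [:: a] ++ (w ++ word_inv w) ++ [:: inv_letter a].
  by rewrite /word_inv /= rev_cons -cats1 -catA.
apply: (WordTrans _ (WordCancel [::] [::] a)).
apply: (word_equiv_cat (WordRefl [:: a])
          (word_equiv_cat IHw (WordRefl [:: inv_letter a]))).
Qed.

Lemma word_invK : involutive word_inv.
Proof.
move=> w; rewrite /word_inv map_rev revK -map_comp -[RHS]map_id.
by apply: eq_map => -[x b]; rewrite /inv_letter /= negbK.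
Qed.

Lemma word_equiv_invl w : word_equiv (word_inv w ++ w) [::].
Proof. by rewrite -{2}(word_invK w); apply: word_equiv_invr. Qed.

Lemma word_equiv_repr u : word_equiv (repr (\pi_raag u)) u.
Proof. by apply/raag_eqP; rewrite reprK. Qed.

Lemma raag_piM u v : raag_mul (\pi_raag u) (\pi_raag v) = \pi_raag (u ++ v).
Proof. by apply/raag_eqP/word_equiv_cat; apply: word_equiv_repr. Qed.

Lemma raag_mulA : associative raag_mul.
Proof.
elim/quotW=> u; elim/quotW=> v; elim/quotW=> w.
by rewrite (raag_piM v w) (raag_piM u v) !raag_piM catA.
Qed.

Lemma raag_mul1g : left_id raag_one raag_mul.
Proof. by elim/quotW=> u; rewrite raag_piM. Qed.

Lemma raag_mulg1 : right_id raag_one raag_mul.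
Proof. by elim/quotW=> u; rewrite raag_piM cats0. Qed.

Lemma raag_mulVg : left_inverse raag_one raag_inv raag_mul.
Proof.
move=> g; rewrite -{2}(reprK g) raag_piM.
by apply/raag_eqP/word_equiv_invl.
Qed.

Lemma raag_mulgV : right_inverse raag_one raag_inv raag_mul.
Proof.
move=> g; rewrite -{1}(reprK g) raag_piM.
by apply/raag_eqP/word_equiv_invr.
Qed.

HB.instance Definition _ := isGroup.Build raag
  raag_mulA raag_mul1g raag_mulg1 raag_mulVg raag_mulgV.

Definition raag_of_word w : raag := \pi_raag w.

Definition raag_gen (x : T) : raag := raag_of_word [:: (x, false)].

End RightAngledArtinGroup.

Section ConjugacyClasses.
Variable G : groupType.

Definition conj_class (g : G) : set G := [set g ^ x | x in [set: G]]%classic.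

Definition aut_act (alpha : G -> G) (U : seq (set G)) : seq (set G) :=
  [seq (alpha @` C)%classic | C <- U].

End ConjugacyClasses.

Definition conj_classes (T : finType) (adj : rel T) (us : seq (word T)) :
    seq (set (raag adj)) :=
  [seq conj_class (raag_of_word adj u) | u <- us].

Inductive recfun : Type :=
| RZero
| RSucc
| RProj of nat
| RComp of recfun & seq recfun
| RPrim of recfun & recfun
| RMu of recfun.

(* [reval f xs y] : the partial function f is defined on the arguments xs and
   has value y there.  Surplus arguments are ignored. *)
Inductive reval : recfun -> seq nat -> nat -> Prop :=
| EvalZero xs : reval RZero xs 0
| EvalSucc n xs : reval RSucc (n :: xs) n.+1
| EvalProj i xs : i < size xs -> reval (RProj i) xs (nth 0 xs i)
| EvalComp f gs xs ys y :
    revals gs xs ys -> reval f ys y -> reval (RComp f gs) xs y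
| EvalPrim0 f g xs y : reval f xs y -> reval (RPrim f g) (0 :: xs) y
| EvalPrimS f g n xs r y :
    reval (RPrim f g) (n :: xs) r -> reval g [:: n, r & xs] y ->
    reval (RPrim f g) (n.+1 :: xs) y
| EvalMu f xs m (r : nat -> nat) :
    (forall j, j < m -> reval f (j :: xs) (r j).+1) ->
    reval f (m :: xs) 0 -> reval (RMu f) xs m
with revals : seq recfun -> seq nat -> seq nat -> Prop :=
| EvalNil xs : revals [::] xs [::]
| EvalCons f fs xs y ys :
    reval f xs y -> revals fs xs ys -> revals (f :: fs) xs (y :: ys).

Scheme reval_mut := Minimality for reval Sort Prop
  with revals_mut := Minimality for revals Sort Prop.

Lemma reval_unique f xs y z : reval f xs y -> reval f xs z -> y = z.
Proof.
move=> fy; move: z; pattern f, xs, y.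
apply: (@reval_mut _ (fun fs xs ys => forall zs, revals fs xs zs -> ys = zs))
  fy => {f xs y}.
- by move=> xs z fz; inversion fz.
- by move=> n xs z fz; inversion fz.
- by move=> i xs _ z fz; inversion fz.
- move=> f gs xs ys y _ IHg _ IHf z fz.
  inversion fz as [| | |f' gs' xs' ys' z' g_ys f_z| | |]; subst.
  by apply: IHf; rewrite (IHg _ g_ys).
- by move=> f g xs y _ IHf z fz; inversion fz; subst; apply: IHf.
- move=> f g n xs r y _ IHr _ IHg z fz.
  inversion fz as [| | | | |f' g' n' xs' r' z' f_r g_z|]; subst.
  by apply: IHg; rewrite (IHr _ f_r).
- move=> f xs m r _ IHlt _ IHm z fz.
  inversion fz as [| | | | | |f' xs' z' r' lt_z f_z]; subst.
  case: (ltngtP m z) => // [ltmz | ltzm].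
    by have := IHm _ (lt_z _ ltmz).
  by have := IHlt _ ltzm _ f_z.
- by move=> xs zs fz; inversion fz.
- move=> f fs xs y ys _ IHf _ IHfs zs fz.
  inversion fz as [|f' fs' xs' y' ys' f_y fs_ys]; subst.
  by rewrite (IHf _ f_y) (IHfs _ fs_ys).
Qed.

(* [CodeSeq.code] is MathComp's computable bijection from seq nat to nat. *)
Section Encoding.
Variable T : finType.

Definition code_letter (a : T * bool) : nat := (enum_rank a.1).*2 + a.2.

Definition code_word (w : word T) : nat :=
  CodeSeq.code [seq code_letter a | a <- w].

Definition code_words (ws : seq (word T)) : nat :=
  CodeSeq.code [seq code_word w | w <- ws].

End Encoding.

Section OrbitProblem.
Variables (T : finType) (adj : rel T).

(* An automorphism of the group is output as the list of words, one for each
   vertex in the order of [enum T], representing the images of the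
   generators. *)
Definition represents_hom (ws : seq (word T)) (alpha : raag adj -> raag adj) :=
  [seq raag_of_word adj w | w <- ws] =
  [seq alpha (raag_gen adj x) | x <- enum T].

(* The output 0 means that there is no automorphism, and the output n.+1 that
   n is the code of one. *)
Definition solves_orbit_problem (P : recfun) : Prop :=
  forall us vs : seq (word T),
    let U := conj_classes adj us in
    let V := conj_classes adj vs in
    let input := [:: code_words us; code_words vs] in
    (exists (alpha : {multiplicative raag adj -> raag adj})
            (ws : seq (word T)),
       [/\ bijective alpha,
           aut_act alpha U = V,
           represents_hom ws alpha &
           reval P input (code_words ws).+1])
    \/
    ((~ exists alpha : {multiplicative raag adj -> raag adj},
         bijective alpha /\ aut_act alpha U = V)
     /\ reval P input 0).

End OrbitProblem.

(* Main.v *)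
Require Import Defs.
From HB Require Import structures.
From mathcomp Require Import all_boot all_order all_algebra perm zify ring.
From mathcomp Require Import boolp classical_sets fsbigop.

Set Implicit Arguments.
Unset Strict Implicit.
Unset Printing Implicit Defensive.
Import Order.TTheory GRing.Theory Num.Theory.

(** Let G be the right-angled Artin group of a finite graph. The proof is a peak
    reduction argument with one kind of move, followed by a bounded search.

    A vertex x has a class: the vertices with the same star. A functional at z is an
    integer function of the letters that is compatible with the relations around the
    star of z; it extends to a level function on G, and the levels of the
    coordinate functional of a letter cut out the half-spaces of G. A family of
    functionals indexed by the class of z, with values on the class that form an
    invertible integer matrix, defines a class automorphism [bet z f]. The length of
    an element is the number of walls that it crosses, and under [bet z f] only the
    walls labelled by the class change: they are replaced by the variations of
    the functionals ([len_bet]).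

    The main geometric statement, [classmin_min], says that if no class automorphism
    shortens the total length of a list of elements, then no automorphism does. Under an
    automorphism the walls of the target pull back to cuts of G that are invariant
    under the kernel of a linear form on the centralizer of a generator. Such a cut
    can be pruned, deepest half-spaces first, without increasing its size, until it is
    given by a functional ([cut_min]). Comparing the matrices of exponent sums of an
    automorphism and of its inverse shows that the functionals obtained this way fill up
    the classes with unimodular matrices, so that they come from class automorphisms.

    For tuples of conjugacy classes one applies this to high powers of the elements
    together with many copies of a deformed basis: descending from a tuple by class
    automorphisms leads to a tuple of minimal total cyclic length without ever raising
    this length, up to a permutation of the letters ([orbit_paths]). A class
    automorphism may be arbitrarily large even if it joins two short tuples. But it
    acts on the cyclic words of a tuple only through the values of the functionals on
    the finitely many turns of these words, and these values are bounded by the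
    lengths ([turn_bound]). Changing them is a problem about rows of integer matrices,
    solved by elementary operations through matrices whose entries are bounded by a
    tower of exponentials ([rows_path]). Hence two tuples of one orbit are joined by a
    path of automorphisms of length at most 3 on the letters, through tuples of bounded
    cyclic length ([orbit_spath]). There are finitely many such tuples, so a shortest path
    bounds the automorphism and its inverse; conjugators are bounded because two walls with the
    same label do not cross ([conj_bound]). The result is [orbit_bound].

    It remains to search below the resulting bound for the images of the letters under an
    automorphism and its inverse, together with conjugators. That these data are correct
    is decided by the pile normal form of words, which is a fold over coded lists and
    therefore recursive ([rc_check]). *)

Record sgraph := SGraph {
  vert :> finType;
  edge : rel vert;
  edge_sym : symmetric edge;
  edge_irr : irreflexive edge }.

Notation letter D := (vert D * bool)%type.
Notation inv := (@inv_letter _).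

(** * Reduced words *)

Section Words.
Variable D : sgraph.
Implicit Types (a b c : letter D) (v w r : word D) (x y z : D) (S : pred D).
Local Notation G := (raag (@edge D)).
Local Notation gw := (raag_of_word (@edge D)).
Local Open Scope group_scope.

Definition com a b := edge a.1 b.1.

Lemma com_sym a b : com a b = com b a.
Proof. exact: edge_sym. Qed.

Lemma invK a : inv (inv a) = a.
Proof. by case: a => x b; rewrite /inv_letter /= negbK. Qed.

Definition lt a : G := gw [:: a].

Lemma gwM u v : gw (u ++ v) = gw u * gw v.
Proof. by rewrite /raag_of_word -(raag_piM (@edge D)). Qed.

Lemma gw0 : gw [::] = 1.
Proof. by []. Qed.

Lemma gw_cons a u : gw (a :: u) = lt a * gw u.
Proof. by rewrite -cat1s gwM. Qed.

Lemma gw_rcons u a : gw (rcons u a) = gw u * lt a.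
Proof. by rewrite -cats1 gwM. Qed.

Lemma gw_inv u : gw (word_inv u) = (gw u)^-1.
Proof.
apply: (@mulgI _ (gw u)); rewrite mulgV -gwM.
by apply/raag_eqP/word_equiv_invr.
Qed.

Lemma ltV a : lt (inv a) = (lt a)^-1.
Proof. by rewrite -gw_inv. Qed.

Lemma gw_repr (g : G) : gw (repr g) = g.
Proof. exact: reprK. Qed.

Lemma lt_com a b : com a b -> lt a * lt b = lt b * lt a.
Proof.
suff pos x y (s : bool) : edge x y -> commute (lt (x, s)) (lt (y, false)).
  case: a b => x s [y [] /= xy]; last exact: pos.
  have -> : (y, true) = inv (y, false) by [].
  by rewrite ltV; apply/commuteV/pos.
have pp x' y' : edge x' y' -> commute (lt (x', false)) (lt (y', false)).
  move=> xy; rewrite /commute -!gwM.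
  by apply/raag_eqP; have := WordCommute [::] [::] xy.
case: s => xy; last exact: pp.
have -> : (x, true) = inv (x, false) by [].
by rewrite ltV; apply/commute_sym/commuteV/commute_sym/pp.
Qed.

Inductive shuf : word D -> word D -> Prop :=
| ShufRefl w : shuf w w
| ShufStep u a b v w : com a b -> shuf (u ++ [:: b; a] ++ v) w ->
    shuf (u ++ [:: a; b] ++ v) w.

Lemma shuf_trans u v w : shuf u v -> shuf v w -> shuf u w.
Proof. by elim=> // u' a b v' w' ab _ IH /IH; apply: ShufStep. Qed.

Lemma shuf_sym u v : shuf u v -> shuf v u.
Proof.
elim=> [w|u' a b v' w' ab _ IH]; first exact: ShufRefl.
by apply: (shuf_trans IH); apply: ShufStep; [rewrite com_sym | apply: ShufRefl].
Qed.

Lemma shuf_rcons u v a : shuf u v -> shuf (rcons u a) (rcons v a).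
Proof.
elim=> [w|u' c b v' w' ab _ IH]; first exact: ShufRefl.
rewrite -!cats1 -!catA; apply: ShufStep => //.
by move: IH; rewrite -!cats1 -!catA.
Qed.

Lemma shuf_last u a b : com a b -> shuf (rcons (rcons u a) b) (rcons (rcons u b) a).
Proof.
move=> ab; rewrite -!cats1 -!catA; apply: (@ShufStep u a b [::]) => //.
exact: ShufRefl.
Qed.

Lemma shuf_perm u v : shuf u v -> perm_eq u v.
Proof.
elim=> // u' a b v' w' _ _; apply: perm_trans.
by rewrite perm_cat2l perm_cat2r; apply/seq.permP => P /=; rewrite !addn0 addnC.
Qed.

Lemma shuf_gw u v : shuf u v -> gw u = gw v.
Proof.
elim=> // u' a b v' w' ab _ <-; rewrite !gwM; congr (_ * (_ * _)).
by rewrite !gw_cons !mulgA lt_com.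
Qed.

(** Piles decide equality of words: each vertex carries a stack recording, from the
    bottom up, the letters on that vertex and a blank for each letter that does not commute
    with it. The stacks determine a reduced word up to commutations. *)
Definition pile := D -> seq (option bool).

Definition push a (p : pile) : pile := fun u =>
  if edge u a.1 then p u else (if u == a.1 then Some a.2 else None) :: p u.

Definition pop a (p : pile) : pile := fun u =>
  if edge u a.1 then p u else behead (p u).

Definition top (p : pile) x := ohead (p x).

Definition blocked a p := top p a.1 == Some (Some (~~ a.2)).

Definition act p a := if blocked a p then pop a p else push a p.

Definition pile0 : pile := fun=> [::].
Definition pilew w := foldl (fun p a => push a p) pile0 w.

Fixpoint redp p w :=
  if w is a :: w' then ~~ blocked a p && redp (push a p) w' else true.
Definition red w := redp pile0 w.

Lemma pilew_rcons w a : pilew (rcons w a) = push a (pilew w).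
Proof. by rewrite /pilew foldl_rcons. Qed.

Lemma red_rcons w a : red (rcons w a) = red w && ~~ blocked a (pilew w).
Proof.
rewrite /red /pilew; elim: w pile0 => [|b w IH] p /=; first by rewrite andbT.
by rewrite IH andbA.
Qed.

Lemma pop_push a b p : a.1 = b.1 -> pop a (push b p) = p.
Proof.
move=> ab; apply/funext => u; rewrite /pop /push ab.
by case: (edge u b.1).
Qed.

Lemma push_com a b p : com a b -> push a (push b p) = push b (push a p).
Proof.
move=> ab; apply/funext => u; rewrite /push.
have [ua|ua] := boolP (edge u a.1); have [ub|ub] := boolP (edge u b.1) => //.
have nua : u != a.1 by apply/eqP => e; move: ub; rewrite e -/(com a b) ab.
have nub : u != b.1.
  by apply/eqP => e; move: ua; rewrite e -/(com b a) com_sym ab.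
by rewrite (negPf nua) (negPf nub).
Qed.

Lemma top_push_com a b p : com a b -> top (push b p) a.1 = top p a.1.
Proof. by rewrite /top /push /com => ->. Qed.

(** A letter on top of its pile commutes with everything written after it, since a letter
    that does not commute would have left a blank above it; so it can be moved to the end. *)
Lemma extract r x (b : bool) : red r -> top (pilew r) x = Some (Some b) ->
  exists r', [/\ red (rcons r' (x, b)), shuf r (rcons r' (x, b)) &
                pilew r = push (x, b) (pilew r')].
Proof.
elim/last_ind: r => [|r c IH] //; rewrite red_rcons pilew_rcons.
case/andP=> redr nbl topx.
have [xc|nxc] := boolP (edge x c.1).
  have [|r' [redr' shr' pr']] := IH redr.
    by rewrite -topx /top /push xc.
  have cx : com c (x, b) by rewrite com_sym.
  exists (rcons r' c); split.
  - move: redr'; rewrite !red_rcons => /andP[-> nbx] /=.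
    move: nbl; rewrite pr' /blocked top_push_com // => ->.
    by rewrite pilew_rcons top_push_com // com_sym.
  - by apply: (shuf_trans (shuf_rcons c shr')); apply: shuf_last; rewrite com_sym.
  - by rewrite pilew_rcons pr' push_com.
move: topx; rewrite /top /push (negPf nxc) /=; case: eqP => // -> [<-].
rewrite -surjective_pairing; exists r; split=> //.
- by rewrite red_rcons redr.
- exact: ShufRefl.
Qed.

Lemma red_exists w : exists r, [/\ red r, pilew r = foldl act pile0 w,
  gw r = gw w & {subset r <= w}].
Proof.
elim/last_ind: w => [|w a [r [redr pr gr sub]]]; first by exists [::].
rewrite foldl_rcons -pr /act.
have [bl|nbl] := boolP (blocked a (pilew r)); last first.
  exists (rcons r a); split.
  - by rewrite red_rcons redr.
  - by rewrite pilew_rcons.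
  - by rewrite !gw_rcons gr.
  - by move=> c; rewrite !mem_rcons !inE => /orP[->|/sub ->] //; rewrite orbT.
have [r' [red' sh pr']] := extract redr (eqP bl).
exists r'; split.
- by move: red'; rewrite red_rcons => /andP[].
- by rewrite pr' pop_push.
- rewrite gw_rcons -gr (shuf_gw sh) gw_rcons.
  by rewrite -[(_, _)]/(inv a) ltV mulgVK.
- move=> c cr; rewrite mem_rcons inE sub ?orbT //.
  by rewrite (perm_mem (shuf_perm sh)) mem_rcons inE cr orbT.
Qed.

Lemma red_act r : red r -> foldl act pile0 r = pilew r.
Proof.
elim/last_ind: r => // r a IH; rewrite red_rcons => /andP[redr nbl].
by rewrite foldl_rcons pilew_rcons IH // /act (negPf nbl).
Qed.

(** Together with [act_inv], this makes the piles an invariant of the element: the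
    relations of the group act trivially on the piles of reduced words. *)
Lemma act_com a b r : red r -> com a b ->
  act (act (pilew r) a) b = act (act (pilew r) b) a.
Proof.
have act_top p c d : com c d -> blocked c (act p d) = blocked c p.
  move=> cd; rewrite /blocked /act /top; case: ifP => _.
    by rewrite /pop -/(com c d) cd.
  by rewrite /push -/(com c d) cd.
have blk c : red r -> blocked c (pilew r) ->
  forall u, ~~ edge u c.1 -> u != c.1 -> exists s, pilew r u = None :: s.
  move=> redr bl u uc nuc; have [r' [_ _ pr']] := extract redr (eqP bl).
  exists (pilew r' u); rewrite pr' /push /= (negPf uc).
  by rewrite (negPf nuc).
move=> redr ab; have ba : com b a by rewrite com_sym.
rewrite {1}/act act_top // [in RHS]/act act_top //.
rewrite /act; apply/funext => u.
have key : ~~ edge u a.1 -> ~~ edge u b.1 -> u != a.1 /\ u != b.1.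
  move=> ua ub; split; apply/eqP => e.
    by rewrite e -/(com a b) ab in ub.
  by rewrite e -/(com b a) ba in ua.
case: (boolP (blocked a _)) => bla; case: (boolP (blocked b _)) => blb;
  rewrite /push /pop; have [ua|ua] := boolP (edge u a.1);
  have [ub|ub] := boolP (edge u b.1) => //;
  have [/negPf nua /negPf nub] := key ua ub; rewrite ?nua ?nub //.
- by have [s ->] := blk _ redr bla u ua (negbT nua).
- by have [s ->] := blk _ redr blb u ub (negbT nub).
Qed.

Lemma act_inv a r : red r -> act (act (pilew r) a) (inv a) = pilew r.
Proof.
move=> redr; rewrite {2}/act; case: ifP => bl; last first.
  rewrite /act /blocked /top /push /= edge_irr eqxx /= negbK eqxx.
  exact: pop_push.
have [r' [red' _ pr']] := extract redr (eqP bl).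
rewrite pr' pop_push // /act.
by move: red'; rewrite red_rcons => /andP[_ /negPf ->].
Qed.

Lemma act_equiv u v : word_equiv (@edge D) u v ->
  foldl act pile0 u = foldl act pile0 v.
Proof.
elim=> // [? ? ? _ -> _ -> //|u' v' a|u' v' x y xy].
  rewrite !foldl_cat /=; have [r [redr <- _ _]] := red_exists u'.
  by rewrite act_inv.
rewrite !foldl_cat /=; have [r [redr <- _ _]] := red_exists u'.
by rewrite act_com.
Qed.

Lemma pilew_nil r : pilew r = pile0 -> r = [::].
Proof.
elim/last_ind: r => // r a _; rewrite pilew_rcons => /(congr1 (@^~ a.1)).
by rewrite /push edge_irr.
Qed.

Lemma red_pilew_shuf u v : red u -> red v -> pilew u = pilew v -> shuf u v.
Proof.
elim/last_ind: u v => [|u a IH] v.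
  by move=> _ _ /esym/pilew_nil ->; apply: ShufRefl.
rewrite red_rcons pilew_rcons => /andP[redu _] redv e.
have [|v' [redv' sh pv']] := @extract v a.1 a.2 redv.
  by rewrite -e /top /push edge_irr eqxx.
move: redv' sh pv'; rewrite -surjective_pairing => redv' sh pv'.
apply: shuf_trans (shuf_sym sh); apply: shuf_rcons; apply: IH => //.
  by move: redv'; rewrite red_rcons => /andP[].
by rewrite -(@pop_push a a (pilew u)) // e pv' pop_push.
Qed.

(** The normal form theorem for right-angled Artin groups. Letters acting on piles
    respect the relations, so equal elements have equal piles. *)
Lemma red_shuf u v : red u -> red v -> gw u = gw v -> shuf u v.
Proof.
move=> redu redv /raag_eqP/act_equiv e.
by apply: red_pilew_shuf => //; rewrite -!red_act.
Qed.

Lemma rw_ex (g : G) : exists r, red r /\ gw r = g.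
Proof.
have [r [redr _ gr _]] := red_exists (repr g).
by exists r; rewrite gr gw_repr.
Qed.

Definition rw (g : G) := projT1 (cid (rw_ex g)).

Lemma rwP g : red (rw g). Proof. by rewrite /rw; case: cid => ? []. Qed.
Lemma rwK g : gw (rw g) = g. Proof. by rewrite /rw; case: cid => ? []. Qed.

Lemma rw_shuf w : red w -> shuf w (rw (gw w)).
Proof. by move=> redw; apply: red_shuf; rewrite ?rwK ?rwP. Qed.

(** Reducing a word only removes letters, and reduced words of one element are
    permutations of each other. *)
Lemma red_geo v w : red w -> gw v = gw w -> size w <= size v.
Proof.
move=> redw e; have [r [redr pr gr sub]] := red_exists v.
have sh : shuf r w by apply: red_shuf; rewrite ?gr.
suff : size r <= size v by rewrite (perm_size (shuf_perm sh)).
move: pr redr; clear; elim/last_ind: v r => [|v a IH] r.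
  by move=> /pilew_nil ->.
have [r' [redr' pr' _ _]] := red_exists v.
have sr' := IH _ pr' redr'.
rewrite foldl_rcons -pr' /act size_rcons; case: ifP => [bl|/negbT nbl] pr redr.
  have [r'' [redr'' sh pr'']] := extract redr' (eqP bl).
  have rr : red r'' by move: redr''; rewrite red_rcons => /andP[].
  rewrite pr'' pop_push // in pr.
  rewrite (perm_size (shuf_perm (red_pilew_shuf redr rr pr))).
  rewrite (perm_size (shuf_perm sh)) size_rcons in sr'.
  by apply: leq_trans (ltnW sr') _.
have rr : red (rcons r' a) by rewrite red_rcons redr' nbl.
rewrite -pilew_rcons in pr.
by rewrite (perm_size (shuf_perm (red_pilew_shuf redr rr pr))) size_rcons.
Qed.

Lemma cancel_last (g : G) a : ~~ red (rcons (rw g) a) ->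
  exists r, [/\ red (rcons r (inv a)), g = gw (rcons r (inv a)) & g * lt a = gw r].
Proof.
rewrite red_rcons rwP /= negbK => bl.
have [r [redr sh _]] := extract (rwP g) (eqP bl).
exists r; rewrite gw_rcons ltV -[(_, _)]/(inv a) in redr sh *.
by move/shuf_gw: sh; rewrite rwK gw_rcons ltV => ->; rewrite mulgVK.
Qed.

Lemma geo_red w : (forall v, gw v = gw w -> size w <= size v) -> red w.
Proof.
elim/last_ind: w => [|w a IH] // geo.
have redw : red w.
  apply: IH => v e; have := geo (rcons v a); rewrite !gw_rcons e !size_rcons ltnS.
  exact.
rewrite red_rcons redw; apply/negP => bl.
have [r [redr sh _]] := extract redw (eqP bl).
have := geo r; rewrite gw_rcons (shuf_gw sh) gw_rcons -[(_, _)]/(inv a) ltV mulgVK.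
by rewrite size_rcons (perm_size (shuf_perm sh)) size_rcons => /(_ erefl); rewrite ltnNge leqnSn.
Qed.

Lemma red_infix u v w : red (u ++ v ++ w) -> red v.
Proof.
move=> redw; apply: geo_red => v' e.
have := @red_geo (u ++ v' ++ w) _ redw; rewrite !gwM e !size_cat => /(_ erefl).
by rewrite leq_add2l leq_add2r.
Qed.

Lemma red_inv w : red w -> red (word_inv w).
Proof.
move=> redw; apply: geo_red => v e.
have := @red_geo (word_inv v) _ redw; rewrite !gw_inv e gw_inv invgK => /(_ erefl).
by rewrite /word_inv !size_rev !size_map.
Qed.

Lemma gw_ind (P : G -> Prop) :
  P 1 -> (forall g a, P g -> P (g * lt a)) -> forall g, P g.
Proof.
move=> P1 PS g; rewrite -(rwK g); elim/last_ind: (rw g) => // w a.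
by rewrite gw_rcons; apply: PS.
Qed.

Definition par (S : pred D) (g : G) :=
  exists w, all (fun a => S a.1) w /\ gw w = g.

Lemma par_red S w : red w -> par S (gw w) -> all (fun a => S a.1) w.
Proof.
move=> redw [u [/allP allu gu]].
have [r [redr _ gr sub]] := red_exists u.
have sh : shuf r w by apply: red_shuf; rewrite ?gr.
apply/allP => a; rewrite -(perm_mem (shuf_perm sh)) => /sub.
exact: allu.
Qed.

Lemma par1 S : par S 1. Proof. by exists [::]. Qed.

Lemma parM S g h : par S g -> par S h -> par S (g * h).
Proof.
by move=> [u [Su <-]] [v [Sv <-]]; exists (u ++ v); rewrite all_cat Su Sv gwM.
Qed.

Lemma parV S g : par S g -> par S g^-1.
Proof.
move=> [u [Su <-]]; exists (word_inv u); rewrite gw_inv; split=> //.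
by rewrite /word_inv all_rev all_map.
Qed.

Lemma par_lt S a : S a.1 -> par S (lt a).
Proof. by move=> Sa; exists [:: a]; rewrite /= Sa. Qed.

Lemma parMr S g h : par S h -> par S (g * h) <-> par S g.
Proof.
move=> Sh; split=> [Sgh|Sg]; last exact: parM.
by rewrite -(mulgK h g); apply: parM Sgh _; apply: parV.
Qed.

Lemma parMl S g h : par S g -> par S (g * h) <-> par S h.
Proof.
move=> Sg; split=> [Sgh|Sh]; last exact: parM.
by rewrite -(mulKg g h); apply: parM Sgh; apply: parV.
Qed.

Lemma parVE S g : par S g^-1 <-> par S g.
Proof. by split=> /parV; rewrite ?invgK. Qed.

Lemma parS (S S' : pred D) g : {subset S <= S'} -> par S g -> par S' g.
Proof.
move=> sub [w [/allP allw <-]]; exists w; split=> //.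
by apply/allP => a /allw; apply: sub.
Qed.

Lemma par_com S g h : (forall a, S a.1 -> commute (lt a) h) -> par S g ->
  commute g h.
Proof.
move=> Sh [w [allw <-]]; elim: w allw => [|a w IH] /=; first by move=> _; apply: commute_sym; apply: commute1.
case/andP=> Sa /IH cw; rewrite gw_cons.
by apply: commute_sym; apply: commuteM; apply: commute_sym => //; apply: Sh.
Qed.

End Words.

(** * Level functions and half-spaces *)

Section Levels.
Variable D : sgraph.
Implicit Types (a b c : letter D) (v w r : word D) (x y z : D).
Local Notation G := (raag (@edge D)).
Local Notation gw := (raag_of_word (@edge D)).
Local Open Scope group_scope.

Definition st z : pred D := fun x => (x == z) || edge z x.
Definition lk z : pred D := fun x => edge z x.
Notation F z := (par (st z)).

(** The three conditions are what the relations impose on a level function that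
    adds up f along the star of z and stops at the first letter outside it: f is odd on the star,
    vanishes on a letter of the star that commutes with a letter outside, and does not
    separate commuting letters outside. *)
Record functional z (f : letter D -> int) : Prop := Functional {
  fun_inv : forall a, st z a.1 -> f (inv a) = (- f a)%R;
  fun_out : forall a b, st z a.1 -> ~~ st z b.1 -> com a b -> f a = 0%R;
  fun_comp : forall a b, ~~ st z a.1 -> ~~ st z b.1 -> com a b -> f a = f b }.

(** The level of a word: letters of the star are added up until the
    first letter outside, which contributes once and ends the sum. *)
Fixpoint Lamw z (f : letter D -> int) w : int :=
  if w is a :: w' then if st z a.1 then (f a + Lamw z f w')%R else f a else 0%R.

Definition Lam z f (g : G) := Lamw z f (rw g).

Section Functional.
Variables (z : D) (f : letter D -> int).
Hypothesis ff : functional z f.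

(** The three conditions on a functional correspond to the three ways in which two
    swapped letters can lie with respect to the star. *)
Lemma Lamw_shuf v w : shuf v w -> Lamw z f v = Lamw z f w.
Proof.
elim=> // u a b v' w' ab _ <-; elim: u => [|c u IH] /=; last by rewrite IH.
have [sa|nsa] := boolP (st z a.1); have [sb|nsb] := boolP (st z b.1).
- by rewrite addrCA.
- by rewrite (fun_out ff sa nsb ab) add0r.
- by rewrite (fun_out ff sb nsa _) ?add0r // com_sym.
- exact: fun_comp ff _ _ nsa nsb ab.
Qed.

Lemma LamE w : red w -> Lam z f (gw w) = Lamw z f w.
Proof. by move=> redw; apply/esym/Lamw_shuf/rw_shuf. Qed.

Lemma Lam1 : Lam z f 1 = 0%R.
Proof. by rewrite -gw0 LamE. Qed.

Lemma Lamw_cat v w : Lamw z f (v ++ w) =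
  if all (fun a => st z a.1) v then (Lamw z f v + Lamw z f w)%R else Lamw z f v.
Proof.
elim: v => [|a v IH] /=; first by rewrite add0r.
by rewrite IH; case: (st z a.1) => //=; case: (all _ _); rewrite ?addrA.
Qed.

Lemma Lam_step g a : F z g -> Lam z f (g * lt a) = (Lam z f g + f a)%R.
Proof.
move=> Fg; have [rd|/cancel_last [r [rd gE gaE]]] := boolP (red (rcons (rw g) a)).
  have all_g : all (fun b => st z b.1) (rw g) by apply: par_red (rwP g) _; rewrite rwK.
  rewrite -{1}(rwK g) -gw_rcons LamE // -cats1 Lamw_cat all_g /= addr0.
  by case: ifP.
move: Fg; rewrite gE => /par_red -/(_ rd); rewrite all_rcons => /andP[sa allr].
rewrite -gE gaE LamE; last by move: rd; rewrite red_rcons => /andP[].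
rewrite gE LamE // -cats1 Lamw_cat allr /= sa addr0 (fun_inv ff) ?addrNK //.
Qed.

Lemma Lam_same g a : ~ F z g -> ~ F z (g * lt a) -> Lam z f (g * lt a) = Lam z f g.
Proof.
move=> nFg nFa.
have nall w h : h = gw w -> ~ F z h -> all (fun b => st z b.1) w = false.
  by move=> -> nF; apply/negP => al; apply: nF; exists w.
have [rd|/cancel_last [r [rd gE gaE]]] := boolP (red (rcons (rw g) a)).
  by rewrite -{1}(rwK g) -gw_rcons LamE // -cats1 Lamw_cat (nall _ _ _ nFg) ?rwK.
rewrite gaE LamE; last by move: rd; rewrite red_rcons => /andP[].
by rewrite gE LamE // -cats1 Lamw_cat (nall _ _ gaE nFa).
Qed.

Lemma Lam_back g a : ~ F z g -> F z (g * lt a) ->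
  Lam z f (g * lt a) = (Lam z f g - f (inv a))%R.
Proof.
move=> nFg Fga; have := @Lam_step (g * lt a) (inv a) Fga.
by rewrite ltV mulgK => ->; rewrite addrK.
Qed.

(** A prefix from the flat only delays the first letter outside the star, so it
    contributes additively. *)
Lemma LamM h g : F z h -> Lam z f (h * g) = (Lam z f h + Lam z f g)%R.
Proof.
move=> Fh; elim/gw_ind: g => [|g a IH]; first by rewrite mulg1 Lam1 addr0.
rewrite mulgA; have [Fg|nFg] := pselect (F z g).
  by rewrite !Lam_step ?IH ?addrA //; apply/parMl.
have nFhg : ~ F z (h * g) by move=> /(parMl _ Fh).
have [Fga|nFga] := pselect (F z (g * lt a)).
  by rewrite !Lam_back ?IH ?addrA // -mulgA; apply/parMl.
by rewrite !Lam_same // -mulgA => /(parMl _ Fh).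
Qed.

Lemma LamV h : F z h -> Lam z f h^-1 = (- Lam z f h)%R.
Proof.
move=> Fh; apply/eqP; rewrite -addr_eq0 addrC -LamM // mulgV Lam1 //.
Qed.

Lemma Lam_zero g a : f a = 0%R -> f (inv a) = 0%R -> Lam z f (g * lt a) = Lam z f g.
Proof.
move=> fa fia; have [Fg|nFg] := pselect (F z g).
  by rewrite Lam_step // fa addr0.
have [Fga|nFga] := pselect (F z (g * lt a)); last exact: Lam_same.
by rewrite Lam_back // fia subr0.
Qed.

Lemma Lam_lt a : Lam z f (lt a) = f a.
Proof. by rewrite -(mul1g (lt a)) Lam_step ?Lam1 ?add0r //; apply: par1. Qed.

End Functional.

(** Every element leaves the flat of [z] through a first letter outside it; its level
    under any functional is read off from the part in the flat and that letter. *)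
Lemma flat_split z (g : G) : exists h l, [/\ F z h,
    (if l is Some a then ~~ st z a.1 /\ exists v, red (a :: v) /\ g = h * gw (a :: v)
     else g = h) &
    forall f, functional z f ->
      Lam z f g = (Lam z f h + (if l is Some a then f a else 0))%R].
Proof.
have : exists u t, rw g = u ++ t /\ all (fun b => st z b.1) u /\
    (if t is a :: _ then ~~ st z a.1 else true).
  elim: (rw g) => [|a w [u [t [-> [allu tP]]]]]; first by exists [::], [::].
  have [sa|nsa] := boolP (st z a.1).
    by exists (a :: u), t; rewrite /= sa allu.
  by exists [::], (a :: u ++ t).
move=> [u [t [e [allu tP]]]].
have Fu : F z (gw u) by exists u.
have gE : g = gw u * gw t by rewrite -gwM -e rwK.
exists (gw u); case: t e tP gE => [|a t] e tP gE.
  exists None; split=> // [|f ff]; first by rewrite gE gw0 mulg1.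
  by rewrite addr0 gE gw0 mulg1.
have redt : red (a :: t).
  by apply: (@red_infix _ u (a :: t) [::]); rewrite cats0 -e; apply: rwP.
exists (Some a); split=> //; first by split=> //; exists t.
by move=> f ff; rewrite gE LamM // (LamE ff redt) /= (negPf tP).
Qed.

(** The exponent of the letter a, as the coordinate functional at its vertex. *)
Definition sdl a b : int := if b == a then 1%R else if b == inv a then (-1)%R else 0%R.

Lemma inv_neq a : (inv a == a) = false.
Proof. by case: a => x [] /=; rewrite /inv_letter /=; apply/eqP => -[]. Qed.

Lemma inv_eq a b : (inv a == inv b) = (a == b).
Proof. by apply/eqP/eqP => [/(congr1 inv)|->//]; rewrite !invK. Qed.

Lemma sdlV a b : sdl a (inv b) = (- sdl a b)%R.
Proof.
rewrite /sdl inv_eq; have [->|nba] := eqVneq b a; first by rewrite inv_neq.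
have -> : (inv b == a) = (b == inv a) by rewrite -inv_eq invK.
by case: (b == inv a); rewrite ?opprK ?oppr0.
Qed.

Lemma sdl_out a b : b.1 != a.1 -> sdl a b = 0%R.
Proof.
rewrite /sdl; have [->|_] := eqVneq b a; first by rewrite eqxx.
by have [->|//] := eqVneq b (inv a); rewrite eqxx.
Qed.

Lemma sdl_fun z a : st a.1 =1 st z -> functional z (sdl a).
Proof.
move=> e; split=> [b _|b c sb nsc bc|b c nsb nsc bc]; first exact: sdlV.
  apply: sdl_out; apply: contra nsc => /eqP e'.
  by rewrite -e /st -e' -[edge _ _]/(com b c) bc orbT.
rewrite !sdl_out //; [apply: contra nsc|apply: contra nsb] => /eqP -> ;
  by rewrite -e /st eqxx.
Qed.

Lemma sdl_fun1 a : functional a.1 (sdl a).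
Proof. exact: sdl_fun. Qed.

Definition lev a g := Lam a.1 (sdl a) g.
(** The half-space of a: the elements that have a reduced word starting with a. *)
Definition H a g : bool := (1 <= lev a g)%R.

Lemma st_refl z : st z z. Proof. by rewrite /st eqxx. Qed.
Lemma lk_st z x : lk z x -> st z x. Proof. by rewrite /st /lk => ->; rewrite orbT. Qed.
Lemma lk_irr z : lk z z = false. Proof. exact: edge_irr. Qed.
Lemma lk_sym x y : lk x y = lk y x. Proof. exact: edge_sym. Qed.

Lemma parlk_st z g : par (lk z) g -> F z g.
Proof. by apply: parS => x; apply: lk_st. Qed.

Lemma levM a h g : F a.1 h -> lev a (h * g) = (lev a h + lev a g)%R.
Proof. by apply: LamM; apply: sdl_fun1. Qed.

Lemma lev_lt1 a b : lev a (lt b) = sdl a b.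
Proof. by rewrite /lev Lam_lt //; apply: sdl_fun1. Qed.

Lemma lev_lk a g : par (lk a.1) g -> lev a g = 0%R.
Proof.
move=> [w [allw <-]]; elim: w allw => [|b w IH] /=.
  by rewrite /lev Lam1 //; apply: sdl_fun1.
case/andP=> lb /IH e; rewrite gw_cons levM; last by apply: par_lt; apply: lk_st.
rewrite e addr0 lev_lt1.
by apply: sdl_out; apply: contraTneq lb => ->; rewrite lk_irr.
Qed.

Lemma H_lk a k g : par (lk a.1) k -> H a (k * g) = H a g.
Proof. move=> k_lk; rewrite /H levM; last exact: parlk_st. by rewrite lev_lk ?add0r. Qed.

Lemma H1 a g : par (lk a.1) g -> H a g = false.
Proof. by move=> gl; rewrite /H lev_lk. Qed.

Lemma lev_lt a g : F a.1 g -> lev a (g * lt a) = (lev a g + 1)%R.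
Proof.
by move=> Fg; rewrite /lev Lam_step //; [rewrite /sdl eqxx|apply: sdl_fun1].
Qed.

Lemma Hlt a g : par (lk a.1) g -> H a (g * lt a).
Proof.
by move=> gl; rewrite /H lev_lt ?lev_lk //; apply: parlk_st.
Qed.

Lemma commute_st a b : st a.1 b.1 -> commute (lt a) (lt b).
Proof.
case/orP=> [/eqP e|ab]; last exact: lt_com.
have [->|n] := eqVneq b a; first exact: commute_refl.
have -> : b = inv a.
  by case: a b e n => [x s] [y t] /= -> ; rewrite /inv_letter /=; case: s t => [] [] //; rewrite eqxx.
by rewrite ltV; apply: commuteV; apply: commute_refl.
Qed.

Lemma flat_commute a h : F a.1 h -> commute (lt a) h.
Proof. by move=> /par_com Fh; apply: commute_sym; apply: Fh => b sb; apply: commute_sym; apply: commute_st. Qed.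

Lemma flat_form a g : F a.1 g -> exists n m h, [/\ par (lk a.1) h,
  g = lt a ^+ n * (lt a)^-1 ^+ m * h & lev a g = (n%:Z - m%:Z)%R].
Proof.
move=> [w [allw <-]]; elim: w allw => [|b w IH] /=.
  exists 0, 0, 1; split; first exact: par1.
    by rewrite !expg0 !mulg1.
  by rewrite /lev gw0 Lam1 //; apply: sdl_fun1.
case/andP=> sb /IH [n [m [h [hl e lv]]]].
have Fb : F a.1 (lt b) by apply: par_lt.
rewrite gw_cons levM // lv {IH}.
rewrite lev_lt1; case/orP: sb => [/eqP eb|lb].
  have [->|n'] := eqVneq b a.
    exists n.+1, m, h; split=> //; first by rewrite e expgS !mulgA.
    by rewrite /sdl eqxx; lia.
  have -> : b = inv a.
    by case: a b eb n' {e lv hl Fb} => [x s] [y t] /= -> ; rewrite /inv_letter /=; case: s t => [] [] //; rewrite eqxx.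
  exists n, m.+1, h; split=> //.
    rewrite e ltV expgS !mulgA; congr (_ * _ * _).
    by apply: commute_sym; apply: commuteV; apply: commute_sym; apply: commuteX; apply: commute_refl.
  by rewrite /sdl inv_neq eqxx; lia.
exists n, m, (lt b * h); split.
- by apply: parM => //; apply: par_lt.
- have cab : commute (lt b) (lt a).
    by apply: commute_sym; apply: commute_st; apply: lk_st.
  rewrite e !mulgA; congr (_ * _); rewrite -mulgA.
  by apply: commuteM; apply: commuteX => //; apply: commuteV.
- by rewrite sdl_out ?add0r //; apply: contraTneq lb => ->; rewrite edge_irr.
Qed.

Lemma lev0_lk a g : F a.1 g -> lev a g = 0%R -> par (lk a.1) g.
Proof.
move=> /flat_form [n [m [h [hl -> ->]]]] /eqP; rewrite subr_eq0 => /eqP[->].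
by rewrite expVgn mulgV mul1g.
Qed.

(** An edge of the Cayley graph crosses the wall of a half-space only if it is
    labelled by the same vertex and issues from the group of the link. *)
Lemma H_cross a b g : H a (g * lt b) != H a g ->
  (b = a /\ par (lk a.1) g) \/ (b = inv a /\ par (lk a.1) (g * lt b)).
Proof.
have ff := sdl_fun1 a.
suff key h : H a (h * lt a) != H a h -> par (lk a.1) h.
  have [->|nb] := eqVneq b a; first by move/key; left.
  have [->|ni] := eqVneq b (inv a).
    have := key (g * lt (inv a)); rewrite ltV mulgVK eq_sym => k nH.
    by right; split=> //; apply: k.
  have e1 : sdl a b = 0%R by rewrite /sdl (negPf nb) (negPf ni).
  have e2 : sdl a (inv b) = 0%R by rewrite sdlV e1 oppr0.
  by rewrite /H /lev (Lam_zero ff) ?eqxx.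
have [Fh|nFh] := pselect (F a.1 h).
  move=> nH; apply: lev0_lk => //; move: nH; rewrite /H lev_lt //.
  by case: (lerP 1 (lev a h)); case: (lerP 1 (lev a h + 1)) => //; lia.
rewrite /H /lev (Lam_same ff) ?eqxx // => Fh.
by apply: nFh; apply/(@parMr D (st a.1) h (lt a)) => //; apply/par_lt/st_refl.
Qed.

End Levels.

(** * Sums over coset spaces *)

Section FiniteSums.
Local Open Scope ring_scope.

Definition S (I : choiceType) (F : I -> int) : int := \sum_(i \in [set: I]) F i.
Definition fsup (I : choiceType) (F : I -> int) :=
  exists s : seq I, forall i, F i != 0 -> i \in s.

Variables I J : choiceType.
Implicit Types (F E : I -> int).

Lemma SE F (s : seq I) : uniq s -> (forall i, F i != 0 -> i \in s) ->
  S F = \sum_(i <- s) F i.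
Proof.
move=> us sup; rewrite /S (@fsbigE _ _ _ _ _ s) //.
  by apply: congr_big => // i; rewrite in_setT.
by move=> i _ nis; apply/eqP; apply: contraNT nis; apply: sup.
Qed.

Lemma fsupP F : fsup F -> exists2 s : seq I, uniq s &
  (forall i, F i != 0 -> i \in s) /\ S F = \sum_(i <- s) F i.
Proof.
move=> [s sP]; have us := undup_uniq s.
have sup i : F i != 0 -> i \in undup s by rewrite mem_undup; apply: sP.
by exists (undup s) => //; split=> //; apply: SE.
Qed.

Lemma fsup_sub F E : (forall i, E i != 0 -> F i != 0) -> fsup F -> fsup E.
Proof. by move=> sub [s sP]; exists s => i /sub; apply: sP. Qed.

Lemma fsup_add F E : fsup F -> fsup E -> fsup (fun i => F i + E i).
Proof.
move=> [s sP] [t tP]; exists (s ++ t) => i; rewrite mem_cat.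
have [e|/sP -> //] := eqVneq (F i) 0.
by rewrite e add0r => /tP ->; rewrite orbT.
Qed.

Lemma S_add F E : fsup F -> fsup E -> S (fun i => F i + E i) = S F + S E.
Proof.
move=> [s sP] [t tP].
have u := undup_uniq (s ++ t).
have sF i : F i != 0 -> i \in undup (s ++ t).
  by rewrite mem_undup mem_cat => /sP ->.
have sE i : E i != 0 -> i \in undup (s ++ t).
  by rewrite mem_undup mem_cat => /tP ->; rewrite orbT.
rewrite (SE u sF) (SE u sE) -big_split; apply: SE => // i.
have [e|/sF -> //] := eqVneq (F i) 0.
by rewrite e add0r => /sE.
Qed.

Lemma eq_S F E : F =1 E -> S F = S E.
Proof. by move=> /funext ->. Qed.

Lemma S_0 F : (forall i, F i = 0) -> S F = 0.
Proof. by move=> F0; rewrite (@SE F [::]) ?big_nil // => i; rewrite F0 eqxx. Qed.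

Lemma S_single F (j : I) : (forall i, i != j -> F i = 0) -> S F = F j.
Proof.
move=> F0; rewrite (@SE F [:: j]) ?big_seq1 // => i.
by rewrite inE; have [//|/F0 ->] := eqVneq i j; rewrite eqxx.
Qed.

Lemma S_ge0 F : (forall i, 0 <= F i) -> 0 <= S F.
Proof. by move=> F0; apply: fsumr_ge0. Qed.

Lemma S_opp F : S (fun i => - F i) = - S F.
Proof.
rewrite /S -[RHS]mulN1r mulr_fsumr; apply: eq_fsbigr => i _.
by rewrite mulN1r.
Qed.

Lemma fsup_opp F : fsup F -> fsup (fun i => - F i).
Proof. by apply: fsup_sub => i; rewrite oppr_eq0. Qed.

Lemma S_sub F E : fsup F -> fsup E -> S (fun i => F i - E i) = S F - S E.
Proof. by move=> fF fE; rewrite S_add ?S_opp //; apply: fsup_opp. Qed.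

Lemma S_le F E : fsup F -> fsup E -> (forall i, F i <= E i) -> S F <= S E.
Proof.
move=> fF fE le; rewrite -subr_ge0 -S_sub //; apply: S_ge0 => i.
by rewrite subr_ge0.
Qed.

Lemma S_norm F : fsup F -> `|S F| <= S (fun i => `|F i|).
Proof.
move=> fF; have [s us [sP ->]] := fsupP fF.
rewrite (@SE _ s) //; last by move=> i; rewrite normr_eq0; apply: sP.
exact: ler_norm_sum.
Qed.

Lemma S_sum (K : Type) (r : seq K) (F : K -> I -> int) :
  (forall k, fsup (F k)) -> fsup (fun i => \sum_(k <- r) F k i) /\
  S (fun i => \sum_(k <- r) F k i) = \sum_(k <- r) S (F k).
Proof.
move=> fF; elim: r => [|k r [IH1 IH2]].
  have z : (fun i : I => \sum_(k <- [::]) F k i) = fun=> 0.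
    by apply/funext => i; rewrite big_nil.
  by split; [exists [::] => i|rewrite big_nil S_0 // => i]; rewrite big_nil ?eqxx.
have e : (fun i => \sum_(k <- k :: r) F k i) = fun i => F k i + \sum_(k <- r) F k i.
  by apply/funext => i; rewrite big_cons.
by rewrite e big_cons; split; [apply: fsup_add|rewrite S_add // IH2].
Qed.

Lemma S_reindex (phi : J -> I) (E : J -> int) F : fsup E ->
  (forall j, E j != 0 -> F (phi j) = E j) ->
  (forall j j', E j != 0 -> E j' != 0 -> phi j = phi j' -> j = j') ->
  (forall i, F i != 0 -> exists2 j, E j != 0 & phi j = i) ->
  fsup F /\ S F = S E.
Proof.
move=> fE val inj surj.
have [s0 sP0] := fE; pose s := undup s0; have us : uniq s := undup_uniq s0.
have sP j : E j != 0 -> j \in s by rewrite mem_undup; apply: sP0.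
pose t := [seq j <- s | E j != 0].
have tE j : j \in t = (E j != 0).
  by rewrite mem_filter andbC; apply/andb_idl => /sP.
have ut : uniq t by rewrite filter_uniq.
have sup i : F i != 0 -> i \in map phi t.
  by move=> /surj [j Ej <-]; apply: map_f; rewrite tE.
split; first by exists (map phi t).
rewrite (SE _ sup); last first.
  rewrite map_inj_in_uniq // => j j'; rewrite !tE; exact: inj.
rewrite big_map (_ : S E = \sum_(j <- t) E j); last first.
  have := @fsbigE _ _ _ _ [set: J]%classic t E ut.
  rewrite /S => -> //.
    by apply: congr_big => // i; rewrite in_setT.
  by move=> j _; rewrite tE negbK => /eqP.
by rewrite !big_seq; apply: eq_bigr => j; rewrite tE => /val.
Qed.

End FiniteSums.

Lemma S_pair (I J : choiceType) (E : I * J -> int) : fsup E ->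
  fsup (fun i => S (fun j => E (i, j))) /\ S E = S (fun i => S (fun j => E (i, j))).
Proof.
move=> [s sP]; pose si := undup (map fst s); pose sj := undup (map snd s).
have e1 i : S (fun j => E (i, j)) = (\sum_(j <- sj) E (i, j))%R.
  apply: SE; first exact: undup_uniq.
  by move=> j /sP ijs; rewrite mem_undup; apply/mapP; exists (i, j).
have sup i : S (fun j => E (i, j)) != 0%R -> i \in si.
  rewrite mem_undup e1; apply: contraNT => nis; apply/eqP/big1 => j _.
  by apply/eqP; apply: contraNT nis => /sP ijs; apply/mapP; exists (i, j).
split; first by exists si.
rewrite (SE _ sup) ?undup_uniq // (eq_bigr _ (fun i _ => e1 i)).
rewrite (@SE _ E (allpairs pair si sj)); last first.
- move=> [i j] /sP ijs; apply/allpairsP; exists (i, j).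
  by split=> //=; rewrite mem_undup; apply/mapP; exists (i, j).
- by apply: allpairs_uniq; rewrite ?undup_uniq // => -[? ?] [? ?].
by rewrite big_allpairs.
Qed.

Section Cosets.
Variable G : groupType.
Implicit Types (K A : G -> Prop) (g h k u : G) (F : G -> int).
Local Open Scope group_scope.

Record subg K : Prop := Subg {
  sub1 : K 1; subM : forall g h, K g -> K h -> K (g * h);
  subV : forall g, K g -> K g^-1 }.

Definition keq K g h := K (h * g^-1).

(** Sums over a coset space are taken over chosen representatives, so that they
    become sums over the group with finite support. *)
Definition rep K g := xget 1 [set h | keq K g h]%classic.
Definition isum K F := S (fun g => if rep K g == g then F g else 0%R).
Definition kinv (X : Type) K (F : G -> X) := forall k g, K k -> F (k * g) = F g.
Definition kfin K F := exists s : seq G, forall g, F g != 0%R -> exists2 t, t \in s & keq K t g.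

Variable K : G -> Prop.
Hypothesis sK : subg K.

Lemma keq_refl g : keq K g g.
Proof. by rewrite /keq mulgV; apply: sub1. Qed.

Lemma keq_sym g h : keq K g h -> keq K h g.
Proof. by rewrite /keq => /(subV sK); rewrite invgM invgK. Qed.

Lemma keq_trans g h u : keq K g h -> keq K h u -> keq K g u.
Proof.
by move=> gh hu; have := subM sK hu gh; rewrite /keq mulgA mulgVK.
Qed.

Lemma keqP (X : Type) (F : G -> X) g h : kinv K F -> keq K g h -> F h = F g.
Proof. by move=> inF gh; rewrite -(inF _ g gh) mulgVK. Qed.

Lemma keq_mulr g h w : keq K g h <-> keq K (g * w) (h * w).
Proof. by rewrite /keq invgM mulgA mulgK. Qed.

Lemma rep_keq g : keq K g (rep K g).
Proof. by apply: (@xgetI _ 1 [set h | keq K g h]%classic g); apply: keq_refl. Qed.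

Lemma rep_eq g h : keq K g h -> rep K g = rep K h.
Proof.
move=> gh; rewrite /rep; congr (xget _ _).
apply/seteqP; split=> u /=; first exact/keq_trans/keq_sym.
exact: keq_trans.
Qed.

Lemma rep_idem g : rep K (rep K g) = rep K g.
Proof. by apply/esym/rep_eq/rep_keq. Qed.

Lemma kfin_fsup F : kfin K F -> fsup (fun g => if rep K g == g then F g else 0%R).
Proof.
move=> [s sP]; exists (map (rep K) s) => g; case: (rep K g =P g); last by rewrite eqxx.
move=> <- /sP[t ts /rep_eq e]; rewrite rep_idem in e.
by rewrite -e; apply: map_f.
Qed.

(** A sum over cosets may be computed along any parametrization of the cosets that
    carry the support. *)
Lemma isum_param (J : choiceType) (phi : J -> G) (E : J -> int) F :
  kinv K F -> fsup E ->
  (forall j, E j != 0%R -> F (phi j) = E j) ->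
  (forall j j', E j != 0%R -> E j' != 0%R -> keq K (phi j) (phi j') -> j = j') ->
  (forall g, F g != 0%R -> exists2 j, E j != 0%R & keq K (phi j) g) ->
  isum K F = S E.
Proof.
move=> inF fE val inj surj.
apply: (proj2 (@S_reindex G J (fun j => rep K (phi j)) E _ fE _ _ _)) => //.
- by move=> j Ej; rewrite rep_idem eqxx -val // (keqP inF (rep_keq _)).
- move=> j j' Ej Ej' e; apply: inj => //.
  by apply: keq_trans (rep_keq _) _; rewrite e; apply/keq_sym/rep_keq.
- move=> g; case: (rep K g =P g); last by rewrite eqxx.
  move=> <- Fg; have [j Ej jg] := surj _ Fg.
  by exists j => //; rewrite (rep_eq jg) rep_idem.
Qed.

Lemma isum_add F F' : kfin K F -> kfin K F' ->
  isum K (fun g => F g + F' g)%R = (isum K F + isum K F')%R.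
Proof.
move=> /kfin_fsup fF /kfin_fsup fF'; rewrite /isum -S_add //; apply: eq_S => g.
by case: ifP.
Qed.

Lemma kfin_add F F' : kfin K F -> kfin K F' -> kfin K (fun g => F g + F' g)%R.
Proof.
move=> [s sP] [t tP]; exists (s ++ t) => g.
have [e|/sP [u us ug] _] := eqVneq (F g) 0%R; last first.
  by exists u; rewrite ?mem_cat ?us.
by rewrite e add0r => /tP [u ut ug]; exists u; rewrite ?mem_cat ?ut ?orbT.
Qed.

Lemma kfin_sub F F' : (forall g, F' g != 0%R -> F g != 0%R) -> kfin K F -> kfin K F'.
Proof. by move=> sub [s sP]; exists s => g /sub; apply: sP. Qed.

Lemma isum_le F F' : kfin K F -> kfin K F' -> (forall g, F g <= F' g)%R ->
  (isum K F <= isum K F')%R.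
Proof.
move=> /kfin_fsup fF /kfin_fsup fF' le; apply: S_le => // g.
by case: (_ == _).
Qed.

Lemma isum_ge0 F : (forall g, 0 <= F g)%R -> (0 <= isum K F)%R.
Proof. by move=> F0; apply: S_ge0 => g; case: (_ == _). Qed.

Lemma eq_isum F F' : F =1 F' -> isum K F = isum K F'.
Proof. by move=> /funext ->. Qed.

Lemma kfin_mulr F w : kfin K F -> kfin K (fun g => F (g * w)).
Proof.
move=> [s sP]; exists [seq t * w^-1 | t <- s] => g /sP [t ts tg].
by exists (t * w^-1); [apply: map_f | rewrite (keq_mulr _ _ w) mulgVK].
Qed.

Lemma isum_mulr F w : kinv K F -> kfin K F -> isum K (fun g => F (g * w)) = isum K F.
Proof.
move=> inF fF; have fE := kfin_fsup (kfin_mulr w fF).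
apply/esym/(isum_param (phi := fun g => g * w)) => //.
- by move=> g; case: (rep K g =P g); rewrite ?eqxx.
- move=> g h; case: (rep K g =P g) => [eg|]; rewrite ?eqxx //.
  case: (rep K h =P h) => [eh|]; rewrite ?eqxx // => _ _ gh.
  by rewrite -eg -eh; apply/rep_eq/(keq_mulr _ _ w).
- move=> g Fg; exists (rep K (g * w^-1)); last first.
    by rewrite (keq_mulr _ _ w^-1) mulgK; apply/keq_sym/rep_keq.
  rewrite rep_idem eqxx; apply: contra_neq Fg => <-.
  apply: keqP => //; apply/(keq_mulr _ _ w^-1); rewrite mulgK.
  exact/keq_sym/rep_keq.
Qed.

Lemma isum_one F (t : G) : kinv K F -> (forall g, F g != 0%R -> keq K t g) -> isum K F = F t.
Proof.
move=> inF supp; rewrite /isum (@S_single _ _ (rep K t)); last first.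
  move=> g; case: (rep K g =P g) => // e ng; apply/eqP; apply: contraNT ng => /supp tg.
  by rewrite (rep_eq tg) e.
by rewrite rep_idem eqxx (keqP inF (rep_keq _)).
Qed.

Lemma isum_sum (I : Type) (r : seq I) (F : I -> G -> int) :
  (forall i, kfin K (F i)) ->
  isum K (fun g => \sum_(i <- r) F i g)%R = (\sum_(i <- r) isum K (F i))%R.
Proof.
move=> fF; rewrite /isum.
have [_ <-] := S_sum r (fun i => kfin_fsup (fF i)).
by apply: eq_S => g; case: ifP => // _; rewrite big1.
Qed.

End Cosets.

Section Tower.
Variable G : groupType.
Variables (K A : G -> Prop).
Hypotheses (sK : subg K) (sA : subg A) (KA : forall g, K g -> A g).
Local Open Scope group_scope.

(** The cosets of [K] inside a coset [A u] are those of the [s u], [s] running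
    through the cosets of K in A; summing these first is the tower law. *)
Lemma isum_tower (F : G -> int) : kinv K F -> kfin K F ->
  let E u s := if `[< A s >] && (rep K s == s) then F (s * u) else 0%R in
  isum K F = isum A (fun u => S (E u)) /\ forall u, fsup (E u).
Proof.
move=> inF fF E.
have fE u : fsup (E u).
  have [s sP] := fF; exists [seq rep K (t * u^-1) | t <- s] => h.
  rewrite /E; case: ifP; rewrite ?eqxx // => /andP[_ /eqP rh] /sP[t ts tg].
  apply/mapP; exists t => //; rewrite -rh; apply/esym/rep_eq => //.
  by rewrite (keq_mulr _ _ _ u) mulgVK.
split=> //.
pose P (p : G * G) := if rep A p.1 == p.1 then E p.1 p.2 else 0%R.
have fP : fsup P.
  have [s sP] := fF.
  exists [seq (rep A t, rep K (t * (rep A t)^-1)) | t <- s] => -[u h].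
  rewrite /P /E /=; do 2![case: ifP; rewrite ?eqxx //].
  move=> /andP[/asboolP Ah /eqP rh] /eqP ru /sP[t ts tg]; apply/mapP; exists t => //.
  have e : rep A t = u.
    rewrite -ru; apply: rep_eq => //.
    have tg' : keq A t (h * u) by apply: KA.
    by apply: keq_trans tg' _ => //; apply: keq_sym => //; rewrite /keq mulgK.
  rewrite e; congr pair; rewrite -rh; apply/esym/rep_eq => //.
  by rewrite (keq_mulr _ _ _ u) mulgVK.
rewrite (@isum_param G K sK _ (fun p => p.2 * p.1) P F) //.
- have [_ ->] := S_pair fP; apply: eq_S => u; rewrite /P /=.
  by case: ifP => // _; apply: S_0.
- by move=> [u h]; rewrite /P /E /=; do 2![case: ifP; rewrite ?eqxx //].
- move=> [u h] [u' h']; rewrite /P /E /=; do 4![case: ifP; rewrite ?eqxx //].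
  move=> /andP[/asboolP Ah' /eqP rh'] /eqP ru' /andP[/asboolP Ah /eqP rh] /eqP ru _ _ e.
  have euu : u = u'.
    rewrite -ru -ru'; apply: rep_eq => //.
    have e1 : keq A u (h * u) by rewrite /keq mulgK.
    have e2 : keq A u' (h' * u') by rewrite /keq mulgK.
    by apply: keq_trans e1 _ => //; apply: keq_trans (keq_sym sA e2) => //; apply: KA.
  rewrite euu in e *; congr pair; rewrite -rh -rh'; apply: rep_eq => //.
  by rewrite (keq_mulr _ _ _ u').
- move=> g Fg; pose u := rep A g; pose h := rep K (g * u^-1).
  have Ah : A h.
    have := KA (rep_keq sK (g * u^-1)); rewrite -/h invgM invgK => A1.
    have A2 : A (u * g^-1) by apply: rep_keq.
    by have := subM sA A1 (subV sA A2); rewrite mulgK.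
  have kg : keq K (h * u) g.
    by apply: keq_sym => //; rewrite (keq_mulr _ _ _ u^-1) mulgK; apply: rep_keq.
  exists (u, h) => //=; rewrite /P /E /= rep_idem // eqxx; case: asboolP => //= _.
  by rewrite rep_idem // eqxx; apply: contra_neq Fg => <-; apply: keqP kg.
Qed.

Variables (psi : G -> int) (rho : int -> G).
Hypotheses (psiM : forall g h, A g -> A h -> psi (g * h) = (psi g + psi h)%R)
  (psiK : forall g, A g -> psi g = 0%R -> K g)
  (Kpsi : forall g, K g -> psi g = 0%R)
  (rhoA : forall j, A (rho j)) (rhoK : forall j, psi (rho j) = j).

(** The same when K is the kernel of a surjection from A to the integers, whose
    section rho then runs through the cosets. *)
Lemma isum_tower_int (F : G -> int) : kinv K F -> kfin K F ->
  isum K F = isum A (fun u => S (fun j => F (rho j * u))) /\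
  forall u, fsup (fun j => F (rho j * u)).
Proof.
move=> inF fF; have [-> fE] := isum_tower inF fF.
have psi1 : psi 1 = 0%R by apply: Kpsi; apply: sub1.
have psiV h : A h -> psi h^-1 = (- psi h)%R.
  move=> Ah; apply/eqP; rewrite -addr_eq0 -psiM ?mulVg ?psi1 //.
  exact: subV.
have key h h' : A h -> A h' -> keq K h h' <-> psi h = psi h'.
  move=> Ah Ah'; have Ai := subV sA Ah; rewrite /keq; split=> [/Kpsi|e].
    by rewrite psiM // psiV // => /eqP; rewrite subr_eq0 => /eqP.
  by apply: psiK; [apply: subM | rewrite psiM // psiV // e subrr].
suff main u : fsup (fun j => F (rho j * u)) /\ S (fun j => F (rho j * u)) =
   S (fun s => if `[< A s >] && (rep K s == s) then F (s * u) else 0%R).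
  by split=> [|u]; [apply: eq_isum => u; have [_ ->] := main u | have [] := main u].
have Frho s : A s -> F (rho (psi s) * u) = F (s * u).
  move=> As; apply: (keqP inF); apply: (proj1 (keq_mulr K _ _ u)).
  by apply/key => //; rewrite rhoK.
apply: (S_reindex (phi := psi)) (fE u) _ _ _.
- move=> s; case: ifP; rewrite ?eqxx // => /andP[/asboolP As _] _; exact: Frho.
- move=> s t; do 2![case: ifP; rewrite ?eqxx //].
  move=> /andP[/asboolP At /eqP rt] /andP[/asboolP As /eqP rs] _ _ e.
  by rewrite -rt -rs; apply: rep_eq => //; apply/key.
- move=> j Fj; have Ar : A (rep K (rho j)).
    have := subM sA (KA (rep_keq sK (rho j))) (rhoA j).
    by rewrite mulgVK.
  have ps : psi (rep K (rho j)) = j.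
    by rewrite -[RHS](rhoK j); apply/esym/key => //; apply: rep_keq.
  exists (rep K (rho j)) => //.
  case: asboolP => //= _; rewrite rep_idem // eqxx -Frho // ps //.
Qed.

End Tower.

(** * Variation of a level function along an element *)

Section Variation.
Variable D : sgraph.
Implicit Types (a b c : letter D) (x y z : D).
Local Notation G := (raag (@edge D)).
Local Notation gw := (raag_of_word (@edge D)).
Local Notation F z := (par (st z)).
Local Open Scope group_scope.

Lemma par_subg (P : pred D) : subg (par (D := D) P).
Proof. by split; [apply: par1|apply: parM|apply: parV]. Qed.

Section Var.
Variables (K : G -> Prop) (L : G -> int).
Hypothesis sK : subg K.

Definition quasi := forall k g g', K k ->
  (L (k * g)%g - L g = L (k * g')%g - L g')%R.
Definition vfin := forall a, kfin K (fun g => L (g * lt a)%g - L g)%R.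
(** The total variation of L along the translates of a path from 1 to w, up to the
    left action of K under which the increments of L are invariant. *)
Definition V w := isum K (fun g => `|L (g * w)%g - L g|%R).

Hypotheses (qL : quasi) (fL : vfin).

Lemma vfin_w w : kfin K (fun g => L (g * w)%g - L g)%R.
Proof.
elim/gw_ind: w => [|w a IH]; first by exists [::] => g; rewrite mulg1 subrr eqxx.
apply: kfin_sub (kfin_add (kfin_mulr w (fL a)) IH) => g.
by rewrite mulgA addrA addrNK.
Qed.

Lemma vfin_n w : kfin K (fun g => `|L (g * w)%g - L g|%R).
Proof. by apply: kfin_sub (vfin_w w) => g; rewrite normr_eq0. Qed.

Lemma kinv_d w : kinv K (fun g => L (g * w)%g - L g)%R.
Proof.
move=> k g Kk; have := qL (g * w) g Kk.
by rewrite mulgA => e; move: e; set x := L _; set y := L _; set t := L _; set u := L _; lia.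
Qed.

Lemma kinv_n w : kinv K (fun g => `|L (g * w)%g - L g|%R).
Proof. by move=> k g Kk; rewrite kinv_d. Qed.

Lemma V_ge0 w : (0 <= V w)%R.
Proof. by apply: isum_ge0 => g. Qed.

Lemma V1 : V 1 = 0%R.
Proof. by apply: S_0 => g; rewrite mulg1 subrr normr0; case: ifP. Qed.

Lemma VM v w : (V (v * w)%g <= V v + V w)%R.
Proof.
have <- : isum K (fun g => `|L (g * v * w)%g%g - L (g * v)%g|%R) = V w.
  exact: (isum_mulr sK v (kinv_n w) (vfin_n w)).
rewrite -isum_add //; [|exact: vfin_n|exact: (kfin_mulr v (vfin_n w))].
apply: isum_le => //; [exact: vfin_n|apply: kfin_add => //|].
- exact: vfin_n.
- exact: (kfin_mulr v (vfin_n w)).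
- by move=> g; rewrite mulgA [leRHS]addrC; apply: ler_distD.
Qed.

Lemma VV w : V (w^-1)%g = V w.
Proof.
rewrite -[RHS](isum_mulr sK w^-1 (kinv_n w) (vfin_n w)); apply: eq_isum => g.
by rewrite mulgVK distrC.
Qed.

End Var.

Lemma Lam_quasi z f : functional z f -> quasi (F z) (Lam z f).
Proof. by move=> ff k g g' Fk; rewrite !LamM // !addrK. Qed.

Lemma Lam_vfin z f : functional z f -> vfin (F z) (Lam z f).
Proof.
move=> ff a; exists [:: 1; (lt a)^-1] => g n.
have [Fg|nFg] := pselect (F z g).
  by exists 1; rewrite ?inE ?eqxx // /keq invg1 mulg1.
have [Fga|nFga] := pselect (F z (g * lt a)).
  by exists (lt a)^-1; rewrite ?inE ?eqxx ?orbT // /keq invgK.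
by move: n; rewrite (Lam_same ff) ?subrr ?eqxx.
Qed.

Definition N z f w := V (F z) (Lam z f) w.
Definition ell a w := V (par (lk a.1)) (fun g => Posz (H a g)) w.

Lemma H_quasi a : quasi (par (lk a.1)) (fun g => Posz (H a g)).
Proof. by move=> k g g' lk_k; rewrite !H_lk // !subrr. Qed.

Lemma H_vfin a : vfin (par (lk a.1)) (fun g => Posz (H a g)).
Proof.
move=> b; exists [:: 1; (lt b)^-1] => g n.
have : H a (g * lt b) != H a g by apply: contra_neq n => ->; rewrite subrr.
case/H_cross=> -[_ e].
  by exists 1; rewrite ?inE ?eqxx // /keq invg1 mulg1.
by exists (lt b)^-1; rewrite ?inE ?eqxx ?orbT // /keq invgK.
Qed.

(** An integer distance counts the thresholds between two integers, which turns
    variations of level functions into counts of walls. *)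
Lemma S_interval (m n : int) :
  S (fun j : int => `|((1 <= j + m)%R%:Z - (1 <= j + n)%R%:Z)|%R) = `|m - n|%R.
Proof.
wlog le : m n / (n <= m)%R.
  move=> W; case: (leP n m) => [|/ltW] le; first exact: W.
  by rewrite distrC -W //; apply: eq_S => j; rewrite distrC.
pose r := [seq (1 - m + i%:Z)%R | i <- iota 0 (absz (m - n)%R)].
rewrite (@SE _ _ r); first last.
- move=> j; have [h1|h1] := lerP 1 (j + m)%R; have [h2|h2] := lerP 1 (j + n)%R => // _.
    by apply/mapP; exists (absz (j - (1 - m))%R); rewrite ?mem_iota; lia.
  by lia.
- by rewrite map_inj_uniq ?iota_uniq // => i j; lia.
rewrite big_seq (eq_bigr (fun=> 1%R)) => [|j /mapP[i]]; last first.
  rewrite mem_iota => h ->.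
  have [h1|h1] := lerP 1 (1 - m + i%:Z + m)%R; last by lia.
  by have [h2|h2] := lerP 1 (1 - m + i%:Z + n)%R; [lia|].
rewrite -big_seq big_const_seq count_predT size_map size_iota.
by rewrite iter_addr_0; lia.
Qed.

Definition zpow (g : G) (j : int) := match j with
  | Posz n => g ^+ n | Negz n => (g ^+ n.+1)^-1 end.

Lemma par_zpow P g j : par P g -> par P (zpow g j).
Proof.
move=> Pg; have PX n : par P (g ^+ n).
  by elim: n => [|n IH]; [apply: par1 | rewrite expgS; apply: parM].
by case: j => n; [|apply: parV]; apply: PX.
Qed.

Lemma Lam_zpow z f g j : functional z f -> F z g -> Lam z f (zpow g j) = (j * Lam z f g)%R.
Proof.
move=> ff Fg; have FX n : F z (g ^+ n) by apply: (par_zpow (Posz n)).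
have LX n : Lam z f (g ^+ n)%g = (n%:Z * Lam z f g)%R.
  elim: n => [|n IH]; first by rewrite Lam1 // mul0r.
  by rewrite expgS LamM // IH intS mulrDl mul1r.
case: j => n; first exact: LX.
by rewrite /zpow LamV // LX NegzE mulNr.
Qed.

Lemma lev_zpow a j : lev a (zpow (lt a) j) = j.
Proof.
rewrite /lev Lam_zpow; [|exact: sdl_fun1|exact/par_lt/st_refl].
by rewrite -/(lev a _) lev_lt1 /sdl eqxx mulr1.
Qed.

Lemma par_lt_st a : F a.1 (lt a).
Proof. exact/par_lt/st_refl. Qed.

(** Walls labelled by a, counted as cosets of the link group, are the level sets of the
    coordinate functional, counted as cosets of the star group and a threshold. *)
Lemma ell_N a w : ell a w = N a.1 (sdl a) w.
Proof.
have [|||||e _] := @isum_tower_int G _ _ (par_subg (lk a.1)) (par_subg (st a.1))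
  (fun g => @parlk_st _ _ g) (lev a) (zpow (lt a)) _ _ _ _ _ _
  (kinv_n (@H_quasi a) w) (vfin_n (@H_vfin a) w).
- by move=> g h Fg _; apply: levM.
- by move=> g Fg; apply: lev0_lk.
- by move=> g; apply: lev_lk.
- by move=> j; apply: par_zpow; apply: par_lt_st.
- exact: lev_zpow.
rewrite /ell /V e; apply: eq_isum => u.
rewrite -S_interval; apply: eq_S => j.
have Fj : F a.1 (zpow (lt a) j) by apply: par_zpow; apply: par_lt_st.
by rewrite /H -mulgA !(levM _ Fj) lev_zpow.
Qed.

Lemma Lam_opp z f g : Lam z (fun a => - f a)%R g = (- Lam z f g)%R.
Proof.
rewrite /Lam; elim: (rw g) => [|a w IH] /=; first by rewrite oppr0.
by rewrite IH; case: ifP => // _; rewrite opprD.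
Qed.

Lemma N_opp z f w : N z (fun a => - f a)%R w = N z f w.
Proof. by apply: eq_isum => g; rewrite !Lam_opp -opprD normrN. Qed.

Lemma sdl_inv a b : sdl (inv a) b = (- sdl a b)%R.
Proof.
rewrite /sdl invK; have [->|nb] := eqVneq b a.
  by rewrite eq_sym inv_neq.
by case: (b == inv a); rewrite ?opprK ?oppr0.
Qed.

Lemma ell_inv a w : ell (inv a) w = ell a w.
Proof.
rewrite !ell_N -[RHS]N_opp; congr N.
by apply/funext => b; apply: sdl_inv.
Qed.

Lemma ell_other a b w : b != a -> b != inv a -> ell a (w * lt b) = ell a w.
Proof.
move=> nba nbia; apply: eq_isum => g; congr (`|_ - _|)%R; rewrite mulgA.
congr (Posz (nat_of_bool _)); apply/eqP; case: eqP => // /eqP /H_cross.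
by case=> -[e _]; rewrite e eqxx in nba nbia.
Qed.

Lemma ell_step a w : ell a (w * lt a)%g = (ell a w + 1 - 2 * (H a (w^-1)%g)%:Z)%R.
Proof.
have sK := par_subg (lk a.1); have fH := vfin_n (@H_vfin a).
apply/eqP; rewrite -subr_eq0 -addrA opprD addrA; apply/eqP.
have fN : kfin (par (lk a.1)) (fun g => - `|(H a (g * w)%g)%:Z - (H a g)%:Z|)%R.
  by apply: kfin_sub (fH w) => g; rewrite oppr_eq0.
have -> : (ell a (w * lt a)%g - ell a w)%R = isum (par (lk a.1)) (fun g =>
   `|(H a (g * (w * lt a))%g)%:Z - (H a g)%:Z| - `|(H a (g * w)%g)%:Z - (H a g)%:Z|)%R.
  rewrite isum_add //; congr (_ + _)%R.
  by rewrite /ell /V /isum -S_opp; apply: eq_S => g; case: ifP.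
rewrite (@isum_one _ _ sK _ w^-1); first last.
- move=> g; rewrite mulgA; case: (boolP (H a (g * w * lt a) != H a (g * w)%g)); last first.
    by move=> /negPn/eqP ->; rewrite subrr eqxx.
  case/H_cross => -[e]; last by move: e => /esym/eqP; rewrite inv_neq.
  by rewrite /keq invgK.
- move=> k g Kk; congr (_ - _)%R; exact: (kinv_n (@H_quasi a)).
by rewrite mulKg mulVg (H1 (par1 _)) -(mul1g (lt a)) Hlt //; [case: (H a _)|apply: par1].
Qed.

(** Length as the number of walls between 1 and w, sorted by label. This form, unlike
    word length, splits along classes. *)
Definition len w := (\sum_(x : D) ell (x, false) w)%R.

(** Multiplication by a letter crosses exactly one wall. *)
Lemma len_step w a : len (w * lt a)%g = (len w + 1 - 2 * (H a (w^-1)%g)%:Z)%R.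
Proof.
have key b v : (b == (a.1, false)) || (b == (a.1, true)) ->
   ell (a.1, false) v = ell b v.
  by case/orP => /eqP -> //; rewrite -[(a.1, true)]/(inv (a.1, false)) ell_inv.
rewrite /len (bigD1 a.1) //= [in RHS](bigD1 a.1) //= !(key a) //; last first.
- by case: (a) => x []; rewrite /= eqxx ?orbT.
- by case: (a) => x []; rewrite /= eqxx ?orbT.
rewrite ell_step (eq_bigr (fun x => ell (x, false) w)); first by lia.
move=> x nx; apply: ell_other; apply: contra nx => /eqP ->//.
Qed.

Lemma len1 : len 1 = 0%R.
Proof. by rewrite /len big1 // => x _; apply: V1. Qed.

Lemma lenM v w : (len (v * w)%g <= len v + len w)%R.
Proof.
rewrite /len -big_split; apply: ler_sum => x _; apply: VM => //.
- exact: par_subg.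
- exact: H_quasi.
- exact: H_vfin.
Qed.

Lemma lenV w : len (w^-1)%g = len w.
Proof.
by apply: eq_bigr => x _; apply: VV; [apply: par_subg|apply: H_quasi|apply: H_vfin].
Qed.

Lemma len_ge0 w : (0 <= len w)%R.
Proof. by apply: sumr_ge0 => x _; apply: V_ge0. Qed.

Lemma H_start a u : H a u -> exists v, u = lt a * gw v /\ size (rw u) = (size v).+1.
Proof.
rewrite /H /lev /Lam => Hu.
have [p [q [e allp]]] : exists p q, rw u = p ++ a :: q /\ all (fun b => st a.1 b.1) p.
  elim: (rw u) Hu => //= b w IH; have [sb|nsb] := boolP (st a.1 b.1); last first.
    by rewrite sdl_out //; apply: contra nsb => /eqP ->; apply: st_refl.
  have [-> _|nb] := eqVneq b a; first by exists [::], w.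
  rewrite {1}/sdl (negPf nb) => le; have [|p [q [-> allp]]] := IH.
    by move: le; case: (_ == _); lia.
  by exists (b :: p), q; rewrite /= sb.
exists (p ++ q); rewrite e !size_cat /= addnS; split=> //.
have Fp : F a.1 (gw p) by exists p.
by rewrite -(rwK u) e !gwM gw_cons !mulgA (flat_commute Fp).
Qed.

Lemma red_H a w : red (a :: w) -> H (inv a) (gw w) = false.
Proof.
move=> redw; apply/negP => /H_start [v [e s]].
have redw' : red w by apply: (@red_infix _ [:: a] w [::]); rewrite cats0.
have := @red_geo _ v _ redw; rewrite gw_cons e ltV mulVKg => /(_ erefl) /=.
have := perm_size (shuf_perm (rw_shuf redw')); rewrite s => ->.
by rewrite ltnNge leqW.
Qed.

Lemma H_inv a w : red (a :: w) -> H a (gw (a :: w)).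
Proof.
move=> /red_H; rewrite gw_cons /H levM ?lev_lt1 /sdl ?eqxx; last exact: par_lt_st.
rewrite /lev /= (_ : sdl (inv a) = fun b => (- sdl a b)%R); last first.
  by apply/funext => b; apply: sdl_inv.
by rewrite Lam_opp; lia.
Qed.

Lemma len_red w : red w -> len (gw w) = Posz (size w).
Proof.
elim/last_ind: w => [|w a IH] redwa; first by rewrite gw0 len1.
have /andP[redw _] : red w && ~~ blocked a (pilew w) by rewrite -red_rcons.
rewrite gw_rcons len_step IH // -gw_inv size_rcons.
have := red_inv redwa; rewrite /word_inv map_rcons rev_rcons => /red_H.
rewrite invK => ->; lia.
Qed.

Lemma len_size w : (len (gw w) <= (size w)%:Z)%R.
Proof.
elim/last_ind: w => [|w a IH]; first by rewrite gw0 len1.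
by rewrite gw_rcons len_step size_rcons; lia.
Qed.

Lemma len_rw g : len g = Posz (size (rw g)).
Proof. by rewrite -{1}(rwK g) len_red ?rwP. Qed.

Lemma len_eq0 g : len g = 0%R -> g = 1.
Proof. by rewrite len_rw => -[/size0nil e]; rewrite -(rwK g) e gw0. Qed.

Lemma len_eq1 g : len g = 1%R -> exists a, g = lt a.
Proof.
rewrite len_rw => -[]; rewrite -{2}(rwK g); case: (rw g) => [|a []] // _.
by exists a.
Qed.

End Variation.

(** * Class automorphisms *)

Section Extension.
Variable D : sgraph.
Implicit Types (a b c : letter D).
Local Notation G := (raag (@edge D)).
Local Notation gw := (raag_of_word (@edge D)).
Local Open Scope group_scope.

Section Hext.
Variable f : letter D -> G.
Hypotheses (fV : forall a, f (inv a) = (f a)^-1)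
  (fC : forall a b, com a b -> commute (f a) (f b)).

Definition prodw (w : word D) : G := \big[*%g/1]_(a <- w) f a.
(** The homomorphism prescribed on the letters, through reduced words. *)
Definition hext (g : G) := prodw (rw g).

Lemma prodw_cat u v : prodw (u ++ v) = prodw u * prodw v.
Proof. exact: big_cat. Qed.

Lemma prodw_equiv u v : word_equiv (@edge D) u v -> prodw u = prodw v.
Proof.
elim=> // [? ? ? _ -> _ -> //|u' v' a|u' v' x y xy]; rewrite !prodw_cat; congr (_ * _).
  by rewrite /prodw big_cons big_seq1 fV mulgV mul1g.
by congr (_ * _); rewrite /prodw !big_cons !big_nil !mulg1; apply: fC.
Qed.

Lemma hext_gw w : hext (gw w) = prodw w.
Proof. by apply: prodw_equiv; apply/raag_eqP; rewrite -/(gw _) rwK. Qed.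

Lemma hextM g h : hext (g * h) = hext g * hext h.
Proof. by rewrite -{1}(rwK g) -{1}(rwK h) -gwM hext_gw prodw_cat. Qed.

Lemma hext_lt a : hext (lt a) = f a.
Proof. by rewrite hext_gw /prodw big_seq1. Qed.

End Hext.

Definition ishom (al : G -> G) := forall g h, al (g * h) = al g * al h.

Lemma hom1 al : ishom al -> al 1 = 1.
Proof. by move=> aM; apply: (@mulgI _ (al 1)); rewrite -aM !mulg1. Qed.

Lemma homV al g : ishom al -> al g^-1 = (al g)^-1.
Proof. by move=> aM; apply: (@mulgI _ (al g)); rewrite -aM !mulgV hom1. Qed.

Lemma homX al g n : ishom al -> al (g ^+ n) = al g ^+ n.
Proof.
by move=> aM; elim: n => [|n IH]; [rewrite !expg0 hom1 | rewrite !expgS aM IH].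
Qed.

Lemma hom_ext al be : ishom al -> ishom be -> (forall a, al (lt a) = be (lt a)) -> al =1 be.
Proof.
move=> aM bM e; elim/gw_ind => [|g a IH]; first by rewrite !hom1.
by rewrite aM bM IH e.
Qed.

Lemma hom_comp al be : ishom al -> ishom be -> ishom (al \o be).
Proof. by move=> aM bM g h /=; rewrite bM aM. Qed.

Definition isaut al := ishom al /\ exists be, [/\ ishom be, cancel al be & cancel be al].

Lemma aut_comp al be : isaut al -> isaut be -> isaut (al \o be).
Proof.
move=> [aM [al' [aM' K K']]] [bM [be' [bM' L L']]]; split; first exact: hom_comp.
by exists (be' \o al'); split; [apply: hom_comp|apply: can_comp|apply: can_comp].
Qed.

Lemma aut_id : isaut id.
Proof. by split=> //; exists id. Qed.

End Extension.

Section Class.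
Variable D : sgraph.
Implicit Types (a b c : letter D) (x y : D).
Local Notation G := (raag (@edge D)).
Local Notation gw := (raag_of_word (@edge D)).
Local Notation F z := (par (st z)).
Local Open Scope group_scope.

Lemma zpowS (g : G) i : zpow g (i + 1)%R = zpow g i * g.
Proof.
case: i => n; first by rewrite -PoszD addn1 /zpow expgSr.
case: n => [|n]; first by rewrite (_ : (Negz 0 + 1)%R = 0%R) //= expg0 expg1 mulVg.
have -> : (Negz n.+1 + 1)%R = Negz n by lia.
rewrite -[RHS]/((g ^+ n.+2)^-1 * g).
by rewrite (expgS g n.+1) invgM mulgVK.
Qed.

Lemma zpow0 (g : G) : zpow g 0%R = 1. Proof. exact: expg0. Qed.

Lemma zpowD (g : G) i j : zpow g (i + j)%R = zpow g i * zpow g j.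
Proof.
elim/int_rec: j => [|n IH|n IH]; first by rewrite addr0 zpow0 mulg1.
  by rewrite intS [(1 + _)%R]addrC addrA !zpowS IH mulgA.
apply: (@mulIg _ g); rewrite -mulgA -!zpowS -addrA.
by rewrite (_ : (- Posz n.+1 + 1)%R = (- Posz n)%R) //; lia.
Qed.

Lemma zpow_commute (g h : G) i : commute h g -> commute h (zpow g i).
Proof.
by move=> hg; rewrite /zpow; case: i => n; [exact: commuteX|exact/commuteV/commuteX].
Qed.

Lemma zpow_hom al (g : G) i : ishom al -> al (zpow g i) = zpow (al g) i.
Proof. by move=> aM; case: i => n; rewrite /zpow ?(homV _ aM) (homX _ _ aM). Qed.

Lemma zpow1 (g : G) : zpow g 1%R = g. Proof. exact: expg1. Qed.
Lemma zpowN1 (g : G) : zpow g (-1)%R = g^-1.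
Proof. by rewrite -[LHS]/((g ^+ 1)^-1) expg1. Qed.

Variable z : D.
(** Boolean so that sums over a class are finite sums over vertices. *)
Definition cls : pred D := fun x => [forall v, st x v == st z v].

Lemma clsP x : cls x -> st x =1 st z.
Proof. by move=> /forallP h v; apply/eqP. Qed.

Lemma cls_st x : cls x -> st z x.
Proof. by move=> /clsP <-; apply: st_refl. Qed.

Lemma cls_z : cls z. Proof. exact/forallP. Qed.

Lemma sdl_cls x s : cls x -> functional z (sdl (x, s)).
Proof. by move=> cx; apply: sdl_fun; apply: clsP. Qed.

Lemma cls_commute x s b : cls x -> st z b.1 -> commute (lt b) (lt (x, s)).
Proof. by move=> /clsP cx; rewrite -cx => sb; apply/commute_sym/commute_st. Qed.

(** Distinct vertices with the same star are adjacent, so the class generates a free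
    abelian group, in which the order of the factors does not matter. *)
Definition Xp (v : D -> int) : G := \big[*%g/1]_(x <- enum cls) zpow (lt (x, false)) (v x).

Lemma Xp_gen (P : G -> Prop) v : P 1 -> (forall g h, P g -> P h -> P (g * h)) ->
  (forall x, cls x -> P (zpow (lt (x, false)) (v x))) -> P (Xp v).
Proof.
move=> P1 PM Px; rewrite /Xp big_seq; apply: big_ind => // x.
by rewrite mem_enum; apply: Px.
Qed.

Lemma Xp_par v : par cls (Xp v).
Proof.
apply: Xp_gen; [exact: par1|exact: parM|] => x cx.
by apply: par_zpow; apply: par_lt.
Qed.

Lemma Xp_F v : F z (Xp v).
Proof. by apply: parS (Xp_par v) => x; apply: cls_st. Qed.

Lemma Xp_commute b v : st z b.1 -> commute (lt b) (Xp v).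
Proof.
move=> sb; apply: Xp_gen; [exact: commute1|exact: commuteM|] => x cx.
by apply: zpow_commute; apply: cls_commute.
Qed.

Lemma Xp_commuteF h v : F z h -> commute h (Xp v).
Proof. by apply: par_com => a sa; apply: Xp_commute. Qed.

Lemma XpD v w : Xp (fun x => v x + w x)%R = Xp v * Xp w.
Proof.
rewrite /Xp; have: all cls (enum cls) by apply/allP => x; rewrite mem_enum.
elim: (enum cls) => [|x s IH] /=; first by rewrite !big_nil mulg1.
move=> /andP[cx cs]; rewrite !big_cons zpowD IH // !mulgA; congr (_ * _).
rewrite -!mulgA; congr (_ * _); rewrite big_seq.
apply: (big_ind (fun g => commute (zpow (lt (x, false)) (w x)) g)) => [||y ys].
- exact: commute1.
- by move=> g h; apply: commuteM.
- have cy := allP cs _ ys; apply: zpow_commute; apply: commute_sym.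
  by apply: zpow_commute; apply: cls_commute => //; apply: cls_st.
Qed.

Lemma eq_Xp v w : (forall x, cls x -> v x = w x) -> Xp v = Xp w.
Proof.
by move=> e; rewrite /Xp !big_seq; apply: eq_bigr => x; rewrite mem_enum => /e ->.
Qed.

Lemma Xp0 v : (forall x, cls x -> v x = 0%R) -> Xp v = 1.
Proof. by move=> v0; rewrite /Xp big1_seq // => x; rewrite mem_enum => /v0 ->; rewrite zpow0. Qed.

Lemma XpN v : Xp (fun x => - v x)%R = (Xp v)^-1.
Proof.
apply: (@mulgI _ (Xp v)); rewrite mulgV -XpD.
by apply: Xp0 => x _; rewrite subrr.
Qed.

Lemma Xp_lt y s : cls y -> Xp (fun x => sdl (x, false) (y, s)) = lt (y, s).
Proof.
move=> cy; rewrite /Xp; have := enum_uniq cls.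
have : y \in enum cls by rewrite mem_enum.
elim: (enum cls) => // x t IH; rewrite inE /= => /orP[/eqP <-|yt] /andP[xt ut].
  rewrite big_cons big1_seq ?mulg1.
    case: (s); last by rewrite /sdl eqxx zpow1.
    by rewrite -[(y, true)]/(inv (y, false)) sdlV /sdl eqxx zpowN1 ltV.
  move=> x' /= xt'; rewrite sdl_out ?zpow0 //=.
  by apply: contraNneq xt => ->.
rewrite big_cons IH // sdl_out ?zpow0 ?mul1g //=.
by apply: contraNneq xt => <-.
Qed.

Lemma Lam_Xp f v : functional z f -> Lam z f (Xp v) = (\sum_(x | cls x) v x * f (x, false))%R.
Proof.
move=> ff; rewrite -big_enum /Xp.
have: all cls (enum cls) by apply/allP => x; rewrite mem_enum.
elim: (enum cls) => [|x s IH] /=; first by rewrite !big_nil Lam1.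
move=> /andP[/cls_st sx cs]; rewrite !big_cons LamM //; last first.
  by apply: par_zpow; apply: par_lt.
by rewrite IH // Lam_zpow ?Lam_lt //; apply: par_lt.
Qed.

Lemma lev_Xp x v : cls x -> Lam z (sdl (x, false)) (Xp v) = v x.
Proof.
move=> cx; rewrite (Lam_Xp _ (sdl_cls false cx)) (bigD1 x cx) /=.
have -> : sdl (x, false) (x, false) = 1%R by rewrite /sdl eqxx.
rewrite mulr1 big1 ?addr0 // => y /andP[_ ny].
by rewrite sdl_out ?mulr0.
Qed.

Variable f : D -> letter D -> int.
Hypothesis ff : forall x, cls x -> functional z (f x).

(** A letter of the star is multiplied inside the free abelian group of the class so that its
    coordinates become the values of f; a letter outside is multiplied on each of its two sides by
    the element with the coordinates prescribed for that side. *)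
Definition bl a : G :=
  if st z a.1 then lt a * Xp (fun x => f x a - sdl (x, false) a)%R
  else Xp (f^~ a) * lt a * (Xp (f^~ (inv a)))^-1.

Lemma bl_inv a : bl (inv a) = (bl a)^-1.
Proof.
rewrite /bl /=; have [sa|nsa] := boolP (st z a.1); last first.
  by rewrite invK ltV !invgM invgK mulgA.
rewrite invgM -XpN -ltV; have /= <- := @Xp_commute (inv a) (fun x => - (f x a - sdl (x, false) a))%R sa.
congr (_ * _); apply: eq_Xp => x cx.
by rewrite (fun_inv (ff cx)) // sdlV opprB; lia.
Qed.

Lemma bl_out a b : st z a.1 -> ~~ st z b.1 -> com a b -> bl a = lt a.
Proof.
move=> sa nsb ab; rewrite /bl sa Xp0 ?mulg1 // => x cx.
rewrite (fun_out (ff cx) sa nsb ab) sdl_out ?subr0 //=.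
apply: contraNneq nsb => e; rewrite -(clsP cx) /st -e.
by rewrite -[edge _ _]/(com a b) ab orbT.
Qed.

Lemma bl_comp a b : ~~ st z a.1 -> ~~ st z b.1 -> com a b ->
  bl a = Xp (f^~ b) * lt a * (Xp (f^~ b))^-1.
Proof.
move=> nsa nsb ab; rewrite /bl (negPf nsa); congr (_ * _ * _^-1); apply: eq_Xp => x cx.
  exact: fun_comp (ff cx) _ _ _ _ ab.
exact: (fun_comp (ff cx) (a := inv a)).
Qed.

Lemma bl_com a b : com a b -> commute (bl a) (bl b).
Proof.
wlog W : a b / st z b.1 -> st z a.1.
  move=> W ab; have [sb|nsb] := boolP (st z b.1); last by apply: W => // ; rewrite (negPf nsb).
  by apply/commute_sym/W; rewrite ?sb // com_sym.
move=> ab; have [sa|nsa] := boolP (st z a.1); last first.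
  have nsb : ~~ st z b.1 by apply: contra nsa.
  have e1 : Xp (f^~ b) = Xp (f^~ a).
    by apply: eq_Xp => x cx; apply: fun_comp (ff cx) _ _ _ _ _ => //; rewrite com_sym.
  rewrite (bl_comp nsa nsb ab) (@bl_comp b a) // ?(com_sym b) // e1.
  rewrite /commute !mulgA !mulgVK; congr (_ * _).
  by rewrite -!mulgA lt_com.
have [sb|nsb] := boolP (st z b.1).
  have cX v w : commute (lt a * Xp v) (lt b * Xp w).
    apply: commute_sym; apply: commuteM; apply: commute_sym; apply: commuteM.
    - exact: lt_com.
    - exact: Xp_commute.
    - exact/commute_sym/Xp_commute.
    - exact/Xp_commuteF/Xp_F.
  by rewrite /bl sa sb; apply: cX.
rewrite (bl_out sa nsb ab) /bl (negPf nsb).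
apply: commuteM; first apply: commuteM; first exact: Xp_commute.
  exact: lt_com.
by apply: commuteV; apply: Xp_commute.
Qed.

Definition bet := hext bl.

Lemma betM : ishom bet. Proof. exact: hextM bl_inv bl_com. Qed.
Lemma bet_lt a : bet (lt a) = bl a. Proof. exact: hext_lt bl_inv bl_com a. Qed.

Lemma bet_F g : F z g -> F z (bet g).
Proof.
move=> [w [allw <-]]; elim: w allw => [|a w IH] /=; first by move=> _; rewrite gw0 (hom1 betM); apply: par1.
case/andP=> sa /IH Fw; rewrite gw_cons betM bet_lt /bl sa; apply: parM => //.
by apply: parM; [apply: par_lt|apply: Xp_F].
Qed.

Lemma bet_Xp v : bet (Xp v) = Xp (fun x => \sum_(y | cls y) f x (y, false) * v y)%R.
Proof.
have blx y : cls y -> bl (y, false) = Xp (f^~ (y, false)).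
  move=> cy; rewrite /bl cls_st //= -[X in X * _](Xp_lt false cy) -XpD.
  by apply: eq_Xp => x cx; lia.
have Xz n w : zpow (Xp w) n = Xp (fun x => w x * n)%R.
  elim/int_rec: n => [|n IH|n IH]; first by rewrite zpow0 Xp0 // => x _; rewrite mulr0.
    by rewrite intS addrC zpowS IH -XpD; apply: eq_Xp => x _; lia.
  apply: (@mulIg _ (Xp w)); rewrite -zpowS -XpD (_ : (- Posz n.+1 + 1)%R = (- Posz n)%R); last by lia.
  by rewrite IH; apply: eq_Xp => x _; lia.
have -> : (fun x => \sum_(y | cls y) f x (y, false) * v y)%R =
   (fun x => \sum_(y <- enum cls) f x (y, false) * v y)%R.
  by apply/funext => x; rewrite big_enum.
rewrite {1}/Xp.
have: all cls (enum cls) by apply/allP => x; rewrite mem_enum.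
elim: (enum cls) => [|y s IH] /=.
  by rewrite big_nil (hom1 betM) Xp0 // => x _; rewrite big_nil.
move=> /andP[cy cs]; rewrite big_cons betM IH // zpow_hom; last exact: betM.
rewrite bet_lt blx // Xz -XpD; apply: eq_Xp => x _.
by rewrite big_cons.
Qed.

End Class.

Section ClassInverse.
Variable D : sgraph.
Implicit Types (a b c : letter D) (x y : D).
Local Notation G := (raag (@edge D)).
Local Notation gw := (raag_of_word (@edge D)).
Local Notation F z := (par (st z)).
Local Open Scope group_scope.

Lemma par_ind_r (P : pred D) (Q : G -> Prop) :
  Q 1 -> (forall g a, Q g -> P a.1 -> Q (g * lt a)) -> forall g, par P g -> Q g.
Proof.
move=> Q1 Qs g [w [allw <-]]; elim/last_ind: w allw => [|w a IH]; first by rewrite gw0.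
by rewrite all_rcons gw_rcons => /andP[Pa /IH Qw]; apply: Qs.
Qed.

Lemma Lam_sameM z f (q h : G) : functional z f -> ~ F z q -> F z h -> Lam z f (q * h) = Lam z f q.
Proof.
move=> ff nFq Fh.
suff [] : Lam z f (q * h) = Lam z f q /\ ~ F z (q * h) by [].
elim/par_ind_r: h / Fh => [|h a [<- nF] sa]; first by rewrite mulg1.
have nF' : ~ F z (q * h * lt a) by move/(parMr _ (par_lt sa)).
by rewrite mulgA; split=> //; apply: Lam_same.
Qed.

Lemma H_insens (P : pred D) b (g h : G) : ~~ P b.1 -> par P h -> H b (g * h) = H b g.
Proof.
move=> nPb; elim/par_ind_r => [|h' a <- Pa]; first by rewrite mulg1.
rewrite mulgA; apply/eqP; apply: contraNT nPb => /H_cross.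
by case=> -[e _]; move: Pa; rewrite e.
Qed.

Lemma sdl_pos x y (s : bool) :
  sdl (x, false) (y, s) = (if s then - (x == y)%:R else (x == y)%:R)%R.
Proof.
have e : sdl (x, false) (y, false) = ((x == y)%:R)%R.
  rewrite /sdl !xpair_eqE /= andbT andbF eq_sym.
  by case: (x == y).
by case: s => //; rewrite -[(y, true)]/(inv (y, false)) sdlV e.
Qed.

Variable z : D.
Local Notation cls := (cls z).
Local Notation Xp := (Xp z).

(** The functionals of the inverse automorphism: the inverse matrix on the class, and
    off the class the values that cancel those of f. *)
Definition dual (f : D -> letter D -> int) (B : D -> D -> int) : D -> letter D -> int :=
  fun x a => if cls a.1 then (if a.2 then - B x a.1 else B x a.1)%R
             else (- (\sum_(t | cls t) B x t * f t a))%R.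

Definition rinv (f : D -> letter D -> int) (B : D -> D -> int) :=
  forall x y, cls x -> cls y ->
    (\sum_(t | cls t) f x (t, false) * B t y)%R = ((x == y)%:R)%R.
Definition linv (f : D -> letter D -> int) (B : D -> D -> int) :=
  forall x y, cls x -> cls y ->
    (\sum_(t | cls t) B x t * f t (y, false))%R = ((x == y)%:R)%R.

Lemma dual_fun f B : (forall x, cls x -> functional z (f x)) ->
  forall x, cls x -> functional z (dual f B x).
Proof.
move=> ff x cx; split=> [a sa|a b sa nsb ab|a b nsa nsb ab]; rewrite /dual.
- rewrite /=; case: ifP => ca; first by case: a.2; rewrite /= ?opprK.
  congr (- _)%R; rewrite -sumrN; apply: eq_bigr => t ct.
  by rewrite (fun_inv (ff t ct)) // mulrN.
- rewrite ifN; last first.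
    apply: contra nsb => ca; rewrite -(clsP ca) /st.
    by rewrite -[edge _ _]/(com a b) ab orbT.
  rewrite big1 ?oppr0 // => t ct.
  by rewrite (fun_out (ff t ct) sa nsb ab) mulr0.
- rewrite ifN; last by apply: contra nsa => /cls_st.
  rewrite ifN; last by apply: contra nsb => /cls_st.
  congr (- _)%R; apply: eq_bigr => t ct.
  by rewrite (fun_comp (ff t ct) nsa nsb ab).
Qed.

Lemma dual_comp f B : (forall x, cls x -> functional z (f x)) -> rinv f B ->
  forall g, bet z f (bet z (dual f B) g) = g.
Proof.
move=> ff fB; have ff' := dual_fun B ff.
have key a x : ~~ cls a.1 -> cls x ->
    (\sum_(y | cls y) f x (y, false) * dual f B y a)%R = (- f x a)%R.
  move=> nca cx; rewrite /dual (negPf nca).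
  transitivity (- \sum_(y | cls y) \sum_(t | cls t) f x (y, false) * B y t * f t a)%R.
    rewrite -sumrN; apply: eq_bigr => y _; rewrite mulrN mulr_sumr; congr (- _)%R.
    by apply: eq_bigr => t _; rewrite mulrA.
  rewrite exchange_big /= (eq_bigr (fun t => (x == t)%:R * f t a)%R); last first.
    by move=> t ct; rewrite -mulr_suml fB.
  rewrite (bigD1 x) //= eqxx mul1r big1 ?addr0 // => t /andP[_ /negPf].
  by rewrite eq_sym => ->; rewrite mul0r.
apply: (@hom_ext _ (bet z f \o bet z (dual f B)) id) => // [|a /=].
  by apply: hom_comp; apply: betM.
rewrite bet_lt // /bl.
have [sa|nsa] := boolP (st z a.1); last first.
  have nca : ~~ cls a.1 by apply: contra nsa => /cls_st.
  rewrite !betM // homV; last exact: betM.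
  rewrite !bet_Xp // bet_lt // /bl (negPf nsa) !mulgA -XpD (Xp0 (v := fun x => _ + _)%R).
    rewrite mul1g -!XpN -!mulgA -XpD Xp0 ?mulg1 // => x cx.
    by rewrite key // opprK addNr.
  by move=> x cx; rewrite key // addNr.
have [ca|nca] := boolP (cls a.1).
  rewrite [a]surjective_pairing -[X in X * _](Xp_lt a.2 ca) -XpD bet_Xp //.
  rewrite -[RHS](Xp_lt a.2 ca); apply: eq_Xp => x cx.
  transitivity (\sum_(t | cls t) f x (t, false) * dual f B t a)%R.
    by apply: eq_bigr => t _; rewrite -surjective_pairing addrC subrK.
  rewrite /dual ca; case: (a) ca => y [] /= cy; rewrite sdl_pos; last exact: fB.
  by rewrite -(fB x y) // -sumrN; apply: eq_bigr => t _; rewrite mulrN.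
rewrite betM // bet_lt // /bl sa bet_Xp // -mulgA -XpD Xp0 ?mulg1 // => x cx.
rewrite (eq_bigr (fun y => f x (y, false) * dual f B y a)%R); last first.
  by move=> y cy; rewrite (@sdl_out _ (y, false) a) ?subr0 //=; apply: contraNneq nca => ->.
by rewrite key // (@sdl_out _ (x, false) a) ?subr0 ?subrr //=; apply: contraNneq nca => ->.
Qed.

Lemma dual_rinv f B : linv f B -> rinv (dual f B) (fun x y => f x (y, false)).
Proof.
move=> fB x y cx cy; rewrite -fB //; apply: eq_bigr => t ct.
by rewrite /dual /= ct.
Qed.

Lemma bet_aut f B : (forall x, cls x -> functional z (f x)) -> rinv f B -> linv f B ->
  [/\ isaut (bet z f), cancel (bet z f) (bet z (dual f B)) &
      cancel (bet z (dual f B)) (bet z f)].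
Proof.
move=> ff fB Bf; have K := dual_comp ff fB.
have ff' := dual_fun B ff.
have K' := dual_comp ff' (dual_rinv Bf).
have KK : cancel (bet z f) (bet z (dual f B)).
  by move=> g; rewrite -{1}(K' g) K K'.
split=> //; split; first exact: betM.
by exists (bet z (dual f B)); split=> //; apply: betM.
Qed.

(** The translation by which [bet z f] moves the walls with label b. *)
Definition shift (f : D -> letter D -> int) b : G := if st z b.1 then 1 else Xp (f^~ b).

Lemma Xp_par_lk b v : ~~ cls b.1 -> st z b.1 -> par (lk b.1) (Xp v).
Proof.
move=> ncb sb; apply: parS (Xp_par z v) => x cx; rewrite -topredE /= /lk.
have : st x b.1 by rewrite (clsP cx).
rewrite /st edge_sym => /orP[/eqP e|//].
by case/negP: ncb; rewrite e; apply: cx.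
Qed.

(** Off the class, the wall of a letter is mapped to a translate of itself, by the class
    element attached to the side from which the letter is seen. *)
Lemma shift_par f b g : (forall x, cls x -> functional z (f x)) -> ~~ cls b.1 ->
  par (lk b.1) g -> par (lk b.1) ((shift f b)^-1 * bet z f g * shift f b).
Proof.
move=> ff ncb; elim/par_ind_r => [|h a]; first by rewrite (hom1 (betM ff)) mulg1 mulVg; apply: par1.
set e := shift f b => IH ba.
have -> : e^-1 * bet z f (h * lt a) * e =
   (e^-1 * bet z f h * e) * (e^-1 * bl z f a * e).
  by rewrite betM // bet_lt // !mulgA mulgK.
apply: parM => // {IH}.
have ab : com a b by rewrite com_sym.
rewrite /e /shift; have [sb|nsb] := boolP (st z b.1).
  rewrite invg1 mul1g mulg1 /bl; have [sa|nsa] := boolP (st z a.1).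
    by apply: parM; [apply: par_lt|apply: Xp_par_lk].
  by apply: parM; [apply: parM; [apply: Xp_par_lk|apply: par_lt]|apply/parV/Xp_par_lk].
have [sa|nsa] := boolP (st z a.1).
  by rewrite (bl_out ff sa nsb ab) -mulgA Xp_commute // mulKg; apply: par_lt.
by rewrite (bl_comp ff nsa nsb ab) !mulgA mulVg mul1g mulgVK; apply: par_lt.
Qed.

Section Lengths.
Variables (f : D -> letter D -> int) (B : D -> D -> int).
Hypotheses (ff : forall x, cls x -> functional z (f x)) (fB : rinv f B) (Bf : linv f B).

Let ff' := dual_fun B ff.

Lemma bet_FE g : F z (bet z f g) <-> F z g.
Proof.
have [_ K _] := bet_aut ff fB Bf.
split=> [Fb|]; last exact: bet_F.
by rewrite -(K g); apply: bet_F.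
Qed.

(** The class coordinates of [bet g] are the functionals [f], by construction on
    letters and by additivity in general. *)
Lemma lev_bet x g : cls x -> Lam z (sdl (x, false)) (bet z f g) = Lam z (f x) g.
Proof.
move=> cx; have fx := ff cx; have sx := sdl_cls false cx.
have LX v : Lam z (sdl (x, false)) (Xp v) = v x by apply: lev_Xp.
have onF h : F z h -> Lam z (sdl (x, false)) (bet z f h) = Lam z (f x) h.
  move=> [w [allw <-]]; elim: w allw => [|a w IH] /=.
    by rewrite gw0 (hom1 (betM ff)) !Lam1.
  case/andP=> sa /IH e; have Fa := par_lt sa; have FX v := Xp_F z v.
  rewrite gw_cons betM // bet_lt // /bl sa -mulgA !LamM // ?e ?LX ?Lam_lt //.
  by rewrite addrA [(sdl _ _ + _)%R]addrC subrK.
elim/gw_ind: g => [|g a IH]; first by rewrite (hom1 (betM ff)) !Lam1.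
have [Fga|nFga] := pselect (F z (g * lt a)); first exact: onF.
have nFb : ~ F z (bet z f (g * lt a)) by move/bet_FE.
move: nFb; rewrite betM // bet_lt // /bl; have [sa|nsa] := boolP (st z a.1) => nFb.
  have nFg : ~ F z g by move=> Fg; apply/nFga/parM => //; apply: par_lt.
  have nFb' : ~ F z (bet z f g) by move/bet_FE.
  rewrite Lam_sameM // ?IH ?Lam_same //.
  by apply: parM; [apply: par_lt|apply: Xp_F].
have FX v := Xp_F z v.
have nF1 : ~ F z (bet z f g * (Xp (f^~ a) * lt a)).
  by move=> h; apply: nFb; rewrite mulgA; apply: parM => //; apply/parV/FX.
rewrite mulgA (Lam_sameM sx nF1 (parV (FX _))).
have sdl0 : sdl (x, false) a = 0%R.
  by apply: sdl_out; apply: contraNneq nsa => ->; apply: cls_st.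
rewrite mulgA (Lam_zero sx) ?sdlV ?sdl0 ?oppr0 //.
have [Fg|nFg] := pselect (F z g).
  by rewrite (LamM sx) ?LX ?(Lam_step fx) ?IH //; apply: bet_F.
by rewrite (Lam_sameM sx) ?(Lam_same fx) ?IH // => /bet_FE.
Qed.

Lemma shift_parE b g : ~~ cls b.1 ->
  par (lk b.1) ((shift f b)^-1 * bet z f g * shift f b) <-> par (lk b.1) g.
Proof.
move=> ncb; split; last exact: shift_par.
move=> /(shift_par ff' ncb); have [_ K _] := bet_aut ff fB Bf.
rewrite !betM // homV; last exact: betM.
rewrite K; suff -> : shift (dual f B) b = (bet z (dual f B) (shift f b))^-1.
  by rewrite invgK !mulgA mulgV mul1g mulgK.
rewrite /shift; case: ifP => sb; first by rewrite (hom1 (betM ff')) invg1.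
rewrite bet_Xp // -XpN; apply: eq_Xp => x cx; rewrite /dual (negPf ncb).
by congr (- _)%R; apply: eq_bigr => t ct; rewrite ct.
Qed.

(** The half-space of a letter off the class is only translated; hence the number of walls
    with this label does not change. *)
Lemma H_bet b g : ~~ cls b.1 -> H b ((shift f b)^-1 * bet z f g) = H b g.
Proof.
move=> ncb; set e := shift f b.
have e_cls : par cls e.
  by rewrite /e /shift; case: ifP => _; [apply: par1|apply: Xp_par].
have bl_b : exists h, par cls h /\ bl z f b = e * lt b * h.
  rewrite /bl /e /shift; case: ifP => sb.
    exists (Xp (fun x => f x b - sdl (x, false) b)%R).
    by rewrite mul1g; split; first exact: Xp_par.
  by exists (Xp (f^~ (inv b)))^-1; split; first exact/parV/Xp_par.
have step g' : H b (e^-1 * bet z f g') = H b g' <->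
    H b (e^-1 * bet z f (g' * lt b)) = H b (g' * lt b).
  have [h [hc blE]] := bl_b.
  have E1 : H b (e^-1 * bet z f (g' * lt b)) = H b (e^-1 * bet z f g' * e * lt b).
    by rewrite betM // bet_lt // blE !mulgA (H_insens _ ncb hc).
  have E2 : H b (e^-1 * bet z f g') = H b (e^-1 * bet z f g' * e).
    by rewrite (H_insens _ ncb e_cls).
  have [lg|nlg] := pselect (par (lk b.1) g').
    have lg' := (shift_parE g' ncb).2 lg.
    by rewrite E1 E2 (H1 lg) (H1 lg') !Hlt.
  have nlg' : ~ par (lk b.1) (e^-1 * bet z f g' * e) by move/(shift_parE g' ncb)/nlg.
  have stay q : ~ par (lk b.1) q -> H b (q * lt b) = H b q.
    move=> nq; apply/eqP/negP => /negP /H_cross [[_]//|[/esym/eqP]].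
    by rewrite inv_neq.
  by rewrite E1 E2 !stay.
elim/gw_ind: g => [|g a IH].
  by rewrite (hom1 (betM ff)) mulg1 -(mul1g e^-1) (H_insens _ ncb (parV e_cls)).
have [->|nab] := eqVneq a b; first exact: (proj1 (step g) IH).
have [ai|nai] := eqVneq a (inv b).
  by apply/step; rewrite ai ltV mulgVK.
have Eg : H b (g * lt a) = H b g.
  by apply/eqP/negP => /negP /H_cross [[e1 _]|[e1 _]]; rewrite e1 eqxx in nab nai.
rewrite Eg -IH betM // bet_lt //.
have Hl q : H b (q * lt a) = H b q.
  by apply/eqP/negP => /negP /H_cross [[e1 _]|[e1 _]]; rewrite e1 eqxx in nab nai.
rewrite /bl; case: ifP => sa; rewrite !mulgA.
  by rewrite (H_insens _ ncb (Xp_par z _)) Hl.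
by rewrite (H_insens _ ncb (parV (Xp_par z _))) Hl (H_insens _ ncb (Xp_par z _)).
Qed.

Lemma isum_aut (K K' : G -> Prop) (al : G -> G) (E1 E2 : G -> int) :
  subg K -> subg K' -> bijective al ->
  (forall g h, K' (al h * (al g)^-1) <-> K (h * g^-1)) ->
  kinv K' E2 -> kfin K E1 -> (forall g, E2 (al g) = E1 g) ->
  isum K' E2 = isum K E1.
Proof.
move=> sK sK' [al' K1 K2] KK inE fE e.
apply: (isum_param sK' (phi := al)) => //; first exact: kfin_fsup.
- by move=> g; case: (rep K g =P g); rewrite ?eqxx.
- move=> g h; case: (rep K g =P g) => [eg|]; rewrite ?eqxx //.
  case: (rep K h =P h) => [eh|]; rewrite ?eqxx // => _ _ /KK gh.
  by rewrite -eg -eh; apply: rep_eq.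
- move=> g Fg.
  have kk : keq K' g (al (rep K (al' g))).
    by rewrite /keq -{2}(K2 g); apply/KK; apply: (rep_keq sK).
  exists (rep K (al' g)); last exact: keq_sym.
  by rewrite rep_idem // eqxx -e (keqP inE kk).
Qed.

Lemma ell_bet b w : ~~ cls b.1 -> ell b (bet z f w) = ell b w.
Proof.
move=> ncb; have [_ K K'] := bet_aut ff fB Bf.
have sK := par_subg (lk b.1).
apply: (isum_aut (al := fun g => (shift f b)^-1 * bet z f g)) => //.
- exists (fun g => bet z (dual f B) (shift f b * g)) => g.
    by rewrite mulVKg K.
  by rewrite K' mulKg.
- move=> g h; apply: (iff_trans _ (shift_parE _ ncb)).
  by rewrite (betM ff) (homV _ (betM ff)) invgM invgK !mulgA.
- exact: (kinv_n (@H_quasi D b)).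
- exact: (vfin_n (@H_vfin D b)).
- by move=> g; rewrite -mulgA -betM // !H_bet.
Qed.

Lemma N_bet x w : cls x -> N z (sdl (x, false)) (bet z f w) = N z (f x) w.
Proof.
move=> cx; have [_ K K'] := bet_aut ff fB Bf.
apply: (isum_aut (al := bet z f)); try exact: par_subg.
- by exists (bet z (dual f B)).
- by move=> g h; rewrite -(homV _ (betM ff)) -(betM ff); apply: bet_FE.
- exact: (kinv_n (Lam_quasi (sdl_cls false cx))).
- exact: (vfin_n (Lam_vfin (ff cx))).
- by move=> g; rewrite -betM // !lev_bet.
Qed.

Lemma Lam_st_eq y h g : st y =1 st z -> Lam y h g = Lam z h g.
Proof. by move=> e; rewrite /Lam; elim: (rw g) => //= a u ->; rewrite e. Qed.

Lemma ell_cls x w : cls x -> ell (x, false) w = N z (sdl (x, false)) w.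
Proof.
move=> cx; rewrite ell_N /N /=; have e := clsP cx.
rewrite (_ : par (st x) = par (st z)); last by rewrite (funext e).
by apply: eq_isum => g; rewrite !(Lam_st_eq _ _ e).
Qed.

(** Walls off the class are permuted, and those of the class are counted by the
    coordinates of the image, which are the functionals f. *)
Theorem len_bet w : len (bet z f w) =
  (\sum_(x | ~~ cls x) ell (x, false) w + \sum_(x | cls x) N z (f x) w)%R.
Proof.
rewrite /len (bigID cls) /= addrC; congr (_ + _)%R.
  by apply: eq_bigr => x ncx; rewrite ell_bet.
by apply: eq_bigr => x cx; rewrite ell_cls // N_bet.
Qed.

End Lengths.
End ClassInverse.

Ltac gnorm := repeat progress (rewrite ?invgM ?invgK ?invg1 -?mulgA
  ?mulKg ?mulVKg ?mulVg ?mulgV ?mul1g ?mulg1).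

(** * Pruning a cut *)

Section Coarea.
Local Open Scope ring_scope.

Lemma sum_below (M n : nat) : (n <= M)%N -> \sum_(i < M) Posz (i < n)%N = Posz n.
Proof.
move=> le; rewrite (bigID (fun i : 'I_M => (i < n)%N)) /=.
rewrite [X in _ + X]big1 => [|i /negPf -> //]; rewrite addr0.
rewrite (eq_bigr (fun=> 1)) => [|i -> //].
rewrite (big_ord_narrow le) /= sumr_const card_ord.
by rewrite -natz.
Qed.

(** A difference of two numbers is spread over thresholds; this is what lets one
    cut, with its multiplicities, be compared with a family of functionals with values 0 and 1. *)
Lemma coarea (M n n' : nat) (m : int) : (n <= M)%N -> (n' <= M)%N ->
  \sum_(i < M) (`|m + Posz (i < n)%N - Posz (i < n')%N| - `|m|) =
  if m == 0 then `|Posz n - Posz n'| else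
  if 0 < m then Posz n - Posz n' else Posz n' - Posz n.
Proof.
move=> le le'; have sn := sum_below le; have sn' := sum_below le'.
have [->|nm0] := eqVneq m 0; last first.
  have [m0|m0] := ltrP 0 m; rewrite -sn -sn' -sumrB; apply: eq_bigr => i _;
  by case: (i < n)%N; case: (i < n')%N; lia.
have [nn|/ltnW nn] := leqP n n'.
  have -> : `|Posz n - Posz n'| = Posz n' - Posz n by lia.
  rewrite -sn -sn' -sumrB.
  apply: eq_bigr => i _; case: (ltnP i n) => h; case: (ltnP i n') => h'; lia.
have -> : `|Posz n - Posz n'| = Posz n - Posz n' by lia.
rewrite -sn -sn' -sumrB.
apply: eq_bigr => i _; case: (ltnP i n) => h; case: (ltnP i n') => h'; lia.
Qed.

(** Contributions of the levels [j] to the change of a cut: only the first level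
    inside the half-space matters. *)
Lemma level_count (A B n n' : int) : 0 <= n -> 0 <= n' ->
  let t (j : int) := if j == 1 - A then n else 0 in
  let t' (j : int) := if j == 1 - B then n' else 0 in
  let r (j : int) :=
    if 1 <= j + A then (if 1 <= j + B then `|t j - t' j| else - t j)
    else (if 1 <= j + B then - t' j else 0) in
  fsup r /\ S r = if B - A == 0 then `|n - n'| else
    if 0 < B - A then n - n' else n' - n.
Proof.
move=> n0 n'0 t t' r.
have sup j : r j != 0 -> j \in undup [:: 1 - A; 1 - B].
  rewrite mem_undup !inE /r /t /t'.
  apply: contraNT => /norP[/negPf-> /negPf->]; rewrite subrr oppr0 normr0.
  by case: (1 <= j + A); case: (1 <= j + B).
split; first by eexists; exact: sup.
rewrite (SE (undup_uniq _) sup) /=.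
have [e|nAB] := eqVneq A B.
  rewrite e inE eqxx /= big_seq1 subrr eqxx /r /t /t' e !eqxx addrNK.
  by rewrite lexx.
have nn : 1 - A != 1 - B by apply: contra nAB => /eqP e; apply/eqP; lia.
rewrite inE (negPf nn) /= big_cons big_seq1 /r /t /t' !eqxx !addrNK lexx (negPf nn).
rewrite [1 - B == _]eq_sym (negPf nn) subr0 sub0r normrN.
have -> : (B - A == 0) = false by apply/negP => /eqP e; case/eqP: nAB; lia.
by case: (lerP 1 (1 - A + B)); case: (lerP 1 (1 - B + A)); case: (ltrP 0 (B - A)); lia.
Qed.

End Coarea.

Section Prune.
Variable D : sgraph.
Implicit Types (a b c : letter D) (x y : D).
Local Notation G := (raag (@edge D)).
Local Notation gw := (raag_of_word (@edge D)).
Local Notation F z := (par (st z)).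
Local Open Scope group_scope.

Definition cut (K : G -> Prop) (e : G -> bool) w := V K (fun g => Posz (e g)) w.
Definition cfin (K : G -> Prop) (e : G -> bool) := vfin K (fun g => Posz (e g)).

Lemma cutE K e w : cut K e w = isum K (fun g => Posz (e (g * w) != e g)).
Proof. by apply: eq_isum => g; case: (e g); case: (e _). Qed.

Lemma cfinP K e a : cfin K e <-> forall a, kfin K (fun g => Posz (e (g * lt a) != e g)).
Proof.
by split=> f b; apply: kfin_sub (f b) => g; case: (e g); case: (e _).
Qed.

Lemma cfin_w K e w : cfin K e -> kfin K (fun g => Posz (e (g * w) != e g)).
Proof.
by move=> /vfin_w fe; apply: kfin_sub (fe w) => g; case: (e g); case: (e _).
Qed.

Variables (K : G -> Prop) (e : G -> bool) (q : G) (a : letter D) (c : bool).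
Hypotheses (sK : subg K) (ke : kinv K e) (fe : cfin K e).
Hypothesis disj : forall k g, K k -> H a (q^-1 * g) -> H a ((k * q)^-1 * g) ->
  par (lk a.1) (q^-1 * k * q).
Hypothesis deep : forall u, (2 <= lev a u)%R -> e (q * u) = c.
Hypothesis branch : forall h b u, F a.1 h -> lev a h = 1%R -> ~~ st a.1 b.1 ->
  H b u -> e (q * h * u) = e (q * h * lt b).

Definition inhs g := `[< exists k, K k /\ H a ((k * q)^-1 * g) >].
(** The cut is made constant on all K-translates of one half-space. *)
Definition prune g := if inhs g then c else e g.

Let K' k := par (lk a.1) k /\ K (q * k * q^-1).

Let sK' : subg K'.
Proof.
split; first by split; [apply: par1|rewrite mulg1 mulgV; apply: sub1].
  move=> g h [lg Kg] [lh Kh]; split; first exact: parM.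
  by have := subM sK Kg Kh; rewrite !mulgA mulgVK.
move=> g [lg Kg]; split; first exact: parV.
by have := subV sK Kg; rewrite !invgM invgK mulgA.
Qed.

Let lkS := par_subg (lk a.1).
Let FS := par_subg (st a.1).

(** Whether a point of the half-space lies on the side of the cut opposite to its
    deep part. *)
Definition dd (u : G) : bool := H a u && (e (q * u) != c).

Lemma e_dd u : H a u -> e (q * u) = dd u (+) c.
Proof. by rewrite /dd => ->; case: (e _); case: c. Qed.

Lemma dd_inv : kinv K' dd.
Proof.
move=> k u [lk_k Kk]; rewrite /dd H_lk // -(ke (q * u) Kk).
by rewrite !mulgA mulgVK.
Qed.

Section W.
Variable w : G.

(** What pruning gains along an edge that starts inside the half-space. *)
Definition R1 (u : G) : int :=
  if H a u then (if H a (u * w) then Posz (dd u != dd (u * w)) else (- Posz (dd u))%R)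
  else 0%R.
(** What pruning gains along an edge entering the half-space. *)
Definition R2 (u : G) : int :=
  if ~~ H a u && H a (u * w) then (- Posz (dd (u * w)%g))%R else 0%R.

Lemma H_K' k u : K' k -> H a (k * u) = H a u.
Proof. by move=> [lk_k _]; apply: H_lk. Qed.

Lemma R1_inv : kinv K' R1.
Proof. by move=> k u Kk; rewrite /R1 -!mulgA !(H_K' _ Kk) !(dd_inv _ Kk). Qed.

Lemma R2_inv : kinv K' R2.
Proof. by move=> k u Kk; rewrite /R2 -!mulgA !(H_K' _ Kk) !(dd_inv _ Kk). Qed.

Definition kpick (g : G) : G :=
  if pselect (exists k, K k /\ H a ((k * q)^-1 * g)) is left ex then projT1 (cid ex) else 1.

Lemma kpickP g : inhs g -> K (kpick g) /\ H a ((kpick g * q)^-1 * g).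
Proof. by move=> /asboolP ex; rewrite /kpick; case: pselect => // p; case: cid. Qed.

Lemma kpick_eq g k (R : G -> int) : kinv K' R -> K k -> H a ((k * q)^-1 * g) ->
  R ((kpick g * q)^-1 * g) = R ((k * q)^-1 * g).
Proof.
move=> inR Kk Hk; have ing : inhs g by apply/asboolP; exists k.
have [Kp Hp] := kpickP ing; set p := kpick g in Kp Hp *.
pose j := q^-1 * (p^-1 * k) * q.
have -> : (p * q)^-1 * g = j * ((k * q)^-1 * g).
  by rewrite /j; gnorm.
have Kpk : K (p^-1 * k) by apply: subM => //; apply: subV.
apply: inR; split; last first.
  by rewrite /j !mulgA mulgV mul1g mulgK.
apply: (@disj (p^-1 * k) (p^-1 * g)) => //; first by rewrite mulgA -invgM.
by move: Hk; gnorm.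
Qed.

Definition T1 g := if inhs g then R1 ((kpick g * q)^-1 * g) else 0%R.
Definition T2 g := if inhs (g * w) then R2 ((kpick (g * w) * q)^-1 * g) else 0%R.

Lemma inhs_K k g : K k -> inhs (k * g) = inhs g.
Proof.
move=> Kk; apply/asboolP/asboolP => -[j [Kj Hj]].
  exists (k^-1 * j); split; first by apply: subM => //; apply: subV.
  by move: Hj; rewrite !invgM invgK !mulgA.
by exists (k * j); split; [apply: subM|move: Hj; rewrite !invgM !mulgA mulgVK].
Qed.

Lemma inhs_q u : H a u -> inhs (q * u).
Proof. by move=> Hu; apply/asboolP; exists 1; rewrite mul1g mulKg; split=> //; apply: sub1. Qed.

Lemma R2_q g k : K k -> H a ((k * q)^-1 * (g * w)) ->
  R2 ((kpick (g * w) * q)^-1 * g) = R2 ((k * q)^-1 * g).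
Proof.
move=> Kk Hk; pose R (u : G) := R2 (u * w^-1).
have inR : kinv K' R by move=> j u Kj; rewrite /R -mulgA R2_inv.
by have := kpick_eq inR Kk Hk; rewrite /R -!mulgA mulgV !mulg1.
Qed.

Lemma T1_inv : kinv K T1.
Proof.
move=> k g Kk; rewrite /T1 inhs_K //; case: ifP => // ing.
have [Kp Hp] := kpickP ing.
rewrite (@kpick_eq (k * g) (k * kpick g)); first by rewrite !invgM !mulgA mulgVK.
- exact: R1_inv.
- exact: subM.
- by move: Hp; rewrite !invgM !mulgA mulgVK.
Qed.

Lemma T2_inv : kinv K T2.
Proof.
move=> k g Kk; rewrite /T2 -!mulgA (inhs_K _ Kk); case: ifP => // ing.
have [Kp Hp] := kpickP ing.
rewrite [k * (g * w)]mulgA (@R2_q (k * g) (k * kpick (g * w))).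
- by congr R2; gnorm.
- exact: subM.
- by move: Hp; gnorm.
Qed.

(** The translates of a half-space under K are disjoint up to its stabilizer, so a
    sum over cosets of K supported on them is a sum over cosets of the stabilizer. *)
Lemma unfold_sum (R T : G -> int) (P : G -> Prop) :
  kinv K T -> kfin K' R ->
  (forall u, R u != 0%R -> T (q * u) = R u) ->
  (forall u u', R u != 0%R -> R u' != 0%R -> K (q * (u' * u^-1) * q^-1) ->
     par (lk a.1) (u' * u^-1)) ->
  (forall g, T g != 0%R -> exists k, K k /\ R ((k * q)^-1 * g) != 0%R) ->
  kinv K' R -> isum K T = isum K' R.
Proof.
move=> inT fR TR inj surj inR.
apply: (isum_param sK (phi := fun u => q * u)) => //; first exact: kfin_fsup.
- by move=> u; case: (rep K' u =P u) => // _ /TR.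
- move=> u u'; case: (rep K' u =P u) => [eu|]; rewrite ?eqxx //.
  case: (rep K' u' =P u') => [eu'|]; rewrite ?eqxx // => Ru Ru'.
  rewrite /keq invgM !mulgA => Kq; have Kq' : K (q * (u' * u^-1) * q^-1) by rewrite !mulgA.
  by rewrite -eu -eu'; apply: rep_eq => //; split=> //; apply: inj.
- move=> g /surj [k [Kk Rk]]; set u := (k * q)^-1 * g in Rk.
  have [lku Ku] := rep_keq sK' u.
  exists (rep K' u).
    rewrite rep_idem // eqxx; apply: contra_neq Rk => <-.
    by apply: (keqP inR); apply: keq_sym => //; apply: rep_keq.
  rewrite /keq; set r := rep K' u in Ku *; have := subM sK Kk (subV sK Ku).
  have -> : k * (q * (r * u^-1) * q^-1)^-1 = g * (q * r)^-1 by rewrite /u; gnorm.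
  by [].
Qed.

(** Edge by edge: T1 and T2 collect the gains at the edges that meet a translate of the
    half-space from inside and from outside. *)
Lemma prune_pointwise g :
  (Posz (prune (g * w)%g != prune g) + (T1 g + T2 g) <= Posz (e (g * w)%g != e g))%R.
Proof.
have edd h : inhs h -> e h = dd ((kpick h * q)^-1 * h) (+) c.
  move=> /kpickP [Kp Hp]; rewrite -e_dd // -[RHS](ke _ Kp); congr e.
  by gnorm.
rewrite /prune /T1 /T2.
have [ig|nig] := boolP (inhs g); have [iw|niw] := boolP (inhs (g * w)).
- have [Kp Hp] := kpickP ig; have [Kp' Hp'] := kpickP iw.
  rewrite eqxx add0r; rewrite (edd _ ig) (edd _ iw) /R1 Hp.
  have [Hw|nHw] := boolP (H a ((kpick g * q)^-1 * g * w)).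
    have E := kpick_eq R2_inv.
    have dE : dd ((kpick (g * w) * q)^-1 * (g * w)) = dd ((kpick g * q)^-1 * (g * w)).
      have := @kpick_eq (g * w) (kpick g) (fun u => Posz (dd u)).
      move=> /(_ _ Kp) h; apply/eqP; have := h; rewrite !mulgA => {}h.
      have [] : Posz (dd ((kpick (g * w) * q)^-1 * g * w)) = Posz (dd ((kpick g * q)^-1 * g * w)).
        by apply: h => // j u Kj; rewrite dd_inv.
      by case: (dd _); case: (dd _).
    have -> : R2 ((kpick (g * w) * q)^-1 * g) = 0%R.
      rewrite (@R2_q g (kpick g)) //; last by rewrite mulgA.
      by rewrite /R2 Hp.
    rewrite addr0 dE !mulgA; case: (dd _); case: (dd _); case: c => //.
  rewrite /R2; case: ifP => _; case: (dd _); case: (dd _); case: c => //.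
- have [Kp Hp] := kpickP ig; rewrite addr0 (edd _ ig) /R1 Hp.
  rewrite (_ : H a _ = false); last first.
    apply/negP => h; case/negP: niw; apply/asboolP; exists (kpick g); split=> //.
    by rewrite mulgA.
  by case: (dd _); case: (e _); case: c.
- have [Kp Hp] := kpickP iw; rewrite add0r (edd _ iw) /R2.
  rewrite -!mulgA Hp andbT ifT; last first.
    apply/negP => h; case/negP: nig; apply/asboolP; exists (kpick (g * w)).
    by [].
  by case: (dd _); case: (e _); case: c.
- by rewrite !addr0.
Qed.

End W.

Definition massf (l : option (letter D)) (h : G) : bool :=
  e (q * h * (if l is Some b then lt b else 1)) != c.
(** The mass of the part to be pruned, according to the first letter outside the flat of
    a: on level one, beyond which the cut is constant, it counts the cosets where
    the cut differs from its deep value. *)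
Definition mass l := isum K' (fun s => if `[< par (lk a.1) s >] then Posz (massf l (s * lt a)) else 0%R).

Lemma kfin_pull (X : G -> int) (P : G -> Prop) (phi : G -> G) :
  (forall s s', P s -> P s' -> keq K (phi s) (phi s') -> K' (s' * s^-1)) -> kfin K X ->
  kfin K' (fun s => if `[< P s >] then X (phi s) else 0%R).
Proof.
move=> inj [t tP].
pose pre (g : G) : G := xget 1 [set s | P s /\ keq K g (phi s)]%classic.
exists (map pre t) => s; case: asboolP; rewrite ?eqxx // => Ps /tP [g gt gs].
exists (pre g); first exact: map_f.
have [Pp gp] : [set s | P s /\ keq K g (phi s)]%classic (pre g).
  by apply: (@xgetI _ 1 _ s).
by apply: inj => //; apply: keq_trans (keq_sym sK gp) gs.
Qed.

Lemma massf_inv l : kinv K' (massf l).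
Proof.
move=> k h [_ Kk]; rewrite /massf -(ke (q * h * _) Kk); congr (_ != _); congr e.
by gnorm.
Qed.

Lemma asb_lk k s : K' k -> `[< par (lk a.1) (k * s) >] = `[< par (lk a.1) s >].
Proof. by move=> [lk_k _]; apply: asbool_equiv_eq; apply: parMl. Qed.

Lemma massf_fin l : kfin K' (fun s => if `[< par (lk a.1) s >] then Posz (massf l (s * lt a)) else 0%R).
Proof.
pose b := odflt a l.
pose X g := (Posz (e (g * lt a)%g != e g) + Posz (e (g * lt b)%g != e g))%R.
have fX : kfin K X by apply: kfin_add; apply: cfin_w.
have := @kfin_pull X (par (lk a.1)) (fun s => q * s * lt a) _ fX.
move=> h; apply: kfin_sub (h _) => [s|s s' ls ls']; last first.
  rewrite /keq => Kq; split; first exact/parM/parV.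
  by move: Kq; gnorm.
case: asboolP => // ls; rewrite /massf /X {h fX}; clear X.
have dp : e (q * s * lt a * lt a) = c.
  rewrite -2!mulgA; apply: deep.
  by rewrite mulgA !lev_lt ?lev_lk //; [apply: parlk_st|apply: parM; [apply: parlk_st|apply: par_lt_st]].
rewrite dp mulgA /b; clear b; case: l => [b'|] /=; rewrite ?mulg1 ?mulgA;
  by case: (e _); case: (e _); case: c.
Qed.

Lemma F_split h : F a.1 h -> lev a h = 1%R -> par (lk a.1) (h * (lt a)^-1).
Proof.
move=> Fh lh; apply: lev0_lk; first by apply: parM => //; apply/parV/par_lt_st.
by rewrite levM // lh -ltV lev_lt1 sdlV /sdl eqxx.
Qed.

Lemma mass_shift l h : F a.1 h -> lev a h = 1%R ->
  let X s := if `[< par (lk a.1) s >] then Posz (massf l (s * h)) else 0%R in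
  kfin K' X /\ isum K' X = mass l.
Proof.
move=> Fh lh X; have lt' := F_split Fh lh; set t := h * (lt a)^-1 in lt'.
pose Y s := if `[< par (lk a.1) s >] then Posz (massf l (s * lt a)) else 0%R.
have -> : X = fun s => Y (s * t).
  apply/funext => s; rewrite /X /Y (asbool_equiv_eq (parMr s lt')).
  by rewrite -mulgA /t mulgVK.
have inY : kinv K' Y by move=> k s Kk; rewrite /Y asb_lk // -mulgA massf_inv.
by split; [apply: kfin_mulr; apply: massf_fin|apply: isum_mulr => //; apply: massf_fin].
Qed.

Section Split.
Variables (u h : G) (l : option (letter D)).
Hypotheses (Fh : F a.1 h) (ul : lev a u = lev a h)
  (uE : if l is Some b then ~~ st a.1 b.1 /\ exists v, red (b :: v) /\ u = h * gw (b :: v) else u = h).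

Lemma ddE k : F a.1 k -> dd (k * u) = ((lev a k + lev a u)%R == 1%R) && massf l (k * h).
Proof.
move=> Fk; have lku : lev a (k * u) = (lev a k + lev a u)%R by rewrite levM.
have [l1|nl1] := eqVneq (lev a k + lev a u)%R 1%R.
  rewrite /dd /H lku l1 /= /massf; congr (_ != _).
  case: l uE => [b [nb [w [redw ->]]]|->]; last by rewrite mulg1.
  have -> : q * (k * (h * gw (b :: w))) = q * (k * h) * gw (b :: w) by gnorm.
  rewrite (branch _ _ nb (H_inv redw)) //; first exact: parM.
  by rewrite levM // -ul.
rewrite /dd /H lku /=; case: (lerP 1 _) => //= l2; apply/negP/negP.
by apply/eqP/deep; rewrite lku; lia.
Qed.

Lemma nhat j :
  let X s := if `[< par (lk a.1) s >] then Posz (dd (s * (zpow (lt a) j * u))) else 0%R in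
  kfin K' X /\ isum K' X = (if j == 1 - lev a u then mass l else 0)%R.
Proof.
move=> X; set r := zpow (lt a) j.
have Fr : F a.1 r by apply/par_zpow/par_lt_st.
have XE s : X s = if j == (1 - lev a u)%R then
    (if `[< par (lk a.1) s >] then Posz (massf l (s * (r * h))) else 0%R) else 0%R.
  rewrite /X; case: asboolP => ls; last by case: ifP.
  have Fs : F a.1 s by apply: parlk_st.
  have lsr : lev a (s * r) = j by rewrite levM // (lev_lk ls) lev_zpow add0r.
  rewrite mulgA ddE ?lsr; last exact: parM.
  rewrite -mulgA (_ : (j + lev a u == 1)%R = (j == 1 - lev a u)%R); last first.
    by apply/eqP/eqP; lia.
  by case: ifP.
have [e1|ne] := eqVneq j (1 - lev a u)%R; last first.
  have -> : X = fun=> 0%R by apply/funext => s; rewrite XE (negPf ne).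
  split; first by exists [::] => g; rewrite eqxx.
  by apply: S_0 => g; case: ifP.
have -> : X = fun s => if `[< par (lk a.1) s >] then Posz (massf l (s * (r * h))) else 0%R.
  by apply/funext => s; rewrite XE e1 eqxx.
apply: mass_shift; first exact: parM.
by rewrite levM // lev_zpow -ul e1 subrK.
Qed.

End Split.

Lemma lab_ex u : exists l h, [/\ F a.1 h, lev a u = lev a h,
    (if l is Some b then ~~ st a.1 b.1 /\ exists v, red (b :: v) /\ u = h * gw (b :: v) else u = h) &
    forall f, functional a.1 f -> Lam a.1 f u = (Lam a.1 f h + (if l is Some b then f b else 0))%R].
Proof.
have [h [l [Fh uE LE]]] := flat_split a.1 u; exists l, h; split=> //.
rewrite /lev LE; last exact: sdl_fun1.
case: l uE {LE} => [b [nb _]|_]; last by rewrite addr0.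
rewrite sdl_out ?addr0 //; apply: contraNneq nb => ->; exact: st_refl.
Qed.

Definition lab u := projT1 (cid (lab_ex u)).
Definition nm l := absz (mass l).

Lemma mass_nm l : mass l = Posz (nm l).
Proof.
rewrite /nm gez0_abs //; apply: isum_ge0 => s; by case: asboolP.
Qed.

Definition PR w (u : G) := isum K' (fun s => if `[< par (lk a.1) s >] then (R1 w (s * u)%g + R2 w (s * u)%g)%R else 0%R).

Lemma kfin_dd u0 : kfin K' (fun s => if `[< par (lk a.1) s >] then Posz (dd (s * u0)) else 0%R).
Proof.
have [l [h [Fh ul uE _]]] := lab_ex u0.
have [fX _] := nhat Fh ul uE 0%R.
by apply: kfin_sub fX => s; rewrite zpow0 mul1g.
Qed.

Lemma kfin_cross (X : G -> int) : kfin (par (lk a.1)) X ->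
  (forall u0, kfin K' (fun s => if `[< par (lk a.1) s >] then X (s * u0) else 0%R)) ->
  kfin K' X.
Proof.
move=> [t tP] fX.
suff : exists r : seq G, forall u, X u != 0%R -> (exists2 u0, u0 \in t & keq (par (lk a.1)) u0 u) ->
    exists2 v, v \in r & keq K' v u.
  by move=> [r rP]; exists r => u Xu; apply: rP => //; apply: tP.
elim: t {tP} => [|u0 t [r rP]]; first by exists [::] => u _ [].
have [r0 r0P] := fX u0; exists ([seq s * u0 | s <- r0] ++ r) => u Xu [u1].
rewrite inE => /orP[/eqP -> k01|u1t k1u]; last first.
  have [|v vr vu] := rP u Xu; first by exists u1.
  by exists v; rewrite ?mem_cat ?vr ?orbT.
have := r0P (u * u0^-1); rewrite mulgVK asboolT // => /(_ Xu) [s sr su].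
exists (s * u0); first by rewrite mem_cat (map_f (fun s => s * u0) sr).
by rewrite (keq_mulr K' _ _ u0^-1) mulgK.
Qed.

Lemma kfin_R w : kfin K' (R1 w) /\ kfin K' (R2 w).
Proof.
pose Y u := if H a (u * w) != H a u then (Posz (dd u) + Posz (dd (u * w)%g))%R else 0%R.
have fY : kfin K' Y.
  apply: kfin_cross => [|u0].
    apply: kfin_sub (vfin_w (@H_vfin D a) w) => u; rewrite /Y.
    by case: (H a (u * w)); case: (H a u).
  apply: kfin_sub (kfin_add (kfin_dd u0) (kfin_dd (u0 * w))) => s.
  case: asboolP => // ls; rewrite /Y -mulgA.
  by case: ifP; rewrite ?eqxx.
pose X u := if `[< H a u >] then Posz (e (q * u * w) != e (q * u)) else 0%R.
have fX : kfin K' X.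
  have := @kfin_pull _ (fun u => H a u) (fun u => q * u) _ (cfin_w w fe); apply.
  move=> u u' Hu Hu'; rewrite /keq => Kq.
  have L : par (lk a.1) (q^-1 * (q * u' * (q * u)^-1) * q).
    by apply: (@disj _ (q * u')) => //; [rewrite mulKg|move: Hu; gnorm].
  by split; [move: L; gnorm|move: Kq; gnorm].
split; last first.
  apply: kfin_sub fY => u; rewrite /R2 /Y; case: (boolP (H a u)); case: (boolP (H a (u * w))) => //=.
  by case: (dd _); case: (dd _).
apply: kfin_sub (kfin_add fX fY) => u; rewrite /R1 /X /Y asboolb.
case: (boolP (H a u)) => Hu //; case: (boolP (H a (u * w))) => Hw /=.
  by rewrite /dd Hu Hw /= mulgA; case: (e _); case: (e _); case: c.
by case: (dd u); case: (dd (u * w)); case: (e _); case: (e _).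
Qed.

Definition tail_count (u w : G) : int :=
  let m := (lev a (u * w)%g - lev a u)%R in
  if m == 0%R then `|Posz (nm (lab u)) - Posz (nm (lab (u * w)%g))|%R else
  if (0 < m)%R then (Posz (nm (lab u)) - Posz (nm (lab (u * w)%g)))%R
  else (Posz (nm (lab (u * w)%g)) - Posz (nm (lab u)))%R.

Lemma isum_opp (X : G -> int) : isum K' (fun s => - X s)%R = (- isum K' X)%R.
Proof. by rewrite /isum -S_opp; apply: eq_S => s; case: ifP => // _; rewrite oppr0. Qed.

Lemma kfin_PR w u : kfin K' (fun s => if `[< par (lk a.1) s >] then (R1 w (s * u)%g + R2 w (s * u)%g)%R else 0%R).
Proof.
have [f1 f2] := kfin_R w; apply: kfin_sub (kfin_mulr u (kfin_add f1 f2)) => s.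
by case: asboolP; rewrite ?eqxx.
Qed.

Lemma PR_bound w u :
  fsup (fun j => PR w (zpow (lt a) j * u)%g) ->
  (tail_count u w <= S (fun j => PR w (zpow (lt a) j * u)%g))%R.
Proof.
move=> fP; rewrite /tail_count.
have [h [Fh ul uE _]] := projT2 (cid (lab_ex u)); rewrite -/(lab u) in uE *.
have [h' [Fh' ul' uE' _]] := projT2 (cid (lab_ex (u * w))); rewrite -/(lab (u * w)) in uE' *.
have [fr <-] := level_count (lev a u) (lev a (u * w)%g) (ltac:(by []) : (0 <= Posz (nm (lab u)))%R)
   (ltac:(by []) : (0 <= Posz (nm (lab (u * w)%g)))%R).
apply: S_le => // j.
have [fn nE] := nhat Fh ul uE j; have [fn' nE'] := nhat Fh' ul' uE' j.
rewrite mass_nm in nE; rewrite mass_nm in nE'; rewrite -nE -nE' {nE nE'}.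
set r := zpow (lt a) j; set X := fun s => _ : int in fn *; set X' := fun s => _ : int in fn' *.
have lr s g : par (lk a.1) s -> lev a (s * (r * g)) = (j + lev a g)%R.
  move=> ls; rewrite levM ?(lev_lk ls) ?add0r; last exact: parlk_st.
  by rewrite levM ?lev_zpow //; apply/par_zpow/par_lt_st.
have fnN : kfin K' (fun s => - X s)%R by apply: kfin_sub fn => s; rewrite oppr_eq0.
have fnN' : kfin K' (fun s => - X' s)%R by apply: kfin_sub fn' => s; rewrite oppr_eq0.
rewrite /PR; have fPR := @kfin_PR w (r * u).
case: (lerP 1 (j + lev a u)%R) => c1; case: (lerP 1 (j + lev a (u * w)%g)%R) => c2.
- rewrite -isum_opp -isum_add //.
  apply: le_trans (S_norm (kfin_fsup sK' (kfin_add fn fnN'))) _.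
  have fN : kfin K' (fun s => `|X s - X' s|%R).
    by apply: kfin_sub (kfin_add fn fnN') => s; rewrite normr_eq0.
  rewrite -[X in (X <= _)%R](@eq_S _ (fun s => if rep K' s == s then `|X s - X' s|%R else 0%R)); last first.
    by move=> s; case: ifP; rewrite ?normr0.
  apply: isum_le => // s; rewrite /X /X'; case: asboolP => // ls.
  rewrite /R1 /R2 /H -!mulgA !lr // c1 c2 /=.
  by case: (dd _); case: (dd _).
- rewrite -isum_opp; apply: isum_le => // s; rewrite /X; case: asboolP => // ls.
  by rewrite /R1 /R2 /H -!mulgA !lr // c1 (leNgt 1%R (j + lev a (u * w)%g)%R) c2 /= addr0.
- rewrite -isum_opp; apply: isum_le => // s; rewrite /X'; case: asboolP => // ls.
  by rewrite /R1 /R2 /H -!mulgA !lr // (leNgt 1%R (j + lev a u)%R) c1 c2 /= add0r.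
- apply: isum_ge0 => s; case: asboolP => // ls.
  by rewrite /R1 /R2 /H -!mulgA !lr // (leNgt 1%R (j + lev a u)%R) c1 (leNgt 1%R (j + lev a (u * w)%g)%R) c2.
Qed.

Lemma isum_PR w : isum K' (fun u => R1 w u + R2 w u)%R =
    isum (F a.1) (fun u => S (fun j => PR w (zpow (lt a) j * u)%g)) /\
  (forall u, fsup (fun j => PR w (zpow (lt a) j * u)%g)) /\
  kfin (F a.1) (fun u => S (fun j => PR w (zpow (lt a) j * u)%g)).
Proof.
have [f1 f2] := kfin_R w; have fR := kfin_add f1 f2.
have inR : kinv K' (fun u => R1 w u + R2 w u)%R by move=> k u Kk; rewrite R1_inv ?R2_inv.
have KL k : K' k -> par (lk a.1) k by case.
have PRE u : PR w u = S (fun s => if `[< par (lk a.1) s >] && (rep K' s == s) then (R1 w (s * u)%g + R2 w (s * u)%g)%R else 0%R).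
  by apply: eq_S => s; case: `[< _ >]; case: (_ == _).
have [-> _] := isum_tower sK' lkS KL inR fR.
have -> : (fun u => S (fun s => if `[< par (lk a.1) s >] && (rep K' s == s) then (R1 w (s * u)%g + R2 w (s * u)%g)%R else 0%R)) = PR w.
  by apply/funext => u; rewrite PRE.
have iP : kinv (par (lk a.1)) (PR w).
  move=> l u ll; pose X s := if `[< par (lk a.1) s >] then (R1 w (s * u)%g + R2 w (s * u)%g)%R else 0%R.
  have iX : kinv K' X by move=> k s Kk; rewrite /X asb_lk // -!mulgA R1_inv // R2_inv.
  rewrite /PR -(isum_mulr sK' l iX (kfin_PR w u)); apply: eq_isum => s.
  by rewrite /X (asbool_equiv_eq (parMr s ll)) mulgA.
have fP : kfin (par (lk a.1)) (PR w).
  have [t tP] := fR; exists t => u nz.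
  have [s] : exists s, par (lk a.1) s /\ (R1 w (s * u)%g + R2 w (s * u)%g)%R != 0%R.
    apply: contrapT => no; case/eqP: nz; rewrite PRE; apply: S_0 => s.
    case: asboolP => //= ls; case: ifP => // _; apply/eqP/negPn/negP => h.
    by apply: no; exists s.
  move=> [ls /tP [g gt [gs _]]]; exists g => //; rewrite /keq.
  by have := parM (parV ls) gs; rewrite !mulgA mulVg mul1g.
have lkF g : par (lk a.1) g -> F a.1 g by apply: parlk_st.
have h3 : forall g h, F a.1 g -> F a.1 h -> lev a (g * h) = (lev a g + lev a h)%R.
  by move=> g h Fg _; rewrite levM.
have h4 j : F a.1 (zpow (lt a) j) by apply/par_zpow/par_lt_st.
have [-> fs] := isum_tower_int lkS FS lkF h3 (@lev0_lk D a) (fun g => @lev_lk D a g) h4 (@lev_zpow D a) iP fP.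
split=> //; split=> //.
have [t tP] := fP; exists t => u nz.
have [j] : exists j, PR w (zpow (lt a) j * u)%g != 0%R.
  apply: contrapT => no; case/eqP: nz; apply: S_0 => j.
  by apply/eqP/negPn/negP => h; apply: no; exists j.
move=> /tP [g gt gj]; exists g => //; rewrite /keq.
have := parM (parV (h4 j)) (lkF _ gj).
by rewrite !mulgA mulVg mul1g.
Qed.

Definition slmax := \max_(l : option (letter D)) nm l.

Lemma Lam_par z f f' h : functional z f -> functional z f' ->
  (forall b, st z b.1 -> f b = f' b) -> F z h -> Lam z f h = Lam z f' h.
Proof.
move=> ff ff' ee [w [aw <-]]; elim: w aw => [_|b w IH /= /andP[sb aw]].
  by rewrite gw0 !Lam1.
by rewrite gw_cons !(LamM ff, LamM ff') ?IH ?(Lam_lt ff) ?(Lam_lt ff') ?ee //; apply: par_lt.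
Qed.

(** The functional that agrees with the exponent of a on the flat and whose values
    outside record which masses exceed the threshold i. *)
Definition slope (i : nat) (b : letter D) : int :=
  if st a.1 b.1 then sdl a b
  else (Posz (i < nm None)%N - Posz (i < nm (Some b))%N)%R.

Lemma nm_com b b' : ~~ st a.1 b.1 -> ~~ st a.1 b'.1 -> com b b' -> nm (Some b) = nm (Some b').
Proof.
move=> nb nb' cb; rewrite /nm; congr absz; apply: eq_isum => s.
case: asboolP => // ls; rewrite /massf; congr (Posz (_ != c)).
have Fs : F a.1 (s * lt a) by apply: parM; [apply: parlk_st|apply: par_lt_st].
have ls1 : lev a (s * lt a) = 1%R.
  by rewrite levM ?(lev_lk ls) ?lev_lt1 /sdl ?eqxx //; apply: parlk_st.
have HH d d' : com d d' -> H d (lt d * lt d').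
  move=> cd; rewrite /H levM; last by apply: par_lt_st.
  rewrite !lev_lt1 {1}/sdl eqxx sdl_out //; apply/eqP => e1.
  by move: cd; rewrite /com e1 edge_irr.
rewrite -(branch Fs ls1 nb (HH _ _ _ cb)) -(branch Fs ls1 nb' (HH _ b' b _)); last by rewrite com_sym.
by rewrite (lt_com cb).
Qed.

Lemma slope_fun i : functional a.1 (slope i).
Proof.
have [f1 f2 f3] := sdl_fun1 a; split.
- by move=> b sb; rewrite /slope /= sb; apply: f1.
- by move=> b b' sb nsb' cb; rewrite /slope sb; apply: f2 cb.
- move=> b b' nb nb' cb; rewrite /slope (negPf nb) (negPf nb').
  by rewrite (nm_com nb nb' cb).
Qed.

Lemma slope_st i b : st a.1 b.1 -> slope i b = sdl a b.
Proof. by rewrite /slope => ->. Qed.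

Lemma Lam_slope i u :
  Lam a.1 (slope i) u = (lev a u + (Posz (i < nm None)%N - Posz (i < nm (lab u))%N))%R.
Proof.
have [h [Fh ul uE LE]] := projT2 (cid (lab_ex u)); rewrite -/(lab u) in uE LE *.
rewrite (LE _ (slope_fun i)) ul; congr (_ + _)%R.
  exact: (Lam_par (slope_fun i) (sdl_fun1 a) (@slope_st i)).
case: (lab u) uE => [b [nb _]|_]; last by rewrite subrr.
by rewrite /slope (negPf nb).
Qed.

(** Summing the functionals [slope i] over the thresholds recovers the masses, hence
    the change of the cut. *)
Lemma prune_gain w :
  (\sum_(i < slmax) (N a.1 (slope i) w - N a.1 (sdl a) w) <= isum K' (fun u => R1 w u + R2 w u)%R)%R.
Proof.
have [-> [fs fS]] := isum_PR w.
pose X (f : letter D -> int) (u : G) := `|Lam a.1 f (u * w)%g - Lam a.1 f u|%R.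
have fX f : functional a.1 f -> kfin (F a.1) (X f).
  move=> ff; have := vfin_n (Lam_vfin ff) w.
  by [].
have fD i : kfin (F a.1) (fun u => X (slope i) u - X (sdl a) u)%R.
  apply: kfin_add (fX _ (slope_fun i)) _.
  by apply: kfin_sub (fX _ (sdl_fun1 a)) => u; rewrite oppr_eq0.
have -> : (\sum_(i < slmax) (N a.1 (slope i) w - N a.1 (sdl a) w))%R =
    isum (F a.1) (fun u => \sum_(i < slmax) (X (slope i) u - X (sdl a) u))%R.
  rewrite (isum_sum FS) //; apply: eq_bigr => i _; rewrite /N /V /isum.
  rewrite -S_sub; [|exact: kfin_fsup (fX _ (slope_fun i))|exact: kfin_fsup (fX _ (sdl_fun1 a))].
  by apply: eq_S => g; case: ifP => // _; rewrite subrr.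
have fT : kfin (F a.1) (fun u => \sum_(i < slmax) (X (slope i) u - X (sdl a) u))%R.
  elim: (index_enum _) => [|i r IH]; first by exists [::] => u; rewrite big_nil eqxx.
  by apply: kfin_sub (kfin_add (fD i) IH) => u; rewrite big_cons.
apply: isum_le => // u; apply: le_trans (PR_bound (fs u)).
have le l : (nm l <= slmax)%N by apply: (leq_bigmax l).
rewrite /tail_count -(coarea _ (le (lab u)) (le (lab (u * w)%g))).
rewrite le_eqVlt; apply/orP; left; apply/eqP; apply: eq_bigr => i _.
rewrite {1}/X !Lam_slope /X -!/(lev a _).
set m1 := lev a _; set m2 := lev a u; set x := Posz _; set y := Posz (i < nm (lab u))%N; set y' := Posz (i < nm (lab (u * w)%g))%N.
by lia.
Qed.

Lemma unfold_fin (R T : G -> int) : kfin K' R ->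
  (forall g, T g != 0%R -> exists k, K k /\ R ((k * q)^-1 * g) != 0%R) -> kfin K T.
Proof.
move=> [t tP] TR; exists [seq q * u | u <- t] => g /TR [k [Kk /tP [u ut [_ Ku]]]].
exists (q * u); first exact: map_f.
by rewrite /keq; have := subM sK Kk Ku; gnorm.
Qed.

Lemma T1_sum w : kfin K (T1 w) /\ isum K (T1 w) = isum K' (R1 w).
Proof.
have T1R g : T1 w g != 0%R -> exists k, K k /\ R1 w ((k * q)^-1 * g) != 0%R.
  rewrite /T1; case: ifP; rewrite ?eqxx // => ig nz.
  by exists (kpick g); split=> //; case: (kpickP ig).
have HR u : R1 w u != 0%R -> H a u by rewrite /R1; case: ifP; rewrite ?eqxx.
have [fR _] := kfin_R w; split; first exact: unfold_fin T1R.
apply: (@unfold_sum (R1 w) (T1 w) xpredT) => //; [exact: T1_inv| | |exact: R1_inv].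
  move=> u /HR Hu; rewrite /T1 inhs_q // (kpick_eq (R1_inv w) (sub1 sK)) ?mul1g ?mulKg //.
move=> u u' /HR Hu /HR Hu' Kq.
have := @disj _ (q * u') Kq; rewrite mulKg => /(_ Hu'); gnorm => h.
by apply: h; move: Hu; gnorm.
Qed.

Lemma T2_sum w : kfin K (T2 w) /\ isum K (T2 w) = isum K' (R2 w).
Proof.
have T2R g : T2 w g != 0%R -> exists k, K k /\ R2 w ((k * q)^-1 * g) != 0%R.
  rewrite /T2; case: ifP; rewrite ?eqxx // => ig nz.
  by exists (kpick (g * w)); split=> //; case: (kpickP ig).
have HR u : R2 w u != 0%R -> H a (u * w).
  by rewrite /R2; case: (H a u) => /=; rewrite ?eqxx //; case: ifP; rewrite ?eqxx.
have [_ fR] := kfin_R w; split; first exact: unfold_fin T2R.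
apply: (@unfold_sum (R2 w) (T2 w) xpredT) => //; [exact: T2_inv| | |exact: R2_inv].
  move=> u /HR Hu; rewrite /T2 -mulgA inhs_q // mulgA (@R2_q w _ 1 (sub1 sK)) ?mul1g ?mulKg //.
  by gnorm.
move=> u u' /HR Hu /HR Hu' Kq.
have := @disj _ (q * (u' * w)) Kq; rewrite mulKg => /(_ Hu'); gnorm => h.
by apply: h; move: Hu; gnorm.
Qed.

Lemma prune_inv : kinv K prune.
Proof. by move=> k g Kk; rewrite /prune inhs_K // ke. Qed.

Lemma cut_prune w : cfin K prune /\
  (cut K prune w + isum K' (fun u => R1 w u + R2 w u) <= cut K e w)%R.
Proof.
have fpr w' : kfin K (fun g => Posz (prune (g * w') != prune g)).
  have [f1 _] := T1_sum w'; have [f2 _] := T2_sum w'.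
  have fn X : kfin K X -> kfin K (fun g => `|X g|%R) by apply: kfin_sub => g; rewrite normr_eq0.
  apply: kfin_sub (kfin_add (kfin_add (fn _ f1) (fn _ f2)) (cfin_w w' fe)) => g.
  have := prune_pointwise w' g.
  by case: (prune _ != _) => //; case: (e _ != _); lia.
split; first by apply/(cfinP _ _ a) => b; apply: fpr.
have [f1 e1] := T1_sum w; have [f2 e2] := T2_sum w; have [g1 g2] := kfin_R w.
rewrite !cutE (isum_add sK') // -e1 -e2 -!(isum_add sK) //; last exact: kfin_add.
apply: isum_le => //.
- by apply: kfin_add => //; apply: kfin_add.
- exact: cfin_w.
- exact: prune_pointwise.
Qed.

(** If no functional extending the exponent of a has smaller variation on W, pruning does
    not increase the cut: its gain is at least a sum over thresholds of the growth of such
    functionals. *)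
Lemma prune_le (W : seq G) :
  (forall f, functional a.1 f -> (forall b, st a.1 b.1 -> f b = sdl a b) ->
     \sum_(w <- W) N a.1 (sdl a) w <= \sum_(w <- W) N a.1 f w)%R ->
  [/\ kinv K prune, cfin K prune &
     (\sum_(w <- W) cut K prune w <= \sum_(w <- W) cut K e w)%R].
Proof.
move=> min; split; [exact: prune_inv|by case: (cut_prune 1)|].
have h : (0 <= \sum_(w <- W) isum K' (fun u => R1 w u + R2 w u))%R.
  apply: le_trans (ler_sum _ (fun w _ => prune_gain w)).
  rewrite exchange_big /=; apply: sumr_ge0 => i _; rewrite sumrB subr_ge0.
  by apply: min; [exact: slope_fun|exact: slope_st].
apply: le_trans (_ : _ <= \sum_(w <- W) (cut K prune w + isum K' (fun u => R1 w u + R2 w u)))%R _.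
  by rewrite big_split /= lerDl.
by apply: ler_sum => w _; case: (cut_prune w).
Qed.

End Prune.

(** * Half-spaces *)

Section Half.
Variable D : sgraph.
Implicit Types (a b c : letter D) (x y : D).
Local Notation G := (raag (@edge D)).
Local Notation gw := (raag_of_word (@edge D)).
Local Notation F z := (par (st z)).
Local Open Scope group_scope.

Lemma lev_inv a g : lev (inv a) g = (- lev a g)%R.
Proof.
rewrite /lev -[in RHS]/((inv a).1) -Lam_opp; congr (Lam _ _ g).
by apply/funext => b; rewrite sdl_inv.
Qed.

(** Every wall is the translate of the wall of a letter, and q is a point on it. *)
Definition hs (q : G) a (g : G) := H a (q^-1 * g).

Lemma hs_kl k q l a g : par (lk a.1) l -> hs (k * q * l) a g = hs q a (k^-1 * g).
Proof.
move=> ll; rewrite /hs (_ : _ * g = l^-1 * (q^-1 * (k^-1 * g))); last by gnorm.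
by rewrite H_lk //; apply: parV.
Qed.

Lemma hs_l q l a g : par (lk a.1) l -> hs q a (g * l) = hs q a g.
Proof. by move=> ll; rewrite /hs mulgA (@H_insens D (lk a.1)) // lk_irr. Qed.

Lemma hs_cross q a g b : hs q a (g * lt b) != hs q a g ->
  (b = a /\ par (lk a.1) (q^-1 * g)) \/ (b = inv a /\ par (lk a.1) (q^-1 * (g * lt b))).
Proof. by rewrite /hs mulgA => /H_cross; rewrite -mulgA. Qed.

(** Half-spaces are connected by prefixes of reduced words. *)
Lemma hs_connected (P : G -> bool) q a :
  (forall g b, hs q a g -> hs q a (g * lt b) -> P (g * lt b) = P g) ->
  forall g, hs q a g -> P g = P (q * lt a).
Proof.
move=> edgeP g Hg; have [v [uE su]] := H_start Hg.
have rd : red (a :: v).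
  apply: geo_red => v' e; rewrite -[size (a :: v)]/(size v).+1 -su.
  by apply: (red_geo (rwP _)); rewrite rwK e gw_cons -uE.
have -> : g = q * gw (a :: v) by rewrite gw_cons -uE mulVKg.
elim/last_ind: v rd {uE su} => [|v b IH] rd; first by rewrite gw_cons gw0 mulg1.
have rd' : red (a :: v) by apply: (@red_infix _ [::] (a :: v) [:: b]); rewrite cats1.
rewrite -(IH rd') -rcons_cons gw_rcons mulgA edgeP //.
  by rewrite /hs mulKg; apply: H_inv.
by rewrite -mulgA -gw_rcons /hs mulKg; apply: H_inv.
Qed.

(** A half-space meeting both sides of a wall contains an edge crossing it, since it is
    connected. *)
Lemma hs_edge q a q' b g1 g2 : hs q' b g1 -> hs q' b g2 -> hs q a g1 -> ~~ hs q a g2 ->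
  exists l, [/\ par (lk a.1) l, hs q' b (q * l) & hs q' b (q * l * lt a)].
Proof.
move=> h1 h2 h3 h4; apply: contrapT => no.
have e : forall g, hs q' b g -> hs q a g = hs q a (q' * lt b).
  apply: hs_connected => g c Hg Hgc; apply/eqP/negPn/negP => /hs_cross.
  case=> -[ec ll]; subst c; apply: no; first by exists (q^-1 * g); rewrite mulVKg.
  by exists (q^-1 * (g * lt (inv a))); rewrite mulVKg; split=> //; rewrite ltV mulgVK.
by move: h4; rewrite (e _ h2) -(e _ h1) h3.
Qed.

Lemma hs_meet q a q' b g o : ~~ hs q a o -> ~~ hs q' b o -> hs q a g -> hs q' b g ->
  (forall h, hs q' b h -> hs q a h) \/
  exists l, par (lk a.1) l /\ hs q' b (q * l * lt a * lt a).
Proof.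
move=> no no' Hg Hg'; have [sub|nsub] := pselect (forall h, hs q' b h -> hs q a h); first by left.
right; have [g2 [H2 nH2]] : exists g2, hs q' b g2 /\ ~~ hs q a g2.
  apply: contrapT => no2; apply: nsub => h Hh; apply/negPn/negP => nh; apply: no2.
  by exists h.
have [l [ll e1 e2]] := hs_edge Hg' H2 Hg nH2; exists l; split=> //.
apply/negPn/negP => e3; have := @hs_cross q' b (q * l * lt a) a.
rewrite e2 (negPf e3) => /(_ isT) [[_ /H1]|[ab lm]].
  by rewrite -/(hs q' b _) e2.
case/negP: no'; rewrite /hs; set m := q'^-1 * _ in lm.
have -> : q'^-1 * o = m * ((lt a)^-1 * ((lt a)^-1 * (l^-1 * (q^-1 * o)))) by rewrite /m; gnorm.
have eb : b = inv a by rewrite ab invK.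
rewrite H_lk // eb /H lev_inv; move: no; rewrite /hs /H; set u := q^-1 * o.
have -> : lev a ((lt a)^-1 * ((lt a)^-1 * (l^-1 * u))) = (lev a u - 2)%R.
  rewrite levM; last exact/parV/par_lt_st.
  rewrite levM; last exact/parV/par_lt_st.
  rewrite levM; last by apply/parlk_st/parV.
  by rewrite -!ltV !lev_lt1 !sdlV /sdl eqxx (lev_lk (parV ll)); lia.
by lia.
Qed.

Lemma hs_compl q a g : hs (q * lt a) (inv a) g = ~~ hs q a g.
Proof.
rewrite /hs invgM -mulgA /H lev_inv levM; last exact/parV/par_lt_st.
rewrite -ltV lev_lt1 sdlV /sdl eqxx.
set L := lev a (q^-1 * g); rewrite -ltNge; apply/idP/idP; lia.
Qed.

(** Two walls with the same label are disjoint, because no edge of one label commutes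
    with another of this label. *)
Lemma hs_nested q q' a g o : ~~ hs q a o -> ~~ hs q' a o -> hs q a g -> hs q' a g ->
  (forall h, hs q' a h -> hs q a h) \/
  (forall h, hs q a h -> hs q' a h) /\ forall l, par (lk a.1) l -> hs q' a (q * l).
Proof.
move=> no no' Hg Hg'; have [sub|nsub] := pselect (forall h, hs q' a h -> hs q a h); first by left.
right; have [g2 [H2 nH2]] : exists g2, hs q' a g2 /\ ~~ hs q a g2.
  apply: contrapT => no2; apply: nsub => h Hh; apply/negPn/negP => nh; apply: no2.
  by exists h.
have [l0 [ll0 e1 e2]] := hs_edge Hg' H2 Hg nH2.
have eq' : hs q' a q by rewrite -(hs_l q' q ll0).
split=> [h Hh|l ll]; last by rewrite hs_l.
apply/negPn/negP => nh.
have [l1 [ll1 f1 _]] := hs_edge Hg Hh Hg' nh.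
have nq : ~~ hs q a q by rewrite /hs mulVg H1 //; apply: par1.
have [|||| l2 [ll2 f2 _]] := @hs_edge q' a (q * lt a) (inv a) q o; rewrite ?hs_compl //.
by move: f2; rewrite hs_compl hs_l // -(hs_l _ _ ll1) f1.
Qed.

Lemma hs_equal q q' a : (forall h, hs q' a h <-> hs q a h) -> par (lk a.1) (q'^-1 * q).
Proof.
move=> e; have h1 : hs q' a (q * lt a) by apply/e; rewrite /hs mulKg -(mul1g (lt a)) Hlt //; apply: par1.
have h0 : ~~ hs q' a q.
  by apply/negP => /e; rewrite /hs mulVg H1 //; apply: par1.
have := @hs_cross q' a q a; rewrite h1 (negPf h0).
case=> // -[] // ea _; by move/eqP: ea; rewrite eq_sym inv_neq.
Qed.

(** A half-space whose wall is not adjacent to the flat of [a] cannot meet both sides of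
    the wall of a without containing the flat. *)
Lemma hs_branch q a b h g : ~~ st a.1 b.1 -> F a.1 h -> lev a h = 1%R ->
  hs (q * h) b g -> hs q a g.
Proof.
move=> nb Fh l1 Hg; apply/negPn/negP => ng.
have Hb : hs (q * h) b (q * h * lt b).
  by rewrite /hs mulKg -(mul1g (lt b)) Hlt //; apply: par1.
have [|l [ll f1 _]] := @hs_edge q a (q * h) b (q * h * lt b) g Hb Hg _ ng.
  rewrite /hs -mulgA mulKg /H levM // l1 lev_lt1 sdl_out ?addr0 //.
  by apply: contraNneq nb => ->; apply: st_refl.
have e : q * l = q * h * (h^-1 * l) by gnorm.
move: f1; rewrite /hs e mulKg -[X in H b X]mul1g (@H_insens D (st a.1)) // ?H1 //.
  exact: par1.
by apply: parM; [apply: parV|apply: parlk_st].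
Qed.

End Half.

Section CutThm.
Variable D : sgraph.
Implicit Types (a b c : letter D) (x y : D).
Local Notation G := (raag (@edge D)).
Local Notation gw := (raag_of_word (@edge D)).
Local Notation F z := (par (st z)).
Local Open Scope group_scope.

(** [W] cannot be shortened by automorphisms multiplying by powers of one vertex. *)
Definition locmin (W : seq G) := forall a f, functional a.1 f ->
  (forall b, st a.1 b.1 -> f b = sdl a b) ->
  (\sum_(w <- W) N a.1 (sdl a) w <= \sum_(w <- W) N a.1 f w)%R.

Variables (W : seq G) (x : D) (psi : G -> int) (t0 : G) (e0 : G -> bool) (n0 : int).
Let A := F x.
Definition psiker k := F x k /\ psi k = 0%R.
Local Notation K := psiker.
Hypotheses (lmW : locmin W)
  (psiM : forall g h, A g -> A h -> psi (g * h) = (psi g + psi h)%R)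
  (At0 : A t0) (psit0 : psi t0 = 1%R)
  (ke0 : kinv K e0) (fe0 : cfin K e0)
  (e0p : forall h, A h -> (n0 <= psi h)%R -> e0 h)
  (e0n : forall h, A h -> (psi h <= - n0)%R -> ~~ e0 h).

Let psi1 : psi 1 = 0%R.
Proof. by have := psiM (par1 _) (par1 _); rewrite mulg1; lia. Qed.

Let psiV h : A h -> psi h^-1 = (- psi h)%R.
Proof. by move=> Ah; have := psiM (parV Ah) Ah; rewrite mulVg psi1; lia. Qed.

Let sK : subg K.
Proof.
split; first by split; [apply: par1|].
  by move=> g h [Ag pg] [Ah ph]; split; [apply: parM|rewrite psiM // pg ph].
by move=> g [Ag pg]; split; [apply: parV|rewrite psiV // pg].
Qed.

Let AK k g : K k -> A (k * g) <-> A g.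
Proof. by case=> Ak _; apply: parMl. Qed.

Let off q a := forall g, hs q a g -> ~ A g.
Let depth n q a := forall g v, hs q a g -> size v < n -> ~ A (g * gw v).
Let const (e : G -> bool) q a := forall g g', hs q a g -> hs q a g' -> e g = e g'.
Let Claim n e := forall q a, depth n q a -> const e q a.
Let good e := [/\ kinv K e, cfin K e, forall h, A h -> e h = e0 h &
  (\sum_(w <- W) cut K e w <= \sum_(w <- W) cut K e0 w)%R].

Let depth_off n q a : 0 < n -> depth n q a -> off q a.
Proof. by move=> n1 dp g Hg Ag; apply: (dp g [::]) => //; rewrite gw0 mulg1. Qed.

Let off1 q a : off q a -> ~~ hs q a 1.
Proof. by move=> of1; apply/negP => /of1; apply; apply: par1. Qed.

Let deeper n q a : off q a ->
  (forall l v, par (lk a.1) l -> size v < n -> ~ A (q * l * gw v)) -> depth n.+1 q a.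
Proof.
move=> ofq ex g v; elim: v g => [|b v IH] g Hg sv; first by rewrite gw0 mulg1; apply: ofq.
rewrite gw_cons mulgA; have [Hgb|nHgb] := boolP (hs q a (g * lt b)).
  by apply: IH => //; apply: ltnW.
have := @hs_cross D q a g b; rewrite Hg (negPf nHgb).
case=> // -[_]; first by move/H1; rewrite -/(hs q a _) Hg.
move=> ll.
by have := ex _ v ll sv; rewrite mulVKg.
Qed.

Let off_sub q a q' b : off q a -> (forall g, hs q' b g -> hs q a g) -> off q' b.
Proof. by move=> ofq sub g /sub /ofq. Qed.

Let depthK n k q l a : K k -> par (lk a.1) l -> depth n (k * q * l) a -> depth n q a.
Proof.
move=> Kk ll dp g v Hg sv Ag; apply: (dp (k * g) v) => //.
  by rewrite hs_kl // mulKg.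
by rewrite -mulgA AK.
Qed.

Let constK e k q l a : kinv K e -> K k -> par (lk a.1) l -> const e q a -> const e (k * q * l) a.
Proof.
move=> ke Kk ll ce g g'; rewrite !hs_kl // => Hg Hg'.
by have := ce _ _ Hg Hg'; rewrite !(ke _ _ (subV sK Kk)).
Qed.

Section Step.
Variables (e : G -> bool) (n : nat) (q : G) (a : letter D).
Hypotheses (ke : kinv K e) (fe : cfin K e) (cl : Claim n.+1 e) (n1 : 0 < n) (dq : depth n q a).

Let ofq : off q a := depth_off n1 dq.
Let c := e (q * lt a * lt a).

Let deep u : (2 <= lev a u)%R -> e (q * u) = c.
Proof.
have Hlev v : (2 <= lev a v)%R -> hs (q * lt a) a (q * v).
  rewrite /hs invgM -mulgA mulKg /H levM; last by apply/parV/par_lt_st.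
  by rewrite -ltV lev_lt1 sdlV /sdl eqxx; lia.
move=> l2; rewrite /c -mulgA.
have sub g : hs (q * lt a) a g -> hs q a g.
  rewrite /hs invgM -mulgA /H levM; last exact/parV/par_lt_st.
  by rewrite -ltV lev_lt1 sdlV /sdl eqxx; set L := lev a (q^-1 * g); lia.
apply: (cl (q := q * lt a) (a := a)); [|exact: Hlev|]; last first.
  apply: Hlev; rewrite lev_lt; last exact: par_lt_st.
  by rewrite lev_lt1 /sdl eqxx.
apply: deeper; first exact: off_sub ofq sub.
move=> l v ll sv; apply: dq => //.
by rewrite hs_l // /hs mulKg -(mul1g (lt a)) Hlt //; apply: par1.
Qed.

Let branch h b u : F a.1 h -> lev a h = 1%R -> ~~ st a.1 b.1 ->
  H b u -> e (q * h * u) = e (q * h * lt b).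
Proof.
move=> Fh l1 nb Hu; apply: (cl (q := q * h) (a := b)); last first.
- by rewrite /hs mulKg -(mul1g (lt b)) Hlt //; apply: par1.
- by rewrite /hs mulKg.
apply: deeper; first by apply: off_sub ofq _ => g; apply: hs_branch.
move=> l v ll sv; apply: dq => //.
rewrite /hs -mulgA mulKg /H levM // (_ : lev a l = 0%R) ?l1 //.
have nbl : ~~ lk b.1 a.1.
  by apply: contra nb => ba; apply: lk_st; rewrite lk_sym.
move: ll; elim/par_ind_r => [|g d IH ld]; first by rewrite /lev Lam1 //; apply: sdl_fun1.
have nda : d.1 != a.1 by apply/eqP => ed; case/negP: nbl; rewrite -ed.
by rewrite /lev Lam_zero ?sdl_out //; apply: sdl_fun1.
Qed.

Lemma step_cand : ~ const e q a -> exists h b, [/\ F a.1 h, lev a h = 1%R &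
  e (q * h * lt b) != e (q * h)].
Proof.
move=> nc; apply: contrapT => no; apply: nc.
have ec h b : F a.1 h -> lev a h = 1%R -> e (q * h * lt b) = e (q * h).
  move=> Fh l1; apply/eqP/negPn/negP => ne; apply: no; by exists h, b.
suff ce g : hs q a g -> e g = c by move=> g g' /ce -> /ce ->.
rewrite /hs => Hg; rewrite -(mulVKg q g); set u := q^-1 * g in Hg *.
have [l2|l1] := lerP 2 (lev a u); first exact: deep.
have {}l1 : lev a u = 1%R by move: Hg; rewrite /H; lia.
have [l [h [Fh ul uE _]]] := lab_ex a u; rewrite l1 in ul.
have eh : e (q * h) = c.
  by rewrite -(ec h a) // -mulgA deep // lev_lt // -ul.
case: l uE => [b [nb [v [rd ->]]]|->] //.
by rewrite mulgA (branch Fh _ nb (H_inv rd)) // ec.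
Qed.

(** Pruning one half-space keeps what pruning others has achieved: those not smaller are
    disjoint from it or contain it. *)
Lemma step_prune : ~ const e q a ->
  [/\ kinv K (prune K e q a c), cfin K (prune K e q a c),
   (forall h, A h -> prune K e q a c h = e h),
   (\sum_(w <- W) cut K (prune K e q a c) w <= \sum_(w <- W) cut K e w)%R &
   const (prune K e q a c) q a /\
   forall q' b, off q' b -> const e q' b -> const (prune K e q a c) q' b].
Proof.
move=> nc; have o1 := off1 ofq.
have oK k : K k -> off (k * q) a.
  move=> Kk g; rewrite -(mulg1 (k * q)) hs_kl; last exact: par1.
  by move=> /ofq nA Ag; apply: nA; rewrite (AK _ (subV sK Kk)).
have hK k g : hs (k * q) a g = hs q a (k^-1 * g).
  by rewrite -(mulg1 (k * q)) hs_kl //; apply: par1.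
have disj k g : K k -> H a (q^-1 * g) -> H a ((k * q)^-1 * g) ->
    par (lk a.1) (q^-1 * k * q).
  rewrite -/(hs q a g) -/(hs (k * q) a g) => Kk Hg Hg'.
  have k1 := off1 (oK k Kk).
  have s1 : forall h, hs (k * q) a h -> hs q a h.
    have [//|[sub exl]] := hs_nested o1 k1 Hg Hg'.
    case: nc; apply: cl; apply: deeper => // l v ll sv.
    have Hk := exl l ll; rewrite hK in Hk.
    by have := dq Hk sv; rewrite -!mulgA (AK _ (subV sK Kk)).
  have s2 : forall h, hs q a h -> hs (k * q) a h.
    have [//|[sub exl]] := hs_nested k1 o1 Hg' Hg.
    case: nc; have : const e (k * q) a.
      apply: cl; apply: deeper; first exact: oK.
      by move=> l v ll sv; apply: dq => //; apply: exl.
    move=> ce g1 g2 h1 h2; have := ce (k * g1) (k * g2); rewrite !hK !mulKg !ke //.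
    exact.
  have := hs_equal (fun h => conj (@s1 h) (@s2 h)).
  move/parV => h; move: h; rewrite !invgM !invgK !mulgA.
  by [].
have [k' f' le'] := prune_le sK ke fe disj deep branch (fun f ff fe => lmW ff fe).
have inA h : A h -> ~~ inhs K q a h.
  by move=> Ah; apply/negP => /asboolP [k [Kk Hk]]; apply: (oK k Kk h).
split=> //; first by move=> h /inA /negPf; rewrite /prune => ->.
split=> [g g' Hg Hg'|q' b of' ce].
  by rewrite /prune !ifT //; apply/asboolP; exists 1; rewrite mul1g; split=> //; apply: sub1.
have [[g0 [H0 ig0]]|no] := pselect (exists g0, hs q' b g0 /\ inhs K q a g0); last first.
  move=> g g' Hg Hg'; rewrite /prune !ifF; first exact: ce.
    by apply/negP => i; apply: no; exists g'.
  by apply/negP => i; apply: no; exists g.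
suff cc g : hs q' b g -> prune K e q a c g = c by move=> g g' /cc -> /cc ->.
move=> Hg; rewrite /prune; case: ifP => // /negP nig.
have /asboolP [k [Kk Hk]] := ig0.
have [sub|[l [ll Hl]]] := hs_meet (off1 (oK k Kk)) (off1 of') Hk H0.
  by case: nig; apply/asboolP; exists k; split=> //; apply: sub.
rewrite (ce _ _ Hg Hl) -!mulgA ke // deep //.
rewrite levM ?(lev_lk ll) ?add0r; last exact: parlk_st.
by rewrite lev_lt ?lev_lt1 /sdl ?eqxx //; apply: par_lt_st.
Qed.

End Step.

Let prune_list n (s : seq (G * letter D)) : 0 < n -> forall e, good e -> Claim n.+1 e ->
  (forall q a, depth n q a -> ~ const e q a -> exists2 p, p \in s &
     p.2 = a /\ exists k l, [/\ K k, par (lk a.1) l & q = k * p.1 * l]) ->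
  exists e', good e' /\ Claim n e'.
Proof.
move=> n1; elim: s => [|[q0 a0] s IH] e ge ce cand.
  exists e; split=> // q a dp; apply: contrapT => nc.
  by have [p] := cand q a dp nc.
have [ke fe eA le] := ge.
have drop : depth n q0 a0 -> const e q0 a0 -> exists e', good e' /\ Claim n e'.
  move=> d0 c0; apply: (IH e) => // q a dp nc.
  have [p] := cand q a dp nc; rewrite inE => /orP[/eqP -> [/= ea [k [l [Kk ll qE]]]]|ps]; last by exists p.
  by case: nc; rewrite qE -ea; apply: constK => //; rewrite ea.
have [d0|nd] := pselect (depth n q0 a0); last first.
  apply: (IH e) => // q a dp nc.
  have [p] := cand q a dp nc; rewrite inE => /orP[/eqP -> [/= ea [k [l [Kk ll qE]]]]|ps]; last by exists p.
  by case: nd; rewrite ea; rewrite qE in dp; apply: depthK dp.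
have [c0|nc0] := pselect (const e q0 a0); first exact: drop.
have [k' f' A' le' [c' pres]] := step_prune ke fe ce n1 d0 nc0.
set e' := prune _ _ _ _ _ in k' f' A' le' c' pres.
apply: (IH e').
- by split=> //; [move=> h Ah; rewrite A' // eA|apply: le_trans le' le].
- by move=> q a dp; apply: pres; [apply: depth_off dp|apply: ce].
move=> q a dp nc.
have nce : ~ const e q a by move=> cq; apply: nc; apply: pres => //; apply: depth_off dp.
have [p] := cand q a dp nce; rewrite inE => /orP[/eqP -> [/= ea [k [l [Kk ll qE]]]]|ps]; last by exists p.
by case: nc; rewrite qE -ea; apply: constK => //; rewrite ea.
Qed.

Let cut_list e : cfin K e -> exists r : seq G, forall g b, e (g * lt b) != e g ->
  exists2 t, t \in r & keq K t g.
Proof.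
move=> fe; have fb b := cfin_w (lt b) fe.
exists (flatten [seq projT1 (cid (fb b)) | b <- enum {: letter D}]) => g b ne.
have := projT2 (cid (fb b)) g; case=> [|t tb tg].
  by move: ne; case: (_ != _).
by exists t => //; apply/flattenP; exists (projT1 (cid (fb b))) => //; apply: map_f; rewrite mem_enum.
Qed.

Let pruned : exists e, good e /\ Claim 1 e.
Proof.
have g0 : good e0 by split.
have [r rP] := cut_list fe0.
pose N := (\max_(t <- r) size (rw t^-1)).+1.
have : Claim N e0.
  move=> q a dp; suff ce g : hs q a g -> e0 g = e0 (q * lt a) by move=> g g' /ce -> /ce ->.
  apply: hs_connected => {}g b Hg _; apply/eqP/negPn/negP => /rP [t tr [Kt _]].
  apply: (dp g (rw t^-1) Hg); last by rewrite rwK.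
  by rewrite ltnS; apply: (@leq_bigmax_seq _ r xpredT (fun t => size (rw t^-1)) t).
have gen n : forall e, good e -> Claim n.+1 e -> exists e', good e' /\ Claim 1 e'; last exact: gen.
elim: n {r rP N} => [|n IH] e ge; first by exists e.
move=> ce; have [ke fe _ _] := ge; have [r rP] := cut_list fe.
have [|e' [ge' ce']] := @prune_list n.+1 (flatten [seq [seq (t * (lt a)^-1, a) | a <- enum {: letter D}] | t <- r]) isT e ge ce.
  move=> q a dp nc; have [h [b [Fh l1 /rP [t tr Kt]]]] := step_cand ce (ltn0Sn n) dp nc.
  exists (t * (lt a)^-1, a).
    by apply/flattenP; eexists; [apply: map_f tr|apply: (map_f (fun a => (t * (lt a)^-1, a))); rewrite mem_enum].
  split=> //; exists (q * h * t^-1), (h * (lt a)^-1)^-1; split=> //=.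
    exact/parV/F_split.
  by gnorm.
exact: IH ge' ce'.
Qed.

(** ** Reading off a functional from a pruned cut *)

Definition heav (j : int) : int := Posz (1 <= j)%R.

Lemma fsup_bnd (X : int -> int) (n : int) :
  (forall j, (n < j)%R \/ (j < - n)%R -> X j = 0%R) -> fsup X.
Proof.
move=> Xn; exists [seq (Posz i - n)%R | i <- iota 0 (absz (n + n)%R).+1] => j nz.
have jn : ((- n <= j) && (j <= n))%R.
  by apply: contraNT nz => h; apply/eqP/Xn; lia.
by apply/mapP; exists (absz (j + n)%R); rewrite ?mem_iota; lia.
Qed.

Lemma S_shift (X : int -> int) s : fsup X -> fsup (fun j => X (j + s)%R) /\ S (fun j => X (j + s)%R) = S X.
Proof.
move=> fX; apply: (@S_reindex int int (fun j => j - s)%R X) => //.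
- by move=> j _; rewrite subrK.
- by move=> j j' _ _; lia.
- by move=> i nz; exists (i + s)%R => //; lia.
Qed.

(** A shifted Heaviside function differs from the original by the shift, in total; this turns
    the relative position of two ends of a cut into an integer. *)
Lemma S_heav s : fsup (fun j => heav (j + s) - heav j)%R /\ S (fun j => heav (j + s) - heav j)%R = s.
Proof.
have fh : fsup (fun j => heav (j + s) - heav j)%R.
  by apply: (@fsup_bnd _ (`|s| + 1)%R) => j h; rewrite /heav; do 2 case: lerP; lia.
split=> //; have := S_interval s 0%R.
have [s0|s0] := lerP 0 s.
  have -> : S (fun j => heav (j + s) - heav j)%R = S (fun j : int => `|((1 <= j + s)%R%:Z - (1 <= j + 0)%R%:Z)|%R).
    by apply: eq_S => j; rewrite addr0 /heav; do 2 case: lerP; lia.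
  by move=> ->; lia.
have -> : S (fun j => heav (j + s) - heav j)%R = (- S (fun j : int => `|((1 <= j + s)%R%:Z - (1 <= j + 0)%R%:Z)|%R))%R.
  rewrite -S_opp; apply: eq_S => j; rewrite addr0 /heav; do 2 case: lerP; lia.
by move=> ->; lia.
Qed.

(** Once the cut is constant on all half-spaces off the flat of x, it depends only on psi on
    the flat and on the first letter outside it, so that it is the level set of a functional that
    extends psi. *)
Theorem cut_min : exists f, [/\ functional x f,
  (forall b, st x b.1 -> f b = psi (lt b)) &
  (\sum_(w <- W) N x f w <= \sum_(w <- W) cut K e0 w)%R].
Proof.
have [e [[ke fe eA le] cl]] := pruned.
have ep h : A h -> (n0 <= psi h)%R -> e h by move=> Ah; rewrite eA //; apply: e0p.
have en h : A h -> (psi h <= - n0)%R -> ~~ e h by move=> Ah; rewrite eA //; apply: e0n.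
pose rho j := zpow t0 j.
have Arho j : A (rho j) by apply: par_zpow.
have psirho j : psi (rho j) = j.
  have h i : psi (zpow t0 (i + 1)%R) = (psi (zpow t0 i) + 1)%R.
    by rewrite zpowS psiM ?psit0 //; apply: par_zpow.
  elim/int_rec: j => [|n IH|n IH]; first by rewrite /rho zpow0.
    by rewrite intS addrC h IH.
  by have := h (- n.+1%:Z)%R; rewrite /rho in IH *; rewrite (_ : (- n.+1%:Z + 1)%R = (- n%:Z)%R) ?IH; lia.
pose tl l : G := if l is Some b then lt b else 1.
pose ft l j : bool := e (rho j * tl l).
have eft h l : A h -> e (h * tl l) = ft l (psi h).
  move=> Ah; rewrite /ft -[LHS](@ke (rho (psi h) * h^-1)); first by congr e; gnorm.
  have AhV : A h^-1 := parV Ah; split; first exact: parM (Arho _) AhV.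
  by rewrite psiM ?psirho ?psiV ?subrr.
(* half-spaces leaving the flat are disjoint from it *)
have coff h b : A h -> ~~ st x b.1 -> const e h b.
  move=> Ah nb; apply: cl => g [|//] Hg _; rewrite gw0 mulg1 => Ag.
  move: Hg; rewrite /hs -[_ * g]mul1g (@H_insens D (st x)) ?H1 //; first exact: par1.
  by apply: parM => //; apply: parV.
have eH h b u : A h -> ~~ st x b.1 -> H b u -> e (h * u) = e (h * lt b).
  move=> Ah nb Hu; apply: (coff h b Ah nb); rewrite /hs mulKg //.
  by rewrite -(mul1g (lt b)) Hlt //; apply: par1.
have com_H b b' : com b b' -> H b (lt b * lt b').
  move=> cb; rewrite /H levM; last exact: par_lt_st.
  rewrite !lev_lt1 {1}/sdl eqxx sdl_out //; apply/eqP => e1.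
  by move: cb; rewrite /com e1 edge_irr.
have fNone l : fsup (fun j => Posz (ft l j) - Posz (ft None j))%R.
  case: l => [b|]; last first.
    by exists [::] => j; rewrite subrr eqxx.
  have [s sP] := cfin_w (lt b) fe.
  exists [seq psi (xget 1 [set h | A h /\ keq K t h]%classic) | t <- s] => j nz.
  have [|t ts Kt] := sP (rho j).
    by apply: contra_neq nz => /eqP; rewrite /ft /= mulg1; case: (e _); case: (e _).
  apply/mapP; exists t => //.
  have [Ah Kh] : [set h | A h /\ keq K t h]%classic (xget 1 [set h | A h /\ keq K t h]%classic).
    by apply: (@xgetI _ 1 _ (rho j)).
  set h := xget _ _ in Ah Kh *; have [_] := keq_trans sK (keq_sym sK Kh) Kt.
  by rewrite psiM ?psirho ?psiV //; [lia|apply: parV].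
pose hv l j := (Posz (ft l j) - heav j)%R.
have fhv l : fsup (hv l).
  have fN : fsup (hv None).
    apply: (@fsup_bnd _ (`|n0| + 1)%R) => j h; rewrite /hv /ft /heav /tl mulg1.
    case: h => h.
      by rewrite ep ?psirho //; [case: lerP; lia|lia].
    by rewrite (negPf (en _ (Arho j) _)) ?psirho; [case: lerP; lia|lia].
  by apply: fsup_sub (fsup_add (fNone l) fN) => j; rewrite /hv addrA subrK.
pose p l := S (hv l).
pose f b := if st x b.1 then psi (lt b) else (p (Some b) - p None)%R.
have ff : functional x f.
  split.
  - by move=> b sb; rewrite /f /= sb ltV psiV //; apply: par_lt.
  - move=> b b' sb nb' cb; rewrite /f sb; set s := psi _.
    have per j : ft (Some b') (j + s)%R = ft (Some b') j.
      have Ab : A (lt b) by apply: par_lt.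
      have Aj : A (rho j * lt b) := parM (Arho j) Ab.
      transitivity (e (rho j * lt b * tl (Some b'))).
        by rewrite (eft _ (Some b')) // psiM // psirho.
      by rewrite /ft /= -mulgA (lt_com cb) (eH _ b') //; apply: com_H; rewrite com_sym.
    have [//|s0] := eqVneq s 0%R; exfalso.
    have fs := fhv (Some b').
    have [f1 e1] := S_shift s fs; have [f2 e2] := S_heav s.
    have := S_add f1 f2; rewrite e1 e2 => e3.
    have : S (hv (Some b')) = (S (hv (Some b')) + s)%R; last by lia.
    rewrite -e3; apply: eq_S => j; rewrite /hv per; lia.
  - move=> b b' nb nb' cb; rewrite /f (negPf nb) (negPf nb'); congr (_ - _)%R.
    apply: eq_S => j; rewrite /hv /ft /=; congr (Posz _ - _)%R.
    rewrite -(eH _ b (lt b * lt b')) //; last exact: com_H.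
    by rewrite (lt_com cb) (eH _ b') //; apply: com_H; rewrite com_sym.
exists f; split=> //; first by move=> b sb; rewrite /f sb.
apply: le_trans le; apply: ler_sum => w _.
have Lf u : exists l, exists2 h, A h & (forall j, e (rho j * u) = ft l (j + psi h)%R) /\
    Lam x f u = (psi h + p l - p None)%R.
  have [h [l [Fh uE LE]]] := flat_split x u; exists l, h => //.
  have Lh : Lam x f h = psi h.
    case: (Fh) => v [av <-]; elim: v av => [_|b v IH /= /andP[sb av]]; first by rewrite gw0 Lam1.
    rewrite gw_cons LamM ?(Lam_lt ff) ?IH //; last exact: par_lt.
    by rewrite psiM ?/f ?sb //; [apply: par_lt|exists v].
  rewrite LE // Lh; case: l uE {LE} => [b [nb [v [rd ->]]]|->]; split=> //=.
  - move=> j; have Aj : A (rho j * h) := parM (Arho j) Fh.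
    by rewrite mulgA (eH _ b _ Aj nb (H_inv rd)) (eft _ (Some b) Aj) psiM // psirho.
  - by rewrite /f (negPf nb) addrA.
  - move=> j; have Aj : A (rho j * h) := parM (Arho j) Fh.
    by rewrite -(mulg1 (_ * h)) (eft _ None Aj) psiM // psirho.
  - by rewrite addr0 addrK.
have ik : kinv K (fun g => Posz (e (g * w) != e g)).
  by move=> k g Kk; rewrite -mulgA !(ke k _ Kk).
have psiK g : A g -> psi g = 0%R -> K g by [].
have KA g : K g -> A g by case.
have Kpsi g : K g -> psi g = 0%R by case.
rewrite cutE; have [-> fS] := isum_tower_int sK (par_subg (st x)) KA psiM psiK Kpsi Arho psirho ik (cfin_w w fe).
have fSS : kfin A (fun u => S (fun j => Posz (e (rho j * u * w)%g != e (rho j * u)%g))).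
  have [s sP] := cfin_w w fe; exists s => u nz.
  have [j] : exists j, Posz (e (rho j * u * w)%g != e (rho j * u)%g) != 0%R.
    apply: contrapT => no; case/eqP: nz; apply: S_0 => j.
    by apply/eqP/negPn/negP => h; apply: no; exists j.
  move=> /sP [g gt [gj _]]; exists g => //; rewrite /keq.
  have := parM (parV (Arho j)) gj; by rewrite !mulgA mulVg mul1g.
apply: (isum_le (par_subg (st x)) (vfin_n (Lam_vfin ff) w) fSS).
move=> u; have [l [h Ah [el ->]]] := Lf u; have [l' [h' Ah' [el' ->]]] := Lf (u * w).
set m := psi h; set m' := psi h'.
have sh k i : fsup (fun j => Posz (ft k (j + i)%R) - heav j)%R /\ S (fun j => Posz (ft k (j + i)%R) - heav j)%R = (p k + i)%R.
  have [f1 e1] := S_shift i (fhv k); have [f2 e2] := S_heav i.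
  have E : (fun j => hv k (j + i) + (heav (j + i) - heav j))%R = (fun j => Posz (ft k (j + i)%R) - heav j)%R.
    by apply/funext => j; rewrite /hv; lia.
  by rewrite -E; split; [apply: fsup_add|rewrite S_add // e1 e2].
have [f1 e1] := sh l m; have [f2 e2] := sh l' m'.
have -> : (m' + p l' - p None - (m + p l - p None))%R =
  S (fun j => (Posz (ft l' (j + m')%R) - heav j) - (Posz (ft l (j + m)%R) - heav j))%R.
  by rewrite S_sub // e1 e2; lia.
apply: le_trans (S_norm _) _; first by apply: fsup_add => //; apply: fsup_opp.
rewrite le_eqVlt; apply/orP; left; apply/eqP/eq_S => j.
rewrite -mulgA el el'; by case: (ft l _); case: (ft l' _); case: (heav j); lia.
Qed.

End CutThm.

Section Ab.
Variable D : sgraph.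
Implicit Types (a b c : letter D) (x y v : D).
Local Notation G := (raag (@edge D)).
Local Notation gw := (raag_of_word (@edge D)).
Local Open Scope group_scope.

(** Exponent sum of a vertex, the coordinate of the abelianization. *)
Definition ab v (g : G) : int := (\sum_(b <- rw g) sdl (v, false) b)%R.

Lemma ab_gw v w : ab v (gw w) = (\sum_(b <- w) sdl (v, false) b)%R.
Proof.
have /raag_eqP : gw (rw (gw w)) = gw w by rewrite rwK.
rewrite /ab; move: (rw _) => w'; elim=> {w w'} [//|w w' _ -> //|u w w' _ -> _ -> //|u w b|u w x y xy].
  by rewrite !big_cat !big_cons big_nil /= -[inv_letter b]/(inv b) sdlV; lia.
by rewrite !big_cat !big_cons !big_nil /=; lia.
Qed.

Lemma ab1 v : ab v 1 = 0%R. Proof. by rewrite -gw0 ab_gw big_nil. Qed.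

Lemma abM v g h : ab v (g * h) = (ab v g + ab v h)%R.
Proof. by rewrite -(rwK g) -(rwK h) -gwM !ab_gw big_cat. Qed.

Lemma abV v g : ab v g^-1 = (- ab v g)%R.
Proof. by have := abM v g^-1 g; rewrite mulVg ab1; lia. Qed.

Lemma ab_lt v a : ab v (lt a) = sdl (v, false) a.
Proof. by rewrite /lt ab_gw big_seq1. Qed.

Lemma ab_gen v x : ab v (lt (x, false)) = Posz (x == v).
Proof.
rewrite ab_lt /sdl xpair_eqE eqxx andbT; case: eqP => //.
by rewrite /inv /inv_letter /= xpair_eqE andbF.
Qed.

Lemma abX v g n : ab v (g ^+ n) = (n%:Z * ab v g)%R.
Proof.
elim: n => [|n IH]; first by rewrite expg0 ab1 mul0r.
by rewrite expgS abM IH; lia.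
Qed.

Lemma zpowN (g : G) j : zpow g (- j)%R = (zpow g j)^-1.
Proof. by apply: (@mulgI _ (zpow g j)); rewrite mulgV -zpowD subrr. Qed.

Lemma ab_zpow v g j : ab v (zpow g j) = (j * ab v g)%R.
Proof. by case: j => n; rewrite /zpow ?abV abX // NegzE; lia. Qed.

Lemma abJ v q g : ab v (q^-1 * g * q) = ab v g.
Proof. by rewrite !abM abV; lia. Qed.

Lemma ab_par v (P : pred D) g : par P g -> ~~ P v -> ab v g = 0%R.
Proof.
move=> [w [/allP aw <-]] nv; rewrite ab_gw big1_seq // => b /andP[_ /aw Pb].
rewrite sdl_out //=; by apply: contraNneq nv => <-.
Qed.

Lemma ab_neq0 v w : ab v (gw w) != 0%R -> exists2 b, b \in w & b.1 = v.
Proof.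
rewrite ab_gw => nz; apply: contrapT => no; case/eqP: nz.
rewrite big1_seq // => b /andP[_ bw]; rewrite sdl_out //.
by apply/negP => /eqP e; apply: no; exists b.
Qed.

End Ab.

(** * Cyclically reduced elements *)

Ltac lens := repeat match goal with
  | |- context [len ?x] => let v := fresh "v" in set v := (len x); move: v => v end.

Section Cyclic.
Variable D : sgraph.
Implicit Types (a b y : letter D).
Local Notation G := (raag (@edge D)).
Local Notation gw := (raag_of_word (@edge D)).
Local Notation F z := (par (st z)).
Local Open Scope group_scope.

Lemma red_of_len w : (size w)%:Z%R = len (gw w) -> red w.
Proof.
move=> e; apply: geo_red => v ev; have := len_size v; rewrite ev -e.
by rewrite lez_nat.
Qed.

Lemma H_two a b g : H a g -> H b g -> a = b \/ com a b.
Proof.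
move=> Ha Hb; have [v [e s]] := H_start Hb.
have rd : red (b :: v).
  by apply: red_of_len; rewrite gw_cons -e len_rw s.
have [ab|nab] := boolP (st a.1 b.1); last first.
  move: Ha; rewrite e -gw_cons /H /lev LamE //=; last exact: sdl_fun1.
  rewrite (negPf nab) sdl_out //; by apply: contraNneq nab => ->; apply: st_refl.
case/orP: ab => [/eqP e1|]; last by right.
left; apply/eqP/negPn/negP => nab; have eb : b = inv a.
  case: (a) (b) e1 nab => [x s1] [x' s2] /= ->; rewrite xpair_eqE eqxx /=.
  by case: s1; case: s2.
by move: Ha Hb; rewrite eb /H lev_inv; lia.
Qed.

Lemma H_cat b v h : red (v ++ h) -> H b (gw v * gw h) -> H b (gw v) \/ par (lk b.1) (gw v).
Proof.
elim: v => [|a v IH] rd Hb; first by right; exists [::].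
have rd' : red (v ++ h) by apply: (@red_infix _ [:: a] (v ++ h) [::]); rewrite cats0.
have rv : red (a :: v) by apply: (@red_infix _ [::] (a :: v) h).
have Ha : H a (gw (a :: v) * gw h) by rewrite -gwM; apply: H_inv.
have [<-|cab] := H_two Ha Hb; first by left; apply: H_inv.
have la : par (lk b.1) (lt a) by apply: par_lt; rewrite /lk edge_sym.
move: Hb; rewrite gw_cons -mulgA !(H_lk _ la) => Hb; case: (IH rd' Hb) => p; [by left|by right; apply: parM].
Qed.

Lemma lenV_step (g : G) b : len (g * lt b)%g = (len g + 1 - 2 * Posz (H b (g^-1)%g))%R.
Proof. exact: len_step. Qed.

Lemma red_step w b : red w -> red (rcons w b) = ~~ H b (gw w)^-1.
Proof.
move=> rd; apply/idP/idP => [rd'|nH].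
  have := lenV_step (gw w) b; rewrite -gw_rcons !len_red // size_rcons.
  by case: (H b _) => //; lia.
apply: red_of_len; rewrite gw_rcons lenV_step len_red // size_rcons (negPf nH).
by lia.
Qed.

Lemma red_cat u v : red u -> red v ->
  (forall b, H b (gw u)^-1 -> H b (gw v) -> False) -> red (u ++ v).
Proof.
move=> ru; elim/last_ind: v => [|v b IH] rv no; first by rewrite cats0.
have rv' : red v by apply: (@red_infix _ [::] v [:: b]); rewrite cats1.
have noI : red (u ++ v).
  apply: IH => // d H1 H2; apply: (no d) => //.
  have := H_inv (D := D) (a := d) (w := behead (rw (gw (rcons v b)))); move=> _.
  have [v' [e s]] := H_start H2.
  have rd : red (d :: v' ++ [:: b]).
    apply: red_of_len; rewrite gw_cons gwM mulgA -e -gwM -cats1 in rv *; rewrite len_red //= !size_cat /=.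
    have : len (gw v) = (size v)%:Z%R by rewrite len_red.
    by rewrite len_rw s /=; lia.
  by have := H_inv rd; rewrite gw_cons gwM mulgA -e -gwM cats1.
rewrite -rcons_cat red_step //; apply/negP => Hb.
have nv : ~~ H b (gw v)^-1 by rewrite -red_step.
have rdi : red (word_inv v ++ word_inv u).
  by have := red_inv noI; rewrite /word_inv map_cat rev_cat.
have := @H_cat b _ _ rdi; rewrite !gw_inv -invgM -gwM => /(_ Hb) [h|p].
  by rewrite h in nv.
move/parVE in p; apply: (no b); last by rewrite gw_rcons -[X in H b X]mulg1 -mulgA H_lk // mulg1 -(mul1g (lt b)) Hlt //; apply: par1.
by move: Hb; rewrite gwM invgM H_lk //; apply: parV.
Qed.

Definition cycred (c : G) := forall a, ~~ (H a c && H a c^-1).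

Lemma len_cat g h : (forall b, H b g^-1 -> H b h -> False) -> len (g * h)%g = (len g + len h)%R.
Proof.
move=> no; have rd : red (rw g ++ rw h) by apply: red_cat; rewrite ?rwP ?rwK.
by rewrite -{1}(rwK g) -{1}(rwK h) -gwM len_red // size_cat !len_rw.
Qed.

Lemma H_prefix a g h : len (g * h)%g = (len g + len h)%R -> H a g -> H a (g * h).
Proof.
move=> le /H_start [v [e s]]; have : red (a :: v ++ rw h).
  apply: red_of_len; rewrite gw_cons gwM mulgA -e rwK le !len_rw s /= size_cat.
  by lia.
by move=> /H_inv; rewrite gw_cons gwM rwK mulgA -e.
Qed.

Lemma len_pow (c : G) n : (len (c ^+ n)%g <= n%:Z * len c)%R.
Proof.
elim: n => [|n IH]; first by rewrite expg0 len1 mul0r.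
rewrite expgSr; apply: le_trans (lenM _ _) _; move: IH; lens; lia.
Qed.

(** No cancellation between consecutive copies means that words for the powers are
    reduced. *)
Lemma cycred_pow c n : cycred c -> len (c ^+ n)%g = (n%:Z * len c)%R.
Proof.
move=> cc; case: n => [|n]; first by rewrite expg0 len1 mul0r.
elim: n => [|n IH]; first by rewrite expg1 mul1r.
suff -> : len (c ^+ n.+2)%g = (len (c ^+ n.+1)%g + len c)%R by rewrite IH; lia.
rewrite [c ^+ n.+2]expgSr; apply: len_cat => b Hb Hc.
have nb : ~~ H b c^-1 by have := cc b; rewrite Hc.
have rd : red (word_inv (rw c) ++ word_inv (rw (c ^+ n))).
  have -> : word_inv (rw c) ++ word_inv (rw (c ^+ n)) = word_inv (rw (c ^+ n) ++ rw c).
    by rewrite /word_inv map_cat rev_cat.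
  apply: red_inv; apply: red_of_len; rewrite gwM !rwK -expgSr IH size_cat PoszD -!len_rw.
  have le1 := len_pow c n; have le2 : (len (c ^+ n.+1)%g <= len (c ^+ n)%g + len c)%R.
    by rewrite expgSr; apply: lenM.
  by move: le1 le2; rewrite IH; lia.
have := @H_cat b _ _ rd; rewrite !gw_inv !rwK -invgM -expgSr => /(_ Hb) [h|/parVE p].
  by rewrite h in nb.
by move: Hc; rewrite H1.
Qed.

Lemma len_conj (q g : G) : (len (q^-1 * g * q)%g <= len g + 2 * len q)%R.
Proof. by have := lenM (q^-1 * g)%g q; have := lenM q^-1 g; rewrite lenV; lens; lia. Qed.

Lemma conjX (q g : G) n : (q^-1 * g * q) ^+ n = q^-1 * g ^+ n * q.
Proof.
elim: n => [|n IH]; first by rewrite !expg0 mulg1 mulVg.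
by rewrite !expgS IH; gnorm.
Qed.

(** A cyclically reduced element is shortest in its conjugacy class: compare the
    lengths of large powers, which conjugation changes by a bounded amount. *)
Lemma cycred_min c q : cycred c -> (len c <= len (q^-1 * c * q)%g)%R.
Proof.
move=> cc; rewrite leNgt; apply/negP => lt1; set d := q^-1 * c * q in lt1.
pose n := absz (2 * len q + 1)%R.
have e1 : c ^+ n = q^-1^-1 * d ^+ n * q^-1 by rewrite conjX; gnorm.
have := len_conj q^-1 (d ^+ n)%g; rewrite -e1 cycred_pow // lenV.
have := len_pow d n; have := len_ge0 q; move: lt1; rewrite /n; clear; lens => h1 h2 h3 h4; nia.
Qed.

Lemma min_cycred c : (forall q, len c <= len (q^-1 * c * q)%g)%R -> cycred c.
Proof.
move=> min a; apply/negP => /andP[Hc Hv].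
have := min (lt a); rewrite leNgt => /negP; apply.
have e1 : len (c * lt a)%g = (len c - 1)%R by rewrite len_step Hv; lia.
have H2 : H a (c * lt a).
  apply/negPn/negP => nH; have := @H_cross D a a c; rewrite Hc (negPf nH) => /(_ isT) [[_ p]|[e _]].
    by move: Hc; rewrite H1.
  by move/eqP: e; rewrite eq_sym inv_neq.
have := len_step (c * lt a)^-1 a; rewrite invgK H2 lenV e1.
have -> : len ((c * lt a)^-1 * lt a)%g = len ((lt a)^-1 * c * lt a)%g.
  by rewrite -lenV; congr len; gnorm.
lens; lia.
Qed.

Lemma cyc_ex g : exists q, cycred (q^-1 * g * q).
Proof.
have ex : exists n, `[< exists q, len (q^-1 * g * q)%g = Posz n >].
  exists (absz (len g)); apply/asboolP; exists 1; rewrite invg1 mul1g mulg1.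
  by have := len_ge0 g; lia.
case: (ex_minnP ex) => n /asboolP [q e] min; exists q; apply: min_cycred => p.
have -> : p^-1 * (q^-1 * g * q) * p = (q * p)^-1 * g * (q * p) by gnorm.
rewrite e; have := min (absz (len ((q * p)^-1 * g * (q * p))%g)).
have l0 := len_ge0 ((q * p)^-1 * g * (q * p))%g.
move=> /(_ _)/wrap[]; first by apply/asboolP; exists (q * p); lia.
by lia.
Qed.

(** Every letter of a cyclically reduced element is the first letter of one of
    its cyclic permutations. *)
Lemma cycred_rot c b : cycred c -> b \in rw c ->
  exists p, cycred (p^-1 * c * p) /\ H b (p^-1 * c * p).
Proof.
move=> cc /splitPr e; case E : _ / e => [u v]; exists (gw u).
have c' : (gw u)^-1 * c * gw u = gw (b :: v ++ u).
  by rewrite -(rwK c) E gwM mulKg -gwM.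
have sz : len ((gw u)^-1 * c * gw u)%g = len c.
  apply/eqP; rewrite eq_le; apply/andP; split; last exact: cycred_min.
  rewrite c'; apply: le_trans (len_size _) _; rewrite len_rw E.
  by rewrite /= !size_cat /=; lia.
split.
  apply: min_cycred => q; rewrite sz.
  have -> : q^-1 * ((gw u)^-1 * c * gw u) * q = (gw u * q)^-1 * c * (gw u * q) by gnorm.
  exact: cycred_min.
rewrite c'; apply: H_inv; apply: red_of_len; rewrite -c' sz len_rw E /= !size_cat /=.
by lia.
Qed.

Section Skewer.
Variables (c : G) (y : letter D).
Hypotheses (cc : cycred c) (Hc : H y c).

Lemma H_pow n : H y (c ^+ n.+1).
Proof.
rewrite expgS; apply: H_prefix => //.
by rewrite -expgS !cycred_pow //; lia.
Qed.

Lemma H_powV n : ~~ H y (c ^+ n)^-1.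
Proof.
apply/negP => Hv; have [v [e s]] := H_start Hc.
have := len_step (c ^+ n)%g y; rewrite Hv => e1.
have e2 : c ^+ n.+1 = c ^+ n * lt y * gw v by rewrite expgSr {2}e mulgA.
have := lenM (c ^+ n * lt y)%g (gw v); rewrite -e2 e1 !cycred_pow //.
have := len_size v; have : len c = (size v).+1%:Z%R by rewrite len_rw s.
by lia.
Qed.

Lemma lk_pow n : par (lk y.1) (zpow c n) -> n = 0%R.
Proof.
case: n => [[|n]|n] // p; first by have := H_pow n; rewrite H1.
by have := H_pow n; rewrite H1 //; apply/parVE.
Qed.

(** The powers of c run through the translates of its wall in order, so each point has
    a position relative to them. *)
Lemma skewer u : exists m : int, forall n : int,
  ((m <= n)%R -> H y (zpow c n * u)) /\ ((n <= - m)%R -> ~~ H y (zpow c n * u)).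
Proof.
elim/gw_ind: u => [|u b [m mP]].
  exists 1%R => n; rewrite mulg1; split.
    by case: n => [[|n]|n] // _; apply: H_pow.
  by case: n => n // _; apply: H_powV.
pose bad n := H y (zpow c n * u * lt b) != H y (zpow c n * u).
have ub n n' : bad n -> bad n' -> n = n'.
  move=> b1 b2; have key t : par (lk y.1) (zpow c n * t) -> par (lk y.1) (zpow c n' * t) -> n = n'.
    move=> p1 p2; have := parM p1 (parV p2).
    rewrite invgM mulgA mulgK => p3.
    have : par (lk y.1) (zpow c (n - n')%R).
      by rewrite zpowD zpowN.
    by move/lk_pow; lia.
  move: b1 b2 => /H_cross [[e1 p1]|[e1 p1]] /H_cross [[e2 p2]|[e2 p2]].
  - exact: key p1 p2.
  - by move: e2; rewrite e1 => /eqP; rewrite eq_sym inv_neq.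
  - by move: e2; rewrite e1 => /eqP; rewrite inv_neq.
  - by apply: (key (u * lt b)); rewrite mulgA.
have [[n0 bn]|nob] := pselect (exists n, bad n); last first.
  exists m => n; rewrite mulgA; have : ~~ bad n by apply/negP => h; apply: nob; exists n.
  by rewrite /bad negbK => /eqP ->.
exists (`|m| + `|n0| + 1)%R => n; rewrite mulgA; have [h1 h2] := mP n.
have [bd|] := boolP (bad n); first by have := ub _ _ bd bn; lia.
by rewrite /bad negbK => /eqP ->; split=> h; [apply: h1|apply: h2]; lia.
Qed.

Variable g : G.
Hypothesis gc : commute g c.

(** The walls of the translates of [H y] by powers of [g], moved by suitable powers of c,
    all separate two fixed points; there are finitely many of those, so two of them agree. *)
Lemma comm_pow : exists n j, par (lk y.1) (g ^+ n.+1 * zpow c j).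
Proof.
have gz j : commute g (zpow c j) by apply: zpow_commute.
have step i : exists j k, par (lk y.1) (zpow c j * (g ^+ i)^-1 * gw (take k (rw c))) /\ k < (size (rw c)).+1.
  have [m mP] := skewer (g ^+ i)^-1; set u := (g ^+ i)^-1 in mP *.
  have [_ lo] := mP (- `|m|)%R; have [hi _] := mP `|m|%R.
  have ex : exists k : nat, H y (zpow c (- `|m| + k%:Z)%R * u).
    exists (absz (2 * m)%R); rewrite (_ : (_ + _)%R = `|m|%R); last by lia.
    by apply: hi; lia.
  case: (ex_minnP ex) => -[|k] Hk min.
    by move: Hk; rewrite addr0 (negPf (lo _)) //; lia.
  set j := (- `|m| + k%:Z)%R.
  have nH : ~~ H y (zpow c j * u) by apply/negP => /min; rewrite ltnn.
  have Hj : H y (zpow c j * u * c).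
    have uc : commute u c by apply/commute_sym/commuteV/commute_sym/commute_sym/commuteX/commute_sym.
    rewrite -mulgA uc mulgA -zpowS; move: Hk; congr (H y (zpow c _ * u)).
    by rewrite /j; lia.
  exists j; set t := zpow c j * u in nH Hj *.
  have : exists k, H y (t * gw (take k (rw c))) != H y t.
    by exists (size (rw c)); rewrite take_size rwK Hj (negPf nH).
  move=> ex'; case: (ex_minnP ex') => -[|k'] Hk' min'.
    by move: Hk'; rewrite take0 gw0 mulg1 eqxx.
  have k's : k' < size (rw c).
    rewrite ltnNge; apply/negP => le; have := min' k'; rewrite ltnn => /contra; move=> h.
    by move: Hk'; rewrite take_oversize ?(leqW le) // -(take_oversize le); apply/negP/h.
  have nk : H y (t * gw (take k' (rw c))) == H y t.
    by apply/negPn/negP => h; have := min' _ h; rewrite ltnn.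
  move: Hk'; rewrite (take_nth y) // gw_rcons mulgA -(eqP nk) => /H_cross [[_ p]|[_ p]].
    by exists k'; split=> //; apply: leqW.
  by exists k'.+1; rewrite (take_nth y) // gw_rcons mulgA.
pose ii i := projT1 (cid (step i)).
have iP i : exists k, par (lk y.1) (zpow c (ii i) * (g ^+ i)^-1 * gw (take k (rw c))) /\ k < (size (rw c)).+1.
  exact: projT2 (cid (step i)).
pose kk i : 'I_(size (rw c)).+1 := inord (projT1 (cid (iP i))).
have kP i : par (lk y.1) (zpow c (ii i) * (g ^+ i)^-1 * gw (take (kk i) (rw c))).
  by have [p lk'] := projT2 (cid (iP i)); rewrite /kk inordK.
have : ~~ injectiveb (fun i : 'I_(size (rw c)).+2 => kk i).
  by apply/negP => /injectiveP /leq_card; rewrite !card_ord ltnn.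
move=> /injectivePn [i [i' ne e]].
wlog lt1 : i i' ne e / (i < i')%N.
  move=> W; case: (ltngtP i i') => [h|h|/val_inj h]; [exact: (W i i')| |by rewrite h eqxx in ne].
  by apply: (W i' i) => //; rewrite eq_sym.
have := parM (kP i) (parV (kP i')); rewrite e.
set t := gw _; set j := zpow c (ii i); set j' := zpow c (ii i').
have -> : j * (g ^+ i)^-1 * t * (j' * (g ^+ i')^-1 * t)^-1 = j * (g ^+ i)^-1 * g ^+ i' * j'^-1 by gnorm.
have -> : g ^+ i' = g ^+ i * g ^+ (i' - i) by rewrite -expgnDr subnKC // ltnW.
rewrite mulgA mulgVK => p; exists (i' - i).-1, (ii i - ii i')%R.
rewrite prednK ?subn_gt0 // zpowD mulgA.
have -> : g ^+ (i' - i) * zpow c (ii i) = j * g ^+ (i' - i).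
  by apply/commute_sym/commuteX/commute_sym/gz.
by rewrite zpowN.
Qed.

Lemma lk_root n : par (lk y.1) (g ^+ n.+1) -> par (lk y.1) g.
Proof.
move=> gn; have [m mP] := skewer 1; have [m' mP'] := skewer g^-1.
pose M := (`|m| + `|m'|)%R.
have gz j : commute g (zpow c j) by apply: zpow_commute.
have gzV j : g^-1 * zpow c j = zpow c j * g^-1 by apply: commute_sym; apply: commuteV; apply: commute_sym.
have [a1 _] := mP M; have [_ a2] := mP (- M)%R.
have [b1 _] := mP' M; have [_ b2] := mP' (- M)%R.
have o1 : ~~ hs 1 y (zpow c (- M)%R).
  by rewrite /hs invg1 mul1g -[zpow c _]mulg1; apply: a2; rewrite /M; lia.
have o2 : ~~ hs g y (zpow c (- M)%R).
  by rewrite /hs gzV; apply: b2; rewrite /M; lia.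
have s1 : hs 1 y (zpow c M) by rewrite /hs invg1 mul1g -[zpow c _]mulg1; apply: a1; rewrite /M; lia.
have s2 : hs g y (zpow c M) by rewrite /hs gzV; apply: b1; rewrite /M; lia.
have inv h : H y ((g ^+ n.+1)^-1 * h) = H y h by apply: H_lk; apply: parV.
suff eqs h : H y (g^-1 * h) = H y h.
  have := @hs_equal D 1 g y; rewrite mulg1 parVE; apply => h.
  by rewrite /hs invg1 mul1g eqs.
have it k h' : g^-1 ^+ k * (g^-1 * h') = g^-1 ^+ k.+1 * h' by rewrite expgSr mulgA.
have iV k : (g ^+ k)^-1 = g^-1 ^+ k by rewrite expVgn.
have [sub|[sub _]] := hs_nested o1 o2 s1 s2.
  have dn h' : H y (g^-1 * h') -> H y h' by have := sub h'; rewrite /hs invg1 mul1g.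
  have dk k h' : H y (g^-1 ^+ k * h') -> H y h'.
    by elim: k => [|k IH]; rewrite ?expg0 ?mul1g // expgS -mulgA => /dn.
  by apply/idP/idP => [/dn //|Hh]; apply: (dk n); rewrite it -iV inv.
have up h' : H y h' -> H y (g^-1 * h') by have := sub h'; rewrite /hs invg1 mul1g.
have uk k h' : H y h' -> H y (g^-1 ^+ k * h').
  by elim: k => [|k IH] Hh; rewrite ?expg0 ?mul1g // expgS -mulgA; apply/up/IH.
by apply/idP/idP => [Hh|/up //]; have := uk n _ Hh; rewrite it -iV inv.
Qed.

(** By the previous lemmas a power of g times a power of c fixes the wall; the exponent
    sum at y forces the power of c to be trivial. *)
Lemma comm_lk : ab y.1 c != 0%R -> ab y.1 g = 0%R -> par (lk y.1) g.
Proof.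
move=> c0 g0; have [n [j p]] := comm_pow; apply: (@lk_root n).
have := @ab_par D y.1 _ _ p; rewrite lk_irr => /(_ isT); rewrite abM abX ab_zpow g0 mulr0 add0r.
by move=> /eqP; rewrite mulf_eq0 (negPf c0) orbF => /eqP j0; move: p; rewrite j0 zpow0 mulg1.
Qed.

End Skewer.
End Cyclic.

(** * Integer linear algebra *)

Section LinAlg.
Variable D : finType.
Implicit Types (P Q : pred D) (M : D -> D -> int).
Local Open Scope ring_scope.

Lemma enum_rank_sum (V : nmodType) P (F : D -> V) :
  \sum_(t | P t) F t = \sum_(i < #|P|) F (enum_val i).
Proof.
have -> : \sum_(t | P t) F t = \sum_(t in P) F t by [].
exact: big_enum_val.
Qed.

(** An injective linear map cannot lower the dimension, and one between spaces of the same
    dimension hits a multiple of every basis vector. *)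
Lemma inj_rank P Q M (y0 : D) :
  (forall n : D -> int, (forall v, Q v -> \sum_(t | P t) n t * M v t = 0) ->
     forall t, P t -> n t = 0) ->
  (#|P| <= #|Q|)%N /\ (#|P| = #|Q| -> forall z, Q z -> exists n : D -> int, exists2 d : int,
     d != 0 & forall v, Q v -> \sum_(t | P t) n t * M v t = if v == z then d else 0).
Proof.
move=> inj.
pose q (j : nat) := nth y0 (enum Q) j.
pose A : 'M[int]_#|P| := \matrix_(i, j) (if (j < #|Q|)%N then M (q j) (enum_val i) else 0).
pose n_of (u : 'I_#|P| -> int) (t : D) := \sum_(i < #|P|) (if enum_val i == t then u i else 0).
have n_ofE u i : n_of u (enum_val i) = u i.
  rewrite /n_of (bigD1 i) //= eqxx big1 ?addr0 // => j ne; case: eqP => // /enum_val_inj e.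
  by rewrite e eqxx in ne.
have sumE u v : \sum_(t | P t) n_of u t * M v t = \sum_(i < #|P|) u i * M v (enum_val i).
  by rewrite enum_rank_sum; apply: eq_bigr => i _; rewrite n_ofE.
have qP v : Q v -> exists2 j : nat, (j < #|Q|)%N & q j = v.
  by move=> Qv; exists (index v (enum Q)); rewrite ?cardE ?index_mem ?mem_enum // /q nth_index ?mem_enum.
have detnz : (#|Q| <= #|P|)%N -> \det A != 0.
  move=> le; apply/negP => /det0P [u unz uA].
  case/eqP: unz; apply/rowP => i; rewrite mxE.
  rewrite -(n_ofE (fun i => u 0 i)); apply: inj; last exact: enum_valP.
  move=> v /qP [j lj <-]; rewrite sumE; have jP : (j < #|P|)%N by apply: leq_trans le.
  transitivity ((u *m A) 0 (Ordinal jP)); last by rewrite uA mxE.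
  by rewrite mxE; apply: eq_bigr => k _; rewrite mxE /= lj.
split.
  rewrite leqNgt; apply/negP => lt1; have := detnz (ltnW lt1); case/eqP.
  rewrite (expand_det_col _ (Ordinal lt1)) big1 // => i _.
  by rewrite mxE /= ltnn mul0r.
move=> e z Qz; have dn := detnz (eq_leq (esym e)).
have [j0 lj0 qj0] := qP z Qz; have j0P : (j0 < #|P|)%N by rewrite e.
exists (n_of (fun i => (\adj A) (Ordinal j0P) i)), (\det A) => // v /qP [j lj <-].
rewrite sumE; have jP : (j < #|P|)%N by rewrite e.
have := congr1 (fun X : 'M_(_, _) => X (Ordinal j0P) (Ordinal jP)) (mul_adj_mx A).
rewrite !mxE => h; transitivity (\det A *+ (Ordinal j0P == Ordinal jP)).
  rewrite -h; apply: eq_bigr => k _; by rewrite !mxE /= lj.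
rewrite -qj0 -val_eqE /= /q nth_uniq ?enum_uniq -?cardE // eq_sym.
by case: (j == j0).
Qed.

Lemma inv_comm P (f B : D -> D -> int) :
  (forall x y, P x -> P y -> \sum_(t | P t) B x t * f t y = (x == y)%:R) ->
  forall x y, P x -> P y -> \sum_(t | P t) f x t * B t y = (x == y)%:R.
Proof.
move=> Bf x y Px Py.
pose F : 'M[int]_#|P| := \matrix_(i, j) f (enum_val i) (enum_val j).
pose C : 'M[int]_#|P| := \matrix_(i, j) B (enum_val i) (enum_val j).
have /mulmx1C FC : C *m F = 1%:M.
  apply/matrixP => i j; rewrite !mxE; have := Bf _ _ (enum_valP i) (enum_valP j).
  rewrite enum_rank_sum (inj_eq enum_val_inj) => <-.
  by apply: eq_bigr => k _; rewrite !mxE.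
have Px' : x \in P by []. have Py' : y \in P by [].
have := congr1 (fun X : 'M_(_, _) => X (enum_rank_in Px' x) (enum_rank_in Px' y)) FC.
rewrite !mxE -(inj_eq enum_val_inj) !enum_rankK_in // => <-.
rewrite enum_rank_sum; apply: eq_bigr => k _.
by rewrite !mxE !enum_rankK_in.
Qed.

(** A matrix with a one-sided inverse has nonzero determinant, so some term of the
    Leibniz formula does not vanish. *)
Lemma transversal (A B : D -> D -> int) :
  (forall x y, \sum_t B x t * A t y = (x == y)%:R) ->
  exists s : D -> D, injective s /\ forall x, A (s x) x != 0.
Proof.
move=> BA.
pose F : 'M[int]_#|D| := \matrix_(i, j) A (enum_val j) (enum_val i).
pose C : 'M[int]_#|D| := \matrix_(i, j) B (enum_val j) (enum_val i).
have FC : F *m C = 1%:M.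
  apply/matrixP => i j; rewrite !mxE; have := BA (enum_val j) (enum_val i).
  rewrite (eq_bigl (fun t => t \in D)) // big_enum_val (inj_eq enum_val_inj) eq_sym => <-.
  by apply: eq_bigr => k _; rewrite !mxE mulrC.
have : \det F != 0.
  by apply/eqP => d0; have := det_mulmx F C; rewrite FC det1 d0 mul0r => /eqP; rewrite oner_eq0.
rewrite /determinant => nz.
have [s sP] : exists s : 'S_#|D|, \prod_i F i (s i) != 0.
  apply: contrapT => no; case/eqP: nz; rewrite big1 // => s _.
  have [->|h] := eqVneq (\prod_i F i (s i)) 0; first by rewrite mulr0.
  by case: no; exists s.
exists (fun x => enum_val (s (enum_rank x))); split.
  by move=> x y /enum_val_inj /perm_inj /enum_rank_inj.
move=> x; move/prodf_neq0: sP => /(_ (enum_rank x) isT); by rewrite mxE enum_rankK.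
Qed.

Lemma gcd_comb P (a : D -> int) (x : D) : P x -> a x != 0 ->
  exists d : int, [/\ 0 < d, forall t, P t -> (d %| a t)%Z &
    exists n : D -> int, \sum_(t | P t) n t * a t = d].
Proof.
move=> Px ax.
pose val (m : nat) := `[< exists n : D -> int, \sum_(t | P t) n t * a t = m.+1%:Z >].
have ex : exists m, val m.
  exists (`|a x|.-1)%N; apply/asboolP; exists (fun t => if t == x then sgz (a x) else 0).
  rewrite (bigD1 x) //= eqxx big1 ?addr0 => [|t /andP[_ /negPf ->]]; last by rewrite mul0r.
  by rewrite mulrC; case: (a x) ax => -[|k] // _; rewrite /= ?mulr1 // NegzE; lia.
case: (ex_minnP ex) => m /asboolP [n nE] min; exists m.+1%:Z; split=> //; last by exists n.
move=> t Pt; rewrite /dvdz_mod0P; apply/dvdz_mod0P.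
have := modz_ge0 (a t) (ltac:(by []) : m.+1%:Z != 0).
have := ltz_pmod (a t) (ltac:(by []) : 0 < m.+1%:Z).
case E : (_ %% _)%Z => [[|k]|k] // lt1 _; exfalso.
have : (m <= k)%N; last by move: lt1; lia.
apply: min; apply/asboolP.
exists (fun s => (if s == t then 1 else 0) - (a t %/ m.+1%:Z)%Z * n s).
under eq_bigr => s _ do rewrite mulrBl -mulrA.
rewrite sumrB -mulr_sumr nE (bigD1 t) //= eqxx mul1r big1 ?addr0 => [|s /andP[_ /negPf ->]]; last by rewrite mul0r.
by rewrite -E {1}(divz_eq (a t) m.+1%:Z); lia.
Qed.

End LinAlg.

Section Transport.
Variable G : groupType.
Local Open Scope group_scope.

Lemma isum_transport (K L : G -> Prop) (phi psi : G -> G) (F : G -> int) :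
  subg K -> subg L -> (forall g, phi (psi g) = g) ->
  (forall g h, keq K g h <-> keq L (phi g) (phi h)) -> kinv L F -> kfin L F ->
  kfin K (fun g => F (phi g)) /\ isum K (fun g => F (phi g)) = isum L F.
Proof.
move=> sK sL pK eK iF [t tP].
have fK : kfin K (fun g => F (phi g)).
  exists (map psi t) => g /tP [u ut ug]; exists (psi u); first exact: map_f.
  by apply/eK; rewrite pK.
split=> //; apply/esym/(isum_param sL (phi := phi)) => //.
- exact: kfin_fsup.
- by move=> g; case: (rep K g =P g); rewrite ?eqxx.
- move=> g h; case: (rep K g =P g) => [eg|]; rewrite ?eqxx //.
  case: (rep K h =P h) => [eh|]; rewrite ?eqxx // => _ _ /eK gh.
  by rewrite -eg -eh; apply: rep_eq.
- move=> g Fg; have kg : keq L g (phi (rep K (psi g))).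
    by rewrite -{1}(pK g); apply/(eK (psi g)); apply: rep_keq.
  exists (rep K (psi g)); last exact: keq_sym.
  by rewrite rep_idem // eqxx -?(keqP iF kg) ?(keqP iF kg).
Qed.

End Transport.

(** * Automorphisms do not shorten what class automorphisms do not shorten *)

Section Rows.
Variable D : sgraph.
Implicit Types (a b : letter D) (x y z : D).
Local Notation G := (raag (@edge D)).
Local Open Scope group_scope.

Definition classmin (W : seq G) := forall z f B,
  (forall x, cls z x -> functional z (f x)) -> rinv z f B -> linv z f B ->
  (\sum_(w <- W) len w <= \sum_(w <- W) len (bet z f w))%R.

Lemma sdl_gen x y : sdl (x, false) (y, false) = (x == y)%:R%R.
Proof. by rewrite -ab_lt ab_gen eq_sym; case: (x == y). Qed.

(** A family prescribed on part of a class, unimodular there, is completed by coordinate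
    functionals on the rest, whose contributions cancel. *)
Lemma rows_min W z (X : pred D) (f : D -> letter D -> int) (L : D -> D -> int) :
  classmin W -> subpred X (cls z) -> (forall x, X x -> functional z (f x)) ->
  (forall x y, X x -> X y -> (\sum_(t | X t) L x t * f t (y, false))%R = (x == y)%:R%R) ->
  (\sum_(w <- W) \sum_(x | X x) ell (x, false) w <= \sum_(w <- W) \sum_(x | X x) N z (f x) w)%R.
Proof.
move=> cm XC ff Lf.
pose f' x := if X x then f x else sdl (x, false).
pose B x t : int := if X x then (if X t then L x t else - \sum_(s | X s) L x s * f s (t, false))%R
                    else (x == t)%:R%R.
have ff' x : cls z x -> functional z (f' x).
  by move=> cx; rewrite /f'; case: ifP => [/ff //|_]; apply: sdl_cls.
have split_cls (E : D -> int) : (\sum_(t | cls z t) E t = \sum_(t | X t) E t + \sum_(t | cls z t && ~~ X t) E t)%R.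
  rewrite (bigID X) /=; congr (_ + _)%R; apply: eq_bigl => t.
  by have [/XC ->|] := boolP (X t); rewrite ?andbF.
have lB : linv z f' B.
  move=> x y cx cy; rewrite split_cls /B; have [Xx|nXx] := boolP (X x); last first.
    rewrite (eq_bigr (fun t => if t == x then f' t (y, false) else 0)%R) => [|t _]; last first.
      by rewrite eq_sym; case: eqP => _; rewrite ?mul1r ?mul0r.
    rewrite [X in (_ + X)%R](eq_bigr (fun t => if t == x then f' t (y, false) else 0)%R) => [|t _]; last first.
      by rewrite eq_sym; case: eqP => _; rewrite ?mul1r ?mul0r.
    rewrite -split_cls -big_mkcondr /= (big_pred1 x) => [|t].
      by rewrite /f' (negPf nXx) sdl_gen.
    by rewrite inE andbC; case: eqP => // ->.
  rewrite (eq_bigr (fun t => L x t * f t (y, false))%R) => [|t Xt]; last by rewrite /f' Xt.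
  rewrite [X in (_ + X)%R](eq_bigr (fun t => if t == y then - \sum_(s | X s) L x s * f s (t, false) else 0)%R) => [|t /andP[_ nXt]]; last first.
    by rewrite /f' (negPf nXt) sdl_gen; case: eqP => _; rewrite ?mulr1 ?mulr0.
  rewrite -big_mkcondr /=; have [Xy|nXy] := boolP (X y).
    rewrite [X in (_ + X)%R]big_pred0 ?addr0 ?Lf // => t; rewrite andbC.
    by case: eqP => // ->; rewrite Xy andbF.
  rewrite [X in (_ + X)%R](big_pred1 y) => [|t]; last by rewrite inE andbC; case: eqP => // ->; rewrite cy nXy.
  rewrite subrr; case: eqP => // e; by rewrite e (negPf nXy) in Xx.
have rB : rinv z f' B by apply: (@inv_comm D (cls z) (fun x y => f' x (y, false)) B).
have := cm z f' B ff' rB lB.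
have lenE w : len w = (\sum_(x | ~~ cls z x) ell (x, false) w + \sum_(x | cls z x) ell (x, false) w)%R.
  by rewrite /len (bigID (cls z)) addrC.
have E w : (len (bet z f' w) - len w = \sum_(x | X x) N z (f x) w - \sum_(x | X x) ell (x, false) w)%R.
  rewrite (len_bet ff' rB lB) lenE !split_cls.
  rewrite [X in (_ + (X + _) - _)%R](eq_bigr (fun x => N z (f x) w)) => [|x Xx]; last by rewrite /f' Xx.
  rewrite [X in (_ + (_ + X) - _)%R](eq_bigr (fun x => ell (x, false) w)) => [|x /andP[cx nXx]]; last first.
    by rewrite /f' (negPf nXx) (ell_cls w cx).
  set s1 := (\sum_(x | ~~ cls z x) _)%R; set s2 := (\sum_(x | X x) N _ _ _)%R; set s3 := (\sum_(x | X x) _)%R; set s4 := (\sum_(x | cls z x && ~~ X x) _)%R; lia.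
rewrite -subr_ge0 -sumrB (eq_bigr (fun w => \sum_(x | X x) N z (f x) w - \sum_(x | X x) ell (x, false) w)%R) => [|w _]; last exact: E.
by rewrite sumrB subr_ge0.
Qed.

Lemma classmin_locmin W : classmin W -> locmin W.
Proof.
move=> cm; have key x f : functional x f -> (forall b, st x b.1 -> f b = sdl (x, false) b) ->
    (\sum_(w <- W) N x (sdl (x, false)) w <= \sum_(w <- W) N x f w)%R.
  move=> ff fe.
  have XC : subpred (pred1 x) (cls x) by move=> y /eqP ->; apply: cls_z.
  have h1 y : pred1 x y -> functional x f by [].
  have h2 y t : pred1 x y -> pred1 x t -> (\sum_(u | pred1 x u) 1 * f (t, false) = (y == t)%:R)%R.
    by move=> /eqP -> /eqP ->; rewrite big_pred1_eq mul1r fe ?sdl_gen //; exact: st_refl.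
  have := @rows_min W x (pred1 x) (fun=> f) (fun _ _ => 1%R) cm XC h1 h2.
  rewrite (eq_bigr (fun w => N x (sdl (x, false)) w)) => [|w _]; last first.
    by rewrite big_pred1_eq; apply: ell_cls; apply: cls_z.
  by rewrite [X in (_ <= X)%R](eq_bigr (fun w => N x f w)) // => w _; rewrite big_pred1_eq.
move=> [x s] f ff fe; case: s ff fe => ff fe; last exact: key.
have := key x (fun a => - f a)%R; rewrite (eq_bigr (fun w => N x (sdl (x, true)) w)) => [|w _]; last first.
  by rewrite -N_opp; congr N; apply/funext => b; rewrite -[(x, false)]/(inv (x, true)) sdl_inv opprK.
rewrite [X in _ -> _ -> (_ <= X)%R](eq_bigr (fun w => N x f w)) => [|w _]; last by rewrite N_opp.
apply; last by move=> b sb; rewrite fe // -[(x, true)]/(inv (x, false)) sdl_inv opprK.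
case: ff => f1 f2 f3; split.
- by move=> b sb; rewrite f1.
- by move=> b b' h1 h2 h3; rewrite (f2 b b').
- by move=> b b' h1 h2 h3; rewrite (f3 b b').
Qed.

End Rows.

Section LG.
Variable D : sgraph.
Implicit Types (a b : letter D) (x y z t v : D).
Local Notation G := (raag (@edge D)).
Local Notation gw := (raag_of_word (@edge D)).
Local Notation F z := (par (st z)).
Local Open Scope group_scope.

Definition gen x : G := lt (x, false).

Definition pw (P : pred D) (n : D -> int) : G :=
  \big[*%g/1]_(t <- enum P) zpow (gen t) (n t).

Lemma pw_par P n : par P (pw P n).
Proof.
rewrite /pw; have : all P (enum P) by apply/allP => t; rewrite mem_enum.
elim: (enum P) => [|t s IH] /=; first by rewrite big_nil; move=> _; apply: par1.
by case/andP=> Pt /IH h; rewrite big_cons; apply: parM => //; apply/par_zpow/par_lt.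
Qed.

Lemma hom_pw P n (al : G -> G) v : ishom al ->
  ab v (al (pw P n)) = (\sum_(t | P t) n t * ab v (al (gen t)))%R.
Proof.
move=> aM; rewrite -big_enum /= /pw; elim: (enum P) => [|t s IH].
  by rewrite !big_nil (hom1 aM) ab1.
by rewrite !big_cons aM abM IH (zpow_hom _ _ aM) ab_zpow.
Qed.

Lemma ab_pw P n v : ab v (pw P n) = (if P v then n v else 0)%R.
Proof.
rewrite (@hom_pw P n id) // (eq_bigr (fun t => if t == v then n t else 0)%R) => [|t _]; last first.
  by rewrite /gen ab_gen; case: eqP => _; rewrite ?mulr1 ?mulr0.
rewrite -big_mkcondr /=; case: ifP => Pv.
  by rewrite (big_pred1 v) // => t; rewrite inE andbC; case: eqP => // ->.
by rewrite big_pred0 // => t; rewrite andbC; case: eqP => // ->.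
Qed.

Lemma hom_ab (al : G -> G) v g : ishom al ->
  ab v (al g) = (\sum_t ab t g * ab v (al (gen t)))%R.
Proof.
move=> aM; elim/gw_ind: g => [|g [t s] IH].
  by rewrite (hom1 aM) ab1 big1 // => t _; rewrite ab1 mul0r.
rewrite aM abM IH.
under [in RHS]eq_bigr => u _ do rewrite abM mulrDl.
rewrite big_split /=; congr (_ + _)%R.
rewrite (bigD1 t) //= big1 => [|u nu]; last first.
  by rewrite ab_lt sdl_out ?mul0r //= eq_sym.
rewrite addr0; case: s; last by rewrite -/(gen t) ab_gen eqxx mul1r.
by rewrite -[(t, true)]/(inv (t, false)) ltV (homV _ aM) !abV ab_gen eqxx mulN1r.
Qed.

Lemma cent_st h a : commute h (lt a) -> F a.1 h.
Proof.
move=> hc; apply: contrapT => nF.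
have h1 := Lam_sameM (sdl_fun1 a) nF (par_lt_st a).
have := levM (lt a * h)%g (par_lt_st a).
have := levM h (par_lt_st a); rewrite -hc /lev h1 => e _; move: e.
by rewrite -/(lev a (lt a)) lev_lt1 /sdl eqxx; lia.
Qed.

Lemma st_cent h a : F a.1 h -> commute h (lt a).
Proof. by apply: par_com => b sb; apply/commute_sym/commute_st. Qed.

Variables (al be : G -> G).
Hypotheses (aM : ishom al) (bM : ishom be) (abK : cancel al be) (baK : cancel be al).

(** The matrix of al on the abelianization. *)
Definition mat y x := ab y (al (gen x)).

Section Pair.
Variables (x y : D).
Hypothesis Ayx : mat y x != 0%R.

Lemma pos_ex : exists q b, [/\ b.1 = y, cycred (q^-1 * al (gen x) * q) &
  H b (q^-1 * al (gen x) * q)].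
Proof.
have [q cq] := cyc_ex (al (gen x)); set c := q^-1 * _ * q in cq.
have : ab y (gw (rw c)) != 0%R by rewrite rwK abJ.
move=> /ab_neq0 [b bc bv]; have [p [cp Hp]] := cycred_rot cq bc.
have e : p^-1 * c * p = (q * p)^-1 * al (gen x) * (q * p) by rewrite /c; gnorm.
by exists (q * p), b; rewrite -e.
Qed.

Variables (q : G) (b : letter D).
Hypotheses (by_ : b.1 = y) (cc : cycred (q^-1 * al (gen x) * q))
  (Hc : H b (q^-1 * al (gen x) * q)).
Let c := q^-1 * al (gen x) * q.
Let ga g := q^-1 * al g * q.

Let gaM : ishom ga.
Proof. by move=> g h; rewrite /ga aM; gnorm. Qed.
Let ga_ab v g : ab v (ga g) = ab v (al g). Proof. exact: abJ. Qed.
Let gi g := be (q * g * q^-1).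
Let gaK g : ga (gi g) = g. Proof. by rewrite /ga /gi baK; gnorm. Qed.
Let giK g : gi (ga g) = g.
Proof. by rewrite /ga /gi (_ : q * _ * q^-1 = al g) ?abK //; gnorm. Qed.
Let cE : c = ga (gen x). Proof. by []. Qed.
Let abc v : ab v c = mat v x. Proof. exact: abJ. Qed.

Lemma F_comm h : F x h -> commute (ga h) c.
Proof.
move=> Fh; have := @st_cent h (x, false) Fh.
by rewrite /commute cE -!gaM => ->.
Qed.

Lemma ker_lk h : F x h -> ab y (al h) = 0%R -> par (lk y) (ga h).
Proof.
move=> Fh h0; rewrite -by_; apply: (comm_lk cc Hc) => //.
- exact: F_comm.
- by rewrite -/c by_ abc.
- by rewrite by_ ga_ab.
Qed.

Let injL n : (forall v, st y v -> (\sum_(t | st x t) n t * mat v t)%R = 0%R) ->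
  forall t, st x t -> n t = 0%R.
Proof.
move=> n0; pose h := pw (st x) n; have Fh : F x h by apply: pw_par.
have hE v : ab v (al h) = (\sum_(t | st x t) n t * mat v t)%R by apply: hom_pw.
have lkh : par (lk y) (ga h) by apply: ker_lk => //; rewrite hE n0 //; apply: st_refl.
have h0 v : ab v (al h) = 0%R.
  have [lv|nlv] := boolP (lk y v); first by rewrite hE n0 //; apply: lk_st.
  by rewrite -ga_ab (ab_par lkh).
move=> t st_t; have : ab t h = 0%R.
  by rewrite -(abK h) (hom_ab _ _ bM) big1 // => v _; rewrite h0 mul0r.
by rewrite ab_pw st_t.
Qed.

(** Where the matrix does not vanish, the columns in the star of x are linearly independent
    already on the rows in the star of y: the centralizer of x maps into that of c, where an element
    without exponent at y lies in the group of the link of y. *)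
Lemma tri_le : #|st x| <= #|st y|.
Proof. by have [] := inj_rank x injL. Qed.

Section Equal.
Hypothesis eqs : #|st x| = #|st y|.

Let unitv z : st y z -> z != y -> exists h, exists2 d : int, d != 0%R & [/\ F x h, par (lk y) (ga h) &
  forall v, ab v (ga h) = (if v == z then d else 0)%R].
Proof.
move=> sz nzy; have [_ /(_ eqs z sz) [n [d dn nE]]] := inj_rank x injL.
pose h := pw (st x) n; have Fh : F x h by apply: pw_par.
have hE v : st y v -> ab v (al h) = (if v == z then d else 0)%R.
  by move=> sv; rewrite -nE //; apply: hom_pw.
have lkh : par (lk y) (ga h).
  by apply: ker_lk => //; rewrite hE ?st_refl // eq_sym (negPf nzy).
exists h, d => //; split=> // v.
have [sv|nsv] := boolP (st y v); first by rewrite ga_ab hE.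
rewrite (ab_par lkh); last by apply: contra nsv; apply: lk_st.
by case: eqP => // e; rewrite e sz in nsv.
Qed.

(** Equality of the sizes of the stars makes the previous comparison of dimensions
    sharp, and the centralizer of c then contains the whole link of y. *)
Lemma supp_st b' z : b' \in rw c -> lk y z -> st z b'.1.
Proof.
move=> bc lz; apply/negPn/negP => nst.
have nzy : z != y by apply: contraTneq lz => ->; rewrite lk_irr.
have [h [d dn [Fh lkh hE]]] := unitv (lk_st lz) nzy.
have [p [cp Hp]] := cycred_rot cc bc; set c' := p^-1 * _ * p in cp Hp.
have com g : commute (ga g) c -> commute (p^-1 * ga g * p) c'.
  rewrite /commute => gc; rewrite /c' -/c.
  have -> : p^-1 * ga g * p * (p^-1 * c * p) = p^-1 * (ga g * c) * p by gnorm.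
  by rewrite gc; gnorm.
set y' := b'.1 in nst *.
have nz' : ~~ lk y' z by apply: contra nst => l; apply: lk_st; rewrite lk_sym.
have abc' v : ab v c' = mat v x by rewrite abJ abc.
have [n [j pn]] := comm_pow cp Hp (com h (F_comm Fh)).
have eqn v : ~~ lk y' v -> (n.+1%:Z * ab v (ga h) + j * mat v x = 0)%R.
  by move=> nl; have := ab_par pn nl; rewrite abM abX ab_zpow abJ abc'.
have jn : j != 0%R.
  by apply/eqP => j0; have := eqn z nz'; rewrite hE eqxx j0; lia.
have [ly|nly] := boolP (lk y' y); last first.
  have := eqn y nly; rewrite hE eq_sym (negPf nzy) mulr0 add0r => /eqP.
  by rewrite mulf_eq0 (negPf jn) (negPf Ayx).
have ny'z : y' != z by apply: contraNneq nst => ->; apply: st_refl.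
have m0 : mat y' x = 0%R.
  have := eqn y'; rewrite lk_irr hE (negPf ny'z) mulr0 add0r => /(_ isT) /eqP.
  by rewrite mulf_eq0 (negPf jn) => /eqP.
have ly' : lk y y' by rewrite lk_sym.
have nyy' : y' != y by apply: contraTneq ly' => ->; rewrite lk_irr.
have [h2 [d2 dn2 [Fh2 _ hE2]]] := unitv (lk_st ly') nyy'.
have [n2 [j2 pn2]] := comm_pow cp Hp (com h2 (F_comm Fh2)).
have := @ab_par D y' _ _ pn2; rewrite lk_irr => /(_ isT).
by rewrite abM abX ab_zpow abJ abc' m0 hE2 eqxx; lia.
Qed.

Let lk_comm z : lk y z -> commute (gen z) c.
Proof.
move=> lz; rewrite -(rwK c); have : {subset rw c <= rw c} by [].
elim: {1 3}(rw c) => [|a w IH] sub; first by rewrite gw0; apply: commute1.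
rewrite gw_cons; apply: commuteM; last by apply: IH => d dw; apply: sub; rewrite inE dw orbT.
apply: commute_st; rewrite /=; apply: supp_st => //; apply: sub; exact: mem_head.
Qed.

(** So the kernel of the exponent sum of y on the centralizer of x corresponds exactly to the
    link group of y, and walls labelled y pull back to cuts of the kind treated by [cut_min]. *)
Lemma lk_ker k : par (lk y) k -> F x (gi k) /\ ab y (al (gi k)) = 0%R.
Proof.
move=> lk_k; split; last by rewrite -ga_ab gaK (ab_par lk_k) // lk_irr.
have kc : commute k c.
  elim/par_ind_r: k / lk_k => [|g [z s] IH lz]; first exact/commute_sym/commute1.
  have zc : commute (lt (z, s)) c.
    move: lz => /= lz; case: s; last exact: lk_comm.
    by rewrite -[(z, true)]/(inv (z, false)) ltV; apply/commute_sym/commuteV/commute_sym/lk_comm.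
  by apply/commute_sym/commuteM; apply/commute_sym.
apply: (@cent_st _ (x, false)); rewrite -/(gen x) -[gen x]giK /commute -/(ga _) -cE.
have giM g h : gi g * gi h = gi (g * h) by rewrite /gi -bM; congr be; gnorm.
by rewrite !giM kc.
Qed.

(** The functional is the row y of the matrix on the star of x, divided by the greatest
    common divisor d of its entries. *)
Lemma cut_pair W : locmin W -> exists f d, [/\ d != 0%R, functional x f,
  (forall t, st x t -> mat y t = (d * f (t, false))%R),
  (exists n : D -> int, (\sum_(t | st x t) n t * f (t, false))%R = 1%R) &
  (\sum_(w <- W) N x f w <= \sum_(w <- W) ell (y, false) (al w))%R].
Proof.
move=> lm; have [g [g0 gdiv [n nE]]] := gcd_comb (st_refl x) Ayx.
pose d := (if 0 < mat y x then g else - g)%R.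
have dn : d != 0%R by rewrite /d; case: ifP; lia.
have ddiv t : st x t -> (d %| mat y t)%Z.
  by move=> st_t; rewrite /d; case: ifP => _; rewrite ?(dvdzE (- g)%R) ?abszN -?dvdzE; apply: gdiv.
have dF h : F x h -> (d %| ab y (al h))%Z.
  elim/par_ind_r => [|h' [t s] IH st_t]; first by rewrite (hom1 aM) ab1 dvdz0.
  move: st_t => /= st_t; rewrite aM abM; apply: rpredD => //; case: s; last exact: ddiv.
  by rewrite -[(t, true)]/(inv (t, false)) ltV (homV _ aM) abV rpredN; apply: ddiv.
pose psi h := (ab y (al h) %/ d)%Z.
have psiE h : F x h -> ab y (al h) = (d * psi h)%R by move=> /dF/divzK; rewrite /psi mulrC.
have psiM h h' : F x h -> F x h' -> psi (h * h') = (psi h + psi h')%R.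
  move=> Fh Fh'; apply: (mulfI dn); rewrite mulrDr -!psiE //; last exact: parM.
  by rewrite aM abM.
have psix : (0 < psi (gen x))%R.
  have Fx : F x (gen x) by exact: (par_lt_st (x, false)).
  have := psiE _ Fx; rewrite -/(mat y x) /d; have := Ayx; case: ltrP => h1 h2; nia.
pose t0 := pw (st x) (fun t => if (0 < mat y x)%R then n t else (- n t)%R).
have Ft0 : F x t0 by apply: pw_par.
have psit0 : psi t0 = 1%R.
  apply: (mulfI dn); rewrite -psiE // mulr1 /t0 (hom_pw _ _ _ aM) -/mat /d.
  case: ifP => _; first exact: nE.
  by rewrite -nE -sumrN; apply: eq_bigr => t _; rewrite mulNr.
have kerE k : psiker x psi k <-> par (lk y) (ga k).
  split=> [[Fk pk]|lk_k]; first by apply: ker_lk => //; rewrite psiE // pk mulr0.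
  have [] := lk_ker lk_k; rewrite giK => Fk e; split=> //.
  by rewrite /psi e div0z.
pose e0 g := H b (q^-1 * al g).
have lkE k : par (lk y) k <-> par (lk b.1) k by rewrite by_.
have ke0 : kinv (psiker x psi) e0.
  move=> k h /kerE/lkE lk_k; rewrite /e0 aM; have -> : q^-1 * (al k * al h) = ga k * (q^-1 * al h) by rewrite /ga; gnorm.
  by rewrite H_lk.
have sK : subg (psiker x psi).
  split; first by apply/kerE; rewrite (hom1 gaM); apply: par1.
    by move=> g1 g2 /kerE l1 /kerE l2; apply/kerE; rewrite gaM; apply: parM.
  by move=> g1 /kerE l1; apply/kerE; rewrite (homV _ gaM); apply: parV.
pose phi g := q^-1 * al g.
have trans w : kfin (psiker x psi) (fun g => `|Posz (e0 (g * w)%g) - Posz (e0 g)|%R) /\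
     isum (psiker x psi) (fun g => `|Posz (e0 (g * w)%g) - Posz (e0 g)|%R) = ell b (al w).
  have E u : `|Posz (e0 (u * w)%g) - Posz (e0 u)|%R = `|Posz (H b (phi u * al w)%g) - Posz (H b (phi u))|%R.
    by rewrite /e0 /phi aM mulgA.
  rewrite (_ : (fun g => _) = fun g => `|Posz (H b (phi g * al w)%g) - Posz (H b (phi g))|%R); last exact/funext.
  apply: (@isum_transport _ (psiker x psi) (par (lk b.1)) phi (fun g => be (q * g)) _ sK (par_subg _)).
  - by move=> g1; rewrite /phi baK mulKg.
  - move=> g1 g2; rewrite /keq -lkE -[X in _ <-> par _ X]/(phi g2 * (phi g1)^-1).
    rewrite (_ : phi g2 * (phi g1)^-1 = ga (g2 * g1^-1)); first exact: kerE.
    by rewrite /phi /ga aM (homV _ aM); gnorm.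
  - by apply: (kinv_n (@H_quasi D b)).
  - by apply: (vfin_n (@H_vfin D b)).
have cutE' w : cut (psiker x psi) e0 w = ell b (al w) by have [_] := trans w.
have fe0 : cfin (psiker x psi) e0.
  move=> a; have [f _] := trans (lt a); apply: kfin_sub f => g1; by rewrite normr_eq0.
pose p := psi (gen x).
have skew (P : nat) : exists M : int, forall r : nat, (r < P)%N -> forall m : int,
    ((M <= m)%R -> H b (zpow c m * (ga (zpow t0 r) * q^-1))) /\
    ((m <= - M)%R -> ~~ H b (zpow c m * (ga (zpow t0 r) * q^-1))).
  elim: P => [|P [M MP]]; first by exists 0%R.
  have [m mP] := skewer cc Hc (ga (zpow t0 P) * q^-1); exists (`|M| + `|m|)%R => r.
  rewrite ltnS leq_eqVlt => /orP[/eqP -> k|/MP rP k].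
    by have [h1 h2] := mP k; split=> h; [apply: h1|apply: h2]; lia.
  by have [h1 h2] := rP k; split=> h; [apply: h1|apply: h2]; lia.
have [M MP] := skew (absz p).
have e0E h : F x h -> exists2 r : nat, (r < absz p)%N &
    e0 h = H b (zpow c (psi h %/ p)%Z * (ga (zpow t0 r) * q^-1)).
  move=> Fh; exists (absz (psi h %% p)%Z).
    by have := ltz_pmod (psi h) psix; have := modz_ge0 (psi h) (lt0r_neq0 psix); rewrite -/p; lia.
  set m := (psi h %/ p)%Z; set r := Posz _.
  have Fx : F x (gen x) by exact: (par_lt_st (x, false)).
  have Fm : F x (zpow (gen x) m) by apply: par_zpow.
  have Fr : F x (zpow t0 r) by apply: par_zpow.
  have pz g1 j : F x g1 -> psi (zpow g1 j) = (j * psi g1)%R.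
    move=> F1; apply: (mulfI dn); rewrite -psiE; last exact: par_zpow.
    by rewrite (zpow_hom _ _ aM) ab_zpow psiE // mulrCA.
  pose k := h * (zpow (gen x) m * zpow t0 r)^-1.
  have Fk : F x k by apply: parM => //; apply/parV/parM.
  have psik : psi k = 0%R.
    have : psi h = (psi k + psi (zpow (gen x) m * zpow t0 r)%g)%R.
      by rewrite -psiM //; [rewrite /k mulgVK|apply: parM].
    rewrite (psiM _ _ Fm Fr) (pz _ _ Fx) (pz _ _ Ft0) psit0 mulr1 -/p.
    have := divz_eq (psi h) p; rewrite -/m /r.
    have := modz_ge0 (psi h) (lt0r_neq0 psix); rewrite -/p; lia.
  have hE : h = k * (zpow (gen x) m * zpow t0 r) by rewrite /k mulgVK.
  have -> : e0 h = H b (ga h * q^-1) by rewrite /e0 /ga mulgK.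
  have lk_k : par (lk b.1) (ga k) by apply/lkE/kerE; split.
  clearbody k; rewrite hE !gaM -(mulgA (ga k)) (H_lk _ lk_k).
  by rewrite -mulgA (zpow_hom _ _ gaM) -cE.
have hp h : F x h -> (p * (`|M| + 1) <= psi h)%R -> e0 h.
  move=> Fh le; have [r rp ->] := e0E h Fh; have [h1 _] := MP r rp (psi h %/ p)%Z.
  apply: h1; have := divz_eq (psi h) p; have := ltz_pmod (psi h) psix; rewrite -/p.
  by have := psix; rewrite -/p; nia.
have hn h : F x h -> (psi h <= - (p * (`|M| + 1)))%R -> ~~ e0 h.
  move=> Fh le; have [r rp ->] := e0E h Fh; have [_ h2] := MP r rp (psi h %/ p)%Z.
  apply: h2; have := divz_eq (psi h) p; have := modz_ge0 (psi h) (lt0r_neq0 psix); rewrite -/p.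
  by have := psix; rewrite -/p; nia.
have [f [ff fE fle]] := cut_min lm psiM Ft0 psit0 ke0 fe0 hp hn.
have matE t : st x t -> mat y t = (d * f (t, false))%R.
  by move=> st_t; rewrite fE // -psiE //; apply: par_lt.
exists f, d; split=> //.
  exists (fun t => if (0 < mat y x)%R then n t else (- n t)%R); apply: (mulfI dn).
  rewrite mulr1 mulr_sumr /d -[RHS]/d; transitivity (\sum_(t | st x t) (if (0 < mat y x)%R then n t else - n t) * mat y t)%R.
    by apply: eq_bigr => t st_t; rewrite (matE t st_t) mulrCA /d.
  rewrite /d; case: ifP => _; first exact: nE.
  by rewrite -nE -sumrN; apply: eq_bigr => t _; rewrite mulNr.
apply: le_trans fle _; rewrite le_eqVlt; apply/orP; left; apply/eqP/eq_bigr => w _.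
rewrite cutE' -by_; case: (b) => v [] //=.
by rewrite -[(v, true)]/(inv (v, false)) ell_inv.
Qed.

Lemma mat_supp y' : mat y' x != 0%R -> exists2 b', b' \in rw c & b'.1 = y'.
Proof. by rewrite -abc -{1}(rwK c); apply: ab_neq0. Qed.

Lemma adj_twin y' : mat y' x != 0%R -> lk y y' -> #|st y'| = #|st y| -> st y' =1 st y.
Proof.
move=> /mat_supp [b' bc e'] ly e.
have sub : st y \subset st y'.
  apply/fintype.subsetP => z szy; have : st y z by [].
  suff h : st y z -> st y' z by move/h.
  case/orP => [/eqP ->|lz]; first by apply: lk_st; rewrite lk_sym.
  have := supp_st bc lz; rewrite e' /st => /orP[/eqP ->|h]; first by rewrite eqxx.
  by rewrite edge_sym h orbT.
have /subset_cardP h := esym e; have := h sub.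
by move=> h' z; exact/esym/h'.
Qed.

(** A vertex that is not adjacent to y sees only the power of c, hence vanishes with
    y. *)
Lemma nonadj_vanish y' h : y' \notin lk y -> F x h -> ab y (al h) = 0%R -> ab y' (al h) = 0%R.
Proof.
move=> nl Fh h0; rewrite -ga_ab (ab_par (ker_lk Fh h0)) //.
Qed.

Section Twin.
Variable y2 : D.
Hypotheses (ny2 : y2 != y) (st2 : st y2 =1 st y).

Let lky2 : lk y y2.
Proof. by have := st_refl y2; rewrite st2 /st (negPf ny2). Qed.

Lemma twin_supp y' : mat y' x != 0%R -> st y y'.
Proof. by move=> /mat_supp [b' bc <-]; rewrite -st2; apply: supp_st. Qed.

Lemma twin_st u : F y u -> F x (gi u).
Proof.
move=> Fu; have uc : commute u c.
  elim/par_ind_r: u / Fu => [|g [z s] IH sz]; first exact/commute_sym/commute1.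
  have zc : commute (gen z) c.
    move: sz; rewrite /st /= => /orP[/eqP ->|]; last exact: lk_comm.
    rewrite -(rwK c); have : {subset rw c <= rw c} by [].
    elim: {1 3}(rw c) => [|a w IHw] sub; first by rewrite gw0; apply: commute1.
    rewrite gw_cons; apply: commuteM; last by apply: IHw => d dw; apply: sub; rewrite inE dw orbT.
    by apply: commute_st; rewrite /= -st2; apply: supp_st => //; apply: sub; exact: mem_head.
  have zc' : commute (lt (z, s)) c.
    by clear sz; case: s => //; rewrite -[(z, true)]/(inv (z, false)) ltV; apply/commute_sym/commuteV/commute_sym.
  by apply/commute_sym/commuteM; apply/commute_sym.
apply: (@cent_st _ (x, false)); rewrite -/(gen x) -[gen x]giK /commute -/(ga _) -cE.
have giM g h : gi g * gi h = gi (g * h) by rewrite /gi -bM; congr be; gnorm.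
by rewrite !giM uc.
Qed.

Lemma twin_ab u v : F y u -> ~~ st x v -> ab v (be u) = 0%R.
Proof.
move=> /twin_st Fg nv; have := ab_par Fg nv; rewrite /gi !bM !abM (homV _ bM) abV.
by lia.
Qed.

(** When the class of y has several members, the element c commutes with all of them and the
    picture is symmetric: stars correspond to stars under al. *)
Lemma twin_full t : st x t -> exists2 u, F y u & ab t (be u) != 0%R.
Proof.
move=> st_t; have inj n : (forall v, st x v -> (\sum_(s | st y s) n s * ab v (be (gen s)))%R = 0%R) ->
    forall s, st y s -> n s = 0%R.
  move=> n0 s sy; have Fu : F y (pw (st y) n) by apply: pw_par.
  have e v : ab v (be (pw (st y) n)) = 0%R.
    have [sv|nsv] := boolP (st x v); last exact: twin_ab.
    by rewrite (hom_pw _ _ _ bM) n0.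
  have : ab s (pw (st y) n) = 0%R.
    by rewrite -(baK (pw (st y) n)) (hom_ab _ _ aM) big1 // => v _; rewrite e mul0r.
  by rewrite ab_pw sy.
have [_ /(_ (esym eqs) t st_t) [n [d dn nE]]] := inj_rank x inj.
exists (pw (st y) n); first exact: pw_par.
by rewrite (hom_pw _ _ _ bM) nE // eqxx.
Qed.

End Twin.
End Equal.
End Pair.

Lemma mat_prod x x' : (\sum_y ab x (be (gen y)) * mat y x')%R = (x == x')%:R%R.
Proof.
transitivity (ab x (be (al (gen x')))); last by rewrite abK /gen ab_gen eq_sym; case: (x == x').
by rewrite (hom_ab _ _ bM); apply: eq_bigr => y _; rewrite mulrC.
Qed.

Lemma mat_le x y : mat y x != 0%R -> #|st x| <= #|st y|.
Proof. by move=> Ayx; have [q [b [e cc Hc]]] := pos_ex Ayx; apply: tri_le cc Hc. Qed.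

End LG.

Section Main.
Variable D : sgraph.
Implicit Types (x y : D).
Local Notation G := (raag (@edge D)).
Local Open Scope group_scope.

(** A transversal s of the matrix pairs each x with a row y = s x, and comparing star sizes
    along s and its inverse gives equality. So each [cut_pair] applies. On each class the resulting
    rows are unimodular: a singleton class has an entry dividing a column of an invertible
    matrix, and for larger classes the inverse of al provides the inverse matrix. *)
Theorem classmin_min (W : seq G) (al : G -> G) : classmin W -> isaut al ->
  (\sum_(w <- W) len w <= \sum_(w <- W) len (al w))%R.
Proof.
move=> cm [aM [be [bM abK baK]]]; have lm := classmin_locmin cm.
pose A := mat al; pose B x y := ab x (be (gen y)).
have Ale x y : A y x != 0%R -> #|st x| <= #|st y| by move=> h; exact: (mat_le aM bM abK h).
have Ble x y : B y x != 0%R -> #|st x| <= #|st y| by move=> h; exact: (mat_le bM aM baK h).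
have BA : forall x x', (\sum_y B x y * A y x')%R = (x == x')%:R%R by apply: mat_prod.
(* on each level of star sizes, the two matrices are still inverse *)
pose lv x y := #|st x| == #|st y|.
have BA' x x' : (\sum_y (if lv x y then B x y else 0) * (if lv y x' then A y x' else 0))%R = (x == x')%:R%R.
  rewrite -BA; have [e|ne] := boolP (lv x x'); last first.
    rewrite BA; have /negPf -> : x != x' by apply: contra ne => /eqP ->; rewrite /lv.
    rewrite big1 // => y _; rewrite /lv; case: eqP => [e1|]; last by rewrite mul0r.
    by case: eqP => [e2|]; [rewrite /lv e1 e2 eqxx in ne|rewrite mulr0].
  apply: eq_bigr => y _; have [|n1] := boolP (lv x y).
    by rewrite /lv => /eqP e1; move: e; rewrite /lv e1 => ->.
  rewrite mul0r; have [->|b1] := eqVneq (B x y) 0%R; first by rewrite mul0r.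
  have [->|a1] := eqVneq (A y x') 0%R; first by rewrite mulr0.
  by case/negP: n1; rewrite /lv eqn_leq (Ble _ _ b1) andbT (eqP e) Ale.
have [s [sinj snz]] := transversal BA'.
have sA x : A (s x) x != 0%R by have := snz x; case: ifP; rewrite ?eqxx.
have sL x : #|st x| = #|st (s x)| by have := snz x; case: ifP; rewrite ?eqxx // /lv => /eqP.
have pos x : {qb : G * letter D | [/\ qb.2.1 = s x, cycred (qb.1^-1 * al (gen x) * qb.1) & H qb.2 (qb.1^-1 * al (gen x) * qb.1)]}.
  by apply: cid; have [q [b h]] := pos_ex (sA x); exists (q, b).
have fd x : {fd : (letter D -> int) * int | [/\ fd.2 != 0%R, functional x fd.1,
    (forall t, st x t -> A (s x) t = (fd.2 * fd.1 (t, false))%R),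
    (exists n : D -> int, (\sum_(t | st x t) n t * fd.1 (t, false))%R = 1%R) &
    (\sum_(w <- W) N x fd.1 w <= \sum_(w <- W) ell (s x, false) (al w))%R]}.
  apply: cid; have [[q b] [e cc Hc]] := pos x.
  have [f [d h]] := cut_pair aM bM abK baK (sA x) e cc Hc (sL x) lm.
  by exists (f, d).
pose f x := (projT1 (fd x)).1; pose d x := (projT1 (fd x)).2.
have fdP x : [/\ d x != 0%R, functional x (f x),
    (forall t, st x t -> A (s x) t = (d x * f x (t, false))%R),
    (exists n : D -> int, (\sum_(t | st x t) n t * f x (t, false))%R = 1%R) &
    (\sum_(w <- W) N x (f x) w <= \sum_(w <- W) ell (s x, false) (al w))%R].
  exact: projT2 (fd x).
have sbij : bijective s by apply: injF_bij.
have key (V : G -> G) : (\sum_(w <- W) len (V w) = \sum_x \sum_(w <- W) ell (x, false) (V w))%R.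
  by rewrite exchange_big.
rewrite (key al) (key id) [X in (_ <= X)%R](reindex s) /=; last exact: onW_bij.
pose k x : {set D} := [set v | st (s x) v].
rewrite (partition_big k xpredT) //= [X in (_ <= X)%R](partition_big k xpredT) //=.
apply: ler_sum => c _.
have [x0 kx0|no] := pickP (fun x => k x == c); last by rewrite !big_pred0.
pose X : pred D := fun x => k x == c.
have kE x : X x -> st (s x) =1 st (s x0).
  by move=> /eqP e v; have := congr1 (fun Z : {set D} => v \in Z) (etrans e (esym (eqP kx0))); rewrite !inE.
apply: le_trans (_ : _ <= \sum_(x | X x) \sum_(w <- W) N x (f x) w)%R _; last first.
  by apply: ler_sum => x _; have [] := fdP x.
(* all stars of the vertices of X agree *)
have XC : subpred X (cls x0).
  move=> x Xx; apply/forallP => v; apply/eqP.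
  have [->//|nx] := eqVneq x x0.
  have ns : s x != s x0 by rewrite (inj_eq sinj).
  have twin x1 x2 : X x1 -> X x2 -> s x2 != s x1 -> subpred (st x1) (st x2).
    move=> X1 X2 n12 t st_t.
    have e12 : st (s x2) =1 st (s x1) by move=> u; rewrite (kE _ X1) (kE _ X2).
    have [[q1 b1] [e1 c1 H1]] := pos x1; have [[q2 b2] [e2 c2 H2]] := pos x2.
    have n21 : s x1 != s x2 by rewrite eq_sym.
    have [u Fu nu] := twin_full aM bM abK baK (sA x1) e1 c1 H1 (sL x1) n12 e12 st_t.
    apply/negPn/negP => nt; case/eqP: nu.
    apply: (twin_ab aM bM abK (sA x2) e2 c2 H2 (sL x2) n21 _ _ nt) => //.
    apply: parS Fu => w; rewrite -!topredE /= => h; by have := e12 w; rewrite h.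
  have Xx0 : X x0 by [].
  by apply/idP/idP; [apply: (twin x x0)|apply: (twin x0 x)] => //; rewrite eq_sym.
have stX x : X x -> st x =1 st x0 by move=> /XC/clsP.
have dF x t : X x -> X t -> A (s x) t = (d x * f x (t, false))%R.
  move=> Xx Xt; have [_ _ h _ _] := fdP x; apply: h.
  by rewrite (stX x Xx) -(stX t Xt) st_refl.
have funX x : X x -> functional x0 (f x).
  move=> Xx; have [_ [f1 f2 f3] _ _ _] := fdP x; have e := stX x Xx; split.
  - by move=> b; rewrite -e; apply: f1.
  - by move=> b b'; rewrite -!e; apply: f2.
  - by move=> b b'; rewrite -!e; apply: f3.
have NX x w : X x -> N x (f x) w = N x0 (f x) w.
  move=> Xx; have e := stX x Xx; rewrite /N /V.
  have -> : Lam x (f x) = Lam x0 (f x) by apply/funext => g; apply: Lam_st_eq.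
  by congr isum; apply/funext => g; apply: propext; split; apply: parS => v; rewrite -!topredE /= e.
rewrite exchange_big [X in (_ <= X)%R]exchange_big /=.
rewrite [X in (_ <= X)%R](eq_bigr (fun w => \sum_(x | X x) N x0 (f x) w)%R) => [|w _]; last first.
  by apply: eq_bigr => x Xx; apply: NX.
have [L LP] : exists L : D -> D -> int, forall x y, X x -> X y ->
    (\sum_(t | X t) L x t * f t (y, false))%R = (x == y)%:R%R; last first.
  exact: (rows_min cm XC funX LP).
have Xx0 : X x0 by [].
have AB x x' y : X x -> X x' -> B x y != 0%R -> A y x' != 0%R -> #|st y| = #|st x'|.
  move=> Xx Xx' /Ble h1 /Ale h2; apply/eqP; rewrite eqn_leq h2 andbT.
  by apply: leq_trans h1 _; rewrite (eq_card (stX x Xx)) (eq_card (stX x' Xx')).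
have [[y2 ny2 e2]|single] := pselect (exists2 y2, y2 != s x0 & st y2 =1 st (s x0)).
  exists (fun x t => B x (s t) * d t)%R => x x' Xx Xx'.
  rewrite -BA [RHS](reindex s) /=; last exact: onW_bij.
  rewrite [RHS](bigID X) /= [X in _ = (_ + X)%R]big1 ?addr0.
    by apply: eq_bigr => t Xt; rewrite -mulrA -dF.
  move=> t nXt; have [->|nb] := eqVneq (B x (s t)) 0%R; first by rewrite mul0r.
  have [->|na] := eqVneq (A (s t) x') 0%R; first by rewrite mulr0.
  have eqc := AB x x' (s t) Xx Xx' nb na.
  have [y3 ny3 e3] : exists2 y3, y3 != s x' & st y3 =1 st (s x').
    have [e|ne] := eqVneq y2 (s x'); last by exists y2 => // v; rewrite (kE _ Xx').
    by exists (s x0); [rewrite -e eq_sym|move=> v; rewrite (kE _ Xx')].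
  have [[q b] [e cc Hc]] := pos x'.
  have sst := twin_supp aM bM abK (sA x') e cc Hc (sL x') ny3 e3 na.
  have nst : s t != s x' by rewrite (inj_eq sinj); apply: contraNneq nXt => ->.
  have lst : lk (s x') (s t) by move: sst; rewrite /st (negPf nst).
  have tw := adj_twin aM bM abK (sA x') e cc Hc (sL x') na lst (etrans eqc (sL x')).
  case/negP: nXt; apply/eqP; rewrite -(eqP kx0); apply/setP => v.
  by rewrite !inE tw (kE _ Xx').
have Xeq x : X x = (x == x0).
  apply/idP/eqP => [Xx|-> //]; apply/sinj/eqP/negPn/negP => ne.
  by apply: single; exists (s x) => //; apply: kE.
have [_ _ fA [n nE] _] := fdP x0.
set e := f x0 (x0, false).
have div y : B x0 y != 0%R -> A y x0 != 0%R -> (e %| A y x0)%Z.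
  move=> nb na; have eqc := AB x0 x0 y Xx0 Xx0 nb na.
  have [->|ny] := eqVneq y (s x0); first by rewrite dF // dvdz_mull // dvdzz.
  have [[q b] [e1 cc Hc]] := pos x0.
  have nl : ~~ lk (s x0) y.
    apply/negP => l; apply: single; exists y => //.
    exact: (adj_twin aM bM abK (sA x0) e1 cc Hc (sL x0) na l (etrans eqc (sL x0))).
  pose t0 := pw (st x0) n; have Ft0 : par (st x0) t0 by apply: pw_par.
  have Fx : par (st x0) (gen x0) by exact: (par_lt_st (x0, false)).
  have st0 : ab (s x0) (al t0) = d x0.
    rewrite (hom_pw _ _ _ aM) -[RHS]mulr1 -nE mulr_sumr; apply: eq_bigr => t st_t.
    by rewrite -/(mat al _ _) -/A fA // mulrCA.
  have := nonadj_vanish aM (sA x0) e1 cc Hc nl (parM Fx (par_zpow (- e)%R Ft0)).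
  rewrite !aM !(zpow_hom _ _ aM) !abM !ab_zpow st0 -!/(mat al _ _) -/A dF // -/e.
  move=> /(_ _)/wrap[]; first by lia.
  by move=> h; apply/dvdzP; exists (ab y (al t0)); lia.
exists (fun _ _ => \sum_y B x0 y * (A y x0 %/ e)%Z)%R => x y.
rewrite !Xeq => /eqP -> /eqP ->; rewrite (big_pred1 x0) // -BA mulr_suml.
apply: eq_bigr => y' _; rewrite -/e.
have [->|nb] := eqVneq (B x0 y') 0%R; first by rewrite !mul0r.
have [->|na] := eqVneq (A y' x0) 0%R; first by rewrite div0z mulr0 mul0r.
by rewrite -mulrA divzK // div.
Qed.

End Main.

(** * Tower bounds *)

Fixpoint Tw (k n : nat) : nat := if k is k'.+1 then 2 ^ Tw k' n else n.
(** Bounds are only needed up to a fixed number of exponentials; this class of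
    functions is closed under everything that occurs below. *)
Definition tb (f : nat -> nat) := exists k, forall n, f n <= Tw k n.

Lemma Tw_mono k m n : m <= n -> Tw k m <= Tw k n.
Proof. by move=> le; elim: k => //= k IH; rewrite leq_pexp2l. Qed.

Lemma Tw_succ k n : Tw k n <= Tw k.+1 n.
Proof. exact/ltnW/ltn_expl. Qed.

Lemma Tw_le k l n : k <= l -> Tw k n <= Tw l n.
Proof.
move=> /subnK <-; elim: (l - k) => //= d IH.
by apply: leq_trans IH _; apply: (Tw_succ (d + k)).
Qed.

Lemma Tw_add k l n : Tw (k + l) n = Tw k (Tw l n).
Proof. by elim: k => //= k ->. Qed.

Lemma tb_id : tb id. Proof. by exists 0. Qed.

Lemma tb_le f g : tb g -> (forall n, f n <= g n) -> tb f.
Proof. by move=> [k kP] le; exists k => n; apply: leq_trans (le n) _. Qed.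

Lemma tb_comp f g : tb f -> tb g -> tb (fun n => f (g n)).
Proof.
move=> [k kP] [l lP]; exists (k + l) => n; rewrite Tw_add.
by apply: leq_trans (kP _) _; apply: Tw_mono.
Qed.

Lemma tb_exp2 f : tb f -> tb (fun n => 2 ^ f n).
Proof. by move=> [k kP]; exists k.+1 => n /=; rewrite leq_pexp2l. Qed.

Lemma tb_const c : tb (fun=> c).
Proof.
exists c => n; elim: c => // c IH; apply: leq_trans (_ : (Tw c n).+1 <= _); first by [].
exact: ltn_expl.
Qed.

Lemma tb_max f g : tb f -> tb g -> tb (fun n => maxn (f n) (g n)).
Proof.
move=> [k kP] [l lP]; exists (maxn k l) => n; rewrite geq_max.
rewrite (leq_trans (kP n)) ?(leq_trans (lP n)) //; apply: Tw_le.
  exact: leq_maxr.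
exact: leq_maxl.
Qed.

Lemma tb_mul f g : tb f -> tb g -> tb (fun n => f n * g n).
Proof.
move=> tf tg; apply: (tb_le (tb_exp2 (tb_exp2 (tb_max tf tg)))) => n.
set m := maxn _ _; have le : f n * g n <= m * m by rewrite leq_mul // ?leq_maxl ?leq_maxr.
apply: leq_trans le _; apply: leq_trans (_ : 2 ^ m * 2 ^ m <= _).
  by rewrite leq_mul // ltnW // ltn_expl.
rewrite -expnD leq_pexp2l // addnn -mul2n.
by case: m => // m; rewrite expnS leq_mul2l /= ltn_expl.
Qed.

Lemma tb_add f g : tb f -> tb g -> tb (fun n => f n + g n).
Proof.
move=> tf tg; apply: (tb_le (tb_mul (tb_const 2) (tb_max tf tg))) => n.
by rewrite mul2n -addnn leq_add // ?leq_maxl ?leq_maxr.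
Qed.

Lemma tb_exp f g : tb f -> tb g -> tb (fun n => f n ^ g n).
Proof.
move=> tf tg; apply: (tb_le (tb_exp2 (tb_mul tf tg))) => n.
rewrite expnM; case: (g n) => [//|m]; rewrite leq_exp2r //; exact/ltnW/ltn_expl.
Qed.

(** * Bounded paths of elementary row operations *)

Section Rows.
Local Open Scope ring_scope.

Definition nb m N (R : nat) (D : 'M[int]_(m, N)) := forall i j, (absz (D i j) <= R)%N.

Definition upd m N (D : 'M[int]_(m, N)) i v := \matrix_k (if k == i then v else row k D).

Definition pm (s : int) := s = 1 \/ s = -1.

(** The rows of F are fixed and may be added to those of D. *)
Definition step m N K (F : 'M[int]_(K, N)) (D D' : 'M[int]_(m, N)) :=
  exists i, exists2 v, D' = upd D i v &
    [\/ exists s j, [/\ pm s, j != i & v = row i D + s *: row j D],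
        exists s k, pm s /\ v = row i D + s *: row k F | v = - row i D].

Inductive bpath m N K (F : 'M[int]_(K, N)) (R : nat) (D : 'M[int]_(m, N)) :
    'M[int]_(m, N) -> Prop :=
| bp0 : nb R D -> bpath F R D D
| bpS D' D'' : bpath F R D D' -> step F D' D'' -> nb R D'' -> bpath F R D D''.

Lemma row_upd m N (D : 'M[int]_(m, N)) i v k : row k (upd D i v) = if k == i then v else row k D.
Proof. exact: rowK. Qed.

Lemma updK m N (D : 'M[int]_(m, N)) i v w : upd (upd D i v) i w = upd D i w.
Proof. by apply/row_matrixP => k; rewrite !row_upd; case: eqP. Qed.

Lemma upd_id m N (D : 'M[int]_(m, N)) i : upd D i (row i D) = D.
Proof. by apply/row_matrixP => k; rewrite !row_upd; case: eqP => // ->. Qed.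

Lemma nb_le m N R R' (D : 'M[int]_(m, N)) : (R <= R')%N -> nb R D -> nb R' D.
Proof. by move=> le nD i j; apply: leq_trans (nD i j) le. Qed.

Lemma nb_row m N R (D : 'M[int]_(m, N)) i : nb R D -> nb R (row i D).
Proof. by move=> nD k j; rewrite mxE. Qed.

Lemma nb_upd m N R (D : 'M[int]_(m, N)) i v : nb R D -> nb R v -> nb R (upd D i v).
Proof. by move=> nD nv k j; rewrite mxE; case: eqP => _; rewrite ?mxE. Qed.

Lemma absz_add (x y : int) : (absz (x + y)%R <= absz x + absz y)%N.
Proof. by lia. Qed.

Lemma nb_add m N R R' (D D' : 'M[int]_(m, N)) : nb R D -> nb R' D' -> nb (R + R') (D + D').
Proof. by move=> nD nD' i j; rewrite mxE; apply: leq_trans (absz_add _ _) (leq_add _ _). Qed.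

Lemma nb_opp m N R (D : 'M[int]_(m, N)) : nb R D -> nb R (- D).
Proof. by move=> nD i j; rewrite mxE abszN. Qed.

Lemma nb_scale m N R (a : int) (D : 'M[int]_(m, N)) : nb R D -> nb (absz a * R) (a *: D).
Proof. by move=> nD i j; rewrite mxE abszM leq_mul. Qed.

Lemma nb_pm m N R s (D : 'M[int]_(m, N)) : pm s -> nb R D -> nb R (s *: D).
Proof. by move=> ps nD i j; rewrite mxE abszM; have := nD i j; case: ps => ->; rewrite mul1n. Qed.

Lemma absz_sum (I : Type) (r : seq I) (E : I -> int) : (absz (\sum_(i <- r) E i)%R <= \sum_(i <- r) absz (E i))%N.
Proof.
elim: r => [|i r IH]; first by rewrite !big_nil.
by rewrite !big_cons; apply: leq_trans (absz_add _ _) (leq_add _ _).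
Qed.

Lemma nb_mul m N K R R' (A : 'M[int]_(m, N)) (B : 'M[int]_(N, K)) :
  nb R A -> nb R' B -> nb (N * (R * R')) (A *m B).
Proof.
move=> nA nB i j; rewrite mxE; apply: leq_trans (absz_sum _ _) _.
apply: leq_trans (_ : \sum_(k < N) R * R' <= _)%N; last by rewrite sum_nat_const card_ord.
by apply: leq_sum => k _; rewrite abszM leq_mul.
Qed.

Lemma bp_r m N K (F : 'M[int]_(K, N)) R (D D' : 'M[int]_(m, N)) : bpath F R D D' -> nb R D'.
Proof. by case. Qed.

Lemma bp_trans m N K (F : 'M[int]_(K, N)) R (D D' D'' : 'M[int]_(m, N)) :
  bpath F R D D' -> bpath F R D' D'' -> bpath F R D D''.
Proof. by move=> p; elim=> // E E' _ IH st nE; apply: bpS IH st nE. Qed.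

Lemma bp_step m N K (F : 'M[int]_(K, N)) R (D D' : 'M[int]_(m, N)) :
  nb R D -> step F D D' -> nb R D' -> bpath F R D D'.
Proof. by move=> nD; apply: bpS; apply: bp0. Qed.

Lemma bp_le m N K (F : 'M[int]_(K, N)) R R' (D D' : 'M[int]_(m, N)) : (R <= R')%N ->
  bpath F R D D' -> bpath F R' D D'.
Proof.
move=> le; elim=> [nD|E E' _ IH st nE]; first exact/bp0/(nb_le le).
by apply: bpS IH st _; apply: nb_le nE.
Qed.

Lemma pmN s : pm s -> pm (- s). Proof. by case=> ->; [right|left]; rewrite ?opprK. Qed.

Lemma step_sym m N K (F : 'M[int]_(K, N)) (D D' : 'M[int]_(m, N)) : step F D D' -> step F D' D.
Proof.
move=> [i [v -> h]]; exists i; exists (row i D); first by rewrite updK upd_id.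
case: h => [[s [j [ps nj ->]]]|[s [k [ps ->]]]|->].
- apply: Or31; exists (- s), j; split; [exact: pmN|by []|].
  by rewrite !row_upd eqxx (negPf nj) scaleNr addrK.
- apply: Or32; exists (- s), k; split; [exact: pmN|].
  by rewrite !row_upd eqxx scaleNr addrK.
- by apply: Or33; rewrite row_upd eqxx opprK.
Qed.

Lemma bp_sym m N K (F : 'M[int]_(K, N)) R (D D' : 'M[int]_(m, N)) : bpath F R D D' -> bpath F R D' D.
Proof.
elim=> [nD|E E' p IH st nE]; first exact: bp0.
by apply: bp_trans IH; apply: bp_step nE (step_sym st) (bp_r p).
Qed.

Lemma deltaM m N p (D : 'M[int]_(m, N)) (i k : 'I_p) (j : 'I_m) :
  row k (delta_mx i j *m D) = if k == i then row j D else 0 :> 'rV_N.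
Proof.
apply/rowP => c; rewrite !mxE (bigD1 j) //= big1 ?addr0 => [|l nl]; last first.
  by rewrite mxE (negPf nl) andbF mul0r.
by rewrite mxE eqxx andbT; case: (k == i); rewrite ?mxE ?mul1r ?mul0r.
Qed.

Definition eqv m N K (F : 'M[int]_(K, N)) (D D' : 'M[int]_(m, N)) :=
  exists A B, A \in unitmx /\ D' = A *m D + B *m F.

Lemma step_eqv m N K (F : 'M[int]_(K, N)) (D D' : 'M[int]_(m, N)) : step F D D' -> eqv F D D'.
Proof.
move=> [i [v -> [[s [j [ps nj ->]]]|[s [k [ps ->]]]|->]]].
- exists (1%:M + s *: delta_mx i j), 0; split.
    have [] // := @mulmx1_unit _ _ (1%:M + s *: delta_mx i j) (1%:M - s *: delta_mx i j) _.
    rewrite mulmxDl !mulmxBr !mulmx1 mul1mx -!scalemxAl -!scalemxAr mul_delta_mx_0 //.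
    by rewrite !scaler0 subr0 subrK.
  rewrite mul0mx addr0 mulmxDl mul1mx -scalemxAl; apply/row_matrixP => l.
  rewrite row_upd raddfD /= linearZ /= deltaM; case: eqP => [->//|_].
  by rewrite scaler0 addr0.
- exists 1%:M, (s *: delta_mx i k); split; first exact: unitmx1.
  rewrite mul1mx -scalemxAl; apply/row_matrixP => l.
  rewrite row_upd raddfD /= linearZ /= deltaM; case: eqP => [->//|_].
  by rewrite scaler0 addr0.
- exists (1%:M - 2 *: delta_mx i i), 0; split.
    have e : (1%:M - 2 *: delta_mx i i) *m (1%:M - 2 *: delta_mx i i) = 1%:M :> 'M[int]_m.
      rewrite mulmxBl !mulmxBr !mulmx1 mul1mx -!scalemxAl -!scalemxAr mul_delta_mx scalerA.
      by apply/matrixP => a b; rewrite !mxE; lia.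
    by have [] := mulmx1_unit e.
  rewrite mul0mx addr0 mulmxBl mul1mx -scalemxAl; apply/row_matrixP => l.
  rewrite row_upd raddfB /= linearZ /= deltaM; case: eqP => [->|_].
    by apply/rowP => c; rewrite !mxE; lia.
  by rewrite scaler0 subr0.
Qed.

Lemma eqv_refl m N K (F : 'M[int]_(K, N)) (D : 'M[int]_(m, N)) : eqv F D D.
Proof. by exists 1%:M, 0; rewrite unitmx1 mul1mx mul0mx addr0. Qed.

Lemma eqv_trans m N K (F : 'M[int]_(K, N)) (D D' D'' : 'M[int]_(m, N)) :
  eqv F D D' -> eqv F D' D'' -> eqv F D D''.
Proof.
move=> [A [B [uA ->]]] [A' [B' [uA' ->]]]; exists (A' *m A), (A' *m B + B').
by rewrite unitmx_mul uA uA' mulmxDr mulmxDl !mulmxA addrA.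
Qed.

Lemma eqv_sym m N K (F : 'M[int]_(K, N)) (D D' : 'M[int]_(m, N)) : eqv F D D' -> eqv F D' D.
Proof.
move=> [A [B [uA ->]]]; exists (invmx A), (- (invmx A *m B)); rewrite unitmx_inv; split=> //.
by rewrite mulmxDr !mulmxA mulVmx // mul1mx mulNmx addrK.
Qed.

Lemma bp_eqv m N K (F : 'M[int]_(K, N)) R (D D' : 'M[int]_(m, N)) : bpath F R D D' -> eqv F D D'.
Proof.
elim=> [_|E E' _ IH st _]; first exact: eqv_refl.
exact: eqv_trans IH (step_eqv st).
Qed.

Lemma bp_lift p m N K (F : 'M[int]_(K, N)) R (r : 'M[int]_(p, N)) (D D' : 'M[int]_(m, N)) :
  nb R r -> bpath F R D D' -> bpath F R (col_mx r D) (col_mx r D').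
Proof.
move=> nr; have nc (E : 'M[int]_(m, N)) : nb R E -> nb R (col_mx r E).
  by move=> nE i j; rewrite mxE; case: splitP => k _.
elim=> [nD|E E' _ IH [i [v -> h]] nE]; first exact/bp0/nc.
apply: bpS IH _ (nc _ nE); exists (rshift p i), v.
  apply/row_matrixP => k; rewrite row_upd; case: (split_ordP k) => l ->.
    by rewrite !rowKu eq_sym; case: eqP => // /eqP; rewrite eq_rlshift.
  by rewrite !rowKd row_upd (inj_eq (@rshift_inj _ _)).
case: h => [[s [j [ps nj ->]]]|[s [k [ps ->]]]|->].
- apply: Or31; exists s, (rshift p j); split=> //; first by rewrite (inj_eq (@rshift_inj _ _)).
  by rewrite !rowKd.
- by apply: Or32; exists s, k; rewrite rowKd.
- by apply: Or33; rewrite rowKd.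
Qed.

(** Adding an integer combination of rows to a row, one row at a time. *)
Lemma row_path m N K (F : 'M[int]_(K, N)) b (D : 'M[int]_(m, N)) i (c : 'rV_m) (e : 'rV_K) n :
  nb b D -> nb b F -> c ord0 i = 0 ->
  (\sum_j absz (c ord0 j) + \sum_k absz (e ord0 k) <= n)%N ->
  bpath F (b + n * b) D (upd D i (row i D + c *m D + e *m F)).
Proof.
move=> nD nF; have gen : forall r, (exists r0, r = (b + r0)%N /\ (r0 <= n * b)%N) -> True by [].
move: c e.
suff key : forall n b0 (D : 'M[int]_(m, N)) (c : 'rV_m) (e : 'rV_K), (forall k, k != i -> nb b (row k D)) -> nb b0 (row i D) ->
   c ord0 i = 0 -> (\sum_j absz (c ord0 j) + \sum_k absz (e ord0 k) <= n)%N -> (b <= b0)%N ->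
   bpath F (b0 + n * b) D (upd D i (row i D + c *m D + e *m F)).
  by move=> c e c0 le; apply: key => // [k _|]; apply: nb_row.
clear gen; move=> {n} n; elim: n {D nD} => [|n IH] b0 D c e nD nDi c0 le bb.
  have z : (\sum_j absz (c ord0 j))%N = 0%N /\ (\sum_k absz (e ord0 k))%N = 0%N by split; lia.
  have -> : c = 0.
    apply/rowP => j; rewrite mxE; have [/eqP] := z; rewrite sum_nat_eq0 => /forallP /(_ j) /= h _.
    by apply/eqP; rewrite -absz_eq0.
  have -> : e = 0.
    apply/rowP => j; rewrite mxE; have [_ /eqP] := z; rewrite sum_nat_eq0 => /forallP /(_ j) /= h.
    by apply/eqP; rewrite -absz_eq0.
  rewrite !mul0mx !addr0 upd_id; apply: bp0 => k j.
  rewrite mul0n addn0; have [->|nk] := eqVneq k i; first by have := nDi 0 j; rewrite mxE.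
  by have := nD k nk 0 j; rewrite mxE => h; apply: leq_trans h bb.
have nbD : nb b0 D.
  move=> k j; have [->|nk] := eqVneq k i; first by have := nDi 0 j; rewrite mxE.
  by have := nD k nk 0 j; rewrite mxE => h; apply: leq_trans h bb.
have sgP (x : int) : x != 0 -> exists2 s, pm s & absz (x - s)%R = (absz x).-1.
  move=> nx; have [x0|x0] := ltrP 0 x; first by exists 1; [left|lia].
  by exists (-1); [right|lia].
have decr p (u : 'rV[int]_p) j s : absz (u ord0 j - s)%R = (absz (u ord0 j)).-1 -> u ord0 j != 0 ->
    (\sum_l absz ((u - s *: delta_mx ord0 j)%R ord0 l) < \sum_l absz (u ord0 l))%N.
  move=> hs nz; rewrite (bigD1 j) //= [X in (_ < X)%N](bigD1 j) //= !mxE !eqxx mulr1 hs.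
  rewrite [X in (_ + X < _)%N](eq_bigr (fun l => absz (u ord0 l))) ?ltn_add2r; first by lia.
  by move=> l nl; rewrite !mxE (negPf nl) andbF mulr0 subr0.
have [[j nz]|allc] := pselect (exists j, c ord0 j != 0).
  have [s ps hs] := sgP _ nz; have nji : j != i by apply: contraNneq nz => ->; rewrite c0.
  pose D1 := upd D i (row i D + s *: row j D).
  have s1 : step F D D1 by exists i; exists (row i D + s *: row j D) => //; apply: Or31; exists s, j.
  have n1 : nb (b0 + b) (row i D1) by rewrite row_upd eqxx; apply: nb_add => //; apply: nb_pm => //; apply: nD.
  have nk1 k : k != i -> nb b (row k D1) by move=> nk; rewrite row_upd (negPf nk); apply: nD.
  have cE (u : 'rV_m) : u ord0 i = 0 -> u *m D1 = u *m D.
    move=> u0; apply/rowP => l; rewrite !mxE; apply: eq_bigr => k _.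
    by rewrite mxE; have [->|_] := eqVneq k i; rewrite ?u0 ?mul0r // mxE.
  have ci : (c - s *: delta_mx ord0 j) ord0 i = 0 by rewrite !mxE c0 eq_sym (negPf nji) andbF mulr0 subr0.
  have := IH (b0 + b)%N D1 (c - s *: delta_mx ord0 j) e nk1 n1 ci _ _.
  rewrite row_upd eqxx updK cE // mulmxBl -scalemxAl -rowE.
  have -> : row i D + s *: row j D + (c *m D - s *: row j D) + e *m F = row i D + c *m D + e *m F.
    by rewrite addrACA subrr addr0.
  have -> : (b0 + b + n * b = b0 + n.+1 * b)%N by lia.
  move=> p; apply: bp_trans (p _ _); last by lia.
    apply: bp_step s1 _; first by apply: nb_le nbD; lia.
    apply: nb_upd; first by apply: nb_le nbD; lia.
    by move: n1; rewrite row_upd eqxx; apply: nb_le; lia.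
  by rewrite -ltnS; apply: leq_trans le; rewrite -addSn leq_add2r; apply: decr.
have [[j nz]|alle] := pselect (exists j, e ord0 j != 0).
  have [s ps hs] := sgP _ nz.
  pose D1 := upd D i (row i D + s *: row j F).
  have s1 : step F D D1 by exists i; exists (row i D + s *: row j F) => //; apply: Or32; exists s, j.
  have n1 : nb (b0 + b) (row i D1) by rewrite row_upd eqxx; apply: nb_add => //; apply: nb_pm => //; apply: nb_row.
  have nk1 k : k != i -> nb b (row k D1) by move=> nk; rewrite row_upd (negPf nk); apply: nD.
  have cE (u : 'rV_m) : u ord0 i = 0 -> u *m D1 = u *m D.
    move=> u0; apply/rowP => l; rewrite !mxE; apply: eq_bigr => k _.
    by rewrite mxE; have [->|_] := eqVneq k i; rewrite ?u0 ?mul0r // mxE.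
  have := IH (b0 + b)%N D1 c (e - s *: delta_mx ord0 j) nk1 n1 c0 _ _.
  rewrite row_upd eqxx updK cE // mulmxBl -scalemxAl -rowE.
  have -> : row i D + s *: row j F + c *m D + (e *m F - s *: row j F) = row i D + c *m D + e *m F.
    by rewrite [row i D + _ + _]addrAC addrACA subrr addr0.
  have -> : (b0 + b + n * b = b0 + n.+1 * b)%N by lia.
  move=> p; apply: bp_trans (p _ _); last by lia.
    apply: bp_step s1 _; first by apply: nb_le nbD; lia.
    apply: nb_upd; first by apply: nb_le nbD; lia.
    by move: n1; rewrite row_upd eqxx; apply: nb_le; lia.
  by rewrite -ltnS; apply: leq_trans le; rewrite -addnS leq_add2l; apply: decr.
apply: bp_le (IH b0 D c e nD nDi c0 _ bb); first by lia.
rewrite !big1 // => j _; apply/eqP; rewrite absz_eq0; apply/negPn/negP => h.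
  by apply: alle; exists j.
by apply: allc; exists j.
Qed.

(** Euclid's algorithm on the values of a linear form; the sum of their absolute values
    decreases, so the number of operations is bounded by it. *)
Lemma euclid m N K (F : 'M[int]_(K, N)) (lam : 'cV_N) L (D : 'M[int]_(m.+1, N)) n :
  nb L D -> (\sum_i absz ((D *m lam)%R i ord0) <= n)%N ->
  exists D', bpath F (L * 2 ^ (n + 2)) D D' /\ forall i, i != ord0 -> (D' *m lam) i 0 = 0.
Proof.
have val (E : 'M[int]_(m.+1, N)) i v k : (upd E i v *m lam) k ord0 =
    if k == i then (v *m lam) 0 0 else (E *m lam) k ord0.
  have h (X : 'M[int]_(m.+1, N)) : (X *m lam) k ord0 = (row k X *m lam) 0 0 by rewrite -row_mul [RHS]mxE.
  by rewrite !h row_upd; case: ifP.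
have rowv (E : 'M[int]_(m.+1, N)) i : (row i E *m lam) 0 0 = (E *m lam) i ord0 by rewrite -row_mul [LHS]mxE.
have addv (E : 'M[int]_(m.+1, N)) i j s : ((row i E + s *: row j E) *m lam) 0 0 = (E *m lam) i ord0 + s * (E *m lam) j ord0.
  by rewrite mulmxDl -scalemxAl mxE [in X in _ + X]mxE !rowv.
have nstep b (E : 'M[int]_(m.+1, N)) i j s : nb b E -> pm s -> nb (2 * b) (upd E i (row i E + s *: row j E)).
  move=> nE ps; apply: nb_upd; first by apply: nb_le nE; lia.
  rewrite mul2n -addnn; apply: nb_add; first exact: nb_row.
  by apply: nb_pm => //; apply: nb_row.
elim: n L D => [|n IH] L D nD le.
  exists D; split; first by apply: bp0; apply: nb_le nD; lia.
  move=> i _; apply/eqP; rewrite -absz_eq0; move: le; rewrite leqn0 sum_nat_eq0.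
  by move=> /forallP /(_ i).
have [[i [j [nij nzj ge]]]|no] := pselect (exists i j, [/\ i != j, (D *m lam) j ord0 != 0 &
    (absz ((D *m lam)%R j ord0) <= absz ((D *m lam)%R i ord0))%N]).
  pose a := (D *m lam) i ord0; pose b := (D *m lam) j ord0.
  have [s ps hs] : exists2 s, pm s & (absz (a + s * b)%R < absz a)%N.
    have [h|h] := boolP ((0 < a) == (0 < b)).
      by exists (-1); [right|move: h nzj ge; rewrite -/a -/b; case: ltrP; case: ltrP; lia].
    by exists 1; [left|move: h nzj ge; rewrite -/a -/b; case: ltrP; case: ltrP; lia].
  pose D1 := upd D i (row i D + s *: row j D).
  have n1 : nb (2 * L) D1 by apply: nstep.
  have [|D' [p z]] := IH (2 * L)%N D1 n1 _.
    rewrite -ltnS; apply: leq_trans le; rewrite (bigD1 i) //= [X in (_ <= X)%N](bigD1 i) //=.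
    rewrite val eqxx addv -/a -/b (eq_bigr (fun k => absz ((D *m lam)%R k ord0))); first by rewrite ltn_add2r.
    by move=> k nk; rewrite val (negPf nk).
  exists D'; split=> //; move: p; have -> : (2 * L * 2 ^ (n + 2) = L * 2 ^ (n.+1 + 2))%N.
    by rewrite addSn expnS; lia.
  move=> p; have pos : (2 <= 2 ^ (n.+1 + 2))%N by rewrite addnS expnS leq_pmulr // expn_gt0.
  apply: bp_trans p; apply: bp_step.
  - by apply: nb_le nD; rewrite leq_pmulr // expn_gt0.
  - exists i; exists (row i D + s *: row j D) => //; apply: Or31; exists s, j; split=> //.
    by rewrite eq_sym.
  - by apply: nb_le n1; rewrite mulnC leq_mul.
have pos : (4 <= 2 ^ (n.+1 + 2))%N by rewrite -[4%N]/(2 ^ 2)%N leq_exp2l // addn2.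
have [[i [ni nzi]]|no2] := pselect (exists i, i != ord0 /\ (D *m lam) i ord0 != 0); last first.
  exists D; split; first by apply: bp0; apply: nb_le nD; rewrite leq_pmulr // expn_gt0.
  by move=> i ni; apply/eqP/negPn/negP => h; apply: no2; exists i.
have z k : k != i -> (D *m lam) k ord0 = 0.
  move=> nk; apply/eqP/negPn/negP => h; apply: no.
  by case: (leqP (absz ((D *m lam)%R k ord0)) (absz ((D *m lam)%R i ord0))) => l; [exists i, k|exists k, i]; split=> //;
    [rewrite eq_sym|apply: ltnW].
have p1 : pm 1 by left. have pN : pm (-1) by right.
pose D1 := upd D ord0 (row ord0 D + 1 *: row i D).
pose D2 := upd D1 i (row i D1 + (-1) *: row ord0 D1).
have n1 : nb (2 * L) D1 by apply: nstep.
have n2 : nb (2 * (2 * L)) D2 by apply: nstep.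
have le4 : (2 * (2 * L) <= L * 2 ^ (n.+1 + 2))%N.
  by rewrite mulnA mulnC leq_mul.
exists D2; split.
  apply: (@bpS _ _ _ _ _ _ D1).
  - apply: bp_step; [by apply: nb_le nD; lia| |by apply: nb_le n1; lia].
    by exists ord0; exists (row ord0 D + 1 *: row i D) => //; apply: Or31; exists 1, i.
  - by exists i; exists (row i D1 + (-1) *: row ord0 D1) => //; apply: Or31; exists (-1), ord0; rewrite eq_sym.
  - exact: nb_le n2.
move=> k nk; rewrite val addv /D1 !val addv eqxx (negPf ni) (negPf nk) (z ord0) ?(eq_sym ord0) //.
by case: eqP => [_|/eqP /z ->]; lia.
Qed.

(** ** Bounded solutions of linear systems *)

Lemma nb_row_mx m N1 N2 R (A : 'M[int]_(m, N1)) (B : 'M[int]_(m, N2)) : nb R A -> nb R B -> nb R (row_mx A B).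
Proof. by move=> nA nB i j; rewrite mxE; case: splitP => k _. Qed.
Lemma nb_col_mx m1 m2 N R (A : 'M[int]_(m1, N)) (B : 'M[int]_(m2, N)) : nb R A -> nb R B -> nb R (col_mx A B).
Proof. by move=> nA nB i j; rewrite mxE; case: splitP => k _. Qed.
Lemma nb_lsub m N1 N2 R (A : 'M[int]_(m, N1 + N2)) : nb R A -> nb R (lsubmx A).
Proof. by move=> nA i j; rewrite mxE. Qed.
Lemma nb_rsub m N1 N2 R (A : 'M[int]_(m, N1 + N2)) : nb R A -> nb R (rsubmx A).
Proof. by move=> nA i j; rewrite mxE. Qed.
Lemma nb_usub m1 m2 N R (A : 'M[int]_(m1 + m2, N)) : nb R A -> nb R (usubmx A).
Proof. by move=> nA i j; rewrite mxE. Qed.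
Lemma nb_dsub m1 m2 N R (A : 'M[int]_(m1 + m2, N)) : nb R A -> nb R (dsubmx A).
Proof. by move=> nA i j; rewrite mxE. Qed.
Lemma nb_0 m N R : nb R (0 : 'M[int]_(m, N)). Proof. by move=> i j; rewrite mxE. Qed.
Lemma nb_1 m R : (0 < R)%N -> nb R (1%:M : 'M[int]_m).
Proof. by move=> R0 i j; rewrite mxE; case: eqP. Qed.

Definition eR K (L : nat) := (L.+1 * 2 ^ (K.+1 * L.+1 + 2))%N.

Lemma tb_eR K f : tb f -> tb (fun n => eR K (f n)).
Proof.
move=> tf; have tS : tb (fun n => (f n).+1).
  by apply: tb_le (tb_add tf (tb_const 1)) _ => n; rewrite addn1.
by apply: tb_mul => //; apply: tb_exp2; apply: tb_add (tb_const _); apply: tb_mul (tb_const _) tS.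
Qed.

(** Clearing a column by a change of basis, keeping track of the latter. *)
Lemma clear_col K N L (G : 'M[int]_(K.+1, N)) j : nb L G ->
  exists A : 'M[int]_(K.+1), [/\ A \in unitmx, nb (eR K L) A, nb (eR K L) (A *m G) &
    forall i, i != ord0 -> (A *m G) i j = 0].
Proof.
move=> nG; pose X := row_mx G 1%:M.
pose lam : 'cV[int]_(N + K.+1) := delta_mx (lshift _ j) ord0.
have lamE (Y : 'M[int]_(K.+1, N + K.+1)) i : (Y *m lam) i ord0 = Y i (lshift _ j).
  rewrite mxE (bigD1 (lshift _ j)) //= mxE !eqxx mulr1 big1 ?addr0 // => k nk.
  by rewrite mxE (negPf nk) mulr0.
have nX : nb L.+1 X by apply: nb_row_mx; [apply: nb_le nG|apply: nb_1].
have [|X' [p z]] := @euclid K (N + K.+1) 0 0 lam L.+1 X (K.+1 * L.+1) nX.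
  apply: leq_trans (_ : \sum_(i < K.+1) L.+1 <= _)%N; last by rewrite sum_nat_const card_ord.
  by apply: leq_sum => i _; rewrite lamE; apply: nX.
have [A [B [uA]]] := bp_eqv p; rewrite (thinmx0 B) mul0mx addr0 => e.
have nX' := bp_r p; have E : X' = row_mx (A *m G) A by rewrite e mul_mx_row mulmx1.
exists A; split=> //.
- by have := nb_rsub nX'; rewrite E row_mxKr.
- by have := nb_lsub nX'; rewrite E row_mxKl.
- by move=> i ni; have := z i ni; rewrite lamE E row_mxEl.
Qed.

Lemma mul_split K N (c : 'rV[int]_(1 + K)) (G : 'M[int]_(1 + K, N)) :
  c *m G = c 0 ord0 *: usubmx G + rsubmx c *m dsubmx G.
Proof.
rewrite -{1}(hsubmxK c) -{1}(vsubmxK G) mul_row_col; congr (_ + _).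
have -> : lsubmx c = (c 0 ord0)%:M.
  apply/rowP => i; rewrite !mxE (ord1 i) eqxx mulr1n; congr (c _ _); exact: val_inj.
by rewrite mul_scalar_mx.
Qed.

Lemma dsub_zero K N (G : 'M[int]_(1 + K, N)) j : (forall i, i != ord0 -> G i j = 0) ->
  forall i, (dsubmx G) i j = 0.
Proof. by move=> z i; rewrite mxE z. Qed.

Lemma usub_E K N (G : 'M[int]_(1 + K, N)) i j : (usubmx G) i j = G ord0 j.
Proof. by rewrite mxE (ord1 i); congr (G _ _); apply: val_inj. Qed.

Lemma pivot_neq0 K N (A : 'M[int]_(1 + K)) (G : 'M[int]_(1 + K, N)) k j : A \in unitmx -> G k j != 0 ->
  (forall i, i != ord0 -> (A *m G) i j = 0) -> (A *m G) ord0 j != 0.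
Proof.
move=> uA nz z; apply/eqP => z0.
have c0 : col j (A *m G) = 0.
  by apply/colP => i; rewrite !mxE; have [->|ni] := eqVneq i ord0; [rewrite -[RHS]z0 mxE|rewrite -[RHS](z i ni) mxE].
have : col j G = 0 by rewrite colE -[G](mulKmx uA) -mulmxA -colE c0 mulmx0.
by move=> /colP /(_ k); rewrite !mxE => e; rewrite e eqxx in nz.
Qed.

Fixpoint cR K (L : nat) : nat := if K is K'.+1 then
  (K'.+1 * ((L + cR K' (L + L * eR K' L + eR K' L)) * eR K' L))%N else 0%N.

Lemma tb_cR K f : tb f -> tb (fun n => cR K (f n)).
Proof.
elim: K f => [|K IH] f tf /=; first exact: tb_const.
have te := tb_eR K tf.
apply: tb_mul (tb_const _) _; apply: (tb_mul _ te); apply: tb_add => //.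
by apply: IH; apply: (tb_add _ te); apply: tb_add => //; apply: tb_mul.
Qed.

(** Pivots make the coefficients unique, one after the other, hence bounded. *)
Lemma combo K N L (G : 'M[int]_(K, N)) v (c : 'rV_K) : nb L G -> nb L v -> v = c *m G ->
  exists2 c' : 'rV_K, nb (cR K L) c' & v = c' *m G.
Proof.
elim: K L G v c => [|K IH] L G v c nG nv vE; first by exists c => // i [].
have [[k [j nz]]|z] := pselect (exists k j, G k j != 0); last first.
  exists 0; first exact: nb_0.
  rewrite mul0mx vE; apply/rowP => j; rewrite !mxE big1 // => k _.
  have -> : G k j = 0 by apply/eqP/negPn/negP => h; apply: z; exists k, j.
  by rewrite mulr0.
have [A [uA nA nG' zc]] := clear_col j nG.
have p0 := pivot_neq0 uA nz zc; set G' := A *m G in nG' zc p0.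
pose c1 : 'rV_(1 + K) := c *m invmx A.
have vE' : v = c1 *m G' by rewrite /c1 /G' -mulmxA (mulmxA (invmx A)) mulVmx // mul1mx.
have split := mul_split c1 (G' : 'M_(1 + K, N)).
have vj : v 0 j = c1 0 ord0 * G' ord0 j.
  rewrite vE' split mxE [X in X + _]mxE usub_E [X in _ + X]mxE big1 ?addr0 // => i _.
  by rewrite (dsub_zero zc) mulr0.
have a0 : (absz (c1 ord0 ord0) <= L)%N.
  apply: leq_trans (nv 0 j); rewrite vj abszM leq_pmulr // absz_gt0.
  by [].
pose w := v - c1 0 ord0 *: usubmx (G' : 'M_(1 + K, N)).
have wE : w = rsubmx c1 *m dsubmx (G' : 'M_(1 + K, N)) by rewrite /w vE' split addrC addKr.
have nw : nb (L + L * eR K L + eR K L) w.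
  have h : nb (L + absz (c1 ord0 ord0) * eR K L) w := nb_add nv (nb_opp (nb_scale (c1 0 ord0) (@nb_usub 1 K _ _ _ nG'))).
  apply: nb_le h.
  by rewrite -addnA leq_add2l; apply: leq_trans (leq_addr _ _); rewrite leq_mul2r a0 orbT.
have nd : nb (L + L * eR K L + eR K L) (dsubmx (G' : 'M_(1 + K, N))).
  by apply: nb_le (@nb_dsub 1 K _ _ _ nG'); rewrite leq_addl.
have [c2 nc2 wE2] := IH _ _ _ _ nd nw wE.
exists ((row_mx (c1 0 ord0)%:M c2 : 'rV_(1 + K)) *m A); last first.
  rewrite -mulmxA -/G' -(vsubmxK (G' : 'M_(1 + K, N))) mul_row_col mul_scalar_mx -wE2 /w.
  by rewrite addrC subrK.
apply: nb_mul => //; apply: (@nb_row_mx 1 1 K); last by apply: nb_le nc2; rewrite leq_addl.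
by move=> i i'; rewrite (ord1 i) (ord1 i') mxE eqxx mulr1n; apply: leq_trans (leq_addr _ _); exact: a0.
Qed.

Fixpoint lR N K (L : nat) : nat := if K is K'.+1 then
  ((L.+1 + eR K' L) * (lR N K' ((L.+1 + eR K' L) * (L.+1 + eR K' L))) +
   N * (eR K' L * lR N K' ((L.+1 + eR K' L) * (L.+1 + eR K' L))) + 1)%N else 1%N.

Lemma tb_lR K N f : tb f -> tb N -> tb (fun n => lR (N n) K (f n)).
Proof.
move=> tf tN; elim: K f tf => [|K IH] f tf /=; first exact: tb_const.
have te := tb_eR K tf.
have t1 : tb (fun n => (f n).+1 + eR K (f n))%N.
  apply: tb_add => //; by apply: tb_le (tb_add tf (tb_const 1)) _ => n; rewrite addn1.
have t2 := IH _ (tb_mul t1 t1).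
by apply: tb_add (tb_const _); apply: tb_add; [apply: tb_mul|apply: tb_mul => //; apply: tb_mul].
Qed.

Lemma lR_gt0 N K L : (0 < lR N K L)%N.
Proof. by case: K => //= K; rewrite addn1. Qed.

(** A vector has a multiple in the row space or is separated from it by a small linear
    form. *)
Lemma separate K N L (G : 'M[int]_(K, N)) (v : 'rV_N) : nb L G -> nb L v ->
  (exists a (c : 'rV_K), a != 0 /\ a *: v = c *m G) \/
  (exists lam : 'cV_N, [/\ nb (lR N K L) lam, G *m lam = 0 & v *m lam != 0]).
Proof.
have single (w : 'rV[int]_N) j M (X : 'M[int]_(M, N)) R : (0 < R)%N -> (forall k, X k j = 0) -> w 0 j != 0 ->
    exists lam : 'cV_N, [/\ nb R lam, X *m lam = 0 & w *m lam != 0].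
  move=> R0 z nz; have E M' (Y : 'M[int]_(M', N)) i k : (Y *m (delta_mx j ord0 : 'cV_N)) i k = Y i j.
    rewrite mxE (bigD1 j) //= mxE eqxx (ord1 k) mulr1 big1 ?addr0 // => l nl.
    by rewrite mxE (negPf nl) mulr0.
  exists (delta_mx j ord0); split.
  - by move=> i k; rewrite mxE; case: (_ && _).
  - by apply/matrixP => i k; rewrite E z mxE.
  - by apply: contra nz => /eqP /matrixP /(_ 0 0); rewrite E mxE => ->.
elim: K L G v => [|K IH] L G v nG nv.
  have [[j nz]|z] := pselect (exists j, v 0 j != 0).
    by right; apply: (single v j) => // -[].
  left; exists 1, 0; split=> //; rewrite scale1r mul0mx; apply/rowP => j; rewrite mxE.
  by apply/eqP/negPn/negP => h; apply: z; exists j.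
have [[k [j nz]]|z] := pselect (exists k j, G k j != 0); last first.
  have G0 : G = 0 by apply/matrixP => k j; rewrite mxE; apply/eqP/negPn/negP => h; apply: z; exists k, j.
  have [[j nz]|zv] := pselect (exists j, v 0 j != 0).
    by right; apply: (single v j _ G) => //; [apply: (lR_gt0 N K.+1)|move=> k; rewrite G0 mxE].
  left; exists 1, 0; split=> //; rewrite scale1r mul0mx; apply/rowP => j; rewrite mxE.
  by apply/eqP/negPn/negP => h; apply: zv; exists j.
have [A [uA nA nG' zc]] := clear_col j nG.
have p0 := pivot_neq0 uA nz zc; set G' := A *m G in nG' zc p0.
pose g0 := usubmx (G' : 'M_(1 + K, N)); pose G1 := dsubmx (G' : 'M_(1 + K, N)).
pose p := G' ord0 j; pose v' := p *: v - v 0 j *: g0.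
pose M := (L.+1 + eR K L)%N.
have pM : (absz p <= eR K L)%N by apply: nG'.
have vM : (absz (v ord0 j) <= L)%N by apply: nv.
have nv' : nb (M * M) v'.
  have h : nb (absz p * L + absz (v ord0 j) * eR K L) v' := nb_add (nb_scale p nv) (nb_opp (nb_scale (v 0 j) (@nb_usub 1 K _ _ _ nG'))).
  apply: nb_le h.
  apply: leq_trans (leq_add (leq_mul pM (leqnn L)) (leq_mul vM (leqnn _))) _.
  by rewrite /M; nia.
have n1 : nb (M * M) G1 by apply: nb_le (@nb_dsub 1 K _ _ _ nG') => //; rewrite /M; nia.
have eG lam : G' *m lam = 0 -> G *m lam = 0.
  by move=> h; rewrite -[G](mulKmx uA) -mulmxA h mulmx0.
case: (IH _ _ _ n1 nv') => [[a [c [na e]]]|[lam [nl z1 nz1]]].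
  left; exists (a * p), ((row_mx (a * v 0 j)%:M c : 'rV_(1 + K)) *m A).
  split; first by rewrite mulf_neq0.
  rewrite -mulmxA -/G' -(vsubmxK (G' : 'M_(1 + K, N))) mul_row_col mul_scalar_mx -e /v'.
  by rewrite scalerBr !scalerA -/g0 addrC subrK.
right; pose d : 'cV[int]_N := delta_mx j ord0.
have E M' (Y : 'M[int]_(M', N)) i k' : (Y *m d) i k' = Y i j.
  rewrite mxE (bigD1 j) //= mxE eqxx (ord1 k') mulr1 big1 ?addr0 // => l nl'.
  by rewrite mxE (negPf nl') mulr0.
pose t := (g0 *m lam) 0 0; exists (p *: lam - t *: d); split.
- have nt : (absz t <= N * (eR K L * lR N K (M * M)))%N by apply: (nb_mul (@nb_usub 1 K _ _ _ nG') nl).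
  have nd : nb 1 d by move=> i i'; rewrite mxE; case: (_ && _).
  apply: nb_le (nb_add (nb_scale p nl) (nb_opp (nb_scale t nd))).
  rewrite muln1 /= -addnA leq_add //; last by apply: leq_trans nt (leq_addr _ _).
  by rewrite leq_mul // (leq_trans pM) // leq_addl.
- apply: eG; have -> X : G' *m X = col_mx (g0 *m X) (G1 *m X) :> 'cV_(1 + K) by rewrite -(@mul_col_mx _ 1 K) vsubmxK.
  rewrite !mulmxBr -!scalemxAr z1 scaler0 sub0r.
  have -> : G1 *m d = 0 by apply/matrixP => i k'; rewrite E (dsub_zero zc) mxE.
  rewrite scaler0 oppr0; have -> : p *: (g0 *m lam) - t *: (g0 *m d) = 0; last by rewrite col_mx0.
  apply/matrixP => i k'; rewrite 2!mxE [X in _ + X]mxE [X in _ - X]mxE E usub_E !ord1 -/t -/p.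
  by rewrite !mxE; lia.
- apply: contra nz1 => /eqP h; apply/eqP.
  rewrite /v' mulmxBl -!scalemxAl; move: h; rewrite mulmxBr -!scalemxAr => <-.
  congr (_ - _); apply/matrixP => i k'; rewrite !mxE !ord1 -/t.
  have := E _ v 0 0; rewrite mxE => ->; have : t = (g0 *m lam) 0 0 by [].
  by rewrite mxE => <-; rewrite mulrC.
Qed.

Definition tors m N K (F : 'M[int]_(K, N)) (D : 'M[int]_(m, N)) :=
  forall i, exists a (c : 'rV_K), a != 0 /\ a *: row i D = c *m F.

Lemma lR_mono K N N' L : (N <= N')%N -> (lR N K L <= lR N' K L)%N.
Proof.
move=> le; elim: K L => //= K IH L; rewrite leq_add2r.
by apply: leq_add; rewrite !leq_mul.
Qed.

Lemma lin_val m N (D : 'M[int]_(m, N)) (lam : 'cV_N) b c : nb b D -> nb c lam ->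
  (\sum_i absz ((D *m lam)%R i ord0) <= m * (N * (b * c)))%N.
Proof.
move=> nD nl; apply: leq_trans (_ : \sum_(i < m) (N * (b * c)) <= _)%N.
  by apply: leq_sum => i _; apply: (nb_mul nD nl).
by rewrite sum_nat_const card_ord.
Qed.

Lemma row_rV N (X : 'rV[int]_N) i : row i X = X.
Proof. by apply/rowP => k; rewrite mxE (ord1 i). Qed.

Section MainInd.
Variable K : nat.
Hypothesis torsP : forall m, exists2 R, tb R & forall N L (F : 'M[int]_(K, N)) (D D' : 'M[int]_(m, N)),
  (N <= L)%N -> nb L F -> nb L D -> nb L D' -> tors F D -> eqv F D D' -> bpath F (R L) D D'.

(** If D is not torsion modulo F, a small linear form vanishing on F detects it. Euclid's
    algorithm concentrates its values in one row, for D and D' alike; that row is then frozen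
    and the number of moving rows decreases. *)
Lemma lin_path m : exists2 R, tb R & forall N L (F : 'M[int]_(K, N)) (D D' : 'M[int]_(m, N)),
  (N <= L)%N -> nb L F -> nb L D -> nb L D' -> eqv F D D' -> bpath F (R L) D D'.
Proof.
elim: m => [|m [R1 t1 IH]].
  exists id; first exact: tb_id.
  by move=> N L F D D' _ _ nD _ _; rewrite (flatmx0 D') -(flatmx0 D); apply: bp0.
have [R0 t0 tP] := torsP m.+1.
pose b1 L := (L * 2 ^ (m.+1 * (L * (L * lR L K L)) + 2))%N.
pose M L := maxn (R1 (b1 L)) (b1 L).
pose R L := (M L + (m + K) * cR (m + K) (2 * b1 L) * M L)%N.
have tb1 : tb b1.
  apply: tb_mul tb_id _; apply: tb_exp2; apply: tb_add (tb_const _); apply: tb_mul (tb_const _) _.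
  by apply: tb_mul tb_id _; apply: tb_mul tb_id _; apply: tb_lR; apply: tb_id.
have tM : tb M by apply: tb_max => //; apply: tb_comp.
exists (fun L => maxn (R0 L) (R L)).
  apply: tb_max => //; apply: tb_add => //; apply: tb_mul => //; apply: tb_mul (tb_const _) _.
  by apply: tb_cR; apply: tb_mul (tb_const _) _.
move=> N L F D D' NL nF nD nD' eq1.
have [tD|ntD] := pselect (tors F D).
  by apply: bp_le (tP _ _ _ _ _ NL nF nD nD' tD eq1); apply: leq_maxl.
apply: (@bp_le _ _ _ _ (R L)); first exact: leq_maxr.
have [i ni] : exists i, ~ exists a (c : 'rV_K), a != 0 /\ a *: row i D = c *m F.
  by apply: contrapT => no; apply: ntD => i; apply: contrapT => h; apply: no; exists i.
have [//|[lam [nl Fl vl]]] := separate nF (nb_row i nD).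
have {}nl : nb (lR L K L) lam by apply: nb_le nl; apply: lR_mono.
have vb (X : 'M[int]_(m.+1, N)) : nb L X -> (\sum_k absz ((X *m lam)%R k ord0) <= m.+1 * (L * (L * lR L K L)))%N.
  by move=> nX; apply: leq_trans (lin_val nX nl) _; rewrite leq_mul2l leq_mul ?orbT.
have [D1 [p1 z1]] := euclid F nD (vb _ nD).
have [D1' [p1' z1']] := euclid F nD' (vb _ nD').
rewrite -/(b1 L) in p1 p1'.
have bM : (b1 L <= M L)%N by apply: leq_maxr.
have MR : (M L <= R L)%N by apply: leq_addr.
have bR := leq_trans bM MR.
apply: bp_trans (bp_le bR p1) _; apply: bp_trans (bp_sym (bp_le bR p1')).
have [A [B [uA eA]]] := eqv_trans (eqv_sym (bp_eqv p1)) (eqv_trans eq1 (bp_eqv p1')).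
have nb1 := bp_r p1; have nb1' := bp_r p1'.
pose p := (D1 *m lam) ord0 0.
have pn : p != 0.
  apply/eqP => p0; case/eqP: vl; have [A' [B' [_ eD]]] := eqv_sym (bp_eqv p1).
  have D1l : D1 *m lam = 0.
    apply/colP => k; rewrite [RHS]mxE; have [->|nk] := eqVneq k ord0; last exact: z1.
    by rewrite -p0 /p; congr (_ _ _).
  by rewrite -row_mul eD mulmxDl -!mulmxA D1l Fl !mulmx0 addr0 raddf0.
have Acol k : k != ord0 -> A k ord0 = 0.
  move=> nk; have := z1' k nk; rewrite eA mulmxDl -!mulmxA Fl mulmx0 addr0 mxE (bigD1 ord0) //=.
  rewrite big1 ?addr0 => [|l nl']; last by rewrite z1 ?mulr0.
  by move=> /eqP; rewrite mulf_eq0 -/p (negPf pn) orbF => /eqP.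
pose a := A ord0 ord0.
have ulE : ulsubmx (A : 'M_(1 + m)) = a%:M.
  by apply/matrixP => k l; rewrite !mxE !ord1 eqxx mulr1n /a; congr (A _ _); apply: val_inj.
have dlE : dlsubmx (A : 'M_(1 + m)) = 0.
  apply/matrixP => k l; rewrite !mxE.
  have -> : lshift m l = ord0 :> 'I_m.+1 by apply: val_inj; rewrite (ord1 l).
  by rewrite Acol.
have AE : A = block_mx (a%:M : 'M_1) (ursubmx (A : 'M_(1 + m))) 0 (drsubmx (A : 'M_(1 + m))).
  by rewrite -ulE -dlE submxK.
set r := ursubmx _ in AE; set A2 := drsubmx _ in AE.
have dA : \det A = a * \det A2 by rewrite AE (@det_ublock _ 1 m) det_scalar1.
have : A \in unitmx by [].
rewrite unitmxE dA unitrM => /andP[ua uA2].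
have {}uA2 : A2 \in unitmx by rewrite unitmxE.
pose u := usubmx (D1 : 'M_(1 + m, N)); pose d := dsubmx (D1 : 'M_(1 + m, N)).
pose u' := usubmx (D1' : 'M_(1 + m, N)); pose d' := dsubmx (D1' : 'M_(1 + m, N)).
have Dud : D1 = col_mx u d by rewrite vsubmxK.
have Dud' : D1' = col_mx u' d' by rewrite vsubmxK.
have : col_mx u' d' = col_mx (a *: u + r *m d + usubmx (B : 'M_(1 + m, K)) *m F)
                             (A2 *m d + dsubmx (B : 'M_(1 + m, K)) *m F).
  have AD : A *m D1 = col_mx (a *: u + r *m d) (A2 *m d).
    transitivity (block_mx (a%:M : 'M_1) r 0 A2 *m col_mx u d); first by rewrite -AE -Dud.
    by rewrite (@mul_block_col _ 1 m 1 m) mul_scalar_mx mul0mx add0r.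
  have BF : B *m F = col_mx (usubmx (B : 'M_(1 + m, K)) *m F) (dsubmx (B : 'M_(1 + m, K)) *m F).
    by rewrite -(@mul_col_mx _ 1 m) vsubmxK.
  by rewrite -(@add_col_mx _ 1 m) -AD -BF -eA Dud'.
move=> /eq_col_mx [eu ed].
have nu : nb (b1 L) u by apply: (@nb_usub 1). have nd : nb (b1 L) d by apply: (@nb_dsub 1).
have nu' : nb (b1 L) u' by apply: (@nb_usub 1). have nd' : nb (b1 L) d' by apply: (@nb_dsub 1).
have Lb : (L <= b1 L)%N by rewrite leq_pmulr // expn_gt0.
have pd : bpath F (R1 (b1 L)) d d'.
  apply: IH => //; [exact: leq_trans Lb|exact: nb_le nF|].
  by exists A2, (dsubmx (B : 'M_(1 + m, K))).
have a1 : pm a.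
  by move: ua; rewrite qualifE /= => /orP[]/eqP ->; [left|right].
have nau : nb (b1 L) (a *: u) by apply: nb_pm.
rewrite Dud Dud'; apply: (@bp_trans _ _ _ _ _ _ (col_mx u d')).
  apply: bp_le MR _; apply: bp_lift; first exact: nb_le nu.
  by apply: bp_le pd; apply: leq_maxl.
apply: (@bp_trans _ _ _ _ _ _ (col_mx (a *: u) d')).
  case: (a1) => ->; first by rewrite scale1r; apply/bp0/(nb_le bR)/nb_col_mx.
  apply: bp_step; first by apply/(nb_le bR)/nb_col_mx.
    exists (lshift m ord0), (- u); last first.
      by apply: Or33; rewrite rowKu row_rV.
    apply/row_matrixP => k; rewrite row_upd; case: (split_ordP k) => l ->.
      by rewrite !rowKu (ord1 l) eqxx scaleN1r row_rV.
    by rewrite !rowKd eq_rlshift.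
  by apply/(nb_le bR)/nb_col_mx => //; rewrite scaleN1r; apply: nb_opp.
pose G := col_mx d' F; pose v := u' - a *: u.
have nG : nb (2 * b1 L) G.
  by apply: nb_col_mx; [apply: nb_le nd'; lia|apply: nb_le nF; lia].
have nv : nb (2 * b1 L) v by rewrite mul2n -addnn; apply: nb_add nu' (nb_opp nau).
have dE : d = invmx A2 *m d' - (invmx A2 *m dsubmx (B : 'M_(1 + m, K))) *m F.
  by rewrite ed mulmxDr !mulmxA mulVmx // mul1mx addrK.
have vE : v = row_mx (r *m invmx A2) (usubmx (B : 'M_(1 + m, K)) - r *m invmx A2 *m dsubmx (B : 'M_(1 + m, K))) *m G.
  have -> : v = r *m d + usubmx (B : 'M_(1 + m, K)) *m F.
    by rewrite /v eu [LHS]addrC !addrA addNr add0r.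
  by rewrite mul_row_col mulmxBl {1}dE mulmxBr !mulmxA -!addrA; congr (_ + _); rewrite addrC.
have [c nc vc] := combo nG nv vE.
have := @row_path _ _ _ F (M L) (col_mx (a *: u) d') (lshift m ord0) (row_mx 0 (lsubmx c)) (rsubmx c)
  ((m + K) * cR (m + K) (2 * b1 L)).
move=> /(_ (nb_le bM (nb_col_mx nau nd')) (nb_le (leq_trans Lb bM) nF)).
have -> : upd (col_mx (a *: u) d') (lshift m ord0) (row (lshift m ord0) (col_mx (a *: u) d') +
   row_mx 0 (lsubmx c) *m col_mx (a *: u) d' + rsubmx c *m F) = col_mx u' d'.
  rewrite rowKu mul_row_col mul0mx add0r -addrA -mul_row_col hsubmxK -/G -vc.
  have -> : row ord0 (a *: u) + v = u' by rewrite row_rV addrC subrK.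
  apply/row_matrixP => k; rewrite row_upd; case: (split_ordP k) => l ->.
    by rewrite !rowKu (ord1 l) eqxx row_rV.
  by rewrite !rowKd eq_rlshift.
move=> /(_ _ _)/wrap[]; first by rewrite row_mxEl mxE.
rewrite big_split_ord /= big1 ?add0n => [|k _]; last by rewrite row_mxEl mxE.
rewrite mulnDl; apply: leq_add.
    apply: leq_trans (_ : \sum_(k < m) cR (m + K) (2 * b1 L) <= _)%N; last by rewrite sum_nat_const card_ord.
  by apply: leq_sum => k _; rewrite row_mxEr mxE; apply: nc.
apply: leq_trans (_ : \sum_(k < K) cR (m + K) (2 * b1 L) <= _)%N; last by rewrite sum_nat_const card_ord.
  by apply: leq_sum => k _; rewrite mxE; apply: nc.
by [].
Qed.

End MainInd.

(** The general linear group over the integers is generated by row operations: the path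
    lemma without rows F, applied to two invertible matrices. *)
Lemma GL_gen m (A : 'M[int]_m) : A \in unitmx -> exists R, bpath (0 : 'M_(0, m)) R 1%:M A.
Proof.
move=> uA; have [|R _ RP] := @lin_path 0 _ m.
  move=> k; exists id; first exact: tb_id.
  move=> N L F D D' _ _ nD _ tD [A' [B' [_ ->]]].
  have -> : D = 0.
    apply/row_matrixP => i; have [a [c [na]]] := tD i.
    rewrite (flatmx0 F) mulmx0 => h; apply/rowP => l.
    have := congr1 (fun X : 'M[int]_(1, N) => X 0 l) h; rewrite !mxE => /eqP.
    by rewrite mulf_eq0 (negPf na) => /eqP ->.
  by rewrite (flatmx0 F) !mulmx0 addr0; apply/bp0/nb_0.
pose L := (m + 1 + \sum_i \sum_j absz (A i j))%N; exists (R L); apply: RP.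
- by rewrite /L; lia.
- by move=> [].
- by apply: nb_1; rewrite /L; lia.
- move=> i j; rewrite /L (bigD1 i) //= (bigD1 j) //=; lia.
- by exists A, 0; rewrite mulmx1 mul0mx addr0.
Qed.

Definition rc N K (F : 'M[int]_(K, N)) (u v : 'rV[int]_N) := exists y : 'rV_K, u = v + y *m F.

Lemma rc_refl N K (F : 'M[int]_(K, N)) u : rc F u u.
Proof. by exists 0; rewrite mul0mx addr0. Qed.
Lemma rc_sym N K (F : 'M[int]_(K, N)) u v : rc F u v -> rc F v u.
Proof. by move=> [y ->]; exists (- y); rewrite mulNmx addrK. Qed.
Lemma rc_trans N K (F : 'M[int]_(K, N)) u v w : rc F u v -> rc F v w -> rc F u w.
Proof. by move=> [y ->] [z ->]; exists (z + y); rewrite mulmxDl addrA. Qed.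
Lemma rc_add N K (F : 'M[int]_(K, N)) u v u' v' : rc F u v -> rc F u' v' -> rc F (u + u') (v + v').
Proof. by move=> [y ->] [z ->]; exists (y + z); rewrite mulmxDl addrACA. Qed.
Lemma rc_scale N K (F : 'M[int]_(K, N)) a u v : rc F u v -> rc F (a *: u) (a *: v).
Proof. by move=> [y ->]; exists (a *: y); rewrite scalerDr scalemxAl. Qed.

Lemma rc_path m N K L (F : 'M[int]_(K, N)) (D D' : 'M[int]_(m, N)) :
  nb L F -> nb L D -> nb L D' -> (forall i, rc F (row i D') (row i D)) ->
  bpath F (2 * L + K * cR K (2 * L) * (2 * L)) D D'.
Proof.
move=> nF nD nD' rcD; set R := (_ + _)%N.
pose E (k : nat) := \matrix_i (if (i < k)%N then row i D' else row i D).
have nE k : nb L (E k) by move=> i j; rewrite mxE; case: ifP => _; rewrite mxE.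
have E0 : E 0%N = D by apply/row_matrixP => i; rewrite rowK.
have Em : E m = D' by apply/row_matrixP => i; rewrite rowK ltn_ord.
suff key k : (k <= m)%N -> bpath F R D (E k) by have := key m (leqnn m); rewrite Em.
have L2 : (L <= 2 * L)%N by lia.
elim: k => [|k IH] le; first by rewrite E0; apply/bp0/(nb_le _ nD); rewrite /R; lia.
apply: bp_trans (IH (ltnW le)) _; pose i := Ordinal le.
have [y ey] := rcD i; have nv : nb (2 * L) (row i D' - row i D).
  by rewrite mul2n -addnn; apply: nb_add (nb_row i nD') (nb_opp (nb_row i nD)).
have [|c nc cE] := @combo K N (2 * L) F (row i D' - row i D) y (nb_le L2 nF) nv; first by rewrite ey addrC addKr.
have := @row_path _ _ _ F (2 * L) (E k) i 0 c (K * cR K (2 * L)) (nb_le L2 (nE k)) (nb_le L2 nF).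
rewrite mul0mx addr0 -cE rowK ltnn addrC subrK.
have -> : upd (E k) i (row i D') = E k.+1.
  apply/row_matrixP => l; rewrite row_upd !rowK ltnS; have [->|nl] := eqVneq l i; first by rewrite leqnn.
  by rewrite (leq_eqVlt l k) (_ : (val l == k) = false) //; apply/negP => /eqP e; case/eqP: nl; apply: val_inj.
apply; first by rewrite mxE.
rewrite big1 ?add0n => [|j _]; last by rewrite mxE.
apply: leq_trans (_ : \sum_(k < K) cR K (2 * L) <= _)%N; last by rewrite sum_nat_const card_ord.
by apply: leq_sum => j _; apply: nc.
Qed.

Lemma tors_comb m N K (F : 'M[int]_(K, N)) (D : 'M[int]_(m, N)) (c : 'rV_m) u : tors F D ->
  rc F u (c *m D) -> exists a (e : 'rV_K), a != 0 /\ a *: u = e *m F.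
Proof.
move=> tD [y ->].
suff [a [e [na eE]]] : exists a (e : 'rV_K), a != 0 /\ a *: (c *m D) = e *m F.
  by exists a, (e + a *: y); split=> //; rewrite scalerDr eE mulmxDl scalemxAl.
rewrite mulmx_sum_row; elim: (index_enum _) => [|i r [a [e [na eE]]]].
  by exists 1, 0; rewrite big_nil scaler0 mul0mx.
have [a' [e' [na' eE']]] := tD i; exists (a' * a), ((a * c 0 i) *: e' + a' *: e).
split; first by rewrite mulf_neq0.
rewrite big_cons scalerDr -scalerA mulmxDl -!scalemxAl -eE -eE' !scalerA.
by congr (_ + _); rewrite -scalerA scalerA; congr (_ *: _); lia.
Qed.

(** A vector with a multiple in a lattice is congruent to a small one: reduce the
    coefficients modulo the multiplier. *)
Lemma tors_red N K L (F : 'M[int]_(K, N)) u a (e : 'rV_K) : nb L F -> a != 0 -> a *: u = e *m F ->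
  exists2 w, nb (K * L) w & rc F w u.
Proof.
move=> nF na ae; pose y : 'rV[int]_K := \row_k (e ord0 k %/ a)%Z; pose z : 'rV[int]_K := \row_k (e ord0 k %% a)%Z.
have ez : e = a *: y + z by apply/rowP => k; rewrite !mxE mulrC; apply: divz_eq.
exists (u - y *m F); last by exists (- y); rewrite mulNmx.
have wE : a *: (u - y *m F) = z *m F.
  by rewrite scalerBr ae scalemxAl -mulmxBl ez addrC addKr.
move=> i j; have h : (absz a * absz ((u - y *m F)%R i j) = absz ((z *m F)%R i j))%N by rewrite -wE [in RHS]mxE abszM.
have : (absz a * absz ((u - y *m F)%R i j) <= absz a * (K * L))%N; last first.
  by rewrite leq_pmul2l // absz_gt0.
rewrite h mxE; apply: leq_trans (absz_sum _ _) _.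
apply: leq_trans (_ : \sum_(k < K) absz a * L <= _)%N; last by rewrite sum_nat_const card_ord mulnCA.
apply: leq_sum => k _; rewrite abszM leq_mul // (ord1 i) mxE.
have := ltz_mod (e ord0 k) na; have := modz_ge0 (e ord0 k) na; lia.
Qed.

(** Torsion rows are kept small by reducing modulo F after each of the operations
    that express the invertible matrix. *)
Lemma tors_path K m : exists2 R, tb R & forall N L (F : 'M[int]_(K, N)) (D D' : 'M[int]_(m, N)),
  (N <= L)%N -> nb L F -> nb L D -> nb L D' -> tors F D -> eqv F D D' -> bpath F (R L) D D'.
Proof.
pose C L := (L + K * L)%N; pose R L := (2 * (2 * C L) + K * cR K (2 * (2 * C L)) * (2 * (2 * C L)))%N.
have tC : tb C by apply: tb_add tb_id _; apply: tb_mul (tb_const _) tb_id.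
have t4 : tb (fun L => 2 * (2 * C L))%N by do 2 apply: tb_mul (tb_const _) _.
exists R; first by apply: tb_add => //; apply: tb_mul => //; apply: tb_mul (tb_const _) _; apply: tb_cR.
move=> N L F D D' NL nF nD nD' tD [A [B [uA eD']]].
have LC : (L <= 2 * C L)%N by rewrite /C; lia.
have CR : (2 * C L <= R L)%N by rewrite /R; lia.
have CC : (C L <= 2 * C L)%N by lia.
have [R' pA] := GL_gen uA.
suff key E : bpath (0 : 'M_(0, m)) R' 1%:M E -> exists D2, [/\ bpath F (R L) D D2, nb (C L) D2 &
    forall i, rc F (row i D2) (row i E *m D)].
  have [D2 [p2 n2 rc2]] := key _ pA; apply: bp_trans p2 _.
  apply: rc_path; [exact: nb_le nF|exact: nb_le n2|exact: nb_le nD'|] => i.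
  apply: rc_trans (rc_sym (rc2 i)); exists (row i B).
  by rewrite eD' raddfD /= !row_mul.
elim=> [_|E1 E2 _ [D2 [p2 n2 rc2]] [i [v -> h]] _].
  exists D; split; first by apply/bp0/(nb_le _ nD); apply: leq_trans CR.
    by apply: nb_le nD; rewrite /C; lia.
  by move=> i; rewrite -row_mul mul1mx; apply: rc_refl.
have [w2 [st2 rcw nw]] : exists w2, [/\ step F D2 (upd D2 i w2), rc F w2 (v *m D) & nb (2 * C L) w2].
  case: h => [[s [j [ps nj ->]]]|[s [[]]]//|->].
  - exists (row i D2 + s *: row j D2); split.
    + by exists i, (row i D2 + s *: row j D2) => //; apply: Or31; exists s, j.
    + by rewrite mulmxDl -scalemxAl; apply: rc_add => //; apply: rc_scale.
    + by rewrite mul2n -addnn; apply: nb_add; [apply: nb_row|apply/nb_pm/nb_row].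
  - exists (- row i D2); split.
    + by exists i, (- row i D2) => //; apply: Or33.
    + by rewrite mulNmx -!scaleN1r; apply: rc_scale.
    + by apply: nb_le (nb_opp (nb_row i n2)).
have [a [e [na ae]]] := tors_comb tD rcw.
have [w nw3 rcw3] := tors_red nF na ae.
have nw3' : nb (C L) w by apply: nb_le nw3; rewrite /C; lia.
exists (upd D2 i w); split.
- apply: bp_trans p2 _; have nu : nb (2 * C L) (upd D2 i w2) by apply: nb_upd => //; apply: nb_le n2.
  apply: bp_trans (bp_step _ st2 (nb_le CR nu)) _; first by apply: nb_le n2; apply: leq_trans CR.
  apply: rc_path; [exact: nb_le nF|exact: nu| |].
    by apply: nb_upd; [apply: nb_le n2|apply: nb_le nw3'].
  by move=> k; rewrite !row_upd; case: eqP => // _; apply: rc_refl.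
- exact: nb_upd.
- move=> k; rewrite !row_upd; case: eqP => // _; exact: rc_trans rcw3 rcw.
Qed.

Theorem rows_path K m : exists2 R, tb R & forall N L (F : 'M[int]_(K, N)) (D D' : 'M[int]_(m, N)),
  (N <= L)%N -> nb L F -> nb L D -> nb L D' -> eqv F D D' -> bpath F (R L) D D'.
Proof. by apply: lin_path => k; apply: tors_path. Qed.

End Rows.

(** * Paths of class automorphisms that do not raise the cyclic length *)

Section Paths.
Variable D : sgraph.
Implicit Types (a b : letter D) (x y z t v : D).
Local Notation G := (raag (@edge D)).
Local Notation gw := (raag_of_word (@edge D)).
Local Open Scope group_scope.
Implicit Types (U V W : seq G).

Definition cyq (g : G) : G := sval (cid (cyc_ex g)).
Definition cyc (g : G) : G := (cyq g)^-1 * g * cyq g.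
Definition clen (g : G) : int := len (cyc g).

Lemma cyc_cycred g : cycred (cyc g).
Proof. exact: (svalP (cid (cyc_ex g))). Qed.

Lemma cycK g : g = cyq g * cyc g * (cyq g)^-1.
Proof. by rewrite /cyc !mulgA mulgV mul1g mulgK. Qed.

Lemma clen_ge0 g : (0 <= clen g)%R. Proof. exact: len_ge0. Qed.

Lemma clen_le g q : (clen g <= len (q^-1 * g * q)%g)%R.
Proof.
have := cycred_min ((cyq g)^-1 * q) (cyc_cycred g).
by rewrite /clen {2}/cyc invgM invgK !mulgA !mulgK.
Qed.

Lemma clen_len g : (clen g <= len g)%R.
Proof. by have := clen_le g 1; rewrite invg1 mul1g mulg1. Qed.

Lemma clen_cycred c : cycred c -> clen c = len c.
Proof.
by move=> cc; apply/eqP; rewrite eq_le clen_len /= /clen; apply: cycred_min.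
Qed.

Lemma clenJ g p : clen (p^-1 * g * p) = clen g.
Proof.
have le h q : (clen h <= clen (q^-1 * h * q)%g)%R.
  rewrite [X in (_ <= X)%R]/clen /cyc; set r := cyq _.
  by have := clen_le h (q * r); rewrite invgM !mulgA.
apply: le_anti; apply/andP; split; last exact: le.
have := le (p^-1 * g * p) p^-1.
by rewrite invgK !mulgA mulgV mul1g mulgK.
Qed.

Lemma pow_le_clen g n : (len (g ^+ n)%g <= n%:Z * clen g + 2 * len (cyq g))%R.
Proof.
rewrite {1}(cycK g) -{1}(invgK (cyq g)) conjX -(lenV (cyq g)) invgK.
have := len_conj (cyq g)^-1 (cyc g ^+ n); rewrite !invgK.
by rewrite (cycred_pow _ (cyc_cycred g)).
Qed.

(** Powers of powers: conjugation costs a bounded amount, repetition a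
    linear one. *)
Lemma clen_pow g n : (n%:Z * clen g <= len (g ^+ n)%g)%R.
Proof.
rewrite leNgt; apply/negP => h.
pose m := (absz (2 * len (cyq g))%R).+1.
have mb : (2 * len (cyq g) < m%:Z)%R by rewrite /m; have := len_ge0 (cyq g); lia.
clearbody m.
have h1 := len_pow (g ^+ n) m.
have h2 : (m%:Z * (n%:Z * clen g) <= len ((g ^+ n) ^+ m)%g + 2 * len (cyq g))%R.
  rewrite mulrA -PoszM mulnC -(cycred_pow _ (cyc_cycred g)) -expgnA /cyc conjX.
  exact: len_conj.
have := len_ge0 (cyq g); move: mb h h1 h2.
move: (len (cyq g)) (len ((g ^+ n) ^+ _)) (len (g ^+ n)) => q A B mb h h1 h2 q0.
have : (m%:Z * (n%:Z * clen g) >= m%:Z * (B + 1))%R by rewrite ler_pM2l //; lia.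
rewrite mulrDr mulr1 => h3; have := le_trans h3 h2; lia.
Qed.

Definition slen (W : seq G) : int := (\sum_(w <- W) len w)%R.
Definition scl (U : seq G) : int := (\sum_(u <- U) clen u)%R.

Lemma scl_ge0 U : (0 <= scl U)%R.
Proof. by apply: sumr_ge0 => u _; apply: clen_ge0. Qed.

Definition powl n U : seq G := [seq (u ^+ n)%g | u <- U].

Lemma scl_pow_le U n (al : G -> G) : ishom al ->
  (n%:Z * scl (map al U) <= slen (map al (powl n U)))%R.
Proof.
move=> aM; rewrite /scl /slen /powl !big_map mulr_sumr; apply: ler_sum => u _.
by rewrite homX //; apply: clen_pow.
Qed.

Lemma scl_pow_ge U n (al : G -> G) : ishom al ->
  (slen (map al (powl n U)) <=
   n%:Z * scl (map al U) + \sum_(u <- U) 2 * len (cyq (al u)))%R.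
Proof.
move=> aM; rewrite /scl /slen /powl !big_map mulr_sumr -big_split /=; apply: ler_sum => u _.
by rewrite homX //; apply: pow_le_clen.
Qed.

Definition cmove U V := exists z f B,
  [/\ forall x, cls z x -> functional z (f x), rinv z f B, linv z f B & V = map (bet z f) U].
Definition pmove U V := exists2 p : letter D -> letter D,
  injective p & exists al : G -> G, [/\ isaut al, forall a, al (lt a) = lt (p a) & V = map al U].

Inductive mpath (L : int) (U : seq G) : seq G -> Prop :=
| Mp0 : mpath L U U
| MpC V W : mpath L U V -> (scl V <= L)%R -> (scl W <= L)%R -> cmove V W -> mpath L U W
| MpP V W : mpath L U V -> (scl V <= L)%R -> (scl W <= L)%R -> pmove V W \/ pmove W V -> mpath L U W.

Lemma slen_ge0 W : (0 <= slen W)%R.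
Proof. by apply: sumr_ge0 => u _; apply: len_ge0. Qed.

(** The total length of the images of W is a natural number, so descending by class
    automorphisms ends; the tuple U follows along. *)
Lemma descent U W L : (forall al, isaut al -> (slen (map al W) <= slen W)%R -> (scl (map al U) <= L)%R) ->
  exists2 al, isaut al & classmin (map al W) /\ mpath L U (map al U) /\ (slen (map al W) <= slen W)%R.
Proof.
move=> bd.
suff loop n al : isaut al -> (slen (map al W) <= slen W)%R -> mpath L U (map al U) ->
    (slen (map al W) <= n%:Z)%R ->
    exists2 al, isaut al & classmin (map al W) /\ mpath L U (map al U) /\ (slen (map al W) <= slen W)%R.
  apply: (loop (absz (slen W)) id); rewrite ?map_id //; first exact: aut_id.
    exact: Mp0.
  by have := slen_ge0 W; lia.
elim: n al => [|n IH] al aA le pA sn.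
  exists al => //; split=> // z f B _ _ _.
  apply: le_trans sn _; apply: sumr_ge0 => w _; exact: len_ge0.
have [cm|] := pselect (classmin (map al W)); first by exists al.
move=> /existsNP[z] /existsNP[f] /existsNP[B] /existsNP[ff] /existsNP[r] /existsNP[l] /negP.
rewrite -ltNge -(big_map _ predT (fun w => len w)) -/(slen _) -map_comp => lt.
have [bA _ _] := bet_aut ff r l.
have bal := aut_comp bA aA.
have le' : (slen (map (bet z f \o al) W) <= slen W)%R.
  by apply: le_trans le; apply: ltW.
apply: (IH (bet z f \o al)) => //; last first.
  have lt1 : (slen (map (bet z f \o al) W) < slen (map al W))%R := lt.
  by move: lt1 sn; set a := slen _; set b := slen (map al _); lia.
apply: (MpC pA); [exact: bd|exact: bd|].
by exists z, f, B; split=> //; rewrite -map_comp.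
Qed.

Lemma lt_inj : injective (@lt D).
Proof.
move=> a b e; have := ab_lt a.1 a; rewrite e ab_lt.
case: a e => x s e; case: b e => y t e /=.
rewrite /sdl /inv /=; case: s e => e; case: t e => e; do ?case: eqP => //=; try by case=> ->.
all: by case=> ->.
Qed.

Lemma aut_inj (al : G -> G) : isaut al -> injective al.
Proof. by move=> [_ [be [_ K _]]]; apply: can_inj K. Qed.

(** Each generator has an image of length at least one, so all have length one. *)
Lemma letters_perm (al : G -> G) : isaut al -> (\sum_x len (al (gen x)) <= #|D|%:Z)%R ->
  exists2 p : letter D -> letter D, injective p & forall a, al (lt a) = lt (p a).
Proof.
move=> aA le; have aM := aA.1.
have l1 x : (1 <= len (al (gen x)))%R.
  have := len_ge0 (al (gen x)); rewrite le_eqVlt => /orP[/eqP e|]; last by lia.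
  have /len_eq0 e1 := esym e.
  have : gen x = 1 by apply: (aut_inj aA); rewrite e1 (hom1 aM).
  by move=> /(congr1 (ab x)); rewrite ab1 /gen ab_gen eqxx.
have len1 x : len (al (gen x)) = 1%R.
  apply/eqP; rewrite eq_le l1 andbT.
  move: le; rewrite (bigD1 x) //= => le.
  have : (\sum_(i | i != x) 1%R <= \sum_(i | i != x) len (al (gen i)))%R by apply: ler_sum.
  rewrite sumr_const (cardC1 x) => h.
  have : (0 < #|D|)%N by apply/card_gt0P; exists x.
  move=> D0; move: (le_trans (lerD (lexx (len (al (gen x)))) h) le); rewrite natz; move: D0; move: (len _) => l; case: #|D| => // d _; by rewrite /= -[d.+1]addn1 PoszD [X in (_ <= X)%R]addrC lerD2r.
have /choice[p pP] a : exists b, al (lt a) = lt b.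
  case: a => x [|]; last exact: len_eq1 (len1 x).
  have [b e] := len_eq1 (len1 x); exists (inv b).
  by rewrite -[(x, true)]/(inv (x, false)) ltV (homV _ aM) -/(gen x) e ltV.
by exists p => // a b e; apply/lt_inj/(aut_inj aA); rewrite !pP e.
Qed.

(** The list W contains the n-th powers of U and M copies of the preimages of the
    generators under ga. At a local minimum al the automorphism ga cannot do better; the error
    terms C and C' are dominated by M and n, so that al differs from ga by a permutation of the
    letters and no stage raises the cyclic length. *)
Lemma descend_min U ga : isaut ga ->
  (forall al, isaut al -> (scl (map ga U) <= scl (map al U))%R) ->
  mpath (scl U) U (map ga U).
Proof.
move=> gA gmin; have [gM [gi [giM gK giK]]] := gA.
have giA : isaut gi by split=> //; exists ga.
pose C := (\sum_(u <- U) 2 * len (cyq (ga u)))%R.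
have C0 : (0 <= C)%R by apply: sumr_ge0 => u _; have := len_ge0 (cyq (ga u)); lia.
(* M dominates C, so that the last automorphism permutes the letters *)
pose M := (absz C).+1.
pose X := [seq gi (gen x) | x <- enum D].
pose C' := (\sum_(u <- U) 2 * len (cyq u) + M%:Z * slen X)%R.
have C'0 : (0 <= C')%R.
  apply: addr_ge0; last by apply: mulr_ge0 => //; apply: slen_ge0.
  by apply: sumr_ge0 => u _; have := len_ge0 (cyq u); lia.
(* n dominates C', so that the descent never raises the cyclic length *)
pose n := (absz C').+1.
pose W := (powl n U) ++ flatten (nseq M X).
have sW al : slen (map al W) = (slen (map al (powl n U)) + M%:Z * slen (map al X))%R.
  rewrite /slen map_cat big_cat map_flatten map_nseq; congr (_ + _)%R.
  elim: (M) => [|m IH]; first by rewrite big_nil mul0r.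
  by rewrite /= big_cat /= IH intS mulrDl mul1r.
have bd al : isaut al -> (slen (map al W) <= slen W)%R -> (scl (map al U) <= scl U)%R.
  move=> aA le; have := scl_pow_le U n aA.1; have := scl_pow_ge U n ((fun _ _ => erefl) : ishom id).
  rewrite !map_id => h1 h2.
  have := slen_ge0 (map al X); move: le; have := sW id; rewrite !map_id sW => -> le x0.
  have h3 : (n%:Z * scl (map al U) <= n%:Z * scl U + C')%R.
    have := mulr_ge0 (isT : (0 <= M%:Z)%R) x0.
    rewrite /C'; move: h1 h2 le; move: (M%:Z * slen (map al X))%R (M%:Z * slen X)%R => A B; lia.
  rewrite leNgt; apply/negP => h.
  have : (n%:Z * (scl U + 1) <= n%:Z * scl (map al U))%R by rewrite ler_pM2l //; lia.
  by rewrite mulrDr mulr1 => h4; have := le_trans h4 h3; rewrite /n; lia.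
have [al aA [cm [pa le]]] := descent bd.
have [aM [ai [aiM aK aiK]]] := aA.
have aiA : isaut ai by split=> //; exists al.
have m1 := classmin_min cm (aut_comp gA aiA).
have e1 : (\sum_(w <- map al W) len ((ga \o ai) w))%R = slen (map ga W).
  by rewrite /slen !big_map; apply: eq_bigr => w _ /=; rewrite aK.
rewrite e1 -/(slen _) !sW in m1.
have sX : slen (map ga X) = Posz #|D|.
  rewrite /slen /X !big_map -enumT big_enum /= (eq_bigr (fun=> 1%R)); last first.
    by move=> x _; rewrite giK /gen -[lt _]/(gw [:: _]) len_red.
  by rewrite sumr_const natz.
have l1 := scl_pow_le U n aM; have l2 := scl_pow_ge U n gM.
have l3 := gmin _ aA.
have l4 : (n%:Z * scl (map ga U) <= n%:Z * scl (map al U))%R by rewrite ler_pM2l.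
have l5 : (slen (map al X) <= #|D|%:Z)%R.
  rewrite leNgt; apply/negP => h.
  have : (M%:Z * (#|D|%:Z + 1) <= M%:Z * slen (map al X))%R by rewrite ler_pM2l //; lia.
  rewrite sX in m1; rewrite mulrDr mulr1 => l6.
  have MC : (C < M%:Z)%R by rewrite /M; move: C0; lia.
  move: m1 l1 l2 l4 l6 MC; rewrite -/C; clearbody C M n.
  move: (n%:Z * scl (map ga U))%R (n%:Z * scl (map al U))%R (M%:Z * #|D|%:Z)%R (M%:Z * slen (map al X))%R.
  move: (slen (map al (powl n U))) (slen (map ga (powl n U))) => a1 a2 a3 a4 a5 a6 q1 q2 q3 q4 q5 q6.
  lia.
have [p pi pP] : exists2 p : letter D -> letter D, injective p & forall a, (al \o gi) (lt a) = lt (p a).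
  apply: letters_perm; first exact: aut_comp.
  by move: l5; rewrite /slen /X !big_map -enumT big_enum.
apply: (MpP pa).
- exact: bd.
- by have := gmin id (@aut_id D); rewrite map_id.
right; exists p => //; exists (al \o gi); split=> //; first exact: aut_comp.
by rewrite -map_comp; apply: eq_map => u /=; rewrite gK.
Qed.

(** Both descents end at the same tuple of minimal cyclic length. *)
Lemma orbit_paths U V al : isaut al -> V = map al U ->
  exists W, mpath (scl U) U W /\ mpath (scl V) V W.
Proof.
move=> aA ->.
have [ga gA gmin] : exists2 ga, isaut ga & forall be, isaut be -> (scl (map ga U) <= scl (map be U))%R.
  pose P n := `[< exists2 ga, isaut ga & scl (map ga U) = Posz n >].
  have P0 : exists n, P n.
    exists (absz (scl U)); apply/asboolP; exists id; first exact: aut_id.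
    by rewrite map_id gez0_abs // scl_ge0.
  case: (ex_minnP P0) => n /asboolP[ga gA e] m; exists ga => // be bA.
  rewrite e; have := m (absz (scl (map be U))); rewrite -lez_nat gez0_abs ?scl_ge0 //.
  by apply; apply/asboolP; exists be; rewrite ?gez0_abs ?scl_ge0.
have [aM [ai [aiM aK aiK]]] := aA.
have aiA : isaut ai by split=> //; exists al.
exists (map ga U); split; first exact: descend_min.
have -> : map ga U = map (ga \o ai) (map al U).
  by rewrite -map_comp; apply: eq_map => u /=; rewrite aK.
apply: descend_min; first exact: aut_comp.
move=> be bA; rewrite -!map_comp (_ : map _ _ = map ga U); last first.
  by apply: eq_map => u /=; rewrite aK.
by apply: gmin; apply: aut_comp.
Qed.

End Paths.

(** * Turns *)

Section CosetSums.
Variables (G : groupType) (K : G -> Prop).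
Hypothesis sK : subg K.
Local Open Scope group_scope.

Lemma isum_ge (s : seq G) (F : G -> int) : kinv K F -> kfin K F -> (forall g, (0 <= F g)%R) ->
  uniq (map (rep K) s) -> (\sum_(u <- s) F u <= isum K F)%R.
Proof.
move=> Fi Ff F0 us; have fs := kfin_fsup sK Ff.
pose E g : int := if g \in map (rep K) s then F g else 0%R.
have Es g : E g != 0%R -> g \in map (rep K) s by rewrite /E; case: ifP.
have -> : (\sum_(u <- s) F u)%R = S E.
  rewrite (SE us Es) big_map big_seq [RHS]big_seq; apply: eq_bigr => u us'.
  rewrite /E; case: ifP => [_|/negP[]]; last by apply/mapP; exists u.
  by apply/esym/(keqP Fi); apply: rep_keq.
apply: S_le => //; first by exists (map (rep K) s).
move=> g; rewrite /E; case: ifP => [/mapP[u _ ->]|_]; first by rewrite rep_idem // eqxx.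
by case: ifP.
Qed.

End CosetSums.

Section Turns.
Variable D : sgraph.
Implicit Types (a b p : letter D) (x y : D) (h v w : word D).
Local Notation G := (raag (@edge D)).
Local Notation gw := (raag_of_word (@edge D)).
Local Notation F z := (par (st z)).
Local Open Scope group_scope.

Definition wpow v n : word D := flatten (nseq n v).

Lemma gw_wpow v n : gw (wpow v n) = gw v ^+ n.
Proof. by elim: n => [|n IH]; rewrite /wpow /= ?gw0 // gwM expgS -IH. Qed.

Lemma wpowD v m n : wpow v (m + n) = wpow v m ++ wpow v n.
Proof. by rewrite /wpow nseqD flatten_cat. Qed.

Lemma wpow1 v : wpow v 1 = v. Proof. by rewrite /wpow /= cats0. Qed.

(** The word realizes the cyclic length, so that all its powers are reduced. *)
Definition tight v := Posz (size v) = clen (gw v).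

Lemma tight_cycred v : tight v -> cycred (gw v).
Proof.
move=> tv; apply: min_cycred => q; apply: le_trans (clen_le _ _).
by rewrite -tv len_size.
Qed.

Lemma tight_pow v n : tight v -> red (wpow v n).
Proof.
move=> tv; have cc := tight_cycred tv; apply: red_of_len.
rewrite gw_wpow cycred_pow // -clen_cycred // -tv /wpow size_flatten /shape map_nseq sumn_nseq.
by rewrite PoszM mulrC.
Qed.

Variable z : D.

Definition turn := (word D * option (letter D * letter D))%type.

(** A turn consists of a stretch h in the star of z with the letters b after it
    and p before it that lie outside. *)
Fixpoint trn p h v : seq turn := if v is a :: v' then
  if st z a.1 then trn p (rcons h a) v' else (h, Some (a, p)) :: trn a [::] v' else [::].

Definition turns v : seq turn := if all (fun a => st z a.1) v then [:: (v, None)]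
  else if v is a :: _ then trn (last a v) [::] v else [::].

(** A cyclic word is read from an occurrence of a letter outside the star of z, if
    there is one, so that it is a sequence of turns. *)
Definition ends v := all (fun a => st z a.1) v || (if v is a :: _ then ~~ st z (last a v).1 else true).

Lemma rot_end v : exists2 v', ends v' & (exists q, gw v' = q^-1 * gw v * q) /\ size v' = size v.
Proof.
have [av|] := boolP (all (fun a => st z a.1) v).
  by exists v; rewrite /ends ?av //; split=> //; exists 1; rewrite invg1 mul1g mulg1.
rewrite -has_predC => /split_find[a p r nsa _].
exists (r ++ rcons p a).
  rewrite /ends; apply/orP; right; case e: (r ++ _) => [//|c s].
  by rewrite -e last_cat last_rcons.
split; last by rewrite !size_cat addnC.
by exists (gw (rcons p a)); rewrite !gwM mulKg.
Qed.

Lemma tight_rep (g : G) : exists v, [/\ tight v, ends v & exists q, gw v = q^-1 * g * q].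
Proof.
have [v ev [[q e] s]] := rot_end (rw (cyc g)).
have e2 : gw v = (cyq g * q)^-1 * g * (cyq g * q) by rewrite e rwK /cyc invgM !mulgA.
exists v; split=> //; last by exists (cyq g * q).
by rewrite /tight e2 clenJ s -len_rw.
Qed.

Definition tvl (f : letter D -> int) (t : turn) : int :=
  (\sum_(a <- t.1) f a + (if t.2 is Some (b, p) then f b - f (inv p) else 0))%R.

Lemma trn_split p h v t : all (fun a => st z a.1) h -> t \in trn p h v ->
  exists b pre post, [/\ h ++ v = pre ++ t.1 ++ b :: post, all (fun a => st z a.1) t.1,
    ~~ st z b.1 & ~~ st z p.1 -> ~~ st z (last p pre).1 /\ t.2 = Some (b, last p pre)].
Proof.
elim: v p h => // a v IH p h ah /=; case: ifP => sa.
  move=> /IH[|b [pre [post [e at1 nb e2]]]]; first by rewrite all_rcons sa.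
  by exists b, pre, post; rewrite -cat_rcons.
rewrite inE => /orP[/eqP ->|]; first by exists a, [::], v; rewrite /= sa; split.
move=> /IH[//|b [pre [post [e at1 nb e2]]]].
exists b, (h ++ a :: pre), post; split=> //; first by rewrite -catA /= -e.
by move=> _; rewrite last_cat; apply: e2; rewrite sa.
Qed.

Lemma Lamw_st (f : letter D -> int) h v : all (fun a => st z a.1) h ->
  Lamw z f (h ++ v) = (\sum_(a <- h) f a + Lamw z f v)%R.
Proof.
elim: h => [|a h IH] /=; first by rewrite big_nil add0r.
by case/andP=> sa /IH e; rewrite sa e big_cons addrA.
Qed.

(** Each period of the power contains the turn once; seen from just before the turn, the
    level changes by the value of f on the turn, and these positions lie in different
    cosets of the flat. *)
Lemma turn_N f v t n : functional z f -> tight v -> ends v -> t \in turns v ->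
  (n%:Z * `|tvl f t| <= N z f (gw v ^+ n.+1)%g)%R.
Proof.
move=> ff tv ev; have sF := @par_subg D (st z).
have fin : kfin (F z) (fun g => `|Lam z f (g * gw v ^+ n.+1)%g - Lam z f g|%R).
  by apply: vfin_n => //; apply: Lam_vfin.
have ge := isum_ge sF (kinv_n (Lam_quasi ff) (gw v ^+ n.+1)) fin (fun g => normr_ge0 _).
rewrite /turns; case: ifP => [av|nav].
  rewrite inE => /eqP ->; rewrite /tvl addr0 /=.
  have := ge [:: 1] isT; rewrite big_seq1 => h; apply: le_trans h.
  have -> : (Lam z f (1%g * (gw v ^+ n.+1)%g)%g - Lam z f 1%g = Lam z f (gw v ^+ n.+1)%g)%R 
    by rewrite (_ : 1%g * gw v ^+ n.+1 = gw v ^+ n.+1) ?mul1g // (_ : Lam z f 1%g = 0%R) ?subr0 // Lam1.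
  have -> : Lam z f (gw v ^+ n.+1) = ((n.+1)%:Z * \sum_(a <- v) f a)%R.
    rewrite -gw_wpow LamE ?tight_pow //; elim: (n.+1) => [|m IH]; first by rewrite mul0r.
    by rewrite /wpow /= Lamw_st // -/(wpow v m) IH intS mulrDl mul1r.
  by rewrite normrM; apply: ler_wpM2r; [exact: normr_ge0 | lia].
clear fin; move=> tin0.
have {tin0} [a0 [lv np tin]] : exists a0, [/\ forall q, last q v = last a0 v, ~~ st z (last a0 v).1 & t \in trn (last a0 v) [::] v].
  by move: ev tin0; rewrite /ends nav /=; case: (v) => // a w l tin; exists a.
have [b [pre [post [e ah nsb e2]]]] := trn_split (isT : all _ [::]) tin.
rewrite /= in e.
(* the position just before the turn in the k-th period *)
pose u k := (gw (wpow v k.+1 ++ pre))^-1.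
have lp k : exists w, wpow v k.+1 ++ pre = rcons w (last (last a0 v) pre).
  rewrite -[_ ++ pre]cats0; case/lastP E: (wpow v k.+1 ++ pre) => [|w p]; first by move: E; rewrite /wpow /= e; case: (pre) (t.1) => // -[].
  exists w.
  rewrite cats0; congr rcons; have := congr1 (last a0) E; rewrite last_rcons => <-.
  by rewrite last_cat -[k.+1]addn1 wpowD last_cat wpow1 lv.
have [nsp {}e2] : ~~ st z (last (last a0 v) pre).1 /\ t.2 = Some (b, last (last a0 v) pre).
  exact: e2.
have Lu k : Lam z f (u k) = f (inv (last (last a0 v) pre)).
  have rd : red (wpow v k.+1 ++ pre).
    have := tight_pow k.+2 tv; rewrite -[k.+2]addn1 wpowD wpow1 {2}e catA.
    by move=> r; apply: (@red_infix _ [::] _ _ r).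
  have [w e3] := lp k; rewrite /u e3 -gw_inv /word_inv map_rcons rev_rcons LamE //=; last first.
    by have := red_inv rd; rewrite e3 /word_inv map_rcons rev_rcons.
  by rewrite (negPf nsp).
have Lu2 k : (k < n)%N -> Lam z f (u k * gw v ^+ n.+1) = (\sum_(a <- t.1) f a + f b)%R.
  move=> kn; have e4 : wpow v n.+1 = (wpow v k.+1 ++ pre) ++ (t.1 ++ b :: post ++ wpow v (n - k.+1)).
    have {1}-> : n.+1 = (k.+1 + (1 + (n - k.+1)))%N by lia.
    by rewrite !wpowD wpow1 {2}e -!catA.
  rewrite -gw_wpow e4 gwM mulKg LamE //.
    by rewrite Lamw_st //= (negPf nsb).
  have := tight_pow n.+1 tv; rewrite e4 => r.
  by apply: (@red_infix _ (wpow v k.+1 ++ pre) _ [::]); rewrite cats0.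
have dis j k : (j < k)%N -> ~ keq (F z) (u j) (u k).
  move=> jk; rewrite /keq /u invgK => /(parV) ; rewrite invgM invgK.
  have -> : k.+1 = (j.+1 + (k - j))%N by lia.
  have gen A B C : (gw (A ++ C))^-1 * gw ((A ++ B) ++ C) = (gw C)^-1 * gw (B ++ C).
    by rewrite !gwM invgM -!mulgA mulKg.
  rewrite wpowD gen.
  have -> : wpow v (k - j) = pre ++ (t.1 ++ b :: post) ++ wpow v (k - j).-1.
    by rewrite -[(k - j)%N](_ : (1 + (k - j).-1)%N = _) ?wpowD ?wpow1 ?{1}e -?catA //; lia.
  rewrite -!catA gwM mulKg !catA -catA => /par_red h.
  have /h : red ((t.1 ++ b :: post) ++ wpow v (k - j).-1 ++ pre).
    have := tight_pow (1 + ((k - j).-1 + 1)) tv.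
    rewrite !wpowD !wpow1; set q := wpow v _; rewrite e => r.
    by apply: (@red_infix _ pre _ (t.1 ++ b :: post)); rewrite -!catA in r *.
  by rewrite !all_cat /= (negPf nsb) /= !andbF.
have := ge (map u (iota 0 n)); rewrite big_map => h; apply: le_trans (h _); last first.
  rewrite -map_comp map_inj_in_uniq ?iota_uniq // => j k _ _ /= e3.
  have kq : keq (F z) (u j) (u k).
    by apply: keq_trans (rep_keq _ _) _ => //; rewrite e3; apply: keq_sym => //; apply: rep_keq.
  case: (ltngtP j k) => // jk; first by case: (dis _ _ jk).
  by case: (dis _ _ jk); apply: keq_sym.
rewrite big_seq (eq_bigr (fun=> `|tvl f t|%R)) => [|k]; last first.
  by rewrite mem_iota add0n => /= kn; rewrite Lu2 // Lu /tvl e2 addrA.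
rewrite -big_seq big_const_seq count_predT size_iota iter_addr_0.
by rewrite -mulr_natl natz.
Qed.

(** By [len_bet] the variation of one row of f on a power is bounded by the length of
    the image of this power; divide by the exponent. *)
Lemma turn_bound f B x v t : (forall y, cls z y -> functional z (f y)) -> rinv z f B -> linv z f B ->
  cls z x -> tight v -> ends v -> t \in turns v -> (`|tvl (f x) t| <= clen (bet z f (gw v)))%R.
Proof.
move=> ff r l cx tv ev tin; set c := bet z f (gw v).
have h n : (n%:Z * `|tvl (f x) t| <= (n.+1)%:Z * clen c + 2 * len (cyq c))%R.
  apply: le_trans (turn_N n (ff x cx) tv ev tin) _.
  apply: le_trans (pow_le_clen c n.+1); rewrite -(homX _ _ (betM ff)) (len_bet ff r l).
  rewrite (bigD1 x cx) /= addrCA lerDl; apply: addr_ge0; apply: sumr_ge0 => y _; exact: V_ge0.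
rewrite leNgt; apply/negP => lt.
have c0 := clen_ge0 c; have q0 := len_ge0 (cyq c).
pose n := (absz (clen c + 2 * len (cyq c))%R).+1.
have nb : (clen c + 2 * len (cyq c) < n%:Z)%R by rewrite /n; lia.
clearbody n.
have := h n; have : (n%:Z * (clen c + 1) <= n%:Z * `|tvl (f x) t|)%R by rewrite ler_pM2l; lia.
move=> h1 h2; have := le_trans h1 h2; rewrite intS mulrDl mul1r mulrDr mulr1.
move: (n%:Z * clen c)%R (clen c) (len _) nb => a b q; lia.
Qed.

Definition ends2 (t : turn) : word D := if t.2 is Some (b, _) then [:: b] else [::].
(** An element rebuilt from its turns, with class elements of exponents u inserted. *)
Definition build (T : seq turn) (u : turn -> D -> int) : G :=
  \big[*%g/1]_(t <- T) (gw t.1 * Xp z (u t) * gw (ends2 t)).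

Lemma build_cons t T u : build (t :: T) u = gw t.1 * Xp z (u t) * gw (ends2 t) * build T u.
Proof. exact: big_cons. Qed.

Lemma len_zpow (g : G) i : (len (zpow g i) <= `|i| * len g)%R.
Proof.
case: i => n; first exact: len_pow.
rewrite NegzE normrN lenV; exact: (len_pow g n.+1).
Qed.

Lemma len_lt a : len (lt a) = 1%R.
Proof. by rewrite -[lt a]/(gw [:: a]) len_red. Qed.

Lemma len_Xp u : (len (Xp z u) <= \sum_(x | cls z x) `|u x|)%R.
Proof.
rewrite -big_enum /= /Xp; elim: (enum _) => [|x s IH]; first by rewrite !big_nil len1.
rewrite !big_cons; apply: le_trans (lenM _ _) _; apply: lerD => //.
by apply: le_trans (len_zpow _ _) _; rewrite len_lt mulr1.
Qed.

Lemma len_build T u : (len (build T u) <=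
  \sum_(t <- T) (Posz (size t.1 + size (ends2 t)) + \sum_(x | cls z x) `|u t x|))%R.
Proof.
rewrite /build; elim: T => [|t T IH]; first by rewrite !big_nil len1.
rewrite !big_cons; apply: le_trans (lenM _ _) _; apply: lerD => //.
apply: le_trans (lenM _ _) _; rewrite PoszD addrAC; apply: lerD; last exact: len_size.
by apply: le_trans (lenM _ _) _; apply: lerD; [exact: len_size|exact: len_Xp].
Qed.

Lemma trn_size p h v : (if v is a :: w then ~~ st z (last a w).1 else h == [::]) ->
  (\sum_(t <- trn p h v) (size t.1 + size (ends2 t)) = size h + size v)%N.
Proof.
elim: v p h => [|a v IH] p h /=; first by move=> /eqP ->; rewrite big_nil.
case: ifP => [sa|nsa] l.
  rewrite IH ?size_rcons ?addSnnS //; case: v {IH} l => //=.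
  by rewrite sa.
rewrite big_cons IH /=; first by rewrite addn1 addSnnS.
by case: v {IH} l.
Qed.

Lemma turns_size v : ends v -> (\sum_(t <- turns v) (size t.1 + size (ends2 t)) = size v)%N.
Proof.
rewrite /ends /turns; case: ifP => [_ _|_]; first by rewrite big_seq1 addn0.
by case: v => [|a v] l; rewrite ?big_nil // trn_size.
Qed.

Lemma size_trn p h v : (size (trn p h v) <= size v)%N.
Proof. by elim: v p h => //= a v IH p h; case: ifP => _; [apply/leqW/IH|exact: IH]. Qed.

Lemma size_turns v : (size (turns v) <= (size v).+1)%N.
Proof.
by rewrite /turns; case: ifP => // _; case: v => // a v; apply: leqW; apply: size_trn.
Qed.

Section Image.
Variable f : D -> letter D -> int.
Hypothesis ff : forall y, cls z y -> functional z (f y).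

Definition tdiff (t : turn) x := (tvl (f x) t - tvl (sdl (x, false)) t)%R.

Lemma bet_st h : all (fun a => st z a.1) h ->
  bet z f (gw h) = gw h * Xp z (fun x => \sum_(a <- h) f x a - \sum_(a <- h) sdl (x, false) a)%R.
Proof.
elim: h => [|a h IH] /=.
  by rewrite gw0 (hom1 (betM ff)) Xp0 ?mulg1 // => x _; rewrite !big_nil subr0.
case/andP=> sa ah; rewrite gw_cons (betM ff) (bet_lt ff) IH // /bl sa.
rewrite -!mulgA; congr (_ * _); rewrite mulgA -(Xp_commuteF _ (_ : F z (gw h))); last by exists h.
by rewrite -mulgA -XpD; congr (_ * _); apply: eq_Xp => x _; rewrite !big_cons opprD addrACA.
Qed.

Lemma sdl_off x b : cls z x -> ~~ st z b.1 -> sdl (x, false) b = 0%R.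
Proof. by move=> cx nb; rewrite sdl_out //=; apply: contraNneq nb => ->; apply: cls_st. Qed.

(** The conjugating factors on the two sides of consecutive letters outside the star
    combine into the value of f on the turn. *)
Lemma bet_trn p h v : ~~ st z p.1 -> all (fun a => st z a.1) h ->
  (if v is a :: w then ~~ st z (last a w).1 else h == [::]) ->
  (Xp z (f^~ (inv p)))^-1 * bet z f (gw (h ++ v)) * Xp z (f^~ (inv (last p v))) =
  build (trn p h v) tdiff.
Proof.
elim: v p h => [|a v IH] p h np ah /=.
  by move=> /eqP ->; rewrite gw0 (hom1 (betM ff)) mulg1 mulVg /build big_nil.
case: ifP => [sa|/negbT nsa] l.
  rewrite -IH ?all_rcons ?sa // ?cat_rcons; last first.
    by case: v {IH} l => //=; rewrite sa.
  by case: v {IH} l => [|b v _] //; rewrite /= sa.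
rewrite build_cons -IH //; last by case: v {IH} l.
rewrite gwM gw_cons !(betM ff) (bet_lt ff) /bl (negPf nsa) bet_st // [ends2 _]/= -[gw [:: a]]/(lt a) [(_, _).1]/=.
have E : Xp z (tdiff (h, Some (a, p))) = (Xp z (f^~ (inv p)))^-1 *
    Xp z (fun x => \sum_(b <- h) f x b - \sum_(b <- h) sdl (x, false) b)%R * Xp z (f^~ a).
  rewrite -XpN -!XpD; apply: eq_Xp => x cx; rewrite /tdiff /tvl /= !(sdl_off cx) //.
  by ring.
have C : (Xp z (f^~ (inv p)))^-1 * gw h = gw h * (Xp z (f^~ (inv p)))^-1.
  by rewrite -XpN (Xp_commuteF _ (_ : F z (gw h))) //; exists h.
by rewrite E cat0s !mulgA C.
Qed.

(** Up to conjugation the image depends only on the values on the turns: the factors at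
    the two ends of the cyclic word cancel after conjugation. *)
Lemma bet_build v : ends v -> exists q, q^-1 * bet z f (gw v) * q = build (turns v) tdiff.
Proof.
rewrite /ends /turns; case: ifP => [av _|nav].
  exists 1; rewrite invg1 mul1g mulg1 bet_st // build_cons /= gw0 mulg1 /build big_nil mulg1.
  by congr (_ * _); apply: eq_Xp => x _; rewrite /tdiff /tvl /= !addr0.
case: v nav => // a v nav /= l; exists (Xp z (f^~ (inv (last a v)))).
by rewrite -(@bet_trn (last a v) [::] (a :: v)).
Qed.

End Image.
End Turns.

(** * Class automorphisms as paths of small automorphisms *)

Section Elementary.
Variable D : sgraph.
Implicit Types (a b p : letter D) (x y : D) (h v w : word D).
Local Notation G := (raag (@edge D)).
Local Notation gw := (raag_of_word (@edge D)).
Local Open Scope group_scope.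

Definition small (e e' : G -> G) := [/\ ishom e, ishom e', cancel e e', cancel e' e &
  forall a, (len (e (lt a)) <= 3)%R /\ (len (e' (lt a)) <= 3)%R].

Variable z : D.

Definition fam (f : D -> letter D -> int) := forall x, cls z x -> functional z (f x).

Lemma fun_add f g : functional z f -> functional z g -> functional z (fun a => f a + g a)%R.
Proof.
move=> ff fg; split=> [a sa|a b sa sb ab|a b sa sb ab].
- by rewrite (fun_inv ff) // (fun_inv fg) // opprD.
- by rewrite (fun_out ff sa sb ab) (fun_out fg sa sb ab).
- by rewrite (fun_comp ff sa sb ab) (fun_comp fg sa sb ab).
Qed.

Lemma fun_scale s f : functional z f -> functional z (fun a => s * f a)%R.
Proof.
move=> ff; split=> [a sa|a b sa sb ab|a b sa sb ab].
- by rewrite (fun_inv ff) // mulrN.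
- by rewrite (fun_out ff sa sb ab) mulr0.
- by rewrite (fun_comp ff sa sb ab).
Qed.

Lemma fun_sum (P : pred D) (c : D -> int) (f : D -> letter D -> int) :
  (forall y, P y -> functional z (f y)) -> functional z (fun a => \sum_(y | P y) c y * f y a)%R.
Proof.
move=> ff; split=> [a sa|a b sa sb ab|a b sa sb ab].
- by rewrite -sumrN; apply: eq_bigr => y /ff fy; rewrite (fun_inv fy) // mulrN.
- by rewrite big1 // => y /ff fy; rewrite (fun_out fy sa sb ab) mulr0.
- by apply: eq_bigr => y /ff fy; rewrite (fun_comp fy sa sb ab).
Qed.

Lemma fam_sdl : fam (fun x => sdl (x, false)).
Proof. by move=> x; apply: sdl_cls. Qed.

(** The class automorphism that modifies a single row of the identity. *)
Definition eg x0 (psi : letter D -> int) x a : int := (sdl (x, false) a + (x == x0)%:R * psi a)%R.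
(** The change of the row x0 of f when [eg x0 psi] is applied after f. *)
Definition ext psi (f : D -> letter D -> int) a : int :=
  (\sum_(y | cls z y) psi (y, false) * (f y a - sdl (y, false) a) + psi a)%R.

Lemma fam_eg x0 psi : functional z psi -> fam (eg x0 psi).
Proof. by move=> fp x cx; apply: fun_add (fam_sdl cx) (fun_scale _ fp). Qed.

Lemma eg_sum x0 psi x (v : D -> int) : cls z x ->
  (\sum_(y | cls z y) eg x0 psi x (y, false) * v y =
   v x + (x == x0)%:R * \sum_(y | cls z y) psi (y, false) * v y)%R.
Proof.
move=> cx; under eq_bigr => y _ do rewrite /eg mulrDl.
rewrite big_split /= mulr_sumr; congr (_ + _)%R; last first.
  by apply: eq_bigr => y _; rewrite mulrA.
rewrite (bigD1 x) //= big1 => [|y /andP[_ ne]]; last by rewrite sdl_gen eq_sym (negPf ne) mul0r.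
by rewrite sdl_gen eqxx mul1r addr0.
Qed.

(** Class automorphisms compose like their matrices, extended by the values off
    the class. *)
Lemma bet_eg x0 psi f f' : functional z psi -> fam f -> fam f' ->
  (forall x a, cls z x -> f' x a = f x a + (x == x0)%:R * ext psi f a)%R ->
  bet z (eg x0 psi) \o bet z f =1 bet z f'.
Proof.
move=> fp ff ff' e; have fe := fam_eg x0 fp.
apply: hom_ext; [exact: hom_comp (betM _) (betM _)|exact: betM|] => a.
rewrite /= !bet_lt // /bl; case: ifP => sa.
  rewrite betM // bet_lt // bet_Xp // /bl sa -mulgA -XpD; congr (_ * _); apply: eq_Xp => x cx.
  by rewrite eg_sum // e // /ext /eg; ring.
rewrite !betM // homV; last exact: betM.
rewrite bet_lt // !bet_Xp // /bl sa !mulgA -XpD -!mulgA -invgM -XpD !mulgA.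
have oe b : ~~ st z b.1 -> forall x, cls z x ->
    (\sum_(y | cls z y) eg x0 psi x (y, false) * f y b + eg x0 psi x b = f' x b)%R.
  move=> nb x cx; rewrite eg_sum // e // /ext /eg (sdl_off cx) //.
  have -> : (\sum_(y | cls z y) psi (y, false) * (f y b - sdl (y, false) b) = \sum_(y | cls z y) psi (y, false) * f y b)%R.
    by apply: eq_bigr => y cy; rewrite (sdl_off cy) ?subr0.
  by ring.
congr (_ * _ * _^-1); apply: eq_Xp => x cx; [exact: oe (negbT sa) _ cx|].
by have := oe (inv a) (negbT sa) x cx.
Qed.

Lemma bet_sdl : bet z (fun x => sdl (x, false)) =1 id.
Proof.
apply: hom_ext => //; first exact: betM fam_sdl.
move=> a; rewrite bet_lt; last exact: fam_sdl.
rewrite /bl; case: ifP => sa.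
  by rewrite Xp0 ?mulg1 // => x cx; rewrite subrr.
by rewrite !Xp0 ?invg1 ?mulg1 ?mul1g // => x cx; rewrite (sdl_off cx) //= sa.
Qed.

Definition tiny (psi : letter D -> int) := forall a, (`|psi a| <= if st z a.1 then 2 else 1)%R.

Lemma sum1 x0 (F : D -> int) : (\sum_(x | cls z x) `|(x == x0)%:R * F x| <= `|F x0|)%R.
Proof.
rewrite big_mkcond (bigD1 x0) //= eqxx mul1r big1 ?addr0.
  by case: ifP => // _; apply: normr_ge0.
by move=> x ne; rewrite (negPf ne) mul0r normr0; case: ifP.
Qed.

Lemma len_eg x0 psi a : functional z psi -> tiny psi -> (len (bet z (eg x0 psi) (lt a)) <= 3)%R.
Proof.
move=> fp tp; rewrite bet_lt; last exact: fam_eg.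
rewrite /bl; case: ifP => sa.
  apply: le_trans (lenM _ _) _; rewrite len_lt.
  have := len_Xp z (fun x => eg x0 psi x a - sdl (x, false) a)%R.
  under [X in (_ <= X)%R]eq_bigr => x _ do rewrite /eg addrAC subrr add0r.
  move/le_trans/(_ (sum1 x0 (fun=> psi a))); have := tp a; rewrite sa => h1 h2.
  by have := le_trans h2 h1; set l := len _; lia.
have b c : ~~ st z c.1 -> (len (Xp z (fun x => eg x0 psi x c)) <= 1)%R.
  move=> nc; apply: le_trans (len_Xp _ _) _.
  rewrite (eq_bigr (fun x => `|(x == x0)%:R * psi c|%R)) => [|x cx]; last first.
    by rewrite /eg (sdl_off cx) // add0r.
  by apply: le_trans (sum1 x0 (fun=> psi c)) _; have := tp c; rewrite (negPf nc).
apply: le_trans (lenM _ _) _; rewrite lenV; have h1 := b (inv a) (negbT sa).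
have h2 := b a (negbT sa); have := lenM (Xp z ((eg x0 psi)^~ a)) (lt a); rewrite len_lt.
by move: h1 h2; set l1 := len _; set l2 := len _; set l3 := len _; lia.
Qed.

Lemma small_eg x0 psi psi' : cls z x0 -> functional z psi -> functional z psi' -> tiny psi -> tiny psi' ->
  (forall a, ext psi' (eg x0 psi) a = - psi a)%R -> (forall a, ext psi (eg x0 psi') a = - psi' a)%R ->
  small (bet z (eg x0 psi)) (bet z (eg x0 psi')).
Proof.
move=> c0 fp fp' tp tp' e e'; have fe := fam_eg x0 fp; have fe' := fam_eg x0 fp'.
have K ps ps' : functional z ps -> functional z ps' -> (forall a, ext ps' (eg x0 ps) a = - ps a)%R ->
    cancel (bet z (eg x0 ps)) (bet z (eg x0 ps')).
  move=> f1 f2 e1 g; rewrite -[RHS]bet_sdl.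
  apply: (@bet_eg x0 ps' (eg x0 ps) (fun x => sdl (x, false))) => //; [exact: fam_eg|exact: fam_sdl|].
  by move=> x a cx; rewrite e1 /eg; ring.
by split; [exact: betM|exact: betM|exact: K|exact: K|] => a; split; exact: len_eg.
Qed.

Lemma tinyZ s psi : pm s -> (forall a, `|psi a| <= 1)%R -> tiny (fun a => s * psi a)%R.
Proof.
move=> ps le a; have := le a; rewrite normrM.
have -> : (`|s| = 1)%R by case: ps => ->; rewrite ?normrN1 ?normr1.
rewrite mul1r => h; apply: le_trans h _; by case: ifP.
Qed.

Lemma sdl_le1 x a : (`|sdl (x, false) a| <= 1)%R.
Proof. by rewrite /sdl; case: ifP => // _; case: ifP. Qed.

(** Row operations and the addition of functionals vanishing on the class are
    realized by composing with [eg x0 psi] for small psi. *)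
Lemma row_small x0 f f' : cls z x0 -> fam f ->
  (forall x, x != x0 -> f' x = f x) ->
  [\/ exists s x1, [/\ pm s, cls z x1, x1 != x0 & f' x0 = fun a => (f x0 a + s * f x1 a)%R],
      exists s ph, [/\ pm s, functional z ph, forall y, cls z y -> ph (y, false) = 0%R,
        (forall a, `|ph a| <= 1)%R & f' x0 = fun a => (f x0 a + s * ph a)%R]
    | f' x0 = fun a => (- f x0 a)%R] ->
  fam f' /\ exists e e', small e e' /\ e \o bet z f =1 bet z f'.
Proof.
move=> c0 ff ne h.
have mk psi psi' : functional z psi -> functional z psi' -> tiny psi -> tiny psi' ->
  (forall a, ext psi' (eg x0 psi) a = - psi a)%R -> (forall a, ext psi (eg x0 psi') a = - psi' a)%R ->
  fam f' -> (forall a, f' x0 a = f x0 a + ext psi f a)%R ->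
  fam f' /\ exists e e', small e e' /\ e \o bet z f =1 bet z f'.
  move=> fp fp' tp tp' e1 e2 ff' e3; split=> //; exists (bet z (eg x0 psi)), (bet z (eg x0 psi')).
  split; first exact: small_eg; apply: bet_eg => // x a cx; have [->|n] := eqVneq x x0.
    by rewrite e3 mul1r.
  by rewrite ne // mul0r addr0.
have ffx : functional z (f' x0) -> fam f'.
  by move=> fx x cx; have [->//|n] := eqVneq x x0; rewrite ne //; apply: ff.
have ext_sdl s x1 g : cls z x1 -> forall a, (ext (fun a => s * sdl (x1, false) a) g a = s * g x1 a)%R.
  move=> c1 a; rewrite /ext (bigD1 x1) //= big1 => [|y /andP[_ n]]; last first.
    by rewrite sdl_gen eq_sym (negPf n) mulr0 mul0r.
  have -> : sdl (x1, false) (x1, false) = 1%R by rewrite sdl_gen eqxx.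
  by ring.
have ext_0 ph g : (forall y, cls z y -> ph (y, false) = 0%R) -> forall a, ext ph g a = ph a.
  by move=> p0 a; rewrite /ext big1 ?add0r // => y /p0 ->; rewrite mul0r.
case: h => [[s [x1 [ps c1 n1 e]]]|[s [ph [ps fph ph0 ph1 e]]]|e].
- have pN : pm (- s)%R by case: ps => ->; [right|left]; rewrite ?opprK.
  apply: (mk (fun a => s * sdl (x1, false) a)%R (fun a => - s * sdl (x1, false) a)%R).
  + by apply: fun_scale; apply: fam_sdl.
  + by apply: fun_scale; apply: fam_sdl.
  + by apply: tinyZ => // a; apply: sdl_le1.
  + by apply: tinyZ => // a; apply: sdl_le1.
  + by move=> a; rewrite ext_sdl // /eg (negPf n1) mul0r addr0 ?mulNr ?opprK.
  + by move=> a; rewrite ext_sdl // /eg (negPf n1) mul0r addr0 ?mulNr ?opprK.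
  + apply: ffx; rewrite e; apply: fun_add; first exact: ff.
    by apply: fun_scale; apply: ff.
  + by move=> a; rewrite e ext_sdl.
- have pN : pm (- s)%R by case: ps => ->; [right|left]; rewrite ?opprK.
  have h0 t y : cls z y -> (t * ph (y, false) = 0)%R by move=> /ph0 ->; rewrite mulr0.
  apply: (mk (fun a => s * ph a)%R (fun a => - s * ph a)%R).
  + exact: fun_scale.
  + exact: fun_scale.
  + exact: tinyZ.
  + exact: tinyZ.
  + by move=> a; rewrite ext_0 ?mulNr // => y; apply: h0.
  + by move=> a; rewrite ext_0 ?mulNr ?opprK // => y; apply: h0.
  + by apply: ffx; rewrite e; apply: fun_add (fun_scale _ _) => //; apply: ff.
  + by move=> a; rewrite e ext_0 // => y; apply: h0.
- have tp : tiny (fun a => -2 * sdl (x0, false) a)%R.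
    move=> a; case: ifP => sa; last by rewrite (sdl_off c0) ?sa.
    by rewrite normrM; have := sdl_le1 x0 a; lia.
  have e2 a : (ext (fun a => -2 * sdl (x0, false) a) (eg x0 (fun a => -2 * sdl (x0, false) a)) a =
     - (-2 * sdl (x0, false) a))%R.
    by rewrite ext_sdl // /eg eqxx mul1r; ring.
  have fp := fun_scale (-2)%R (fam_sdl c0).
  apply: (mk _ _ fp fp tp tp e2 e2); last by move=> a; rewrite e ext_sdl //; ring.
  apply: ffx; rewrite e (_ : (fun a => _) = fun a => (-1 * f x0 a)%R).
    by apply: fun_scale; apply: ff.
  by apply/funext => a; rewrite mulN1r.
Qed.

(** A functional that vanishes on the class is a sum of functionals with values
    in {-1, 0, 1}, of which there are finitely many. *)
Definition nphi := #|{: {ffun letter D -> 'I_3}}|.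
Definition dec (k : 'I_nphi) a : int := (Posz (enum_val k a) - 1)%R.
Definition vphi (ph : letter D -> int) := functional z ph /\ forall y, cls z y -> ph (y, false) = 0%R.
(** All candidates with values in {-1, 0, 1} are listed, and those that are not functionals
    vanishing on the class are replaced by 0. *)
Definition phi k : letter D -> int := if `[< vphi (dec k) >] then dec k else fun=> 0%R.

Lemma phi_v k : vphi (phi k).
Proof. by rewrite /phi; case: ifP => [/asboolP|_] //; split=> //; split=> *; rewrite ?oppr0. Qed.

Lemma phi_le1 k a : (`|phi k a| <= 1)%R.
Proof. by rewrite /phi /dec; case: ifP => // _; have := ltn_ord (enum_val k a); lia. Qed.

(** Slice rho by the thresholds of its absolute value; each slice is again a
    functional. *)
Lemma phi_span rho : vphi rho -> exists c : 'I_nphi -> int, forall a, rho a = (\sum_k c k * phi k a)%R.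
Proof.
move=> [fr r0].
have lev j : exists k, phi k =1 fun a => (sgz (rho a) * Posz (j < absz (rho a)))%R.
  pose q := [ffun a : letter D => inord (absz (sgz (rho a) * Posz (j < absz (rho a)) + 1)%R) : 'I_3].
  exists (enum_rank q) => a.
  have de b : dec (enum_rank q) b = (sgz (rho b) * Posz (j < absz (rho b)))%R.
    rewrite /dec enum_rankK ffunE inordK; case: sgzP => h; case: (j < _)%N; lia.
  rewrite /phi; case: asboolP => [_|[]]; first exact: de.
  split; last by move=> y cy; rewrite de r0 // sgz0.
  split=> [b sb|b c sb sc bc|b c sb sc bc]; rewrite !de.
  - by rewrite (fun_inv fr) // sgzN abszN mulNr.
  - by rewrite (fun_out fr sb sc bc) sgz0.
  - by rewrite (fun_comp fr sb sc bc).
have [kk kP] := choice lev.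
pose M := (\sum_a absz (rho a))%N.
exists (fun k => \sum_(j < M | kk j == k) 1)%R => a.
under eq_bigr => k _ do rewrite big_distrl /=.
rewrite (exchange_big_dep predT) //=.
rewrite (eq_bigr (fun j : 'I_M => (sgz (rho a) * Posz (j < absz (rho a)))%R)); last first.
  by move=> j _; rewrite (big_pred1 (kk j)) => [|k]; rewrite ?mul1r ?kP // eq_sym.
rewrite -mulr_sumr; have le : (absz (rho a) <= M)%N by rewrite /M (bigD1 a) //= leq_addr.
have -> : (\sum_(j < M) Posz (j < absz (rho a)) = Posz (absz (rho a)))%R.
  rewrite (eq_bigr (fun j : 'I_M => if (j < absz (rho a))%N then 1 else 0)%R) => [|j _]; last by case: ltnP.
  by rewrite -big_mkcond (big_ord_narrow le) sumr_const card_ord natz.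
by case: sgzP => h; lia.
Qed.

End Elementary.

(** * Paths of small automorphisms *)

Section SmallPaths.
Variable D : sgraph.
Implicit Types (a b p : letter D) (x y z : D) (v w : word D).
Local Notation G := (raag (@edge D)).
Local Notation gw := (raag_of_word (@edge D)).
Local Open Scope group_scope.
Implicit Types (U V W : seq G).

Definition cj (g h : G) := exists q, h = q^-1 * g * q.

Lemma cj_refl g : cj g g. Proof. by exists 1; rewrite invg1 mul1g mulg1. Qed.

Lemma cj_sym g h : cj g h -> cj h g.
Proof. by move=> [q ->]; exists q^-1; rewrite invgK !mulgA mulgV mul1g mulgK. Qed.

Lemma cj_trans g h k : cj g h -> cj h k -> cj g k.
Proof. by move=> [q ->] [r ->]; exists (q * r); rewrite invgM !mulgA. Qed.

Lemma cj_hom (e : G -> G) g h : ishom e -> cj g h -> cj (e g) (e h).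
Proof. by move=> eM [q ->]; exists (e q); rewrite !eM (homV _ eM). Qed.

Lemma cj_clen g h : cj g h -> clen h = clen g.
Proof. by move=> [q ->]; apply: clenJ. Qed.

Definition cjs U V := size U = size V /\ forall i, cj (nth 1 U i) (nth 1 V i).

Lemma cjs_refl U : cjs U U. Proof. by split=> // i; apply: cj_refl. Qed.

Lemma cjs_sym U V : cjs U V -> cjs V U.
Proof. by move=> [s h]; split=> // i; apply/cj_sym/h. Qed.

Lemma cjs_trans U V W : cjs U V -> cjs V W -> cjs U W.
Proof. by move=> [s h] [s' h']; split=> [|i]; [rewrite s|apply: cj_trans (h i) (h' i)]. Qed.

Lemma cjs_hom (e : G -> G) U V : ishom e -> cjs U V -> cjs (map e U) (map e V).
Proof.
move=> eM [s h]; split=> [|i]; first by rewrite !size_map.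
have [lt|ge] := ltnP i (size U); last first.
  by rewrite !nth_default ?size_map -?s //; apply: cj_refl.
by rewrite !(nth_map 1) -?s //; apply: cj_hom.
Qed.

Lemma cjs_scl U V : cjs U V -> scl V = scl U.
Proof.
move=> [s h]; rewrite /scl !(big_nth 1) s; apply: eq_bigr => i _.
exact: cj_clen.
Qed.

Definition smove V W := exists e e', small e e' /\ cjs (map e V) W.

Inductive spath (R : int) U : seq G -> Prop :=
| Sp0 : spath R U U
| SpS V W : spath R U V -> (scl V <= R)%R -> (scl W <= R)%R -> smove V W -> spath R U W.

Lemma spath_trans R U V W : spath R U V -> spath R V W -> spath R U W.
Proof. by move=> p; elim=> // V' W' _ p' h1 h2 m; apply: SpS p' h1 h2 m. Qed.

Lemma spath_le R R' U V : (R <= R')%R -> spath R U V -> spath R' U V.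
Proof.
move=> le; elim=> [|V' W' _ p' h1 h2 m]; first exact: Sp0.
by apply: SpS p' _ _ m; apply: le_trans le.
Qed.

Lemma smove_sym V W : smove V W -> smove W V.
Proof.
move=> [e [e' [[eM eM' K K' h] c]]]; exists e', e; split.
  by split=> // a; have [] := h a.
apply: cjs_sym; have := cjs_hom eM' c; rewrite -map_comp (_ : map _ V = V) //.
by rewrite -[RHS]map_id; apply: eq_map => g /=.
Qed.

Lemma spath_sym R U V : spath R U V -> spath R V U.
Proof.
elim=> [|V' W' _ p' h1 h2 m]; first exact: Sp0.
by apply: spath_trans p'; apply: SpS (Sp0 _ _) h2 h1 (smove_sym m).
Qed.

Lemma pmove_smove V W : pmove V W -> smove V W.
Proof.
move=> [p pi [al [[aM [ai [aiM K K']]] pP ->]]]; exists al, ai; split; last exact: cjs_refl.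
split=> // a; rewrite pP len_lt; split=> //.
have -> : ai (lt a) = lt (invF pi a) by rewrite -{1}(f_invF pi a) -pP K.
by rewrite len_lt.
Qed.

Section OneClass.
Variable z : D.
Local Notation m := #|cls z|.
Let x_ (i : 'I_m) : D := enum_val i.

Lemma tvl_sum (I : finType) (P : pred I) (c : I -> int) (f : I -> letter D -> int) t :
  (tvl (fun a => \sum_(i | P i) c i * f i a) t = \sum_(i | P i) c i * tvl (f i) t)%R.
Proof.
rewrite /tvl exchange_big /=.
under [RHS]eq_bigr => i _ do rewrite mulrDr.
rewrite big_split /=; congr (_ + _)%R; first by apply: eq_bigr => i _; rewrite mulr_sumr.
case: t.2 => [[b p]|]; last by rewrite big1 // => i _; rewrite mulr0.
by rewrite -sumrB; apply: eq_bigr => i _; rewrite mulrBr.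
Qed.

Lemma tvlD f g t : (tvl (fun a => f a + g a) t = tvl f t + tvl g t)%R.
Proof.
rewrite /tvl big_split /=; case: t.2 => [[b p]|]; last by rewrite !addr0.
by ring.
Qed.

Lemma tvlZ s f t : (tvl (fun a => s * f a) t = s * tvl f t)%R.
Proof.
rewrite /tvl -mulr_sumr mulrDr; case: t.2 => [[b p]|]; last by rewrite mulr0.
by rewrite mulrBr.
Qed.

Lemma eq_tvl (f g : letter D -> int) t : f =1 g -> tvl f t = tvl g t.
Proof. by move=> /funext ->. Qed.

Lemma tvl_le f t : (forall a, `|f a| <= 1)%R -> (`|tvl f t| <= Posz (size t.1) + 2)%R.
Proof.
move=> f1; apply: le_trans (ler_normD _ _) _; apply: lerD.
  elim: t.1 => [|a s IH]; first by rewrite big_nil.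
  rewrite big_cons; apply: le_trans (ler_normD _ _) _.
  by rewrite /= intS; apply: lerD.
case: t.2 => [[b p]|] //; apply: le_trans (ler_normB _ _) _.
by rewrite (_ : 2 = 1 + 1)%R //; apply: lerD.
Qed.

Section OneMove.
Variables (L : nat) (U : seq G) (f : D -> letter D -> int) (B : D -> D -> int).
Variables (rp : G -> word D).
Hypotheses (sU : size U <= L) (ff : fam z f) (fB : rinv z f B) (Bf : linv z f B).
Hypotheses (lU : (scl U <= Posz L)%R) (lV : (scl (map (bet z f) U) <= Posz L)%R).
Hypothesis rpP : forall g, [/\ tight (rp g), ends z (rp g) & exists q, gw (rp g) = q^-1 * g * q].

Let t0 : turn D := ([::], None).
Let Ts : seq (turn D) := flatten [seq turns z (rp u) | u <- U].
Let mat (g : D -> letter D -> int) : 'M[int]_(m, size Ts) := (\matrix_(i, j) tvl (g (x_ i)) (nth t0 Ts j))%R.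
Let Fm : 'M[int]_(nphi D, size Ts) := (\matrix_(k, j) tvl (phi z k) (nth t0 Ts j))%R.
Let L' := 2 * L + 2.

Lemma cls_x i : cls z (x_ i). Proof. by have := enum_valP i; rewrite unfold_in. Qed.

Lemma size_rp u : Posz (size (rp u)) = clen u.
Proof. by have [-> _ [q ->]] := rpP u; rewrite clenJ. Qed.

Lemma clen_scl u V : u \in V -> (clen u <= scl V)%R.
Proof.
move=> uV; rewrite /scl (big_rem u) //= lerDl.
by apply: sumr_ge0 => v _; apply: clen_ge0.
Qed.

Lemma size_Ts : size Ts <= 2 * L.
Proof.
have h : size Ts <= \sum_(u <- U) (size (rp u)).+1.
  rewrite size_flatten /shape -map_comp sumnE big_map.
  by apply: leq_sum => u _; apply: size_turns.
apply: leq_trans h _.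
rewrite (eq_bigr (fun u => size (rp u) + 1)) => [|u _]; last by rewrite addn1.
rewrite big_split /= sum1_size mul2n -addnn; apply: leq_add => //.
rewrite -lez_nat (big_morph Posz PoszD (erefl _)); apply: le_trans lU.
by rewrite /scl; apply: ler_sum => u _; rewrite size_rp.
Qed.

Lemma Ts_in t : t \in Ts -> exists2 u, u \in U & t \in turns z (rp u).
Proof. by move=> /flattenP[s /mapP[u uU ->] ts]; exists u. Qed.

Lemma size_t t : t \in Ts -> size t.1 <= L.
Proof.
move=> /Ts_in[u uU tu]; have [_ e _] := rpP u.
apply: (@leq_trans (size (rp u))).
  by rewrite -(turns_size e) (big_rem t) //= -addnA leq_addr.
by rewrite -lez_nat size_rp; apply: le_trans (clen_scl uU) lU.
Qed.

Lemma nth_in (j : 'I_(size Ts)) : nth t0 Ts j \in Ts. Proof. exact: mem_nth. Qed.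

Lemma abs_le (i : int) s : (`|i| <= Posz s + 2)%R -> s <= L -> absz i <= L'.
Proof. by rewrite /L'; lia. Qed.

Lemma abs_sub (a b : int) r s : absz a <= r -> absz b <= s -> (`|a - b| <= Posz (r + s)%N)%R.
Proof. by lia. Qed.

Lemma nb_F : nb L' Fm.
Proof.
move=> k j; rewrite mxE; apply: (abs_le _ (size_t (nth_in j))).
by apply: tvl_le => a; apply: phi_le1.
Qed.

Lemma nb_D1 : nb L' (mat (fun x => sdl (x, false))).
Proof.
move=> k j; rewrite mxE; apply: (abs_le _ (size_t (nth_in j))).
by apply: tvl_le => a; apply: sdl_le1.
Qed.

Lemma nb_D2 : nb L' (mat f).
Proof.
move=> k j; rewrite mxE; have [u uU tu] := Ts_in (nth_in j); have [ti e [q E]] := rpP u.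
have := turn_bound ff fB Bf (cls_x k) ti e tu.
have -> : clen (bet z f (gw (rp u))) = clen (bet z f u).
  by apply: cj_clen; apply: cj_hom; [exact: betM|exists q].
have := clen_scl (map_f (bet z f) uU); move: lV; rewrite /L'.
set c := clen _; set s := scl _; lia.
Qed.

Lemma sum_cls (F : D -> int) : (\sum_(y | cls z y) F y = \sum_i F (x_ i))%R.
Proof. by rewrite -(big_enum_val F) /=; apply: eq_bigl => y; rewrite unfold_in. Qed.

(** On the class f is an invertible matrix, and the rest of f vanishes on the class, so
    it is a combination of the rows of Fm. *)
Lemma eqv_D : eqv Fm (mat (fun x => sdl (x, false))) (mat f).
Proof.
pose rho i a := (f (x_ i) a + \sum_(y | cls z y) - f (x_ i) (y, false) * sdl (y, false) a)%R.
have vr i : vphi z (rho i).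
  split; first by apply: fun_add; [apply: ff; apply: cls_x|apply: fun_sum => y; apply: fam_sdl].
  move=> y cy; rewrite /rho (bigD1 y) //= big1 => [|t /andP[_ n]].
    by rewrite sdl_gen eqxx addr0 mulr1 subrr.
  by rewrite sdl_gen (negPf n) mulr0.
have [c cP] := choice (fun i => phi_span (vr i)).
exists (\matrix_(i, i') f (x_ i) (x_ i', false))%R, (\matrix_(i, k) c i k)%R; split.
  apply: (@proj1 _ (_ \in unitmx)); apply: (@mulmx1_unit _ _ _ (\matrix_(i, j) B (x_ i) (x_ j))%R).
  apply/matrixP => i j; rewrite !mxE; have := fB (cls_x i) (cls_x j); rewrite sum_cls.
  under [X in _ -> X = _]eq_bigr => k _ do rewrite !mxE.
  by move=> ->; rewrite (inj_eq enum_val_inj).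
apply/matrixP => i j; rewrite !mxE.
under [X in _ = (X + _)%R]eq_bigr => k _ do rewrite !mxE.
under [X in _ = (_ + X)%R]eq_bigr => k _ do rewrite !mxE.
set t := nth _ _ _.
rewrite -(sum_cls (fun y => f (x_ i) (y, false) * tvl (sdl (y, false)) t)%R) -!tvl_sum -tvlD.
apply: eq_tvl => a; rewrite -cP /rho addrCA -big_split /= big1 ?addr0 // => y _.
by rewrite mulNr subrr.
Qed.

Lemma bet_cj g u : fam z g -> cj (bet z g u) (build z (turns z (rp u)) (tdiff g)).
Proof.
move=> fg; have [_ e [q E]] := rpP u; have [r R] := bet_build fg e.
by apply: cj_trans (_ : cj _ (bet z g (gw (rp u)))) _; [apply: cj_hom; [exact: betM|exists q]|exists r].
Qed.

Lemma mat_tvl g t x : t \in Ts -> cls z x -> exists i j, tvl (g x) t = mat g i j /\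
  tvl (sdl (x, false)) t = mat (fun x => sdl (x, false)) i j.
Proof.
move=> tT cx; have it : index t Ts < size Ts by rewrite index_mem.
exists (enum_rank_in cx x), (Ordinal it); rewrite !mxE /= nth_index //.
by rewrite /x_ enum_rankK_in.
Qed.

Lemma scl_mat g R : fam z g -> nb R (mat g) ->
  (scl (map (bet z g) U) <= Posz (L + 2 * L * (#|D| * (R + L'))))%R.
Proof.
move=> fg nR; pose M := (#|D| * (R + L'))%N.
have one u : u \in U -> (clen (bet z g u) <= clen u + Posz (size (turns z (rp u)) * M))%R.
  move=> uU; rewrite -(cj_clen (bet_cj u fg)); apply: le_trans (clen_len _) _.
  apply: le_trans (len_build _ _ _) _; rewrite big_split /=; apply: lerD.
    have [_ e _] := rpP u; rewrite -(big_morph Posz PoszD (erefl _)) (turns_size e).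
    by rewrite size_rp.
  rewrite big_seq -[size _]sum1_size big_distrl /= big_seq (big_morph Posz PoszD (erefl _)).
  apply: ler_sum => t tu; rewrite mul1n /M PoszM.
  apply: le_trans (_ : \sum_(x : D) Posz (R + L') <= _)%R; last first.
    by rewrite sumr_const -mulr_natl natz.
  rewrite big_mkcond; apply: ler_sum => x _; case: ifP => // cx.
  have tT : t \in Ts by apply/flattenP; exists (turns z (rp u)) => //; apply: map_f.
  rewrite /tdiff; have [i [j [-> ->]]] := mat_tvl g tT cx.
  exact: abs_sub (nR i j) (nb_D1 i j).
rewrite /scl big_map; apply: le_trans (_ : \sum_(u <- U) (clen u + Posz (size (turns z (rp u)) * M)) <= _)%R.
  by rewrite big_seq [X in (_ <= X)%R]big_seq; apply: ler_sum.
rewrite big_split /= PoszD; apply: lerD; first exact: lU.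
rewrite -(big_morph Posz PoszD (erefl _)) -big_distrl /= lez_nat leq_mul2r; apply/orP; right.
apply: leq_trans size_Ts; rewrite /Ts size_flatten /shape -map_comp sumnE big_map.
by apply: leq_sum.
Qed.

(** Follow the path of matrices by class automorphisms: each matrix comes from a family of
    functionals, whose image tuple is short because it can be rebuilt from the turns, and at
    the end the same values on turns give conjugate tuples. *)
Lemma one_move R : bpath Fm R (mat (fun x => sdl (x, false))) (mat f) ->
  spath (Posz (L + 2 * L * (#|D| * (R + L')))) U (map (bet z f) U).
Proof.
move=> bp; set R' := Posz _.
have [g fg [mg pg]] : exists2 g, fam z g & mat g = mat f /\ spath R' U (map (bet z g) U).
  have bnd M : bpath Fm R (mat (fun x => sdl (x, false))) M -> nb R M by case.
  elim: bp => [nR|M M' bM [g fg [mg pg]] [i [v eM' cs]] nR].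
    exists (fun x => sdl (x, false)); first exact: fam_sdl.
    split=> //; rewrite (_ : map _ U = U); first exact: Sp0.
    by rewrite -[RHS]map_id; apply: eq_map; apply: bet_sdl.
  have [nw nwP nwv] : exists2 nw,
    [\/ exists s x1, [/\ pm s, cls z x1, x1 != x_ i & nw = fun a => (g (x_ i) a + s * g x1 a)%R],
      exists s ph, [/\ pm s, functional z ph, forall y, cls z y -> ph (y, false) = 0%R,
        (forall a, `|ph a| <= 1)%R & nw = fun a => (g (x_ i) a + s * ph a)%R]
    | nw = fun a => (- g (x_ i) a)%R] & forall j : 'I_(size Ts), tvl nw (nth t0 Ts j) = (v ord0 j)%R.
    case: cs => [[s [j [ps ji ->]]]|[s [k [ps ->]]]|->].
    - exists (fun a => g (x_ i) a + s * g (x_ j) a)%R.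
        by apply: Or31; exists s, (x_ j); split=> //; [exact: cls_x|rewrite (inj_eq enum_val_inj)].
      by move=> l; rewrite tvlD tvlZ -mg !mxE.
    - exists (fun a => g (x_ i) a + s * phi z k a)%R.
        by have [p1 p2] := phi_v z k; apply: Or32; exists s, (phi z k); split=> //; apply: phi_le1.
      by move=> l; rewrite tvlD tvlZ -mg !mxE.
    - exists (fun a => - g (x_ i) a)%R; first exact: Or33.
      move=> l; rewrite (@eq_tvl _ (fun a => -1 * g (x_ i) a)%R) => [|a]; last by rewrite mulN1r.
      by rewrite tvlZ -mg !mxE mulN1r.
  pose g' x := if x == x_ i then nw else g x.
  have mg' : mat g' = M'.
    apply/matrixP => k l; rewrite eM' !mxE /g' (inj_eq enum_val_inj).
    by case: eqP => _; rewrite ?nwv // -mg !mxE.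
  have exi : g' (x_ i) = nw by rewrite /g' eqxx.
  have hn x : x != x_ i -> g' x = g x by move=> n; rewrite /g' (negPf n).
  rewrite -exi in nwP; have [fg' [e [e' [se ee]]]] := row_small (cls_x i) fg hn nwP.
  exists g' => //; split=> //; apply: SpS pg _ _ _.
  - by apply: scl_mat fg _; rewrite mg; apply: bnd.
  - by apply: scl_mat fg' _; rewrite mg'.
  exists e, e'; split=> //; rewrite -map_comp (eq_map ee); exact: cjs_refl.
apply: SpS pg _ _ _.
- by apply: scl_mat => //; rewrite mg; case: bp.
- by apply: scl_mat => //; case: bp.
exists id, id; split.
  by split=> // a; rewrite len_lt.
rewrite map_id; split; first by rewrite !size_map.
move=> i; have [lt|ge] := ltnP i (size U); last by rewrite !nth_default ?size_map //; apply: cj_refl.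
rewrite !(nth_map 1) //; set u := nth 1 U i; have uU : u \in U by apply: mem_nth.
apply: cj_trans (bet_cj u fg) _; apply: cj_sym; apply: cj_trans (bet_cj u ff) _.
rewrite (_ : build _ _ _ = build z (turns z (rp u)) (tdiff f)); first exact: cj_refl.
rewrite /build big_seq [RHS]big_seq; apply: eq_bigr => t tu; congr (_ * _ * _); apply: eq_Xp => x cx.
have tT : t \in Ts by apply/flattenP; exists (turns z (rp u)) => //; apply: map_f.
have [k [j [_ _]]] := mat_tvl g tT cx.
have it : index t Ts < size Ts by rewrite index_mem.
have := congr1 (fun M : 'M[int]_(m, size Ts) => M (enum_rank_in cx x) (Ordinal it)) mg.
by rewrite /tdiff !mxE /= nth_index // /x_ enum_rankK_in // => ->.
Qed.

Lemma one_path R : (forall N L (F : 'M[int]_(nphi D, N)) (D1 D2 : 'M[int]_(m, N)),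
  (N <= L)%N -> nb L F -> nb L D1 -> nb L D2 -> eqv F D1 D2 -> bpath F (R L) D1 D2) ->
  spath (Posz (L + 2 * L * (#|D| * (R (2 * L + 2) + (2 * L + 2))))%N) U (map (bet z f) U).
Proof.
move=> RP; apply: one_move; apply: RP.
- by apply: leq_trans size_Ts _; rewrite leq_addr.
- exact: nb_F.
- exact: nb_D1.
- exact: nb_D2.
- exact: eqv_D.
Qed.

End OneMove.

Lemma class_path : exists2 S, tb S & forall L U f B, size U <= L -> fam z f -> rinv z f B -> linv z f B ->
  (scl U <= Posz L)%R -> (scl (map (bet z f) U) <= Posz L)%R -> spath (Posz (S L)) U (map (bet z f) U).
Proof.
have [R tR RP] := rows_path (nphi D) m.
exists (fun L => L + 2 * L * (#|D| * (R (2 * L + 2) + (2 * L + 2))))%N.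
  have t1 : tb (fun L => 2 * L)%N by apply: tb_mul; [exact: tb_const|exact: tb_id].
  have t2 : tb (fun L => 2 * L + 2)%N by apply: tb_add => //; exact: tb_const.
  apply: tb_add; first exact: tb_id.
  apply: tb_mul => //; apply: tb_mul; first exact: tb_const.
  by apply: tb_add => //; apply: tb_comp tR t2.
move=> L U f B sU ff fB Bf lU lV.
have [rp rpP] := choice (tight_rep z).
exact: (one_path sU ff fB Bf lU lV rpP RP).
Qed.

End OneClass.

(** Class automorphisms along the paths of [orbit_paths] are replaced by
    paths of small ones, whose tuples are longer by a bounded amount. *)
Theorem orbit_spath : exists2 S, tb S & forall L U al, isaut al -> size U <= L ->
  (scl U <= Posz L)%R -> (scl (map al U) <= Posz L)%R -> spath (Posz (S L)) U (map al U).
Proof.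
have h z : exists S, tb S /\ forall L U f B, size U <= L -> fam z f ->
  rinv z f B -> linv z f B -> (scl U <= Posz L)%R -> (scl (map (bet z f) U) <= Posz L)%R ->
  spath (Posz (S L)) U (map (bet z f) U).
  by have [S tS SP] := class_path z; exists S.
have [Sz SzP] := choice h.
exists (fun L => L + \sum_(z : D) Sz z L).
  apply: tb_add; first exact: tb_id.
  elim: (index_enum D) => [|z s IH]; first by apply: tb_le (tb_const 0) _ => n; rewrite big_nil.
  apply: tb_le (tb_add (SzP z).1 IH) _ => n; by rewrite big_cons.
move=> L U al aA sU lU lV.
have conv V W : size V <= L -> (scl V <= Posz L)%R -> mpath (scl V) V W ->
   spath (Posz (L + \sum_(z : D) Sz z L)) V W.
  move=> sV lV' p.
  suff [] : spath (Posz (L + \sum_(z : D) Sz z L)) V W /\ size W = size V by [].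
  elim: p => [|V1 W1 _ [IH s1] h1 h2 [z [f [B [ff fB Bf eW]]]]|V1 W1 _ [IH s1] h1 h2 pm1].
  - by split=> //; apply: Sp0.
  - subst W1; split; last by rewrite size_map.
    apply: spath_trans IH _; apply: (@spath_le (Posz (Sz z L))).
      by rewrite lez_nat (bigD1 z) //= addnCA leq_addr.
    have sV1 : size V1 <= L by rewrite s1.
    have [_ P] := SzP z; have P1 := P L V1 f B sV1 ff fB Bf (le_trans h1 lV') (le_trans h2 lV').
    exact P1.
  have le1 (X : seq G) : (scl X <= scl V)%R -> (scl X <= Posz (L + \sum_(z : D) Sz z L))%R.
    by move=> h3; apply: le_trans h3 (le_trans lV' _); rewrite lez_nat leq_addr.
  split; last by case: pm1 => [[p _ [be [_ _ e]]]|[p _ [be [_ _ e]]]]; rewrite -s1 e size_map.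
  apply: SpS IH _ _ _; [exact: le1|exact: le1|].
  by case: pm1 => h3; [|apply: smove_sym]; apply: pmove_smove.
have [W [p1 p2]] := orbit_paths aA (erefl (map al U)).
apply: spath_trans (conv _ _ sU lU p1) _; apply: spath_sym.
by apply: conv => //; rewrite size_map.
Qed.

End SmallPaths.

(** * Bounded conjugators and bounded automorphisms *)

Section ConjBound.
Variable D : sgraph.
Implicit Types (a b : letter D) (x y : D) (v w : word D).
Local Notation G := (raag (@edge D)).
Local Notation gw := (raag_of_word (@edge D)).
Local Open Scope group_scope.
Implicit Types (g h : G).

(** Four points in the four quadrants of two walls with one label are impossible, by
    [hs_nested]. *)
Lemma no_cross (q q' : G) a (s s' : bool) g1 g2 g3 g4 :
  hs q a g1 = s -> hs q' a g1 = s' -> hs q a g2 = ~~ s -> hs q' a g2 = ~~ s' ->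
  hs q a g3 = ~~ s -> hs q' a g3 = s' -> hs q a g4 = s -> hs q' a g4 = ~~ s' -> False.
Proof.
have core o g h1 h2 : ~~ hs q a o -> ~~ hs q' a o -> hs q a g -> hs q' a g ->
    hs q a h1 -> ~~ hs q' a h1 -> ~~ hs q a h2 -> hs q' a h2 -> False.
  move=> o1 o2 G1 G2 x1 x2 y1 y2; have [sub|[sub _]] := hs_nested o1 o2 G1 G2.
    by rewrite (sub _ y2) in y1.
  by rewrite (sub _ x1) in x2.
move=> a1 a2 b1 b2 c1 c2 d1 d2; case: s a1 b1 c1 d1 => a1 b1 c1 d1; case: s' a2 b2 c2 d2 => a2 b2 c2 d2.
- by apply: (core g2 g1 g4 g3); rewrite ?a1 ?a2 ?b1 ?b2 ?c1 ?c2 ?d1 ?d2.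
- by apply: (core g3 g4 g1 g2); rewrite ?a1 ?a2 ?b1 ?b2 ?c1 ?c2 ?d1 ?d2.
- by apply: (core g4 g3 g2 g1); rewrite ?a1 ?a2 ?b1 ?b2 ?c1 ?c2 ?d1 ?d2.
- by apply: (core g1 g2 g3 g4); rewrite ?a1 ?a2 ?b1 ?b2 ?c1 ?c2 ?d1 ?d2.
Qed.

Section Label.
Variable x : D.
Local Notation a := (x, false).
Local Notation K := (par (lk x)).
Let e (u g : G) := H a (u * g).
Let sK : subg K := par_subg (lk x).
Let dif g h (u : G) : int := Posz (e u g != e u h).

Lemma dif_sum g h : isum K (dif g h) = ell a (g^-1 * h).
Proof.
rewrite /ell /V -(isum_mulr sK g (kinv_n (@H_quasi D a) _)); last first.
  by apply: vfin_n => //; apply: H_vfin.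
apply: eq_isum => u; rewrite /dif /e -mulgA mulVKg.
by case: (H _ _); case: (H _ _).
Qed.

Lemma dif_fin g h : kfin K (dif g h).
Proof.
have fi : kfin K (fun u => `|Posz (H a (u * (g^-1 * h))%g) - Posz (H a u)|%R).
  by apply: vfin_n => //; apply: H_vfin.
apply: kfin_sub (kfin_mulr g fi) => u; rewrite /dif /e -mulgA mulVKg.
by case: (H _ _); case: (H _ _).
Qed.

Lemma dif_inv g h : kinv K (dif g h).
Proof.
move=> k u Kk; have hk (y : G) : H a (k * y) = H a y by rewrite H_lk.
by rewrite /dif /e -!mulgA !hk.
Qed.

(** A geodesic crosses a wall at most once, so a wall between 1 and p does not
    separate p from q. *)
Lemma between (p q u : G) : len q = (len p + len (p^-1 * q)%g)%R -> e u p != e u 1 -> e u p = e u q.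
Proof.
move=> lq; pose F u : int := (dif 1%g p u + dif p q u - dif 1%g q u)%R.
have F0 t : (0 <= F t)%R by rewrite /F /dif; case: (e t 1); case: (e t p); case: (e t q).
have Fi : kinv K F by move=> k t Kk; rewrite /F !dif_inv.
have fD : kfin K (fun t => dif 1%g p t + dif p q t)%R by apply: kfin_add => //; apply: dif_fin.
have Ff : kfin K F.
  apply: kfin_sub (kfin_add fD (dif_fin 1 q)) => t; rewrite /F /dif.
  by case: (e t 1); case: (e t p); case: (e t q).
have el y : (ell (y, false) q <= ell (y, false) p + ell (y, false) (p^-1 * q)%g)%R.
  rewrite -{1}(mulVKg p q); apply: VM; [exact: par_subg|exact: H_quasi|exact: H_vfin].
have ex : ell a q = (ell a p + ell a (p^-1 * q)%g)%R.
  apply: le_anti; rewrite el /= leNgt; apply/negP => lt.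
  have : (\sum_y ell (y, false) q < \sum_y (ell (y, false) p + ell (y, false) (p^-1 * q)%g))%R.
    rewrite (bigD1 x) //= [X in (_ < X)%R](bigD1 x) //=; apply: ltr_leD => //.
    by apply: ler_sum => y _; apply: el.
  by rewrite big_split /= -/(len p) -/(len q) -/(len _) lq ltxx.
have sF : isum K F = 0%R.
  have : isum K (fun t => F t + dif 1%g q t)%R = isum K (fun t => dif 1%g p t + dif p q t)%R.
    by apply: eq_isum => t; rewrite /F subrK.
  have -> : isum K (fun t => F t + dif 1%g q t)%R = (isum K F + isum K (dif 1%g q))%R.
    by apply: isum_add => //; apply: dif_fin.
  have -> : isum K (fun t => dif 1%g p t + dif p q t)%R = (isum K (dif 1%g p) + isum K (dif p q))%R.
    by apply: isum_add => //; apply: dif_fin.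
  rewrite !dif_sum invg1 !mul1g ex => h; apply: (addIr (ell a p + ell a (p^-1 * q)%g)%R).
  by rewrite h add0r.
move=> up; have := isum_ge (s := [:: u]) sK Fi Ff F0 isT; rewrite big_seq1 sF /F /dif.
by move: up; case: (e u 1); case: (e u p); case: (e u q).
Qed.

(** Compare the walls crossed by the path from 1 to p with those crossed by its
    translate from c to c p: there are equally many. If one of them is crossed only by the first
    path, and separates neither 1 from c nor q from c q, then no wall is crossed only
    by the second path in the same way, because these two walls would cross. *)
Lemma conj_prefix_ell (c p q : G) : len q = (len p + len (p^-1 * q)%g)%R ->
  (ell a (p^-1 * c * p)%g <= 3 * ell a c + 2 * ell a (q^-1 * c * q)%g)%R.
Proof.
move=> lq.
pose A u := e u p != e u 1; pose B u := e u (c * p) != e u c.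
pose XA u : int := Posz (A u && ~~ B u); pose XB u : int := Posz (B u && ~~ A u).
have eA : dif 1%g p =1 fun u => Posz (A u) by move=> u; rewrite /dif /A eq_sym.
have eB : dif c (c * p) =1 fun u => Posz (B u) by move=> u; rewrite /dif /B eq_sym.
have fA := dif_fin 1 p; have fB := dif_fin c (c * p).
have fXA : kfin K XA by apply: kfin_sub fA => u; rewrite eA /XA; case: (A u).
have fXB : kfin K XB by apply: kfin_sub fB => u; rewrite eB /XB; case: (B u).
have sAB : isum K XA = isum K XB.
  have : isum K (fun u => XA u + dif c (c * p)%g u)%R = isum K (fun u => XB u + dif 1%g p u)%R.
    by apply: eq_isum => u; rewrite eA eB /XA /XB; case: (A u); case: (B u).
  by rewrite !isum_add // !dif_sum mulKg invg1 mul1g => /addIr.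
have fN1 := dif_fin 1 c; have fN2 := dif_fin q (c * q).
have fN := kfin_add fN1 fN2.
have sN : isum K (fun u => dif 1%g c u + dif q (c * q)%g u)%R = (ell a c + ell a (q^-1 * c * q)%g)%R.
  by rewrite isum_add // !dif_sum invg1 mul1g mulgA.
have bA : (isum K XA <= ell a c + ell a (q^-1 * c * q))%R.
  (* a wall u0 crossed by the first path only excludes those crossed by the second only *)
  rewrite -sN; have [h|] := pselect (forall u, XA u <= dif 1%g c u + dif q (c * q)%g u)%R.
    exact: isum_le.
  move=> /existsNP[u0 /negP]; rewrite -ltNge => h0; rewrite sAB; apply: isum_le => // u.
  rewrite leNgt; apply/negP => h.
  have [Au0 [nBu0 [n1 n2]]] : e u0 p != e u0 1 /\ e u0 (c * p) = e u0 c /\ e u0 1 = e u0 c /\ e u0 q = e u0 (c * q).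
    move: h0; rewrite /XA /A /B /dif.
    case: (e u0 p); case: (e u0 1); case: (e u0 (c * p)); case: (e u0 c); case: (e u0 q); case: (e u0 (c * q)) => //=.
  have [Bu [nAu [m1 m2]]] : e u (c * p) != e u c /\ e u p = e u 1 /\ e u 1 = e u c /\ e u q = e u (c * q).
    move: h; rewrite /XB /A /B /dif.
    case: (e u p); case: (e u 1); case: (e u (c * p)); case: (e u c); case: (e u q); case: (e u (c * q)) => //=.
  have b1 := between lq Au0.
  have b2 : e u (c * p) = e u (c * q).
    have := @between p q (u * c) lq; rewrite /e -!mulgA mulg1; apply.
    exact: Bu.
  have tr t g : hs t^-1 a g = e t g by rewrite /hs invgK.
  apply: (@no_cross u0^-1 u^-1 a (e u0 1) (e u 1) 1 q p (c * p)); rewrite !tr //.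
  - by rewrite -b1; move: Au0; case: (e u0 p); case: (e u0 1).
  - by rewrite m2 -b2 m1; move: Bu; case: (e u (c * p)); case: (e u c).
  - by move: Au0; case: (e u0 p); case: (e u0 1).
  - by rewrite nBu0.
  - by rewrite m1; move: Bu; case: (e u (c * p)); case: (e u c).
have -> : ell a (p^-1 * c * p) = isum K (dif p (c * p)) by rewrite dif_sum mulgA.
have : (isum K (dif p (c * p)%g) <= isum K (fun u => XA u + (XB u + dif 1%g c u)))%R.
  apply: isum_le => //; [exact: dif_fin|by do 2!apply: kfin_add => //|].
  move=> u; rewrite /dif /XA /XB /A /B.
  by case: (e u p); case: (e u 1); case: (e u (c * p)); case: (e u c).
rewrite isum_add //; last exact: kfin_add.
rewrite isum_add // -sAB (dif_sum 1 c) invg1 mul1g => h; apply: le_trans h _.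
by move: bA; set X := isum K XA; set E1 := ell a c; set E2 := ell a _; lia.
Qed.

End Label.

Lemma conj_prefix (c p q : G) : len q = (len p + len (p^-1 * q)%g)%R ->
  (len (p^-1 * c * p)%g <= 3 * len c + 2 * len (q^-1 * c * q)%g)%R.
Proof.
move=> lq; rewrite /len !mulr_sumr -big_split /=; apply: ler_sum => x _.
exact: conj_prefix_ell.
Qed.

Lemma short_path (X : finType) (r : rel X) s t : connect r s t ->
  exists p, [/\ path r s p, last s p = t & size p < #|X|].
Proof.
move=> /connectP[p0 p0P ->]; have [p pp up _] := shortenP p0P.
by exists p; split=> //; have /card_uniqP /= <- := up; apply: max_card.
Qed.

Definition nwords R := #|{: R.-bseq (letter D)}|.

Lemma tb_sum (f : nat -> nat) c : tb f -> tb (fun n => \sum_(i < (f n).+1) c ^ i)%N.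
Proof.
move=> tf; apply: (tb_le (g := fun n => ((f n).+1 * c.+1 ^ f n)%N)).
  apply: tb_mul; last by apply: tb_exp => //; apply: tb_const.
  by apply: tb_le (tb_add (tb_const 1) tf) _ => n; rewrite add1n.
move=> n; apply: leq_trans (_ : \sum_(i < (f n).+1) c.+1 ^ f n <= _).
  apply: leq_sum => i _; apply: (@leq_trans (c.+1 ^ i)); first by case: (nat_of_ord i) => // m; rewrite leq_exp2r.
  by rewrite leq_pexp2l // -ltnS.
by rewrite sum_nat_const card_ord.
Qed.

Lemma tb_nwords f : tb f -> tb (fun n => nwords (f n)).
Proof.
move=> tf; have le n : nwords (f n) <= (\sum_(i < (f n).+1) #|{: letter D}| ^ i)%N by rewrite /nwords card_bseq.
exact: tb_le (tb_sum _ tf) le.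
Qed.

Definition bword R w : R.-bseq (letter D) := insubd (nil_bseq R _) w.
Lemma bwordK R w : size w <= R -> bword R w = w :> word D.
Proof. by move=> h; rewrite /bword val_insubd h. Qed.

(** By [conj_prefix] the conjugates of c by the prefixes of a conjugator stay short, so
    repetitions can be cut out. *)
Lemma conj_bound R (c c' : G) : cj c c' -> (len c <= Posz R)%R -> (len c' <= Posz R)%R ->
  exists2 q, c' = q^-1 * c * q & (len q <= Posz (nwords (5 * R)))%R.
Proof.
move=> [q0 e0] lc lc'; pose M := (5 * R)%N.
(* the graph of conjugations by one letter among words of size at most M *)
pose r (s t : M.-bseq (letter D)) := `[< exists b, gw t = (lt b)^-1 * gw s * lt b >].
pose sg g := bword M (rw g).
have sgK g : (len g <= Posz M)%R -> gw (sg g) = g.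
  by rewrite len_rw lez_nat => h; rewrite /sg bwordK // rwK.
have pre w1 w2 : rw q0 = w1 ++ w2 -> (len ((gw w1)^-1 * c * gw w1)%g <= Posz M)%R.
  move=> e1; have rq := rwP q0; have e2 : q0 = gw w1 * gw w2 by rewrite -gwM -e1 rwK.
  have l1 : len q0 = (len (gw w1) + len ((gw w1)^-1 * q0)%g)%R.
    rewrite {2}e2 mulKg len_rw e1 size_cat PoszD !len_red //.
      by apply: (@red_infix _ w1 _ [::]); rewrite cats0 -e1.
    by apply: (@red_infix _ [::] _ w2); rewrite /= -e1.
  apply: le_trans (conj_prefix c l1) _; rewrite -e0 /M.
  by move: lc lc'; set l2 := len c; set l3 := len c'; lia.
have cn w1 w2 : rw q0 = w1 ++ w2 -> connect r (sg c) (sg ((gw w1)^-1 * c * gw w1)).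
  elim/last_ind: w1 w2 => [|w1 b IH] w2 e1; first by rewrite gw0 invg1 mul1g mulg1 connect0.
  have e2 : rw q0 = w1 ++ b :: w2 by rewrite e1 cat_rcons.
  apply: connect_trans (IH _ e2) _; apply: connect1; apply/asboolP; exists b.
  by rewrite !sgK; [rewrite gw_rcons invgM !mulgA|exact: pre e2|exact: pre e1].
have := cn (rw q0) [::]; rewrite cats0 rwK -e0 => /(_ erefl) /short_path[p [pp lp sp]].
have [q [qE lq]] : exists q, gw (last (sg c) p) = q^-1 * c * q /\ (len q <= Posz (size p))%R.
  elim/last_ind: p pp {lp sp} => [|p t IH] /=.
    move=> _; exists 1; rewrite invg1 mul1g mulg1 len1 sgK //.
    by apply: le_trans lc _; rewrite /M; lia.
  rewrite rcons_path last_rcons => /andP[/IH[q [qE lq]] /asboolP[b ->]].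
  exists (q * lt b); rewrite qE invgM !mulgA; split=> //.
  apply: le_trans (lenM _ _) _; rewrite len_lt size_rcons -addn1 PoszD.
  by rewrite lerD2r.
exists q; first by rewrite -qE lp sgK // (le_trans lc') // /M; lia.
by apply: le_trans lq _; rewrite lez_nat ltnW.
Qed.

(** Up to conjugation, tuples of bounded cyclic length are represented by the elements of
    a finite type. *)
Section Graph.
Variables R k : nat.
Local Notation X := (k.-tuple (R.-bseq (letter D))).
Definition elts (s : X) : seq G := [seq gw (bseqval t) | t <- (s : seq (R.-bseq (letter D)))].
Definition state (V : seq G) : X := [tuple bword R (rw (cyc (nth 1 V i))) | i < k].

Lemma state_cjs V : size V = k -> (scl V <= Posz R)%R -> cjs (elts (state V)) V.
Proof.
move=> sV lV; split; first by rewrite size_map size_tuple.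
move=> i; have [lt|ge] := ltnP i k; last first.
  have -> : nth 1 (elts (state V)) i = 1 by rewrite nth_default // size_map size_tuple.
  have -> : nth 1 V i = 1 by rewrite nth_default // sV.
  exact: cj_refl.
rewrite /elts (nth_map (nil_bseq R _)) ?size_tuple // -(tnth_nth _ _ (Ordinal lt)) tnth_mktuple /=.
rewrite bwordK; first by rewrite rwK; apply: cj_sym; exists (cyq (nth 1 V i)).
have := clen_scl (mem_nth 1 (_ : i < size V)%N); rewrite sV => /(_ lt) h.
by rewrite -lez_nat -len_rw; apply: le_trans h lV.
Qed.

Definition adjs (s t : X) := `[< smove (elts s) (elts t) >].

Lemma smove_cjs (V V' W W' : seq G) : cjs V V' -> cjs W W' -> smove V W -> smove V' W'.
Proof.
move=> cV cW [e [e' [se c]]]; exists e, e'; split=> //.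
have eM : ishom e by case: se.
exact: cjs_trans (cjs_hom eM (cjs_sym cV)) (cjs_trans c cW).
Qed.

Lemma spath_connect U V : size U = k -> (scl U <= Posz R)%R -> spath (Posz R) U V ->
  [/\ size V = k, (scl V <= Posz R)%R & connect adjs (state U) (state V)].
Proof.
move=> sU lU; elim=> [|V1 W1 _ [s1 l1 c1] _ l2 m]; first by split=> //; apply: connect0.
have s2 : size W1 = k by case: (m) => e [e' [_ [<- _]]]; rewrite size_map.
split=> //; apply: connect_trans c1 _; apply: connect1; apply/asboolP.
by apply: smove_cjs m; apply: cjs_sym; apply: state_cjs.
Qed.

Definition mild M (e e' : G -> G) := [/\ ishom e, ishom e', cancel e e', cancel e' e &
  forall a, (len (e (lt a)) <= Posz M)%R /\ (len (e' (lt a)) <= Posz M)%R].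

Lemma len_hom e M g : ishom e -> (forall a, len (e (lt a)) <= Posz M)%R ->
  (len (e g) <= Posz M * len g)%R.
Proof.
move=> eM h; rewrite -{1}(rwK g) [X in (_ <= _ * X)%R]len_rw; elim: (rw g) => [|a w IH]; first by rewrite gw0 (hom1 eM) len1 mulr0.
rewrite gw_cons eM; apply: le_trans (lenM _ _) _.
by rewrite /= intS mulrDr mulr1; apply: lerD.
Qed.

Lemma mild_comp M e e' f f' : mild M e e' -> small f f' -> mild (3 * M) (f \o e) (e' \o f').
Proof.
move=> [eM eM' K K' h] [fM fM' L L' h']; split.
- exact: hom_comp.
- exact: hom_comp.
- exact: can_comp.
- exact: can_comp.
move=> a; have [h1 h2] := h a; have [h3 h4] := h' a; split=> /=.
  apply: le_trans (len_hom (M := 3) _ fM (fun b => (h' b).1)) _.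
  by rewrite PoszM ler_wpM2l.
apply: le_trans (len_hom (M := M) _ eM' (fun b => (h b).2)) _.
by rewrite mulnC PoszM ler_wpM2l.
Qed.

Lemma path_mild s p : path adjs s p -> exists e e', mild (3 ^ size p) e e' /\ cjs (map e (elts s)) (elts (last s p)).
Proof.
elim/last_ind: p => [|p t IH] /=.
  exists id, id; rewrite map_id expn0; split; last exact: cjs_refl.
  by split=> // a; rewrite len_lt.
rewrite rcons_path last_rcons size_rcons => /andP[/IH[e [e' [me ce]]] /asboolP[f [f' [sf cf]]]].
exists (f \o e), (e' \o f'); rewrite expnS; split; first exact: mild_comp.
have fM : ishom f by case: sf.
by rewrite map_comp; apply: cjs_trans (cjs_hom fM ce) cf.
Qed.

Lemma spath_mild U V : size U = k -> (scl U <= Posz R)%R -> spath (Posz R) U V ->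
  exists e e', mild (3 ^ (nwords R ^ k)) e e' /\ cjs (map e U) V.
Proof.
move=> sU lU p; have [sV lV /short_path[q [pq lq sq]]] := spath_connect sU lU p.
have [e [e' [[eM eM' K K' h] ce]]] := path_mild pq.
exists e, e'; split.
  have le : (Posz (3 ^ size q) <= Posz (3 ^ (nwords R ^ k)))%R.
    by rewrite lez_nat leq_pexp2l // /nwords -card_tuple ltnW.
  by split=> // a; have [h1 h2] := h a; split; apply: le_trans le.
apply: cjs_trans (_ : cjs (map e (elts (state U))) V).
  by apply: cjs_hom => //; apply: cjs_sym; apply: state_cjs.
by apply: cjs_trans ce _; rewrite lq; apply: state_cjs.
Qed.

End Graph.

(** The tuples of bounded cyclic length are finitely many up to conjugation, so a path
    without repetitions has bounded length; conjugators are bounded by [conj_bound]. *)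
Theorem orbit_bound : exists2 B, tb B & forall L (U V : seq G) al, isaut al -> cjs (map al U) V ->
  (size U <= L)%N -> (forall g, g \in U -> len g <= Posz L)%R -> (forall g, g \in V -> len g <= Posz L)%R ->
  exists e e' (Q : seq G), [/\ mild (B L) e e', size Q = size U, (forall q, q \in Q -> len q <= Posz (B L))%R &
    forall i, nth 1 V i = (nth 1 Q i)^-1 * e (nth 1 U i) * nth 1 Q i].
Proof.
have [S tS SP] := orbit_spath D.
pose L2 L := (L * L)%N; pose R L := (L2 L + L + S (L2 L + L))%N.
pose M L := (3 ^ (nwords (R L) ^ L))%N; pose C L := nwords (5 * (M L * L + L)).
have t2 : tb (fun L => L2 L + L)%N by apply: tb_add; [apply: tb_mul; exact: tb_id|exact: tb_id].
have tR : tb R by apply: tb_add => //; apply: tb_comp tS t2.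
have tM : tb M.
  apply: tb_exp; first exact: tb_const.
  by apply: tb_exp; [exact: tb_nwords|exact: tb_id].
have tC : tb C.
  apply: tb_nwords; apply: tb_mul; first exact: tb_const.
  by apply: tb_add; [apply: tb_mul => //; exact: tb_id|exact: tb_id].
exists (fun L => M L + C L)%N; first exact: tb_add.
move=> L U V al aA c sU lU lV.
have sclb (W : seq G) : (size W <= L)%N -> (forall g, g \in W -> len g <= Posz L)%R -> (scl W <= Posz (L2 L))%R.
  move=> sW lW; apply: le_trans (_ : \sum_(g <- W) Posz L <= _)%R.
    rewrite /scl big_seq [X in (_ <= X)%R]big_seq; apply: ler_sum => g /lW.
    by apply: le_trans; apply: clen_len.
  rewrite big_const_seq count_predT iter_addr_0 -mulr_natl natz /L2 PoszM.
  by rewrite ler_wpM2r.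
have sV : size V = size U by case: c => <- _; rewrite size_map.
have sc : scl (map al U) = scl V by apply/esym/cjs_scl.
have le2 X : (X <= Posz (L2 L))%R -> (X <= Posz (L2 L + L))%R.
  by move=> h; apply: le_trans h _; rewrite lez_nat leq_addr.
have sp : spath (Posz (R L)) U (map al U).
  apply: (@spath_le _ (Posz (S (L2 L + L)))); first by rewrite lez_nat leq_addl.
  apply: SP aA _ _ _; first by apply: leq_trans sU _; rewrite leq_addl.
    by apply/le2/sclb.
  by rewrite sc; apply/le2/sclb; rewrite ?sV.
have lUR : (scl U <= Posz (R L))%R.
  by apply: le_trans (le2 _ (sclb _ sU lU)) _; rewrite lez_nat leq_addr.
have [e [e' [[eM eM' K K' h] ce]]] := spath_mild (erefl (size U)) lUR sp.
have leM : (3 ^ (nwords (R L) ^ size U) <= M L)%N.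
  rewrite leq_pexp2l // leq_pexp2l // /nwords; apply/card_gt0P.
  by exists (nil_bseq _ _).
have cV := cjs_trans ce c.
have hQ i : exists q, nth 1 V i = q^-1 * e (nth 1 U i) * q /\ (len q <= Posz (C L))%R.
  have [ltU|ge] := ltnP i (size U); last first.
    exists 1; rewrite !nth_default ?sV // (hom1 eM) invg1 !mulg1 len1; split=> //.
  have cji : cj (e (nth 1 U i)) (nth 1 V i).
    by have := cV.2 i; rewrite (nth_map 1).
  have b1 : (len (e (nth 1%g U i)) <= Posz (M L * L + L))%R.
    have hb a : (len (e (lt a)) <= Posz (M L))%R by apply: le_trans (h a).1 _; rewrite lez_nat.
    apply: le_trans (len_hom _ eM hb) _; rewrite PoszD PoszM.
    apply: le_trans (_ : Posz (M L) * Posz L <= _)%R; last by rewrite lerDl.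
    by rewrite ler_wpM2l // lU // mem_nth.
  have b2 : (len (nth 1%g V i) <= Posz (M L * L + L))%R.
    by apply: le_trans (lV _ _) _; rewrite ?mem_nth ?sV // lez_nat leq_addl.
  by have [q qE lq] := conj_bound cji b1 b2; exists q.
have [Qf QfP] := choice hQ.
exists e, e', (mkseq Qf (size U)); split.
- split=> // a; have [h1 h2] := h a; split.
    by apply: le_trans h1 _; rewrite lez_nat; apply: leq_trans leM (leq_addr _ _).
  by apply: le_trans h2 _; rewrite lez_nat; apply: leq_trans leM (leq_addr _ _).
- by rewrite size_mkseq.
- move=> q /mapP[i _ ->]; apply: le_trans (QfP i).2 _; by rewrite lez_nat leq_addl.
move=> i; have [lt|ge] := ltnP i (size U); first by rewrite nth_mkseq // (QfP i).1.
by rewrite !nth_default ?size_mkseq ?sV // (hom1 eM) invg1 !mulg1.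
Qed.

End ConjBound.

(** * Recursive functions on coded lists *)

Section Recursive.
Implicit Types (F A B C I : seq nat -> nat) (xs : seq nat).

(** Total functions of k arguments are written as functions of the list of
    arguments, so that variables are projections. *)
Definition recursive k F := exists P, forall xs, size xs = k -> reval P xs (F xs).

Lemma rc_ext k F F' : (forall xs, size xs = k -> F xs = F' xs) -> recursive k F -> recursive k F'.
Proof. by move=> e [P PP]; exists P => xs s; rewrite -e //; apply: PP. Qed.

Lemma rc_comp m k F (Gs : seq (seq nat -> nat)) : recursive m F -> size Gs = m ->
  foldr (fun A R => recursive k A /\ R) True Gs -> recursive k (fun xs => F [seq A xs | A <- Gs]).
Proof.
move=> [P PP] sG aG.
have [Ps PsP] : exists Ps, forall xs, size xs = k -> revals Ps xs [seq A xs | A <- Gs].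
  elim: Gs aG {sG} => [_|A Gs IH /= [[Q QP] /IH[Ps PsP]]].
    by exists [::] => xs _; apply: EvalNil.
  by exists (Q :: Ps) => xs s; apply: EvalCons; [apply: QP|apply: PsP].
exists (RComp P Ps) => xs s; apply: EvalComp (PsP xs s) _.
by apply: PP; rewrite size_map.
Qed.

Lemma rc_proj k i : i < k -> recursive k (fun xs => nth 0 xs i).
Proof. by move=> ik; exists (RProj i) => xs s; apply: EvalProj; rewrite s. Qed.

Definition c1 f := recursive 1 (fun xs => f (nth 0 xs 0)).
Definition c2 f := recursive 2 (fun xs => f (nth 0 xs 0) (nth 0 xs 1)).

Lemma rc1 k f A : c1 f -> recursive k A -> recursive k (fun xs => f (A xs)).
Proof. by move=> cf cA; apply: (@rc_comp 1 k _ [:: A] cf). Qed.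

Lemma rc2 k f A B : c2 f -> recursive k A -> recursive k B -> recursive k (fun xs => f (A xs) (B xs)).
Proof. by move=> cf cA cB; apply: (@rc_comp 2 k _ [:: A; B] cf). Qed.

Lemma c1_succ : c1 succn.
Proof. by exists RSucc => -[|x [|? ?]] // _; apply: EvalSucc. Qed.

Lemma rc_const k c : recursive k (fun=> c).
Proof.
elim: c => [|c IH]; first by exists RZero => xs _; apply: EvalZero.
exact: (rc1 c1_succ IH).
Qed.

Fixpoint prec (b : nat) (g : nat -> nat -> nat) n := if n is m.+1 then g m (prec b g m) else b.

Lemma rc_prec k A F : recursive k A -> recursive k.+2 F ->
  recursive k.+1 (fun xs => prec (A (behead xs)) (fun m r => F [:: m, r & behead xs]) (nth 0 xs 0)).
Proof.
move=> [P PP] [Q QP]; exists (RPrim P Q) => -[//|n xs] [s] /=.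
elim: n => [|n IH]; first by apply: EvalPrim0; apply: PP.
by apply: EvalPrimS IH _; apply: QP; rewrite /= s.
Qed.

Lemma proj_drop xs d k : size xs = d + k -> [seq A xs | A <- mkseq (fun i xs => nth 0 xs (d + i)) k] = drop d xs.
Proof.
move=> s; rewrite -map_comp /=; apply: (@eq_from_nth _ 0) => [|i].
  by rewrite size_map size_iota size_drop s addKn.
by rewrite size_map size_iota => ik; rewrite (nth_map 0) ?size_iota // nth_iota // nth_drop.
Qed.

Lemma rc_projs d k : foldr (fun A R => recursive (d + k) A /\ R) True (mkseq (fun i xs => nth 0 xs (d + i)) k).
Proof.
rewrite /mkseq; have : all (fun i => i < k) (iota 0 k) by apply/allP => i; rewrite mem_iota.
elim: (iota 0 k) => //= i s IH /andP[ik /IH h]; split=> //.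
by apply: rc_proj; rewrite ltn_add2l.
Qed.

(** The first d variables are replaced by a computed value, as needed for the
    parameters of recursions and folds. *)
Lemma rc_sub1 d k F A : recursive k.+1 F -> recursive (d + k) A -> recursive (d + k) (fun xs => F (A xs :: drop d xs)).
Proof.
move=> cF cA; have := @rc_comp _ (d + k) F (A :: mkseq (fun i xs => nth 0 xs (d + i)) k) cF.
rewrite /= size_mkseq => /(_ erefl (conj cA (rc_projs d k))); apply: rc_ext => xs s.
by rewrite proj_drop.
Qed.

Lemma rc_sub2 d k F A B : recursive k.+2 F -> recursive (d + k) A -> recursive (d + k) B ->
  recursive (d + k) (fun xs => F [:: A xs, B xs & drop d xs]).
Proof.
move=> cF cA cB; have := @rc_comp _ (d + k) F [:: A, B & mkseq (fun i xs => nth 0 xs (d + i)) k] cF.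
rewrite /= size_mkseq => /(_ erefl (conj cA (conj cB (rc_projs d k)))); apply: rc_ext => xs s.
by rewrite proj_drop.
Qed.

Lemma c1_prec b g : c2 g -> c1 (prec b g).
Proof.
move=> cg; apply: (rc_ext _ (@rc_prec 0 (fun=> b) (fun ys => g (nth 0 ys 0) (nth 0 ys 1)) _ _)).
- by case=> [|x [|]].
- exact: rc_const.
- exact: rc2 cg (rc_proj _) (rc_proj _).
Qed.

Lemma c2_prec f g : c1 f -> recursive 3 (fun ys => g (nth 0 ys 0) (nth 0 ys 1) (nth 0 ys 2)) ->
  c2 (fun n x => prec (f x) (fun m r => g m r x) n).
Proof.
move=> cf cg; apply: (rc_ext _ (@rc_prec 1 (fun ys => f (nth 0 ys 0)) _ cf cg)).
by case=> [|x [|y [|]]].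
Qed.

Lemma c2_add : c2 addn.
Proof.
apply: rc_ext (c2_prec (f := id) (g := fun _ r _ => r.+1) (rc_proj _) (rc1 c1_succ (rc_proj _))) => // xs _.
by elim: (nth 0 xs 0) => //= n ->.
Qed.

Lemma c1_pred : c1 predn.
Proof. by apply: rc_ext (c1_prec 0 (g := fun m _ => m) (rc_proj _)) => // xs _; case: (nth 0 xs 0). Qed.

Lemma c2_sub : c2 subn.
Proof.
have h : c2 (fun n x => x - n).
  apply: rc_ext (c2_prec (f := id) (g := fun _ r _ => r.-1) (rc_proj _) (rc1 c1_pred (rc_proj _))) => // xs _.
  by elim: (nth 0 xs 0) => //= [|n ->]; rewrite ?subn0 // subnS.
exact: rc2 h (rc_proj (isT : 1 < 2)) (rc_proj (isT : 0 < 2)).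
Qed.

Lemma c2_mul : c2 muln.
Proof.
apply: rc_ext (c2_prec (f := fun=> 0) (g := fun _ r x => r + x) (rc_const 1 0) (rc2 c2_add (rc_proj _) (rc_proj _))) => // xs _.
by elim: (nth 0 xs 0) => //= n ->; rewrite mulSn addnC.
Qed.

Lemma rc_if k (c : seq nat -> bool) A B : recursive k (fun xs => c xs) -> recursive k A -> recursive k B ->
  recursive k (fun xs => if c xs then A xs else B xs).
Proof.
move=> cc cA cB; apply: rc_ext (rc2 c2_add (rc2 c2_mul cc cA) (rc2 c2_mul (rc2 c2_sub (rc_const k 1) cc) cB)).
by move=> xs _; case: (c xs); rewrite /= ?mul1n ?mul0n ?addn0.
Qed.

Lemma rc_eq k A B : recursive k A -> recursive k B -> recursive k (fun xs => A xs == B xs).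
Proof.
move=> cA cB; apply: rc_ext (rc2 c2_sub (rc_const k 1) (rc2 c2_add (rc2 c2_sub cA cB) (rc2 c2_sub cB cA))).
move=> xs _; rewrite [A xs == _]eqn_leq -!subn_eq0; by case: (A xs - _) => [|?]; case: (B xs - _).
Qed.

Lemma rc_and k (b c : seq nat -> bool) : recursive k (fun xs => b xs) -> recursive k (fun xs => c xs) ->
  recursive k (fun xs => b xs && c xs).
Proof. by move=> cb cc; apply: rc_ext (rc2 c2_mul cb cc) => xs _; case: (b xs); case: (c xs). Qed.

Lemma rc_not k (b : seq nat -> bool) : recursive k (fun xs => b xs) -> recursive k (fun xs => ~~ b xs).
Proof. by move=> cb; apply: rc_ext (rc2 c2_sub (rc_const k 1) cb) => xs _; case: (b xs). Qed.

Lemma c1_exp2 : c1 (expn 2).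
Proof.
apply: rc_ext (c1_prec 1 (g := fun _ r => r + r) (rc2 c2_add (rc_proj _) (rc_proj _))) => // xs _.
by elim: (nth 0 xs 0) => //= n ->; rewrite expnS mul2n -addnn.
Qed.

Lemma rc_Tw k (t : nat) A : recursive k A -> recursive k (fun xs => iter t (expn 2) (A xs)).
Proof. by move=> cA; elim: t => [|t IH] //=; apply: rc1 c1_exp2 IH. Qed.

Lemma c1_odd : c1 (fun n => odd n).
Proof.
apply: rc_ext (c1_prec 0 (g := fun _ r => 1 - r) (rc2 c2_sub (rc_const _ 1) (rc_proj _))) => // xs _.
by elim: (nth 0 xs 0) => //= n ->; case: (odd n).
Qed.

Lemma c1_half : c1 half.
Proof.
apply: rc_ext (c1_prec 0 (g := fun m r => r + odd m) (rc2 c2_add (rc_proj _) (rc1 c1_odd (rc_proj _)))) => // xs _.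
by elim: (nth 0 xs 0) => //= n ->; rewrite uphalf_half addnC.
Qed.

(** The code of a list is its head paired with the code of its tail in this way, so
    lists double as pairs. *)
Definition kons a c := 2 ^ a * c.*2.+1.
Definition hd n := head 0 (CodeSeq.decode n).
Definition tl n := CodeSeq.code (behead (CodeSeq.decode n)).

Lemma code_cons a s : CodeSeq.code (a :: s) = kons a (CodeSeq.code s).
Proof. by []. Qed.

Lemma hd_code s : hd (CodeSeq.code s) = head 0 s. Proof. by rewrite /hd CodeSeq.codeK. Qed.
Lemma tl_code s : tl (CodeSeq.code s) = CodeSeq.code (behead s). Proof. by rewrite /tl CodeSeq.codeK. Qed.

Lemma hd_kons a c : hd (kons a c) = a.
Proof. by rewrite -[c]CodeSeq.decodeK -code_cons hd_code. Qed.
Lemma tl_kons a c : tl (kons a c) = c.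
Proof. by rewrite -{1}[c]CodeSeq.decodeK -code_cons tl_code CodeSeq.decodeK. Qed.

Lemma kons_eta n : 0 < n -> n = kons (hd n) (tl n).
Proof.
rewrite -{1 2}[n]CodeSeq.decodeK /hd /tl; case: (CodeSeq.decode n) => //.
Qed.

Lemma c2_kons : c2 kons.
Proof.
apply: rc2 c2_mul (rc1 c1_exp2 (rc_proj _)) (rc1 c1_succ _) => //.
by apply: rc_ext (rc2 c2_add (rc_proj (isT : 1 < 2)) (rc_proj (isT : 1 < 2))) => xs _; rewrite addnn.
Qed.

(** Halving while possible, to recover the exponent of 2 and the odd part of a
    code. *)
Definition strip n := prec n (fun _ r => if odd r then r else r./2).

Lemma stripS n k : strip n k.+1 = if odd (strip n k) then strip n k else (strip n k)./2.
Proof. by []. Qed.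

Lemma strip_kons a c k : strip (kons a c) k = kons (a - k) c.
Proof.
elim: k => [|k IH]; first by rewrite subn0.
rewrite stripS IH subnS /kons; case: (a - k) => [|m]; first by rewrite expn0 mul1n /= odd_double.
by rewrite expnS -mulnA mul2n odd_double doubleK.
Qed.

Lemma c2_strip : c2 (fun k n => strip n k).
Proof.
apply: (c2_prec (f := id) (g := fun _ r _ => if odd r then r else r./2)); first exact: rc_proj.
by apply: rc_if; [apply: rc1 c1_odd (rc_proj _)|apply: rc_proj|apply: rc1 c1_half (rc_proj _)].
Qed.

Lemma kons_gt a c : a < kons a c.
Proof. by apply: leq_trans (ltn_expl a (isT : 1 < 2)) _; rewrite leq_pmulr. Qed.

Lemma hd_le n : hd n <= n.
Proof. by case: (posnP n) => [->//|n0]; rewrite {2}(kons_eta n0) ltnW // kons_gt. Qed.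

Lemma c1_tl : c1 tl.
Proof.
have h : c1 (fun n => (strip n n)./2) by apply: rc1 c1_half (rc2 c2_strip (rc_proj _) (rc_proj _)).
apply: rc_ext h => xs _; case: (posnP (nth 0 xs 0)) => [->//|n0].
rewrite {1}(kons_eta n0) strip_kons; set n := nth 0 xs 0.
have -> : hd n - n = 0 by apply/eqP; rewrite subn_eq0 hd_le.
by rewrite /kons mul1n /= uphalf_double.
Qed.

Lemma c1_hd : c1 hd.
Proof.
have h : c2 (fun m n => prec 0 (fun k r => r + ~~ odd (strip n k)) m).
  apply: (c2_prec (f := fun=> 0) (g := fun k r n => r + ~~ odd (strip n k))); first exact: rc_const.
  by apply: rc2 c2_add (rc_proj _) (rc_not (rc1 c1_odd (rc2 c2_strip (rc_proj _) (rc_proj _)))).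
have h2 := rc2 h (rc_proj (isT : 0 < 1)) (rc_proj (isT : 0 < 1)).
apply: rc_ext h2 => xs _; set n := nth 0 xs 0; case: (posnP n) => [->//|n0].
have e m : prec 0 (fun k r => r + ~~ odd (strip n k)) m = minn m (hd n).
  elim: m => [|m IH] /=; first by rewrite min0n.
  rewrite IH {2}(kons_eta n0) strip_kons /kons.
  case: (ltnP m (hd n)) => le; last first.
    have -> : hd n - m = 0 by apply/eqP; rewrite subn_eq0.
    rewrite mul1n /= odd_double /= addn0.
    by rewrite (minn_idPr (leqW le)).
  rewrite -(subnSK le) expnS -mulnA oddM /= (minn_idPl le).
  by rewrite addn1.
by rewrite e; apply/minn_idPr/hd_le.
Qed.

Definition nthc l i := nth 0 (CodeSeq.decode l) i.

Lemma c2_nthc : c2 nthc.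
Proof.
have h : c2 (fun i l => prec l (fun _ r => tl r) i).
  apply: (c2_prec (f := id) (g := fun _ r _ => tl r)); first exact: rc_proj.
  by apply: rc1 c1_tl _; apply: rc_proj.
have := rc1 c1_hd (rc2 h (rc_proj (isT : 1 < 2)) (rc_proj (isT : 0 < 2))); apply: rc_ext => xs _.
set l := nth 0 xs 0; set i := nth 0 xs 1.
have -> : prec l (fun _ r => tl r) i = CodeSeq.code (drop i (CodeSeq.decode l)).
  elim: i => [|i IH] /=; first by rewrite drop0 CodeSeq.decodeK.
  by rewrite IH tl_code -drop1 drop_drop.
by rewrite hd_code /nthc -nth0 nth_drop addn0.
Qed.

Lemma size_code s : size s <= CodeSeq.code s.
Proof.
elim: s => //= a s IH; rewrite -/(kons _ _) /kons; apply: leq_ltn_trans IH _.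
apply: (@leq_trans (CodeSeq.code s).*2.+1); first by rewrite ltnS -addnn leq_addl.
by rewrite leq_pmull // expn_gt0.
Qed.

(** The code of a list bounds its length, so iterating the step that often
    consumes the list; the state is a pair of the accumulator and the remaining list. *)
Lemma rc_fold k I F A : recursive k I -> recursive k.+2 F -> recursive k A ->
  recursive k (fun xs => foldl (fun r e => F [:: r, e & xs]) (I xs) (CodeSeq.decode (A xs))).
Proof.
move=> cI cF cA.
pose St xs (m r : nat) := if tl r == 0 then r else kons (F [:: hd r, hd (tl r) & xs]) (tl (tl r)).
have cr : recursive k.+2 (fun ys => nth 0 ys 1) by apply: rc_proj.
have cg : recursive k.+2 (fun ys => St (drop 2 ys) (nth 0 ys 0) (nth 0 ys 1)).
  apply: rc_if; first exact: rc_eq (rc1 c1_tl cr) (rc_const _ 0).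
    exact: cr.
  apply: rc2 c2_kons _ (rc1 c1_tl (rc1 c1_tl cr)).
  exact: (@rc_sub2 2 k F _ _ cF (rc1 c1_hd cr) (rc1 c1_hd (rc1 c1_tl cr))).
have h := rc_prec (rc2 c2_kons cI cA) cg.
have := rc1 c1_hd (@rc_sub1 0 k _ A h cA); apply: rc_ext => xs s /=.
rewrite /= drop0; set n := A xs.
have e m : m <= size (CodeSeq.decode n) -> prec (kons (I xs) n) (fun m r => St xs m r) m =
  kons (foldl (fun r e => F [:: r, e & xs]) (I xs) (take m (CodeSeq.decode n))) (CodeSeq.code (drop m (CodeSeq.decode n))).
  elim: m => [|m IH] lt; first by rewrite /= take0 drop0 CodeSeq.decodeK.
  rewrite [LHS]/= IH ?(ltnW lt) // /St tl_kons hd_kons (drop_nth 0 lt) (take_nth 0 lt) foldl_rcons.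
  by rewrite code_cons tl_kons hd_kons; case: eqP => // /eqP; rewrite /kons muln_eq0 expn_eq0.
(* the remaining iterations leave the state unchanged *)
have e2 m : prec (kons (I xs) n) (fun m r => St xs m r) (size (CodeSeq.decode n) + m) =
   kons (foldl (fun r e => F [:: r, e & xs]) (I xs) (CodeSeq.decode n)) 0.
  elim: m => [|m IH]; first by rewrite addn0 e // take_size drop_size.
  by rewrite addnS [LHS]/= IH /St tl_kons.
have le : size (CodeSeq.decode n) <= n by rewrite -{2}[n]CodeSeq.decodeK size_code.
by have := e2 (n - size (CodeSeq.decode n)); rewrite subnKC // !drop0 => ->; rewrite hd_kons.
Qed.

Lemma rc_list k (T : Type) (s : seq T) (F : T -> seq nat -> nat) : (forall t, recursive k (F t)) ->
  recursive k (fun xs => CodeSeq.code [seq F t xs | t <- s]).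
Proof.
move=> cF; elim: s => [|t s IH] /=; first exact: rc_const.
exact: rc2 c2_kons (cF t) IH.
Qed.

Lemma rc_all k (T : Type) (s : seq T) (F : T -> seq nat -> bool) : (forall t, recursive k (fun xs => F t xs)) ->
  recursive k (fun xs => all (F^~ xs) s).
Proof.
move=> cF; elim: s => [|t s IH] /=; first exact: rc_const.
exact: rc_and (cF t) IH.
Qed.

(** Bounded search, returning the successor of a solution or 0. *)
Definition find_below (p : nat -> bool) n := prec 0 (fun m r => if r == 0 then if p m then m.+1 else 0 else r) n.

Lemma find_belowS p n : find_below p n.+1 =
  if find_below p n == 0 then if p n then n.+1 else 0 else find_below p n.
Proof. by []. Qed.

Lemma find_belowP p n : if find_below p n is m.+1 then p m else forall m, m < n -> ~~ p m.
Proof.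
elim: n => // n; rewrite find_belowS; case: (find_below p n) => //= IH.
case: ifP => [//|np] m; rewrite ltnS leq_eqVlt => /orP[/eqP ->|/IH] //; by rewrite np.
Qed.

Lemma rc_find k (p : seq nat -> nat -> bool) A : recursive k.+1 (fun ys => p (behead ys) (nth 0 ys 0)) -> recursive k A ->
  recursive k (fun xs => find_below (p xs) (A xs)).
Proof.
move=> cp cA.
have cg : recursive k.+2 (fun ys => if nth 0 ys 1 == 0 then if p (drop 2 ys) (nth 0 ys 0) then (nth 0 ys 0).+1 else 0 else nth 0 ys 1).
  apply: rc_if; first exact: rc_eq (rc_proj _) (rc_const _ 0).
    apply: rc_if; last exact: rc_const.
      exact: (@rc_sub1 2 k _ (fun ys => nth 0 ys 0) cp (rc_proj _)).
    by apply: rc1 c1_succ (rc_proj _).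
  exact: rc_proj.
have := @rc_sub1 0 k _ A (rc_prec (rc_const k 0) cg) cA.
by apply: rc_ext => xs s; rewrite /= !drop0.
Qed.

End Recursive.

(** * A recursive test for certificates *)

Section Checker.
Variable D : sgraph.
Implicit Types (a b : letter D) (x : D) (p : pile D).
Local Notation G := (raag (@edge D)).
Local Notation gw := (raag_of_word (@edge D)).
Local Notation cl := (@code_letter (vert D)).
Local Notation code := CodeSeq.code.
Local Notation decode := CodeSeq.decode.

Lemma cl_inj : injective cl.
Proof.
move=> [x s] [y t] e.
have := congr1 odd e; rewrite /code_letter /= !oddD !odd_double !oddb /= => st.
have := congr1 half e; rewrite /code_letter /= ![_.*2 + _]addnC !half_bit_double => /val_inj/enum_rank_inj xy.
by rewrite xy st.
Qed.

Lemma cl_lt a : cl a < 2 * #|D|.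
Proof.
rewrite /code_letter mul2n; apply: (@leq_trans (enum_rank a.1).*2.+2).
  by case: a.2; rewrite ?addn1 ?addn0.
by rewrite -doubleS leq_double.
Qed.

Definition letters : seq (letter D) := enum {: letter D}.

Definition dl c : option (letter D) := [pick a | cl a == c].
Definition dw n : word D := pmap dl (decode n).

Lemma dlK : pcancel cl dl.
Proof. by move=> a; rewrite /dl; case: pickP => [b /eqP/cl_inj ->|/(_ a)] //; rewrite eqxx. Qed.

Lemma dw_code_word (w : word D) : dw (code_word w) = w.
Proof. by rewrite /dw /code_word CodeSeq.codeK map_pK //; apply: dlK. Qed.

Definition copt (o : option bool) : nat := if o is Some b then b.+1 else 0.
Definition cst p := code [seq code (map copt (p u)) | u <- enum D].

Definition newp a (u : D) st :=
  if edge u a.1 then nthc st (enum_rank u)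
  else if hd (nthc st (enum_rank a.1)) == (~~ a.2).+1 then tl (nthc st (enum_rank u))
  else kons (if u == a.1 then a.2.+1 else 0) (nthc st (enum_rank u)).
Definition actc a st := code [seq newp a u st | u <- enum D].

Lemma cst_nth p (u : D) : nthc (cst p) (enum_rank u) = code (map copt (p u)).
Proof. by rewrite /nthc /cst CodeSeq.codeK (nth_map u) ?nth_enum_rank // -cardE. Qed.

Lemma copt_inj : injective copt.
Proof. by case=> [[]|] [[]|]. Qed.

Lemma cst_inj : injective cst.
Proof.
move=> p q e; apply/funext => u; have := cst_nth p u; rewrite e cst_nth.
by move/(can_inj CodeSeq.codeK)/(inj_map copt_inj).
Qed.

Lemma actcE a p : actc a (cst p) = cst (act p a).
Proof.
congr code; apply: eq_map => u; rewrite /newp !cst_nth hd_code /act /blocked /top.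
have -> : (head 0 (map copt (p a.1)) == (~~ a.2).+1) = (ohead (p a.1) == Some (Some (~~ a.2))).
  by case: (p a.1) => [//|[[]|] s] //=; case: a.2.
case: ifP => ua; first by case: ifP => _; rewrite /pop /push ua.
case: ifP => _; rewrite /pop /push ua; first by rewrite tl_code -behead_map.
by rewrite -code_cons /=; case: eqP.
Qed.

Definition actl st c := foldr (fun a r => if c == cl a then actc a st else r) st letters.

Lemma actlE p c : actl (cst p) c = cst (if dl c is Some a then act p a else p).
Proof.
rewrite /actl /dl; case: pickP => [a /eqP <-|no].
  have : a \in letters by rewrite mem_enum.
  elim: letters => //= b s IH; rewrite inE (inj_eq cl_inj).
  by case: eqP => [<- _|_ /IH //]; rewrite actcE.
elim: letters => //= b s IH; by rewrite eq_sym no.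
Qed.

Definition run st w := foldl actl st (decode w).

Lemma runE p w : run (cst p) w = cst (foldl (@act D) p (dw w)).
Proof.
rewrite /run /dw; elim: (decode w) p => //= c s IH p.
by rewrite actlE; case: (dl c) => [a|] /=; rewrite IH.
Qed.

Definition vl c := ~~ all (fun a => c != cl a) letters.
(** Codes of words are characterized so that the answer is the code of a word; letters
    that decode to nothing are ignored elsewhere. *)
Definition validc w := foldl (fun r c => if vl c then r else 0) 1 (decode w).

Lemma vlP c : reflect (exists a, c = cl a) (vl c).
Proof.
rewrite /vl -has_predC; apply: (iffP hasP) => [[a _ /=]|[a ->]].
  by rewrite negbK => /eqP ->; exists a.
by exists a; rewrite ?mem_enum //= eqxx.
Qed.

Lemma validcE w : validc w = all vl (decode w).
Proof.
rewrite /validc; elim: (decode w) => //= c s; case: ifP => //= _ _.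
by elim: s => //= e s IH; case: ifP.
Qed.

Lemma valid_dw w : validc w == 1 -> decode w = map cl (dw w).
Proof.
rewrite validcE /dw; elim: (decode w) => //= c s IH.
case: vlP => [[a ->]|] //= h; rewrite dlK /=; congr (_ :: _); exact: IH.
Qed.

Lemma code_word_dw w : validc w == 1 -> code_word (dw w) = w.
Proof. by move=> v; rewrite /code_word -valid_dw // CodeSeq.decodeK. Qed.

Lemma valid_code_word (w : word D) : validc (code_word w) == 1.
Proof.
rewrite validcE /code_word CodeSeq.codeK (_ : all _ _) //.
by apply/allP => c /mapP[a _ ->]; apply/vlP; exists a.
Qed.

(** The piles of the word obtained from u by substituting the words listed in l, computed
    without writing that word down. *)
Definition runs l st u := foldl (fun st c => run st (nthc l c)) st (decode u).
Definition wl l a : word D := dw (nthc l (cl a)).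

Lemma runsE l p u : validc u == 1 -> runs l (cst p) u = cst (foldl (@act D) p (flatten (map (wl l) (dw u)))).
Proof.
move/valid_dw => e; rewrite /runs e; elim: (dw u) p => //= a s IH p.
by rewrite runE IH foldl_cat.
Qed.

(** The word problem: two words are equal in the group exactly if they leave the same
    piles. *)
Lemma nfP u v : foldl (@act D) (@pile0 D) u = foldl (@act D) (@pile0 D) v <-> gw u = gw v.
Proof.
split=> [|/raag_eqP/act_equiv //].
have [r [rr pr gr _]] := red_exists u; have [s [rs ps gs _]] := red_exists v.
rewrite -pr -ps => e; rewrite -gr -gs; apply: shuf_gw.
exact: red_pilew_shuf.
Qed.

Definition st0 := cst (@pile0 D).

Lemma nf_run u v : (cst (foldl (@act D) (@pile0 D) u) == cst (foldl (@act D) (@pile0 D) v)) <-> gw u = gw v.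
Proof. by rewrite (inj_eq cst_inj); split=> [/eqP/nfP|/nfP ->]. Qed.

Definition chk_valid l := all (fun a => validc (nthc l (cl a)) == 1) letters.
Definition chk_inv l := all (fun a => run (run st0 (nthc l (cl a))) (nthc l (cl (inv a))) == st0) letters.
Definition pairs := [seq ab : letter D * letter D <- enum {: letter D * letter D} | com ab.1 ab.2].
Definition chk_com l := all (fun ab : letter D * letter D =>
  run (run st0 (nthc l (cl ab.1))) (nthc l (cl ab.2)) == run (run st0 (nthc l (cl ab.2))) (nthc l (cl ab.1))) pairs.
Definition chk_id l l' := all (fun a => runs l' st0 (nthc l (cl a)) == cst (act (@pile0 D) a)) letters.

(** Conjugacy of the image of u to v by q, written without inverses. *)
Definition good l u v q := run (runs l st0 u) q == run (run st0 q) v.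
Definition stepc l r e :=
  kons ((hd r == 1) && ((hd (tl r) != 0) && good l e (hd (hd (tl r))) (hd (tl (tl r)))))
    (kons (tl (hd (tl r))) (tl (tl (tl r)))).
Definition outc l cu cv q := foldl (stepc l) (kons 1 (kons cv q)) (decode cu).
Definition chk_conj l cu cv q := (hd (outc l cu cv q) == 1) && (hd (tl (outc l cu cv q)) == 0).

(** A certificate lists the images of all letters, inverses included, under an
    automorphism and under its inverse, and a conjugator for each component. *)
Definition check cu cv n :=
  (chk_valid (hd n) && chk_valid (hd (tl n))) && ((chk_inv (hd n) && chk_inv (hd (tl n))) &&
  ((chk_com (hd n) && chk_com (hd (tl n))) && ((chk_id (hd n) (hd (tl n)) && chk_id (hd (tl n)) (hd n)) &&
  chk_conj (hd n) cu cv (tl (tl n))))).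

Lemma chk_validP l : chk_valid l <-> forall a, validc (nthc l (cl a)) == 1.
Proof. by split=> [/allP h a|h]; [apply: h; rewrite mem_enum|apply/allP]. Qed.

Local Open Scope group_scope.

Lemma chk_invP l : chk_inv l <-> forall a, gw (wl l a) * gw (wl l (inv a)) = 1.
Proof.
have e a : (run (run st0 (nthc l (cl a))) (nthc l (cl (inv a))) == st0) <-> gw (wl l a) * gw (wl l (inv a)) = 1.
  by rewrite /st0 !runE -foldl_cat -gwM -(gw0 D); apply: (nf_run _ [::]).
by split=> [/allP h a|h]; [apply/e/h; rewrite mem_enum|apply/allP => a _; apply/e].
Qed.

Lemma chk_comP l : chk_com l <-> forall a b, com a b -> commute (gw (wl l a)) (gw (wl l b)).
Proof.
have e a b : (run (run st0 (nthc l (cl a))) (nthc l (cl b)) == run (run st0 (nthc l (cl b))) (nthc l (cl a)))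
    <-> commute (gw (wl l a)) (gw (wl l b)).
  by rewrite /commute -!gwM /st0 !runE -!foldl_cat; apply: nf_run.
split=> [/allP h a b ab|h]; last by apply/allP => -[a b]; rewrite mem_filter /= => /andP[ab _]; apply/e/h.
by apply/e; apply: (h (a, b)); rewrite mem_filter mem_enum ab.
Qed.

Definition sub l (w : word D) : G := gw (flatten (map (wl l) w)).

Lemma chk_idP l l' : chk_valid l -> (chk_id l l' <-> forall a, sub l' (wl l a) = lt a).
Proof.
move/chk_validP => v.
have e a : (runs l' st0 (nthc l (cl a)) == cst (act (@pile0 D) a)) <-> sub l' (wl l a) = lt a.
  by rewrite /st0 runsE //; apply: (nf_run _ [:: a]).
by split=> [/allP h a|h]; [apply/e/h; rewrite mem_enum|apply/allP => a _; apply/e].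
Qed.

Lemma goodP l (u v : word D) q : good l (code_word u) (code_word v) q <-> sub l u * gw (dw q) = gw (dw q) * gw v.
Proof.
rewrite /good /st0 runsE ?valid_code_word // !runE !dw_code_word -!foldl_cat /sub -!gwM.
exact: nf_run.
Qed.

Lemma stepcE l (ok : bool) v q e : stepc l (kons ok (kons v q)) e =
  kons (ok && ((v != 0)%N && good l e (hd v) (hd q))) (kons (tl v) (tl q)).
Proof. by rewrite /stepc !tl_kons !hd_kons; case: ok. Qed.

Lemma foldl_step l r (u : word D) us : foldl (stepc l) r [seq code_word w | w <- u :: us] =
  foldl (stepc l) (stepc l r (code_word u)) [seq code_word w | w <- us].
Proof. by []. Qed.

Lemma chk_conjP l (us vs : seq (word D)) q : chk_conj l (code_words us) (code_words vs) q <->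
  size us = size vs /\ forall i, (i < size us)%N ->
    sub l (nth [::] us i) * gw (dw (nthc q i)) = gw (dw (nthc q i)) * gw (nth [::] vs i).
Proof.
rewrite /chk_conj /outc /code_words CodeSeq.codeK.
suff main (ok : bool) : (hd (foldl (stepc l) (kons ok (kons (code [seq code_word w | w <- vs]) q)) [seq code_word w | w <- us]) == 1)%N &&
    (hd (tl (foldl (stepc l) (kons ok (kons (code [seq code_word w | w <- vs]) q)) [seq code_word w | w <- us])) == 0)%N <->
  ok /\ size us = size vs /\ forall i, (i < size us)%N ->
    sub l (nth [::] us i) * gw (dw (nthc q i)) = gw (dw (nthc q i)) * gw (nth [::] vs i).
  by split=> [/(main true)[_]|h]; last by apply/(main true).
elim: us vs ok q => [|u us IH] vs ok q.
  rewrite /= tl_kons !hd_kons; split=> [/andP[o c]|[-> [/esym/size0nil -> _]]] //.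
  split; first by case: ok o.
  by split=> //; case: vs c => //= v vs; rewrite -/(kons _ _) /kons muln_eq0 expn_eq0.
have nthS i : nthc q i.+1 = nthc (tl q) i.
  by rewrite /nthc /tl CodeSeq.codeK nth_behead.
have hq : hd q = nthc q 0 by rewrite /nthc nth0.
case: vs => [|v vs].
  rewrite foldl_step stepcE eqxx andbF; have := IH [::] false (tl q); rewrite [tl _]/= => ->.
  by split=> [[]|[_ []]].
rewrite foldl_step stepcE [map _ (v :: vs)]/= hd_code tl_code.
have -> : (code (code_word v :: [seq code_word w | w <- vs]) != 0)%N by rewrite code_cons /kons muln_eq0 expn_eq0.
rewrite IH /= hq; split=> [[/andP[okT /goodP g] [s h]]|[-> [[s] h]]].
  split=> //; split; first by rewrite s.
  by case=> [|i] lt //=; rewrite nthS; apply: h.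
split; first by apply/goodP; apply: (h 0).
by split=> // i lt; have := h i.+1 lt; rewrite nthS.
Qed.

Local Close Scope group_scope.

Lemma rc_actc k a S : recursive k S -> recursive k (fun xs => actc a (S xs)).
Proof.
move=> cS; have cn (u : D) : recursive k (fun xs => nthc (S xs) (enum_rank u)) by apply: rc2 c2_nthc cS (rc_const _ _).
apply: rc_list => u; rewrite /newp; case: (edge u a.1) => //.
apply: rc_if; first exact: rc_eq (rc1 c1_hd (cn _)) (rc_const _ _).
  exact: rc1 c1_tl (cn _).
exact: rc2 c2_kons (rc_const _ _) (cn _).
Qed.

Lemma rc_actl k S C : recursive k S -> recursive k C -> recursive k (fun xs => actl (S xs) (C xs)).
Proof.
move=> cS cC; rewrite /actl; elim: letters => //= a s IH.
by apply: rc_if; [apply: rc_eq cC (rc_const _ _)|apply: rc_actc|].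
Qed.

Lemma rc_run k S W : recursive k S -> recursive k W -> recursive k (fun xs => run (S xs) (W xs)).
Proof.
move=> cS cW; apply: (@rc_fold k S (fun ys => actl (nth 0 ys 0) (nth 0 ys 1)) W) => //.
by apply: rc_actl; apply: rc_proj.
Qed.

Lemma rc_drop2 k L : recursive k L -> recursive k.+2 (fun ys => L (drop 2 ys)).
Proof.
move=> cL; apply: (rc_ext _ (rc_comp cL (size_mkseq _ _) (rc_projs 2 k))) => xs s.
by rewrite proj_drop.
Qed.

Lemma rc_fold2 k I (F : nat -> nat -> seq nat -> nat) A : recursive k I ->
  recursive k.+2 (fun ys => F (nth 0 ys 0) (nth 0 ys 1) (drop 2 ys)) -> recursive k A ->
  recursive k (fun xs => foldl (fun r e => F r e xs) (I xs) (decode (A xs))).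
Proof.
move=> cI cF cA; apply: rc_ext (rc_fold cI cF cA) => xs _ /=.
by rewrite drop0.
Qed.

Lemma rc_runs k L S U : recursive k L -> recursive k S -> recursive k U -> recursive k (fun xs => runs (L xs) (S xs) (U xs)).
Proof.
move=> cL cS cU; apply: (@rc_fold2 k S (fun r e xs => run r (nthc (L xs) e))) => //.
by apply: rc_run; [apply: rc_proj|apply: rc2 c2_nthc (rc_drop2 cL) (rc_proj _)].
Qed.

Lemma rc_validc k W : recursive k W -> recursive k (fun xs => validc (W xs)).
Proof.
move=> cW; apply: (@rc_fold2 k (fun=> 1) (fun r c _ => if vl c then r else 0)) => //; first exact: rc_const.
apply: rc_if; [|exact: rc_proj|exact: rc_const].
apply: rc_not; apply: (@rc_all _ _ letters (fun a ys => nth 0 ys 1 != cl a)) => a.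
by apply: rc_not; apply: rc_eq (rc_proj _) (rc_const _ _).
Qed.

Lemma rc_check : recursive 3 (fun ys => check (nth 0 ys 1) (nth 0 ys 2) (nth 0 ys 0)).
Proof.
have p0 : recursive 3 (fun ys => nth 0 ys 0) by apply: rc_proj.
have cl1 := rc1 c1_hd p0; have ct := rc1 c1_tl p0; have cl2 := rc1 c1_hd ct; have cq := rc1 c1_tl ct.
have s0 k : recursive k (fun=> st0) by apply: rc_const.
have nl k L a : recursive k L -> recursive k (fun xs => nthc (L xs) (cl a)) by move=> cL; apply: rc2 c2_nthc cL (rc_const _ _).
have r1 L : recursive 3 L -> recursive 3 (fun xs => chk_valid (L xs)).
  move=> cL; apply: (@rc_all _ _ letters (fun a ys => validc (nthc (L ys) (cl a)) == 1)) => a.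
  by apply: rc_eq (rc_validc (nl _ _ _ cL)) (rc_const _ _).
have rr L a b : recursive 3 L -> recursive 3 (fun xs => run (run st0 (nthc (L xs) (cl a))) (nthc (L xs) (cl b))).
  by move=> cL; apply: rc_run (rc_run (s0 3) (nl _ _ _ cL)) (nl _ _ _ cL).
have r2 L : recursive 3 L -> recursive 3 (fun xs => chk_inv (L xs)).
  move=> cL; apply: (@rc_all _ _ letters (fun a xs => run (run st0 (nthc (L xs) (cl a))) (nthc (L xs) (cl (inv a))) == st0)) => a.
  exact: rc_eq (rr _ _ _ cL) (rc_const _ _).
have r3 L : recursive 3 L -> recursive 3 (fun xs => chk_com (L xs)).
  move=> cL; apply: (@rc_all _ _ pairs (fun ab xs => run (run st0 (nthc (L xs) (cl ab.1))) (nthc (L xs) (cl ab.2)) ==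
    run (run st0 (nthc (L xs) (cl ab.2))) (nthc (L xs) (cl ab.1)))) => ab.
  exact: rc_eq (rr _ _ _ cL) (rr _ _ _ cL).
have r4 L L' : recursive 3 L -> recursive 3 L' -> recursive 3 (fun xs => chk_id (L xs) (L' xs)).
  move=> cL cL'; apply: (@rc_all _ _ letters (fun a xs => runs (L' xs) st0 (nthc (L xs) (cl a)) == cst (act (@pile0 D) a))) => a.
  exact: rc_eq (rc_runs cL' (s0 3) (nl _ _ _ cL)) (rc_const _ _).
have r5 : recursive 3 (fun ys => outc (hd (nth 0 ys 0)) (nth 0 ys 1) (nth 0 ys 2) (tl (tl (nth 0 ys 0)))).
  apply: (@rc_fold2 3 (fun ys => kons 1 (kons (nth 0 ys 2) (tl (tl (nth 0 ys 0))))) (fun r e ys => stepc (hd (nth 0 ys 0)) r e)).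
  - by apply: rc2 c2_kons (rc_const _ _) (rc2 c2_kons (rc_proj _) cq).
  - have cr : recursive 5 (fun ys => nth 0 ys 0) by apply: rc_proj.
    have cb := rc1 c1_tl cr; have cbh := rc1 c1_hd cb; have cbt := rc1 c1_tl cb.
    have cL := rc_drop2 cl1.
    apply: rc2 c2_kons _ (rc2 c2_kons (rc1 c1_tl cbh) (rc1 c1_tl cbt)).
    apply: rc_and; first exact: rc_eq (rc1 c1_hd cr) (rc_const _ _).
    apply: rc_and; first by apply: rc_not; apply: rc_eq cbh (rc_const _ _).
    apply: rc_eq.
      by apply: rc_run (rc_runs cL (s0 5) (rc_proj _)) (rc1 c1_hd cbt).
    exact: rc_run (rc_run (s0 5) (rc1 c1_hd cbt)) (rc1 c1_hd cbh).
  - exact: rc_proj.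
apply: rc_and; first by apply: rc_and; apply: r1.
apply: rc_and; first by apply: rc_and; apply: r2.
apply: rc_and; first by apply: rc_and; apply: r3.
apply: rc_and; first by apply: rc_and; apply: r4.
apply: rc_and; first exact: rc_eq (rc1 c1_hd r5) (rc_const _ _).
exact: rc_eq (rc1 c1_hd (rc1 c1_tl r5)) (rc_const _ _).
Qed.

(** The images of the generators, read off from the first component. *)
Definition answer n := code [seq nthc (hd n) (cl (x, false)) | x <- enum D].

Lemma rc_solver t : exists P, forall cu cv, reval P [:: cu; cv]
  (if find_below (check cu cv) (Tw t (cu + cv)) is n.+1 then (answer n).+1 else 0).
Proof.
have cT : recursive 2 (fun xs => Tw t (nth 0 xs 0 + nth 0 xs 1)).
  by apply: rc_ext (rc_Tw t (rc2 c2_add (rc_proj (isT : 0 < 2)) (rc_proj (isT : 1 < 2)))) => // xs _; elim: (t) => //= t' ->.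
have cf := rc_find (p := fun xs n => check (nth 0 xs 0) (nth 0 xs 1) n) _ cT.
have {}cf := cf (rc_ext (fun l (_ : size l = 3) => _) rc_check).
have {}cf := cf (fun l => esym (congr2 (fun i j => nat_of_bool (check i j (nth 0 l 0))) (nth_behead 0 l 0) (nth_behead 0 l 1))).
have ca : c1 (fun r => if r is n.+1 then (answer n).+1 else 0).
  have h : c1 (fun r => if r == 0 then 0 else (answer r.-1).+1).
    apply: rc_if; [exact: rc_eq (rc_proj _) (rc_const _ _)|exact: rc_const|].
    apply: rc1 c1_succ _; apply: rc_list => x.
    by apply: rc2 c2_nthc (rc1 c1_hd (rc1 c1_pred (rc_proj _))) (rc_const _ _).
  by apply: rc_ext h => xs _; case: (nth 0 xs 0).
have [P PP] : recursive 2 (fun xs => if find_below (check (nth 0 xs 0) (nth 0 xs 1)) (Tw t (nth 0 xs 0 + nth 0 xs 1)) is n.+1 then (answer n).+1 else 0).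
  exact: rc1 ca cf.
by exists P => cu cv; apply: (PP [:: cu; cv]).
Qed.

End Checker.

(** * Certificates *)

Section Certificates.
Variable D : sgraph.
Implicit Types (a b : letter D) (w : word D).
Local Notation G := (raag (@edge D)).
Local Notation gw := (raag_of_word (@edge D)).
Local Notation cl := (@code_letter (vert D)).
Local Notation code := CodeSeq.code.
Local Open Scope group_scope.

Section Sound.
Variable l : nat.
Hypotheses (il : chk_inv D l) (co : chk_com D l).

Definition img a : G := gw (wl l a).

Lemma imgV a : img (inv a) = (img a)^-1.
Proof. by apply: (@mulgI _ (img a)); rewrite mulgV; have /chk_invP := il; apply. Qed.

Lemma imgC a b : com a b -> commute (img a) (img b).
Proof. by have /chk_comP := co; apply. Qed.

Lemma sub_prodw w : sub l w = prodw img w.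
Proof.
rewrite /sub /prodw; elim: w => [|a w IH]; first by rewrite gw0 big_nil.
by rewrite /= gwM IH big_cons.
Qed.

Lemma hext_sub w : hext img (gw w) = sub l w.
Proof. by rewrite (hext_gw imgV imgC) sub_prodw. Qed.

Lemma hext_hom : ishom (hext img).
Proof. exact: hextM imgV imgC. Qed.

End Sound.

Lemma sub_hom l (e : G -> G) w : ishom e -> (forall a, gw (wl l a) = e (lt a)) -> sub l w = e (gw w).
Proof.
move=> eM h; rewrite /sub; elim: w => [|a w IH]; first by rewrite gw0 (hom1 eM).
by rewrite /= gwM h IH gw_cons eM.
Qed.

Lemma hext_inverse l l' (v : chk_valid D l) (i : chk_inv D l) (i' : chk_inv D l') (c : chk_com D l) (c' : chk_com D l') :
  chk_id D l l' -> cancel (hext (img l)) (hext (img l')).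
Proof.
move=> /(chk_idP _ v) h; apply: (hom_ext (hom_comp (hext_hom i' c') (hext_hom i c))) => // a.
by rewrite /= (hext_lt (imgV i) (imgC c)) (hext_sub i' c') h.
Qed.

Lemma code_bound (s : seq nat) m k : (forall i, i \in s -> i <= m)%N -> (size s <= k)%N -> (code s <= 2 ^ (m.+1 * k))%N.
Proof.
move=> sm sk; apply: (@leq_trans (2 ^ (m.+1 * size s))); last by rewrite leq_pexp2l // leq_mul2l sk orbT.
suff : (code s < 2 ^ (m.+1 * size s))%N by apply: ltnW.
elim: s sm {sk} => [|a s IH] sm; first by rewrite muln0.
have h : (code s < 2 ^ (m.+1 * size s))%N by apply: IH => i si; apply: sm; rewrite inE si orbT.
have am : (a <= m)%N by apply: sm; rewrite inE eqxx.
rewrite code_cons /kons (_ : size (a :: s) = (size s).+1) // (mulnS m.+1) expnD.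
apply: (@leq_trans (2 ^ a * (2 * 2 ^ (m.+1 * size s)))); last first.
  by rewrite mulnA -expnSr leq_mul2r leq_pexp2l ?orbT // ltnS.
by rewrite ltn_pmul2l ?expn_gt0 // mul2n; move: h; rewrite -leq_double doubleS.
Qed.

Definition lst (e : G -> G) := code (mkseq (fun c => if dl D c is Some a then code_word (rw (e (lt a))) else 0%N) (2 * #|D|)%N).
Definition cert (e e' : G -> G) (Q : seq G) := kons (lst e) (kons (lst e') (code [seq code_word (rw g) | g <- Q])).

Lemma lst_nth e a : nthc (lst e) (cl a) = code_word (rw (e (lt a))).
Proof. by rewrite /nthc /lst CodeSeq.codeK nth_mkseq ?cl_lt // dlK. Qed.

Lemma wl_lst e a : gw (wl (lst e) a) = e (lt a).
Proof. by rewrite /wl lst_nth dw_code_word rwK. Qed.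

Lemma cert_check e e' Q (us vs : seq (word D)) : ishom e -> ishom e' -> cancel e e' -> cancel e' e ->
  size us = size vs -> size Q = size us ->
  (forall i, (i < size us)%N -> gw (nth [::] vs i) = (nth 1 Q i)^-1 * e (gw (nth [::] us i)) * nth 1 Q i) ->
  check D (code_words us) (code_words vs) (cert e e' Q).
Proof.
move=> eM eM' K K' s sQ c; rewrite /check /cert !tl_kons !hd_kons.
have va f : chk_valid D (lst f) by apply/chk_validP => a; rewrite lst_nth valid_code_word.
have iv f : ishom f -> chk_inv D (lst f).
  by move=> fM; apply/chk_invP => a; rewrite !wl_lst -fM ltV mulgV hom1.
have co f : ishom f -> chk_com D (lst f).
  by move=> fM; apply/chk_comP => a b ab; rewrite !wl_lst /commute -!fM lt_com.
have id f f' : ishom f' -> cancel f f' -> chk_id D (lst f) (lst f').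
  move=> fM fK; apply/chk_idP; first exact: va.
  by move=> a; rewrite (sub_hom _ fM (wl_lst f')) wl_lst fK.
rewrite !va !iv ?co ?id //=; apply/chk_conjP; split=> // i lt.
rewrite (sub_hom _ eM (wl_lst e)) c // /nthc CodeSeq.codeK (nth_map 1) ?sQ // dw_code_word rwK.
by rewrite !mulgA mulgV mul1g.
Qed.

Lemma cert_bound : forall B, tb B -> exists2 f, tb f & forall L e e' Q, mild (B L) e e' -> (size Q <= L)%N ->
  (forall q, q \in Q -> len q <= Posz (B L))%R -> (cert e e' Q < f L)%N.
Proof.
move=> B tB; pose d2 := (2 * #|D|)%N.
pose w1 L := (2 ^ (d2.+1 * B L))%N; pose w2 L := (2 ^ ((w1 L).+1 * d2))%N; pose w3 L := (2 ^ ((w1 L).+1 * L))%N.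
pose kb (a c : nat) := (2 ^ a * (2 * c + 1))%N.
have tS f : tb f -> tb (fun n => (f n).+1).
  by move=> tf; apply: tb_le (tb_add (tb_const 1) tf) _ => n; rewrite add1n.
have t1 : tb w1 by apply: tb_exp2; apply: tb_mul tB; apply: tb_const.
have t2 : tb w2 by apply: tb_exp2; apply: tb_mul (tS _ t1) _; apply: tb_const.
have t3 : tb w3 by apply: tb_exp2; apply: tb_mul (tS _ t1) tb_id.
have tk f g : tb f -> tb g -> tb (fun n => kb (f n) (g n)).
  move=> tf tg; apply: tb_mul; first exact: tb_exp2.
  by apply: tb_add; [apply: tb_mul tg; apply: tb_const|apply: tb_const].
exists (fun L => (kb (w2 L) (kb (w2 L) (w3 L))).+1); first exact: (tS _ (tk _ _ t2 (tk _ _ t2 t3))).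
move=> L e e' Q [_ _ _ _ h] sQ lQ.
have kle (a c a' c' : nat) : (a <= a')%N -> (c <= c')%N -> (kons a c <= kb a' c')%N.
  by move=> aa cc; rewrite /kons /kb leq_mul ?leq_pexp2l // mul2n addn1 ltnS leq_double.
have wb (g : G) : (len g <= Posz (B L))%R -> (code_word (rw g) <= w1 L)%N.
  rewrite len_rw lez_nat => lg; apply: code_bound; last by rewrite size_map.
  by move=> i /mapP[a _ ->]; apply: ltnW; apply: cl_lt.
have lb f : (forall a, len (f (lt a)) <= Posz (B L))%R -> (lst f <= w2 L)%N.
  move=> fb; apply: code_bound; last by rewrite size_mkseq.
  by move=> i /mapP[c _ ->]; case: (dl D c) => // a; apply/wb/fb.
rewrite ltnS; apply: (kle (lst e)); first by apply: (lb e) => a; case: (h a).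
apply: (kle (lst e')); first by apply: (lb e') => a; case: (h a).
by apply: code_bound; [move=> i /mapP[g gQ ->]; apply/wb/lQ|rewrite size_map].
Qed.

(** A copy of e that carries its proof of multiplicativity, so that it can be bundled. *)
Definition bundle (e : G -> G) (eM : ishom e) := e.
HB.instance Definition _ e (eM : ishom e) := isMultiplicative.Build G G (bundle eM) eM.

Lemma conj_classE (g : G) : conj_class g = [set h | cj g h]%classic.
Proof.
apply/predeqP => h; split=> [[x _ <-]|[q ->]]; first by exists x; rewrite /conjg mulgA.
by exists q => //; rewrite /conjg mulgA.
Qed.

Lemma image_conj_class (e e' : G -> G) g : ishom e -> cancel e' e -> (e @` conj_class g)%classic = conj_class (e g).
Proof.
move=> eM K; rewrite !conj_classE; apply/predeqP => h; split=> [[k [q ->] <-]|[q ->]].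
  by apply: cj_hom => //; exists q.
exists ((e' q)^-1 * g * e' q); first by exists (e' q).
by rewrite !eM (homV _ eM) K.
Qed.

Theorem solver (t : nat) : exists P, forall us vs : seq (word D),
  let n := find_below (check D (code_words us) (code_words vs)) (Tw t (code_words us + code_words vs)) in
  reval P [:: code_words us; code_words vs] (if n is m.+1 then (answer D m).+1 else 0%N).
Proof. by have [P PP] := rc_solver D t; exists P => us vs; apply: PP. Qed.

(** The tests say that the listed words define two homomorphisms inverse to each
    other, and that the conjugators work. *)
Lemma answer_sound (us vs : seq (word D)) n : check D (code_words us) (code_words vs) n ->
  exists (al : {multiplicative G -> G}) (ws : seq (word D)),
    [/\ bijective al, aut_act al (conj_classes (@edge D) us) = conj_classes (@edge D) vs,
        represents_hom ws al & answer D n = code_words ws].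
Proof.
case/andP=> /andP[v v'] /andP[/andP[i i'] /andP[/andP[c c'] /andP[/andP[d d'] /chk_conjP[s h]]]].
set l := hd n in v i c d d' h *; set l' := hd (tl n) in v' i' c' d d' *.
have K := hext_inverse v i i' c c' d; have K' := hext_inverse v' i' i c' c d'.
exists (bundle (hext_hom i c)), [seq wl l (x, false) | x <- enum D]; split.
- by exists (hext (img l')).
- apply: (@eq_from_nth _ set0); first by rewrite !size_map.
  rewrite !size_map => j lt; rewrite !(nth_map set0) ?size_map // !(nth_map [::]) -?s //.
  rewrite -[bundle _]/(hext (img l)) (image_conj_class _ (hext_hom i c) K') (hext_sub i c).
  have e := h j lt; rewrite !conj_classE; apply/predeqP => g.
  have cc : cj (sub l (nth [::] us j)) (gw (nth [::] vs j)).
    by exists (gw (dw D (nthc (tl (tl n)) j))); rewrite -mulgA e mulKg.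
  by split=> [x|x]; [apply: cj_trans (cj_sym cc) x|apply: cj_trans cc x].
- rewrite /represents_hom -map_comp; apply: eq_map => x /=.
  by rewrite -[raag_gen _ _]/(lt (x, false)) -[bundle _]/(hext (img l)) (hext_lt (imgV i) (imgC c)).
rewrite /answer /code_words -map_comp; congr code; apply: eq_map => x /=.
by rewrite /wl code_word_dw //; have /chk_validP := v; apply.
Qed.

(** The certificate of the bounded data of [orbit_bound] has a code below a
    tower of exponentials in the codes of the input. *)
Lemma answer_complete : exists t, forall (us vs : seq (word D)) (al : {multiplicative G -> G}),
  bijective al -> aut_act al (conj_classes (@edge D) us) = conj_classes (@edge D) vs ->
  exists2 n, (n < Tw t (code_words us + code_words vs))%N & check D (code_words us) (code_words vs) n.
Proof.
have [B tB BP] := orbit_bound D; have [f [t tP] fP] := cert_bound tB.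
exists t => us vs al [be K K'] e.
have alM : ishom al by move=> g h; apply: gmulfM.
have beM : ishom be by move=> g h; apply: (can_inj K); rewrite alM !K'.
have aA : isaut al by split=> //; exists be.
have suv : size us = size vs by have := congr1 size e; rewrite !size_map.
have cAl : cjs (map al (map gw us)) (map gw vs).
  split; first by rewrite !size_map.
  move=> i; have [lt|ge] := ltnP i (size us); last first.
    by rewrite !nth_default ?size_map -?suv //; apply: cj_refl.
  rewrite (nth_map 1) ?size_map // !(nth_map [::]) -?suv //.
  have := congr1 (fun s => nth set0 s i) e; rewrite /= !(nth_map set0) ?size_map // !(nth_map [::]) -?suv //.
  rewrite (image_conj_class _ alM K') !conj_classE => /predeqP/(_ (gw (nth [::] vs i)))[_]; apply.
  exact: cj_refl.
set L := (code_words us + code_words vs)%N.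
have szb (ws : seq (word D)) : (size ws <= code_words ws)%N /\ forall g, g \in map gw ws -> (len g <= Posz (code_words ws))%R.
  split; first by have := size_code [seq code_word w | w <- ws]; rewrite size_map.
  move=> g /mapP[w wws ->]; apply: le_trans (len_size w) _; rewrite lez_nat.
  have := size_code [seq code_letter a | a <- w]; rewrite size_map => le1; apply: leq_trans le1 _.
  have /allP h := CodeSeq.ltn_code [seq code_word w | w <- ws].
  by apply/ltnW/h/map_f.
have [s1 l1] := szb us; have [s2 l2] := szb vs.
have [|g gU|g gV|e1 [e2 [Q [me sQ lQ cQ]]]] := BP L (map gw us) (map gw vs) al aA cAl.
- by rewrite size_map; apply: leq_trans s1 (leq_addr _ _).
- by apply: le_trans (l1 _ gU) _; rewrite lez_nat leq_addr.
- by apply: le_trans (l2 _ gV) _; rewrite lez_nat leq_addl.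
rewrite size_map in sQ; have [eM eM' K1 K2 _] := me.
exists (cert e1 e2 Q).
  apply: leq_trans (tP L); apply: fP => //.
  by rewrite sQ; apply: leq_trans s1 (leq_addr _ _).
apply: cert_check => // i lt; have := cQ i.
by rewrite !(nth_map [::]) -?suv.
Qed.

End Certificates.

Theorem theorem1p1 (T : finType) (adj : rel T)
    (adj_sym : symmetric adj) (adj_irr : irreflexive adj) :
  exists P : recfun, solves_orbit_problem adj P.
Proof.
pose D := SGraph adj_sym adj_irr.
have [t tP] := answer_complete D; have [P PP] := solver D t.
exists P => us vs /=; have := PP us vs; have := find_belowP (check D (code_words us) (code_words vs)) (Tw t (code_words us + code_words vs)).
case: (find_below _ _) => [no r|n yes r]; [right|left].
  split=> // -[al [bal e]]; have [n lt c] := tP us vs al bal e.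
  by have := no n lt; rewrite c.
have [al [ws [bal e rh eq]]] := answer_sound yes.
by exists al, ws; split=> //; rewrite -eq.
Qed.
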